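(* There exist an algorithm and a polynomial $Q$ such that the following holds. Let $\ell,k\in\mathbb{N}^*$, $A\geq1$, $R>1$, $\beta>0$, $\epsilon,\delta\in(0,1)$, and let $\mathcal{F}$ be a class of $k$ functions $f_1,\dots,f_k:\mathbb{R}^d\to\{0,1\}$. Let $\mathcal{D}$ be any $A$-hypercontractive distribution on $\mathbb{R}^d$ and $\mathcal{D}'$ any distribution on $\mathbb{R}^d$. Let $S$ and $S'$ be multisets of independent examples drawn from $\mathcal{D}$ and $\mathcal{D}'$ respectively, with $|S|,|S'|\geq Q(R,\beta,A^\ell,(d+1)^\ell,1/\epsilon,\log(k/\delta)^\ell)$. Then the algorithm, given $\mathcal{F},S,S',\ell,R,\beta,\epsilon$, runs in time $k\cdot\mathrm{poly}(|S|,|S'|,(d+1)^\ell)$ and outputs a succinct description of a function $s:\mathbb{R}^d\to\{0,1\}$, computable at any point in time $k\sqrt{\beta R^3/\epsilon^5}\,\mathrm{poly}(|S|,(d+1)^\ell)$, such that: 1. For any $p_1,\dots,p_k\in\mathcal{P}_{d,\ell}$ with $\max_{i\in[k]}\mathbb{E}_{x\sim\mathcal{D}}[p_i(x)^2]\leq\beta$, with probability at least $1-\delta$ over $S,S'$, for every $i\in[k]$: $\mathbb{E}_{x\sim\mathcal{D}'}[f_i(x)p_i(x)s(x)]\leq(R+\epsilon)(1+\epsilon)\mathbb{E}_{x\sim\mathcal{D}}[f_i(x)|p_i(x)|]+2\epsilon$. 2. With probability at least $1-\delta$ over $S,S'$, $\Pr_{x\sim\mathcal{D}}[s(x)=0]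\leq\min\left\{\frac{1+\epsilon}{R},\frac{d_{\mathrm{TV}}(\mathcal{D},\mathcal{D}')+\epsilon}{R-1}\right\}$.
   Context: $\mathcal{P}_{d,\ell}$ is the set of $d$-variate real polynomials of degree at most $\ell$; $[k]=\{1,\dots,k\}$; $\mathbb{N}^*=\{1,2,\dots\}$; $d_{\mathrm{TV}}$ is total variation distance. A distribution $\mathcal{D}$ on $\mathbb{R}^d$ is $A$-hypercontractive ($A\geq1$) if for every polynomial $p$ and every $t\geq2$, $\mathbb{E}_{\mathcal{D}}[|p|^t]\leq(At)^{t\deg(p)}\mathbb{E}_{\mathcal{D}}[|p|]^t$, and the absolute value of every degree-1 monomial has finite expectation under $\mathcal{D}$. $\mathrm{poly}(\cdot)$ denotes a bound by a fixed polynomial in the listed quantities.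
   Formalization: The evaluation time is k·max(1, √(βR³/ε⁵))·poly(|S|,(d+1)^ℓ) instead of k√(βR³/ε⁵)·poly(|S|,(d+1)^ℓ), since for β→0 with all else fixed the latter falls below one computation step. *)

(* Defs.v *)
From HB Require Import structures.
From mathcomp Require Import all_boot all_order all_algebra.
From mathcomp Require Import all_classical all_reals all_analysis.
From mathcomp Require mpoly.
Set Implicit Arguments.
Unset Strict Implicit.
Unset Printing Implicit Defensive.
Import Order.TTheory GRing.Theory Num.Theory.
Local Open Scope classical_set_scope.
Local Open Scope ring_scope.

(** R^d with the product (Borel) sigma-algebra. *)
Notation Rn K d := (d.-tuple (measurableTypeR K)).

(** ** Distributions on R^d *)

Definition peval (K : realType) d (p : mpoly.mpoly d K) (x : Rn K d) : K :=
  mpoly.meval (tnth x) p.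

(** The zero polynomial gets degree 0. *)
Definition total_degree (K : realType) d (p : mpoly.mpoly d K) : nat :=
  \max_(m <- mpoly.msupp p) mpoly.mdeg m.

Definition hypercontractive (K : realType) d (A : K)
    (D : probability (Rn K d) K) : Prop :=
  (forall (p : mpoly.mpoly d K) (t : K), 2 <= t ->
     ('E_D[fun x => (`|peval p x| `^ t)%R] <=
      ((A * t) `^ (t * (total_degree p)%:R))%R%:E *
      'E_D[fun x => `|peval p x|%R] `^ t)%E) /\
  (forall i : 'I_d, ('E_D[fun x => `|(tnth x i : K)|%R] < +oo)%E).

Definition tv_dist (K : realType) d (D D' : probability (Rn K d) K) : K :=
  sup [set `|fine (D B) - fine (D' B)| | B in (measurable : set (set (Rn K d)))].

(** [X] and [X'] are jointly independent samples of sizes [n] and [n'] from [D]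
    and [D']: the product rule for arbitrary measurable sets (possibly the
    whole space) gives both the independence and the marginal laws. *)
Definition iid_samples (K : realType) d n n' (D D' : probability (Rn K d) K)
    disp (Omega : measurableType disp) (P : probability Omega K)
    (X : Omega -> n.-tuple (Rn K d)) (X' : Omega -> n'.-tuple (Rn K d)) : Prop :=
  [/\ measurable_fun setT X,
      measurable_fun setT X' &
      forall (B : 'I_n -> set (Rn K d)) (B' : 'I_n' -> set (Rn K d)),
        (forall j, measurable (B j)) -> (forall j, measurable (B' j)) ->
        P [set w | (forall j, B j (tnth (X w) j)) /\
                   (forall j, B' j (tnth (X' w) j))] =
        ((\prod_(j < n) fine (D (B j))) *
         (\prod_(j < n') fine (D' (B' j))))%:E].

(** [E] holds with probability at least [q]; asking for a measurable subevent
    avoids applying [P] to a set not known to be measurable. *)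
Definition with_prob_ge (K : realType) disp (Omega : measurableType disp)
    (P : probability Omega K) (q : K) (E : set Omega) : Prop :=
  exists E0, [/\ measurable E0, E0 `<=` E & (q%:E <= P E0)%E].

(** ** Algorithms: structured programs for the real RAM

    The memory has two unbounded arrays of cells, one of naturals (used for
    indices and counters, with addition and truncated subtraction only) and
    one of reals (with exact field operations and comparisons).  There is no
    rounding of reals and no multiplication of naturals.  Programs
    contain no real constants, so they do not depend on the field.  Hypotheses
    [f_1, ..., f_k] are accessed through an evaluation oracle.

    Each assignment, test and oracle call has cost one; as the expressions of a
    program have bounded size, counting the individual operations would only
    change the cost by a constant factor. *)

Inductive nexp : Type :=
| NLit of nat
| NMem of nexp
| NAdd of nexp & nexp
| NSub of nexp & nexp.

Inductive rexp : Type :=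
| RNat of nexp
| RMem of nexp
| RAdd of rexp & rexp
| RSub of rexp & rexp
| RMul of rexp & rexp
| RDiv of rexp & rexp.

Inductive test : Type :=
| NLe of nexp & nexp
| RLe of rexp & rexp.

(** [Ask r i a] queries [f_i] at the point stored in the real cells
    [a, ..., a + d - 1] and writes the answer to the natural cell [r]. *)
Inductive cmd : Type :=
| Skip
| NSet of nexp & nexp
| RSet of nexp & rexp
| Ask of nexp & nexp & nexp
| Seq of cmd & cmd
| If of test & cmd & cmd
| While of test & cmd.

Record store (K : Type) := Store { nmem : nat -> nat; rmem : nat -> K }.

Fixpoint neval K (st : store K) (e : nexp) : nat :=
  match e with
  | NLit n => n
  | NMem a => nmem st (neval st a)
  | NAdd e1 e2 => (neval st e1 + neval st e2)%N
  | NSub e1 e2 => (neval st e1 - neval st e2)%N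
  end.

Fixpoint reval (K : realType) (st : store K) (e : rexp) : K :=
  match e with
  | RNat n => (neval st n)%:R
  | RMem a => rmem st (neval st a)
  | RAdd e1 e2 => reval st e1 + reval st e2
  | RSub e1 e2 => reval st e1 - reval st e2
  | RMul e1 e2 => reval st e1 * reval st e2
  | RDiv e1 e2 => reval st e1 / reval st e2
  end.

Definition teval (K : realType) (st : store K) (b : test) : bool :=
  match b with
  | NLe e1 e2 => (neval st e1 <= neval st e2)%N
  | RLe e1 e2 => reval st e1 <= reval st e2
  end.

Definition nset K (st : store K) (a v : nat) : store K :=
  Store [eta nmem st with a |-> v] (rmem st).

Definition rset K (st : store K) (a : nat) (v : K) : store K :=
  Store (nmem st) [eta rmem st with a |-> v].

Definition ask (K : realType) d k (f : 'I_k -> Rn K d -> bool)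
    (st : store K) (i a : nat) : bool :=
  if insub i is Some j then f j [tuple rmem st (a + m) | m < d] else false.

(** [exec f c st t st']: with the oracle [f], started in [st], the program [c]
    halts in [st'] at cost [t]. *)
Inductive exec (K : realType) d k (f : 'I_k -> Rn K d -> bool) :
    cmd -> store K -> nat -> store K -> Prop :=
| ExecSkip st : exec f Skip st 1 st
| ExecNSet st a e :
    exec f (NSet a e) st 1 (nset st (neval st a) (neval st e))
| ExecRSet st a e :
    exec f (RSet a e) st 1 (rset st (neval st a) (reval st e))
| ExecAsk st r i a :
    exec f (Ask r i a) st 1
      (nset st (neval st r) (ask f st (neval st i) (neval st a)))
| ExecSeq c1 c2 st1 t1 st2 t2 st3 :
    exec f c1 st1 t1 st2 -> exec f c2 st2 t2 st3 ->
    exec f (Seq c1 c2) st1 (t1 + t2) st3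
| ExecIf b c1 c2 st t st' :
    exec f (if teval st b then c1 else c2) st t st' ->
    exec f (If b c1 c2) st t.+1 st'
| ExecWhileStop b c st :
    ~~ teval st b -> exec f (While b c) st 1 st
| ExecWhileStep b c st1 t1 st2 t2 st3 :
    teval st1 b -> exec f c st1 t1 st2 -> exec f (While b c) st2 t2 st3 ->
    exec f (While b c) st1 (t1 + t2).+1 st3.

Definition load (K : realType) (ns : seq nat) (rs : seq K) : store K :=
  Store (nth 0%N ns) (nth 0 rs).

Definition learner_input (K : realType) d (l k : nat) (R beta eps : K) n n'
    (S : n.-tuple (Rn K d)) (S' : n'.-tuple (Rn K d)) : store K :=
  load [:: d; l; k; n; n']
    ([:: R; beta; eps] ++ flatten [seq tval x | x <- S]
                       ++ flatten [seq tval x | x <- S']).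

(** On halting, the description is the list of reals in the first [nmem 0] real
    cells; writing it out is charged to the running time, which also bounds
    its length. *)
Definition outputs_description (K : realType) d k
    (f : 'I_k -> Rn K d -> bool) (alg : cmd) (st : store K) (T : K)
    (desc : seq K) : Prop :=
  exists t st', [/\ exec f alg st t st', desc = mkseq (rmem st') (nmem st' 0%N)
                  & (t + size desc)%:R <= T].

(** [ev] is given [d], [k], the description and the point [x], and leaves the
    value [s x] (0 or 1) in the first natural cell. *)
Definition describes (K : realType) d k
    (f : 'I_k -> Rn K d -> bool) (ev : cmd) (desc : seq K) (T : K)
    (s : Rn K d -> bool) : Prop :=
  forall x : Rn K d, exists t st',
    [/\ exec f ev (load [:: d; k; size desc] (tval x ++ desc)) t st',
        nmem st' 0%N = s x & t%:R <= T].

(** A polynomial in the listed quantities, evaluated at them. *)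
Definition poly_at (K : realType) m (Q : mpoly.mpoly m K) (v : m.-tuple K) : K :=
  mpoly.meval (tnth v) Q.

(* Main.v *)
Require Import Defs.
From HB Require Import structures.
From mathcomp Require Import all_boot all_order all_algebra.
From mathcomp Require Import all_classical all_reals all_analysis.
From mathcomp Require Import measurable_realfun.
From mathcomp Require mpoly.
From mathcomp Require Import ring lra zify.
Set Implicit Arguments.
Unset Strict Implicit.
Unset Printing Implicit Defensive.
Import Order.TTheory GRing.Theory Num.Theory.
Local Open Scope classical_set_scope.
Local Open Scope ring_scope.

(** Write [B] for [bmax n n'], so that [B ^ 40] is at most both sample sizes.

    The first [B] points [S1] of [S] define the region of the points [x] with
    [g x ^ 2 <= \sum_(y <- S1) g y ^ 2] for all polynomials [g] of degree at most [l].
    By a leave-one-out argument (the leverages of a sample add up to at most the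
    dimension) the region misses little mass of [D].  Hypercontractivity bounds
    [p_i] on [S1], hence on the region, where [p_i] has bounded coordinates in a
    Gram-Schmidt basis computed from [S1].

    For each [i] a perceptron keeps a polynomial [q] and works on the selected points
    with [f_i = 1].  If the mass of some set [q > z] in [S'] clearly exceeds [R] times
    its mass in [S], the set is cut off; the cuts together have this property too,
    which bounds [D(cut)] by [1 / R] and by [d_TV / (R - 1)] up to errors.  Otherwise
    [q] is updated by the vector [u] with [<q, u> = E_S'[q] - R E_S[|q|]], which is
    nearly nonpositive because there was nothing to cut; hence [q] grows only like the
    square root of the number [T] of rounds.  For every polynomial [p], an update
    satisfies [<p, u> >= E_S'[p] - R E_S[|p|]], so the average [<p, q> / T] bounds the
    right-hand side, and this is the first guarantee.

    Cuts are given by integers over a fixed denominator.  There are thus finitely many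
    outputs once [S1] is fixed, and Hoeffding's bound for the remaining points with
    a union bound over all outputs turns the empirical statements into true ones. *)

(** * Loop programs and their cost *)

(** The machine has no square root and no map from reals to naturals. Hence columns are scaled by
    their l1 norm on the sample, and integers kept in real cells are read back by search. Time must
    be linear in [k] although every cut changes the selected set and voids what was shown for
    earlier hypotheses; starting again at hypothesis 0 is affordable, because each cut gains more
    than [b ^ -18] out of a total of 1, so there are at most [b ^ 18] cuts.

    The exponents: after [T = b ^ 16] rounds [q] has square norm at most [T * b ^ 4], so coordinates
    at most [b ^ 10]; those of a hypothesis are at most [b ^ 3], and [b * b ^ 13 / T = b ^ -2].
    Iterates are rounded to mesh [b ^ -18], negligible against their crude bound [b ^ 17]. The
    outputs, and with them all events of the union bound, number at most exp(b ^ 26), and 40 is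
    large enough for Hoeffding's bound at accuracy [b ^ -5] to beat this. *)

Section ForPrograms.

(* Reals live in a read-only zone below the address held in the natural cell
   [BASE] and, above it, in sixteen interleaved unbounded arrays. *)
Definition BASE := 5%N.
Definition TMP := 6%N.

Inductive prog : Type :=
| PSkip
| PN of nat & nexp
| PA of nat & nexp & rexp
| PO of nexp & rexp
| PAsk of nat & nexp & nexp
| PSeq of prog & prog
| PIf of test & prog & prog
| PFor of nat & nat & prog.

Definition var (v : nat) : nexp := NMem (NLit v).
Definition dbl (e : nexp) : nexp := NAdd e e.
(** Entry [e] of array [c] sits at [BASE + 16 e + c]; the factor 16 is made of four doublings,
    because naturals can only be added. *)
Definition cell (c : nat) (e : nexp) : nexp :=
  NAdd (var BASE) (NAdd (dbl (dbl (dbl (dbl e)))) (NLit c)).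
Definition arr (c : nat) (e : nexp) : rexp := RMem (cell c e).

Fixpoint comp (p : prog) : cmd :=
  match p with
  | PSkip => Skip
  | PN v e => NSet (NLit v) e
  | PA c e r => RSet (cell c e) r
  | PO e r => RSet e r
  | PAsk v i a => Ask (NLit v) i a
  | PSeq p q => Seq (comp p) (comp q)
  | PIf b p q => If b (comp p) (comp q)
  | PFor v w p =>
      Seq (NSet (NLit v) (NLit 0))
          (While (NLe (NAdd (var v) (NLit 1)) (var w))
                 (Seq (comp p) (NSet (NLit v) (NAdd (var v) (NLit 1)))))
  end.

Fixpoint nwrites (p : prog) : seq nat :=
  match p with
  | PSkip | PA _ _ _ | PO _ _ => [::]
  | PN v _ | PAsk v _ _ => [:: v]
  | PSeq p q | PIf _ p q => nwrites p ++ nwrites q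
  | PFor v _ p => v :: nwrites p
  end.

Fixpoint awrites (p : prog) : seq nat :=
  match p with
  | PA c _ _ => [:: c]
  | PSeq p q | PIf _ p q => awrites p ++ awrites q
  | PFor _ _ p => awrites p
  | _ => [::]
  end.

(** Pure programs leave the read-only zone intact; array numbers below 16 keep the interleaved
    arrays disjoint. *)
Fixpoint pure (p : prog) : bool :=
  match p with
  | PO _ _ => false
  | PA c _ _ => (c < 16)%N
  | PSeq p q | PIf _ p q => pure p && pure q
  | PFor v w p => pure p
  | PN v _ | PAsk v _ _ => true
  | _ => true
  end.

(** The compiled loop rereads counter and bound at every test, whereas [den] fixes the number of
    rounds at entry. The two agree when the body writes neither cell. *)
Fixpoint wf (p : prog) : bool :=
  match p with
  | PSeq p q | PIf _ p q => wf p && wf q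
  | PFor v w p => [&& v \notin nwrites p, w \notin nwrites p, v != w & wf p]
  | _ => true
  end.

Variables (K : realType) (d k : nat) (f : 'I_k -> Rn K d -> bool).
Implicit Types (st s : store K) (p q : prog).

Fixpoint den (p : prog) (st : store K) : store K :=
  match p with
  | PSkip => st
  | PN v e => nset st v (neval st e)
  | PA c e r => rset st (neval st (cell c e)) (reval st r)
  | PO e r => rset st (neval st e) (reval st r)
  | PAsk v i a => nset st v (ask f st (neval st i) (neval st a))
  | PSeq p q => den q (den p st)
  | PIf b p q => if teval st b then den p st else den q st
  | PFor v w p =>
      iter (nmem st w) (fun s => nset (den p s) v (nmem (den p s) v).+1)
        (nset st v 0)
  end.

(** A round costs its body plus 2, for the test and the increment; the loop adds 1 for clearing the
    counter and 1 for the failing test. *)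
Fixpoint cost (p : prog) (st : store K) : nat :=
  match p with
  | PSeq p q => cost p st + cost q (den p st)
  | PIf b p q => (if teval st b then cost p st else cost q st).+1
  | PFor v w p =>
      1 + (\sum_(i < nmem st w)
             (cost p (iter i (fun s => nset (den p s) v (nmem (den p s) v).+1)
                        (nset st v 0%N)) + 2) + 1)
  | _ => 1
  end%N.

#[global] Arguments nset : simpl never.
#[global] Arguments rset : simpl never.
#[global] Arguments cell : simpl never.

Lemma nmem_nset st a v x :
  nmem (nset st a v) x = if x == a then v else nmem st x.
Proof. by []. Qed.

Lemma iter_inv (I : nat -> store K -> Prop) F n st :
  I 0%N st -> (forall i s, (i < n)%N -> I i s -> I i.+1 (F s)) ->
  I n (iter n F st).
Proof.
move=> I0 IS; have: (n <= n)%N by [].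
elim: {-2}n => // i IH iln; apply: (IS _ _ iln); apply: IH; exact: ltnW.
Qed.

Lemma den_nframe p st x : x \notin nwrites p -> nmem (den p st) x = nmem st x.
Proof.
elim: p st => //=.
- by move=> v e st; rewrite inE => /negPf->.
- by move=> v i a st; rewrite inE => /negPf->.
- by move=> p IHp q IHq st; rewrite mem_cat negb_or => /andP[xp xq]; rewrite IHq// IHp.
- by move=> b p IHp q IHq st; rewrite mem_cat negb_or => /andP[xp xq]; case: ifP => _; [exact: IHp|exact: IHq].
- move=> v w p IHp st; rewrite inE negb_or => /andP[/negPf xv xp].
  apply: (iter_inv (I := fun _ s => nmem s x = nmem st x)) => /=; first by rewrite xv.
  by move=> i s _ <-; rewrite xv IHp.
Qed.

Lemma neval_cell st c e :
  neval st (cell c e) = (nmem st BASE + (neval st e * 16 + c))%N.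
Proof. by rewrite /=; congr (_ + _)%N; congr (_ + _)%N; lia. Qed.

Definition ar st c i : K := rmem st (nmem st BASE + (i * 16 + c))%N.

#[global] Arguments ar : simpl never.

Lemma reval_arr st c e : reval st (arr c e) = ar st c (neval st e).
Proof. by rewrite /arr/= /ar; congr (rmem _ (_ + (_ + _))%N); lia. Qed.

Lemma ar_nset st v x c i : v != BASE -> ar (nset st v x) c i = ar st c i.
Proof. by move=> vB; rewrite /ar/= eq_sym (negPf vB). Qed.

Lemma rmem_nset st v x a : rmem (nset st v x) a = rmem st a.
Proof. by []. Qed.

Lemma ar_rset st c e r c' i : (c < 16)%N -> (c' < 16)%N ->
  ar (rset st (neval st (cell c e)) r) c' i =
  if (c' == c) && (i == neval st e) then r else ar st c' i.
Proof.
move=> c16 c'16; rewrite neval_cell /ar/=.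
case: ifP => [/eqP E|/negP E].
  have -> : c' = c by lia.
  have -> : i = neval st e by lia.
  by rewrite !eqxx.
by case: ifP => // /andP[/eqP Ec /eqP Ei]; case: E; rewrite Ec Ei.
Qed.

Lemma rmem_rset st c e r a : (a < nmem st BASE)%N ->
  rmem (rset st (neval st (cell c e)) r) a = rmem st a.
Proof. by move=> aB; rewrite neval_cell /=; case: ifP => // /eqP; lia. Qed.

Lemma den_aframe p st c i : pure p -> BASE \notin nwrites p ->
  c \notin awrites p -> (c < 16)%N -> ar (den p st) c i = ar st c i.
Proof.
move=> + + + c16; elim: p st => //=.
- by move=> v e st _; rewrite inE => vB _; rewrite ar_nset// eq_sym.
- move=> c' e r st c'16 _; rewrite inE => /negPf cc'.
  by have := ar_rset st e (reval st r) i c'16 c16; rewrite cc' /= => <-.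
- by move=> v e a st _; rewrite inE => vB _; rewrite ar_nset// eq_sym.
- move=> p IHp q IHq st /andP[? ?]; rewrite !mem_cat !negb_or => /andP[? ?] /andP[? ?].
  by rewrite IHq// IHp.
- move=> b p IHp q IHq st /andP[? ?]; rewrite !mem_cat !negb_or => /andP[? ?] /andP[? ?].
  by case: ifP => _; [exact: IHp|exact: IHq].
- move=> v w p IHp st pp; rewrite inE negb_or => /andP[Bv Bp] cp.
  apply: (iter_inv (I := fun _ s => ar s c i = ar st c i)) => /=.
    by rewrite ar_nset// eq_sym.
  by move=> j s _ <-; rewrite ar_nset 1?eq_sym// IHp.
Qed.

Lemma den_rframe p st a : pure p -> BASE \notin nwrites p ->
  (a < nmem st BASE)%N -> rmem (den p st) a = rmem st a.
Proof.
elim: p st => //=.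
- by move=> c e r st _ _ aB; exact: (rmem_rset c e (reval st r) aB).
- move=> p IHp q IHq st /andP[? ?]; rewrite mem_cat negb_or => /andP[? ?] aB.
  by rewrite IHq// ?den_nframe// IHp.
- move=> b p IHp q IHq st /andP[? ?]; rewrite !mem_cat !negb_or => /andP[? ?] aB.
  by case: ifP => _; [exact: IHp|exact: IHq].
- move=> v w p IHp st pp; rewrite inE negb_or => /andP[Bv Bp] aB.
  apply: (iter_inv (I := fun _ s => (a < nmem s BASE)%N /\ rmem s a = rmem st a)
    (n := nmem st w) (st := nset st v 0%N) _ _).2 => /=.
    by rewrite (negPf Bv).
  by move=> j s _ [aB' <-]; rewrite (negPf Bv) den_nframe// IHp.
Qed.

Lemma den_exec p st : wf p -> exec f (comp p) st (cost p st) (den p st).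
Proof.
elim: p st => //=.
- by move=> st _; exact: ExecSkip.
- by move=> v e st _; exact: (ExecNSet f st (NLit v) e).
- by move=> c e r st _; exact: ExecRSet.
- by move=> e r st _; exact: ExecRSet.
- by move=> v i a st _; exact: (ExecAsk f st (NLit v) i a).
- by move=> p IHp q IHq st /andP[wp wq]; apply: ExecSeq; [exact: IHp|exact: IHq].
- by move=> b p IHp q IHq st /andP[wp wq]; apply: ExecIf; case: ifP => _; [exact: IHp|exact: IHq].
- move=> v w p IHp st /and4P[vp wp vw wfp].
  apply: ExecSeq; first exact: (ExecNSet f st (NLit v) (NLit 0)).
  set F := fun s => _.
  (* Generalized to a loop entered at counter value [i] with [n] rounds left, so that induction on
     [n] applies. *)
  have key n i s : nmem s v = i -> nmem s w = (i + n)%N ->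
     exec f (While (NLe (NAdd (var v) (NLit 1)) (var w))
                 (Seq (comp p) (NSet (NLit v) (NAdd (var v) (NLit 1))))) s
      (\sum_(j < n) (cost p (iter j F s) + 2) + 1) (iter n F s).
    elim: n i s => [|n IHn] i s sv sw.
      rewrite big_ord0 add0n; apply: ExecWhileStop => /=.
      by rewrite sv sw; lia.
    have -> : (\sum_(j < n.+1) (cost p (iter j F s) + 2) + 1 =
      ((cost p s + 1) + (\sum_(j < n) (cost p (iter j F (F s)) + 2) + 1)).+1)%N.
      rewrite big_ord_recl (eq_bigr (fun j : 'I_n => (cost p (iter j F (F s)) + 2)%N)).
        rewrite (_ : iter (@ord0 n) F s = s)//.
        by move: (\sum_(j < n) _)%N (cost p s) => X Y; lia.
      by move=> j _; rewrite -iterSr.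
    rewrite [iter n.+1 F s]iterSr.
    apply: (ExecWhileStep (st2 := F s)).
    - by rewrite /= sv sw; lia.
    - apply: ExecSeq; first exact: IHp.
      by rewrite /F -[X in nset _ _ X]addn1; exact: (ExecNSet f (den p s) (NLit v) (NAdd (var v) (NLit 1))).
    - apply: (IHn i.+1); rewrite /F /=; first by rewrite eqxx den_nframe// sv.
      by rewrite eq_sym (negPf vw) den_nframe// sw addnS.
  have := key (nmem st w) 0%N (nset st v 0%N).
  apply; rewrite /= ?eqxx// eq_sym (negPf vw)//.
Qed.

(** The facts due to framing alone (cells and arrays that the body does not write, the read-only
    zone, the counter) are carried along, so an invariant [I] has to mention only what changes. *)
Lemma for_inv (I : nat -> store K -> Prop) v w p st :
  v \notin nwrites p -> v != w -> w \notin nwrites p -> v != BASE -> BASE \notin nwrites p ->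
  pure p ->
  I 0%N (nset st v 0%N) ->
  (forall i s, (i < nmem st w)%N -> nmem s v = i ->
     (forall x, x \notin v :: nwrites p -> nmem s x = nmem st x) ->
     (forall c j, c \notin awrites p -> (c < 16)%N -> ar s c j = ar st c j) ->
     (forall a, (a < nmem st BASE)%N -> rmem s a = rmem st a) ->
     I i s -> I i.+1 (nset (den p s) v i.+1)) ->
  I (nmem st w) (den (PFor v w p) st).
Proof.
move=> vp vw wp vB Bp pp I0 IS /=.
pose J i s := [/\ I i s, nmem s v = i,
  (forall x, x \notin v :: nwrites p -> nmem s x = nmem st x),
  (forall c j, c \notin awrites p -> (c < 16)%N -> ar s c j = ar st c j) &
  (forall a, (a < nmem st BASE)%N -> rmem s a = rmem st a)].
suff: J (nmem st w) (den (PFor v w p) st) by case.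
apply: iter_inv.
- split=> //=; first by rewrite eqxx.
  + by move=> x; rewrite inE negb_or => /andP[/negPf-> _].
  + by move=> c j _ _; rewrite ar_nset.
- move=> i s iw [Ii sv sn sa sr]; split => //.
  + by rewrite den_nframe// sv; exact: IS.
  + by rewrite /= eqxx den_nframe// sv.
  + move=> x xvp; move: (xvp); rewrite inE negb_or => /andP[/negPf xv xp] /=.
    by rewrite xv den_nframe// sn.
  + by move=> c j cp c16; rewrite ar_nset// den_aframe// sa.
  + move=> a aB /=; rewrite den_rframe ?sr//.
    by rewrite sn// inE negb_or eq_sym vB.
Qed.

Fixpoint bvars (p : prog) : seq nat :=
  match p with
  | PSeq p q | PIf _ p q => bvars p ++ bvars q
  | PFor _ w p => w :: bvars p
  | _ => [::]
  end.

(** The 4 of a loop pays for two units per round and for the two units of the loop itself. *)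
Fixpoint csize (p : prog) : nat :=
  match p with
  | PSeq p q | PIf _ p q => (csize p + csize q).+1
  | PFor _ _ p => csize p + 4
  | _ => 1
  end%N.

(* [depth kv p] does not count the loops bounded by the cell [kv], which are
   counted by [kdepth kv p]. *)
Fixpoint depth (kv : nat) (p : prog) : nat :=
  match p with
  | PSeq p q | PIf _ p q => maxn (depth kv p) (depth kv q)
  | PFor _ w p => (w != kv) + depth kv p
  | _ => 0
  end%N.

Fixpoint kdepth (kv : nat) (p : prog) : nat :=
  match p with
  | PSeq p q | PIf _ p q => maxn (kdepth kv p) (kdepth kv q)
  | PFor _ w p => (w == kv) + kdepth kv p
  | _ => 0
  end%N.

(** No loop bound is written anywhere in [p], so the values at entry bound every loop throughout;
    each level of nesting then contributes one factor. The cell [kv] has a factor of its own, which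
    makes linearity in [k] visible. *)
Lemma cost_le kv W kk p st : wf p -> all [predC nwrites p] (bvars p) ->
  (0 < W)%N -> (0 < kk)%N ->
  (forall w, w \in bvars p -> nmem st w <= if w == kv then kk else W)%N ->
  (cost p st <= csize p * (W ^ depth kv p * kk ^ kdepth kv p))%N.
Proof.
move=> + + W0 kk0.
have mono D D' E E' : (D <= D' -> E <= E' -> W ^ D * kk ^ E <= W ^ D' * kk ^ E')%N.
  by move=> DD EE; rewrite leq_mul// leq_pexp2l.
have pos D E : (0 < W ^ D * kk ^ E)%N by rewrite muln_gt0 !expn_gt0 W0 kk0.
elim: p st => //=; try by move=> *; rewrite mul1n.
- move=> p IHp q IHq st /andP[wp wq]; rewrite all_cat => /andP[/allP/= ap /allP/= aq] B.
  have nin w : w \in bvars p ++ bvars q -> w \notin nwrites p /\ w \notin nwrites q.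
    rewrite mem_cat => /orP[/ap|/aq]; rewrite mem_cat negb_or => /andP[? ?];
    by split.
  rewrite mulSn; apply: leq_trans (leq_addl _ _).
  rewrite mulnDl; apply: leq_add.
    apply: (leq_trans (IHp st wp _ _)); last by rewrite leq_mul// mono ?leq_maxl.
      by apply/allP => w wp'; have [] := nin w; rewrite // mem_cat wp'.
    by move=> w wb; apply: B; rewrite mem_cat wb.
  apply: (leq_trans (IHq _ wq _ _)); last by rewrite leq_mul// mono ?leq_maxr.
    by apply/allP => w wp'; have [] := nin w; rewrite // mem_cat wp' orbT.
  move=> w wb; have wb' : w \in bvars p ++ bvars q by rewrite mem_cat wb orbT.
  by rewrite den_nframe ?(nin _ wb').1// B.
- move=> b p IHp q IHq st /andP[wp wq]; rewrite all_cat => /andP[/allP/= ap /allP/= aq] B.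
  rewrite mulSn addnC -addn1; apply: leq_add => //.
  rewrite mulnDl; case: ifP => _.
    apply: leq_trans (leq_addr _ _).
    apply: (leq_trans (IHp st wp _ _)); last by rewrite leq_mul// mono ?leq_maxl.
      by apply/allP => w /ap; rewrite mem_cat negb_or => /andP[].
    by move=> w wb; apply: B; rewrite mem_cat wb.
  apply: leq_trans (leq_addl _ _).
  apply: (leq_trans (IHq st wq _ _)); last by rewrite leq_mul// mono ?leq_maxr.
    by apply/allP => w /aq; rewrite mem_cat negb_or => /andP[].
  by move=> w wb; apply: B; rewrite mem_cat wb orbT.
- move=> v w p IHp st /and4P[vp wp vw wfp] /andP[_ /allP ab] B.
  set X := (W ^ depth kv p * kk ^ kdepth kv p)%N in IHp *.
  have X0 : (0 < X)%N by exact: pos.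
  pose n := nmem st w.
  have nB : (n <= if w == kv then kk else W)%N by apply: B; rewrite inE eqxx.
  have E : (W ^ ((w != kv) + depth kv p) * kk ^ ((w == kv) + kdepth kv p) =
            (if w == kv then kk else W) * X)%N.
    by rewrite /X; case: (w == kv); rewrite /= !expnD ?expn1 ?expn0; lia.
  rewrite E.
  set F := fun s : store K => _.
  have Cst i : (i < n)%N -> (cost p (iter i F (nset st v 0)) <= csize p * X)%N.
    move=> il; apply: IHp => //.
      by apply/allP => x /ab; rewrite /= inE negb_or => /andP[].
    move=> x xb; rewrite (_ : nmem _ x = nmem st x).
      by apply: B; rewrite inE xb orbT.
    have := ab _ xb; rewrite /= inE negb_or => /andP[/negPf xv xp].
    apply: (iter_inv (I := fun _ s => nmem s x = nmem st x)).
      by rewrite nmem_nset xv.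
    by move=> j s _ <-; rewrite /F nmem_nset xv den_nframe.
  have S : (\sum_(i < n) (cost p (iter i F (nset st v 0)) + 2) <= n * (csize p * X + 2))%N.
    have -> : (n * (csize p * X + 2) = \sum_(i < n) (csize p * X + 2))%N.
      by rewrite sum_nat_const card_ord.
    by apply: leq_sum => i _; rewrite leq_add2r Cst.
  have S2 : (n * (csize p * X + 2) <= (if w == kv then kk else W) * ((csize p + 2) * X))%N.
    by apply: leq_mul => //; rewrite mulnDl leq_add2l; lia.
  have B0 : (0 < if w == kv then kk else W)%N by case: ifP.
  rewrite -/n addn1 add1n -add2n.
  apply: (leq_trans (leq_add (leqnn 2) (leq_trans S S2))).
  move: (if w == kv then kk else W) B0 => b B0.
  have : (0 < b * X)%N by rewrite muln_gt0 B0.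
  by rewrite !mulnDl mulnDr !(mulnCA b); lia.
Qed.

End ForPrograms.
#[global] Arguments nset : simpl never.
#[global] Arguments rset : simpl never.
#[global] Arguments cell : simpl never.
#[global] Arguments ar : simpl never.

(** * Gram-Schmidt and leverage *)

Section GramSchmidt.
Variables (K : realType) (V : Type) (m : nat).
Implicit Types (S : seq V) (F : V -> nat -> K) (g : V -> K).

Definition dot S F (i j : nat) : K := \sum_(y <- S) F y i * F y j.

(** One sweep of Gram-Schmidt: column [i] is projected out of all later columns. Inner products are
    taken over [S], but the functions change at every point of [V]. Nothing is normalized, for lack
    of square roots; a column vanishing on [S] is projected out with coefficient 0, since division
    by 0 gives 0. *)
Definition gstep S F (i : nat) : V -> nat -> K := fun x j =>
  if (i < j)%N then F x j - dot S F i j / dot S F i i * F x i else F x j.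

Fixpoint gs S F (i : nat) : V -> nat -> K :=
  if i is i'.+1 then gstep S (gs S F i') i' else F.

Definition inspan F g := exists a : nat -> K, forall x, g x = \sum_(j < m) a j * F x j.

Lemma dot_ge0 S F i : 0 <= dot S F i i.
Proof. by apply: sumr_ge0 => y _; rewrite -expr2 sqr_ge0. Qed.

Lemma dotC S F i j : dot S F i j = dot S F j i.
Proof. by apply: eq_bigr => y _; rewrite mulrC. Qed.

Lemma sqr_le_sum_sqr (I : Type) (s : seq I) (h : I -> K) (P : pred I) :
  0 <= \sum_(y <- s | P y) h y ^+ 2.
Proof. by apply: sumr_ge0 => y _; exact: sqr_ge0. Qed.

(** A sum of squares that vanishes has vanishing terms. This is what makes linearly dependent
    columns harmless. *)
Lemma dot_eq0 S F i j : dot S F i i = 0 -> dot S F i j = 0.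
Proof.
elim: S => [|y S IH]; first by rewrite /dot !big_nil.
rewrite /dot !big_cons -/(dot S F i i) -/(dot S F i j) => H.
have y0 : 0 <= F y i * F y i by rewrite -expr2 sqr_ge0.
have Fy : F y i = 0.
  apply/eqP; rewrite -sqrf_eq0 expr2; apply/eqP.
  have := dot_ge0 S F i; lra.
by rewrite IH ?Fy ?mul0r ?add0r//; move: H; rewrite Fy mul0r add0r.
Qed.

Lemma gstep_le S F i x j : (j <= i)%N -> gstep S F i x j = F x j.
Proof. by rewrite /gstep ltnNge => ->. Qed.

Lemma dot_gstep S F i a j : (a <= i)%N -> dot S (gstep S F i) a j =
  if (i < j)%N then dot S F a j - dot S F i j / dot S F i i * dot S F a i else dot S F a j.
Proof.
move=> ai; rewrite /dot; case: ifPn => ij; last first.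
  by apply: eq_bigr => y _; rewrite !gstep_le// leqNgt.
rewrite mulr_sumr -sumrB; apply: eq_bigr => y _.
by rewrite gstep_le// /gstep ij mulrBr (mulrCA (F y a)).
Qed.

(** Once a column has been swept, later sweeps leave it alone and change the columns after it only
    by multiples of columns already orthogonal to it. *)
Lemma gs_orth_lt S F i a j : (a < i)%N -> (a < j)%N -> dot S (gs S F i) a j = 0.
Proof.
elim: i a j => // i IH a j; rewrite ltnS leq_eqVlt => /orP[/eqP->|ai] aj /=.
  rewrite dot_gstep// aj; have [D0|D0] := eqVneq (dot S (gs S F i) i i) 0.
    by rewrite (dot_eq0 j D0) D0 mulr0 subrr.
  by rewrite divfK// subrr.
by rewrite (dot_gstep _ _ _ (ltnW ai)) (IH _ _ ai aj) (IH _ _ ai ai) mulr0 subrr if_same.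
Qed.

Lemma gs_orth S F i j : (i < m)%N -> (j < m)%N -> i != j -> dot S (gs S F m) i j = 0.
Proof.
move=> im jm; rewrite neq_ltn => /orP[ij|ij]; first exact: gs_orth_lt.
by rewrite dotC gs_orth_lt.
Qed.

(** The change of columns is unipotent: column [j] loses [u j] times column [i], and [u i = 0], so
    adding the same multiples back inverts it. *)
Lemma inspan_gstep S F i g : (i < m)%N -> inspan F g <-> inspan (gstep S F i) g.
Proof.
move=> im; pose u j := if (i < j)%N then dot S F i j / dot S F i i else 0.
have FE x j : gstep S F i x j = F x j - u j * F x i.
  by rewrite /gstep /u; case: ifP => //; rewrite mul0r subr0.
pose im' := Ordinal im.
have key a c x : \sum_(j < m) (if j == im' then a i + c else a j) * F x j =
    \sum_(j < m) a j * F x j + c * F x i.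
  rewrite (bigD1 im')//= eqxx [in RHS](bigD1 im')//=.
  rewrite mulrDl -!addrA; congr (_ + _); rewrite addrC; congr (_ + _).
  by apply: eq_bigr => j /negPf->.
have ui : u i = 0 by rewrite /u ltnn.
split=> -[a aE].
- exists (fun j => if j == i then a i + \sum_(j < m) a j * u j else a j) => x.
  have key' c : \sum_(j < m) (if j == i :> nat then a i + c else a j) * gstep S F i x j =
    \sum_(j < m) a j * gstep S F i x j + c * gstep S F i x i.
    rewrite (bigD1 im')//= eqxx [in RHS](bigD1 im')//=.
    rewrite mulrDl -!addrA; congr (_ + _); rewrite addrC; congr (_ + _).
    by apply: eq_bigr => j /negPf jj; rewrite -val_eqE/= in jj; rewrite jj.
  rewrite key' FE ui mul0r subr0 aE.
  under [X in _ = X + _]eq_bigr do rewrite FE mulrBr.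
  rewrite sumrB mulr_suml; under [X in _ = _ - X + _]eq_bigr do rewrite mulrA.
  by rewrite subrK.
- exists (fun j => if j == i then a i - \sum_(j < m) a j * u j else a j) => x.
  rewrite aE (eq_bigr (fun j : 'I_m => a j * F x j - a j * u j * F x i)); last first.
    by move=> j _; rewrite FE mulrBr mulrA.
  rewrite sumrB -mulr_suml -mulNr -key; apply: eq_bigr => j _.
  by rewrite -val_eqE.
Qed.

Lemma inspan_gs S F g : inspan F g <-> inspan (gs S F m) g.
Proof.
have: (m <= m)%N by [].
elim: {1 3}m => // i IH im; rewrite IH 1?ltnW//=.
exact: inspan_gstep.
Qed.

Variables (F : V -> nat -> K).
Implicit Types (x : V).

Definition psi S := gs S F m.
Definition nrm S j := dot S (psi S) j j.
(** The l1 norm on [S] stands in for the square root of [nrm]. From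
    [nrm <= scal ^ 2 <= size S * nrm], the price is at most a factor of the square root of [size S]
    in the coordinates. *)
Definition scal S j := \sum_(y <- S) `|psi S y j|.
Definition zeta S x j := psi S x j / scal S j.
Definition lev S x := \sum_(j < m) psi S x j ^+ 2 / nrm S j.
(** [lev] is the leverage of [x]. A column with [nrm = 0] contributes 0 to it, by the convention for
    division by 0; the first conjunct excludes the points at which such a column is nonzero. *)
Definition good S x := [forall j : 'I_m, psi S x j ^+ 2 <= nrm S j] && (lev S x <= 1).

Lemma parseval S (a : nat -> K) :
  \sum_(y <- S) (\sum_(j < m) a j * psi S y j) ^+ 2 = \sum_(j < m) a j ^+ 2 * nrm S j.
Proof.
have E (y : V) : (\sum_(j < m) a j * psi S y j) ^+ 2 =
    \sum_(i < m) \sum_(j < m) a i * a j * (psi S y i * psi S y j).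
  rewrite expr2 mulr_suml; apply: eq_bigr => i _; rewrite mulr_sumr.
  by apply: eq_bigr => j _; rewrite mulrACA.
under eq_bigr do rewrite E.
rewrite exchange_big; apply: eq_bigr => i _ /=.
rewrite exchange_big /= (bigD1 i)//= [X in _ + X]big1 ?addr0.
  by rewrite -mulr_sumr expr2.
move=> j ji; rewrite -mulr_sumr -/(dot _ _ _ _).
by rewrite (gs_orth S F (ltn_ord i) (ltn_ord j)) ?mulr0// eq_sym.
Qed.

(** Cauchy-Schwarz with weights [nrm], obtained without roots: the expression [key] is a quadratic
    in [t] that is nonnegative, and it is evaluated at its minimum [t = B / lev]. *)
Lemma sqr_le_lev S (a : nat -> K) x :
  (forall j : 'I_m, nrm S j = 0 -> psi S x j = 0) ->
  (\sum_(j < m) a j * psi S x j) ^+ 2 <= (\sum_(j < m) a j ^+ 2 * nrm S j) * lev S x.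
Proof.
move=> N0; set B := \sum_(j < m) _; set A := \sum_(j < m) _.
have key t : 0 <= A - 2 * t * B + t ^+ 2 * lev S x.
  rewrite /A /B /lev !mulr_sumr -sumrB -big_split/=.
  apply: sumr_ge0 => j _; have [n0|n0] := eqVneq (nrm S j) 0.
    by rewrite N0// n0 !mulr0 subr0 expr0n/= mul0r mulr0 addr0.
  rewrite (_ : _ + _ = nrm S j * (a j - t * (psi S x j / nrm S j)) ^+ 2).
    by rewrite mulr_ge0 ?sqr_ge0// dot_ge0.
  by field.
have L0 : 0 <= lev S x.
  by apply: sumr_ge0 => j _; rewrite mulr_ge0 ?sqr_ge0// invr_ge0 dot_ge0.
have [l0|l0] := eqVneq (lev S x) 0.
  have -> : B = 0.
    apply: big1 => j _; have [n0|n0] := eqVneq (nrm S j) 0; first by rewrite N0// mulr0.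
    have /eqP : psi S x j ^+ 2 / nrm S j = 0.
      apply: (psumr_eq0P (P := xpredT) _ l0) => // i _.
      by rewrite mulr_ge0 ?sqr_ge0// invr_ge0 dot_ge0.
    by rewrite mulf_eq0 invr_eq0 (negPf n0) orbF sqrf_eq0 => /eqP->; rewrite mulr0.
  by rewrite l0 mulr0 expr0n.
have lp : 0 < lev S x by rewrite lt_def l0.
have := key (B / lev S x).
rewrite (_ : _ + _ = A - B ^+ 2 / lev S x); last by field.
by rewrite subr_ge0 ler_pdivrMr.
Qed.

(** This makes the region computable. One direction is Parseval together with [sqr_le_lev]. For the
    other, the test functions are the single columns and the combination with coefficients
    [psi S x i / nrm S i], for which the hypothesis reads [lev ^ 2 <= lev]. *)
Lemma goodP S x :
  reflect (forall g, inspan F g -> g x ^+ 2 <= \sum_(y <- S) g y ^+ 2) (good S x).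
Proof.
apply: (iffP andP) => [[/forallP Gn Gl] g /(inspan_gs S) [a ag]|H].
  under eq_bigr do rewrite ag.
  rewrite ag parseval; apply: (le_trans (sqr_le_lev _ _)).
    by move=> j n0; apply/eqP; rewrite -sqrf_eq0 eq_le sqr_ge0 andbT -n0.
  apply: ler_piMr => //.
  by apply: sumr_ge0 => j _; rewrite mulr_ge0 ?sqr_ge0 ?dot_ge0.
have Hpsi (a : nat -> K) : (\sum_(j < m) a j * psi S x j) ^+ 2 <= \sum_(j < m) a j ^+ 2 * nrm S j.
  rewrite -(parseval S a); apply: (H (fun y => \sum_(j < m) a j * psi S y j)).
  by apply/(inspan_gs S); exists a.
have Hj (j : 'I_m) : psi S x j ^+ 2 <= nrm S j.
  have := Hpsi (fun i => (i == j :> nat)%:R).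
  rewrite (bigD1 j)//= eqxx mul1r big1 ?addr0; last first.
    by move=> i; rewrite -val_eqE/= => /negPf->; rewrite mul0r.
  rewrite (bigD1 j)//= eqxx expr1n mul1r big1 ?addr0//.
  by move=> i; rewrite -val_eqE/= => /negPf->; rewrite expr0n mul0r.
split; first by apply/forallP.
have := Hpsi (fun i => psi S x i / nrm S i).
have -> : \sum_(j < m) psi S x j / nrm S j * psi S x j = lev S x.
  by apply: eq_bigr => j _; rewrite mulrAC -expr2.
have -> : \sum_(j < m) (psi S x j / nrm S j) ^+ 2 * nrm S j = lev S x.
  apply: eq_bigr => j _; have [n0|n0] := eqVneq (nrm S j) 0; last by field.
  by rewrite n0 invr0 !mulr0.
have L0 : 0 <= lev S x.
  by apply: sumr_ge0 => j _; rewrite mulr_ge0 ?sqr_ge0// invr_ge0 dot_ge0.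
by nra.
Qed.

Lemma good_sub S S' x : (forall g : V -> K, \sum_(y <- S) g y ^+ 2 <= \sum_(y <- S') g y ^+ 2) ->
  good S x -> good S' x.
Proof. by move=> SS /goodP H; apply/goodP => g gF; apply: (le_trans (H g gF)). Qed.

Lemma sum_sqr_le (s : seq V) (h : V -> K) :
  \sum_(y <- s) h y ^+ 2 <= (\sum_(y <- s) `|h y|) ^+ 2.
Proof.
elim: s => [|y s IH]; first by rewrite !big_nil expr0n.
rewrite !big_cons -real_normK ?num_real//.
move: IH; have : 0 <= \sum_(y <- s) `|h y| by apply: sumr_ge0.
move: (normr_ge0 (h y)).
by move: (\sum_(y <- s) `|h y| : K) (\sum_(y <- s) h y ^+ 2) (`|h y| : K) => A B z z0 A0 AB; nra.
Qed.

Lemma sqr_sum_norm_le (s : seq V) (h : V -> K) :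
  (\sum_(y <- s) `|h y|) ^+ 2 <= (size s)%:R * \sum_(y <- s) h y ^+ 2.
Proof.
elim: s => [|y s IH]; first by rewrite !big_nil expr0n mul0r.
rewrite !big_cons /= -[(size s).+1]addn1 natrD -[h y ^+ 2]real_normK ?num_real//.
move: IH; have A0 : 0 <= \sum_(y <- s) `|h y| by apply: sumr_ge0.
have B0 : 0 <= \sum_(y <- s) h y ^+ 2 by apply: sumr_ge0 => w _; exact: sqr_ge0.
move: (normr_ge0 (h y)) (ler0n K (size s)) A0 B0.
move: (\sum_(y <- s) `|h y| : K) (\sum_(y <- s) h y ^+ 2) (`|h y| : K) (size s)%:R => A B z n z0 n0 A0 B0 H.
have [n00|n00] := eqVneq n 0.
  rewrite n00 mul0r in H; have A00 : A = 0.
    by apply/eqP; rewrite -sqrf_eq0 eq_le sqr_ge0 andbT.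
  by rewrite n00 A00 addr0 add0r mul1r; lra.
have np : 0 < n by rewrite lt_def n00.
have Q : 0 <= (n * z - A) ^+ 2 by exact: sqr_ge0.
suff : 0 <= n * ((n + 1) * (z ^+ 2 + B) - (z + A) ^+ 2) by rewrite pmulr_rge0// subr_ge0.
have : 0 <= (n + 1) * (n * B - A ^+ 2) by rewrite mulr_ge0 ?subr_ge0// addr_ge0.
by lra.
Qed.

Lemma nrm_sqr S j : nrm S j = \sum_(y <- S) psi S y j ^+ 2.
Proof. by apply: eq_bigr => y _; rewrite expr2. Qed.

Lemma nrm_le_scal S j : nrm S j <= scal S j ^+ 2.
Proof. by rewrite nrm_sqr; exact: sum_sqr_le. Qed.

Lemma scal_le_nrm S j : scal S j ^+ 2 <= (size S)%:R * nrm S j.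
Proof. by rewrite nrm_sqr; exact: sqr_sum_norm_le. Qed.

Lemma zeta_le1 S x j : good S x -> (j < m)%N -> `|zeta S x j| <= 1.
Proof.
move=> /andP[/forallP Gn _] jm; have := Gn (Ordinal jm) => /= H.
have c0 : 0 <= scal S j by apply: sumr_ge0.
have [s0|s0] := eqVneq (scal S j) 0; first by rewrite /zeta s0 invr0 mulr0 normr0.
have cp : 0 < scal S j by rewrite lt_def s0.
rewrite /zeta normrM normfV (ger0_norm c0) ler_pdivrMr// mul1r.
rewrite -ler_sqr ?nnegrE// real_normK ?num_real//.
exact: (le_trans H (nrm_le_scal _ _)).
Qed.

(** Parseval gives [a j ^ 2 * nrm j <= size S * lam ^ 2] for the coefficients over [psi]; passing to
    [zeta] multiplies them by [scal], whose square is at most [size S * nrm]. On the region,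
    [g x ^ 2] is at most the sum of squares over [S], so the same number bounds [g] there. *)
Lemma zeta_coord S g (lam : K) : inspan F g -> (forall y, List.In y S -> `|g y| <= lam) ->
  exists a : nat -> K, (forall j, (j < m)%N -> `|a j| <= (size S)%:R * lam) /\
    forall x, good S x -> g x = \sum_(j < m) a j * zeta S x j /\ `|g x| <= (size S)%:R * lam.
Proof.
move=> /[dup] gsp /(inspan_gs S) [a]; rewrite -/(psi S) => ag gl.
have gS : \sum_(y <- S) g y ^+ 2 <= (size S)%:R * lam ^+ 2.
  elim: {ag} S gl => [|y S IH] gl; first by rewrite big_nil mul0r.
  rewrite big_cons/= -[(size S).+1]add1n natrD mulrDl mul1r lerD ?IH//.
    rewrite -real_normK ?num_real// ler_sqr ?nnegrE//; first by apply: gl; left.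
    by apply: (le_trans (normr_ge0 (g y))); apply: gl; left.
  by move=> z zS; apply: gl; right.
(* For an empty sample every function of the span vanishes at a good point, and zero coordinates do;
   otherwise [lam] is nonnegative. *)
have [S0|Sp] := posnP (size S).
  move/size0nil: S0 => SE; subst S; exists (fun _ => 0); split => [j _|x].
    by rewrite normr0 mul0r.
  move=> /goodP/(_ g gsp); rewrite big_nil => H.
  have /eqP : g x ^+ 2 = 0 by apply/eqP; rewrite eq_le H sqr_ge0.
  rewrite sqrf_eq0 => /eqP ->; rewrite normr0 mul0r; split=> //.
  by rewrite big1// => j _; rewrite mul0r.
have lam0 : 0 <= lam.
  by case: S Sp gl {ag gS} => // y S _ gl; apply: (le_trans (normr_ge0 (g y))); apply: gl; left.
have s1 : 1 <= (size S)%:R :> K by rewrite ler1n.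
have s0 : 0 <= (size S)%:R :> K by rewrite ler0n.
exists (fun j => a j * scal S j); split=> [j jm|x gx].
  rewrite -ler_sqr ?nnegrE//; last by rewrite mulr_ge0.
  rewrite real_normK ?num_real// exprMn.
  have aN : a j ^+ 2 * nrm S j <= \sum_(y <- S) g y ^+ 2.
    under eq_bigr do rewrite ag.
    rewrite parseval (bigD1 (Ordinal jm))//= lerDl.
    by apply: sumr_ge0 => i _; rewrite mulr_ge0 ?sqr_ge0 ?dot_ge0.
  have := scal_le_nrm S j; move: (scal S j ^+ 2) (nrm S j) aN => A B aN AB.
  apply: (@le_trans _ _ ((size S)%:R * (a j ^+ 2 * B))).
    by rewrite mulrCA ler_wpM2l ?sqr_ge0.
  rewrite (_ : (_ * lam) ^+ 2 = (size S)%:R * ((size S)%:R * lam ^+ 2)); last by ring.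
  by rewrite ler_wpM2l// (le_trans aN).
split.
  rewrite ag; apply: eq_bigr => j _; rewrite /zeta; have [s0'|s0'] := eqVneq (scal S j) 0; last first.
    by rewrite mulrACA divff// mulr1.
  rewrite s0' mulr0 mul0r; move: gx => /andP[/forallP/(_ j) + _] => H.
  have := nrm_le_scal S j; rewrite s0' expr0n/= => N0.
  have /eqP : psi S x j ^+ 2 = 0 by apply/eqP; rewrite eq_le sqr_ge0 andbT (le_trans H).
  by rewrite sqrf_eq0 => /eqP->; rewrite mulr0.
rewrite -ler_sqr ?nnegrE//; last by rewrite mulr_ge0.
rewrite real_normK ?num_real//; move/goodP: gx => /(_ g gsp) H.
apply: (le_trans H); apply: (le_trans gS); rewrite exprMn ler_wpM2r ?sqr_ge0//.
by rewrite expr2 ler_peMr.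
Qed.

(* If [x = ps j] is bad for the other points, some [g] in the span carries more
   than half of its square mass at [x], so that [x] has leverage above 1/2; the
   leverages sum to at most [m]. *)
Lemma leave_one_out c (ps : 'I_c -> V) :
  (#|[pred j : 'I_c | ~~ good [seq ps i | i <- enum 'I_c & i != j] (ps j)]| <= 2 * m)%N.
Proof.
set S := [seq ps i | i <- enum 'I_c].
have sumE (h : V -> K) : \sum_(y <- S) h y = \sum_(i < c) h (ps i).
  by rewrite big_map big_enum.
have bad_lev j : ~~ good [seq ps i | i <- enum 'I_c & i != j] (ps j) -> 1/2 <= lev S (ps j).
  move=> /goodP/existsNP[g /not_implyP[gF /negP]]; rewrite -ltNge big_map big_filter big_enum_cond/=.
  move=> H; move: (gF) => /(inspan_gs S)[a ag].
  have E : \sum_(y <- S) g y ^+ 2 = g (ps j) ^+ 2 + \sum_(i < c | i != j) g (ps i) ^+ 2.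
    by rewrite sumE (bigD1 j).
  have := @sqr_le_lev S a (ps j); rewrite -(parseval S a) -ag.
  rewrite (eq_bigr (fun y => g y ^+ 2)); last by move=> y _; rewrite ag.
  rewrite E => HL; have {HL}/HL : forall i : 'I_m, nrm S i = 0 -> psi S (ps j) i = 0.
    move=> i n0; apply/eqP; rewrite -sqrf_eq0 eq_le sqr_ge0 andbT -n0 /nrm /dot sumE.
    rewrite (bigD1 j)//= expr2 lerDl; apply: sumr_ge0 => ? _; by rewrite -expr2 sqr_ge0.
  move: (sqr_ge0 (g (ps j))) (sqr_le_sum_sqr (index_enum 'I_c) (fun i => g (ps i)) (fun i => i != j)) H.
  move: (g (ps j) ^+ 2) (\sum_(i < c | i != j) _) (lev S (ps j)) => u v L u0 v0 vu uL.
  by nra.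
have sumlev : \sum_(j < c) lev S (ps j) <= m%:R.
  rewrite exchange_big /= -[X in _ <= X%:R]card_ord -sumr_const.
  apply: ler_sum => i _; rewrite -mulr_suml -(sumE (fun y => psi S y i ^+ 2)).
  rewrite (_ : \sum_(y <- S) _ = nrm S i); last by apply: eq_bigr => y _; rewrite expr2.
  by have [->|n0] := eqVneq (nrm S i) 0; [rewrite mul0r|rewrite divff].
have L0 j : 0 <= lev S (ps j).
  by apply: sumr_ge0 => i _; rewrite mulr_ge0 ?sqr_ge0// invr_ge0 dot_ge0.
set B := [pred j : 'I_c | _].
rewrite -(ler_nat K) natrM -ler_pdivrMl//; apply: le_trans sumlev.
rewrite (bigID (mem B))/= -[X in X <= _]addr0 lerD//; last exact: sumr_ge0.
rewrite -[#|B|%:R]sumr_const mulr_sumr; apply: ler_sum => j.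
by rewrite inE mulr1 => /bad_lev; rewrite mul1r.
Qed.

End GramSchmidt.

(** * Monomials of bounded degree as words over the coordinates *)

Section Features.
Variables (K : realType) (d : nat).

(** Homogeneous coordinates: thanks to the constant 1 at index 0, the products of exactly [l] of
    them are the monomials of degree at most [l]. *)
Definition xhom (x : Rn K d) (i : nat) : K := if i is i'.+1 then nth 0 (tval x : seq K) i' else 1.

(** The digits of [j] in base [d.+1] select the [l] factors. A monomial may occur several times;
    Gram-Schmidt turns the repetitions into columns that vanish on the sample. *)
Fixpoint feat (l : nat) (x : Rn K d) (j : nat) : K :=
  if l is l'.+1 then
    feat l' x (j %% d.+1 ^ l')%N * xhom x (j %/ d.+1 ^ l')%N
  else 1.

(** Induction on [l]: a monomial of smaller degree is padded with the leading digit 0; otherwise a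
    variable [i0] that occurs is split off as the leading digit [i0.+1]. *)
Lemma feat_monomial l (mu : 'I_d -> nat) : (\sum_i mu i <= l)%N ->
  exists2 j, (j < d.+1 ^ l)%N & forall x, feat l x j = \prod_i tnth x i ^+ mu i.
Proof.
elim: l mu => [|l IH] mu.
  rewrite leqn0 => /eqP mu0; exists 0%N => // x /=.
  rewrite big1// => i _; suff -> : mu i = 0%N by rewrite expr0.
  by apply/eqP; rewrite -leqn0 -mu0 (bigD1 i)//= leq_addr.
have len0 : (0 < d.+1 ^ l)%N by rewrite expn_gt0.
rewrite leq_eqVlt => /orP[/eqP E|]; last first.
  rewrite ltnS => /IH[j jl jE]; exists j => [|x /=].
    by rewrite (leq_trans jl)// leq_pexp2l.
  by rewrite modn_small// divn_small// jE mulr1.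
have [i0 mi0] : exists i, (0 < mu i)%N.
  apply: contra_eqP E => /forallNP H; rewrite big1// => i _.
  by apply/eqP; rewrite -leqn0 leqNgt; apply/negP/H.
pose mu' i := (mu i - (i == i0))%N.
have E2 : (\sum_i mu i = (\sum_i mu' i).+1)%N.
  rewrite (bigD1 i0)//= [in RHS](bigD1 i0)//= {1}/mu' eqxx subn1 -addSn prednK//.
  by congr (_ + _)%N; apply: eq_bigr => i /negPf ii; rewrite /mu' ii subn0.
have /IH[j jl jE] : (\sum_i mu' i <= l)%N by rewrite -ltnS -E2 E.
exists (j + i0.+1 * d.+1 ^ l)%N => [|x /=].
  rewrite expnS (@leq_trans (i0.+2 * d.+1 ^ l))//; first by rewrite mulSn ltn_add2r.
  by rewrite leq_mul// ltnS.
rewrite addnC modnMDl divnMDl// modn_small// divn_small// addn0 jE.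
rewrite /= -tnth_nth [in RHS](bigD1 i0)//= [X in X * _](bigD1 i0)//= {1}/mu' eqxx.
rewrite mulrAC -exprSr subn1 prednK//; congr (_ * _).
by apply: eq_bigr => i /negPf ii; rewrite /mu' ii subn0.
Qed.

Lemma peval_feat l (p : mpoly.mpoly d K) : (total_degree p <= l)%N ->
  inspan (d.+1 ^ l) (fun x => feat l x) (peval p).
Proof.
rewrite /total_degree => pl; rewrite /inspan.
have -> : peval p = fun x => \sum_(mu <- mpoly.msupp p) mpoly.mcoeff mu p *
    \prod_i tnth x i ^+ mpoly.fun_of_multinom mu i.
  by apply/funext => x; rewrite /peval mpoly.mevalE.
elim: (mpoly.msupp p : seq _) pl => [|mu s IH].
  by exists (fun=> 0) => x; rewrite big_nil big1// => j _; rewrite mul0r.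
rewrite big_cons geq_max => /andP[mul /IH[a aE]].
have [|j0 j0l j0E] := @feat_monomial l (mpoly.fun_of_multinom mu).
  by rewrite -mpoly.mdegE.
exists (fun j => a j + (j == j0)%:R * mpoly.mcoeff mu p) => x.
rewrite big_cons aE -j0E addrC; under [RHS]eq_bigr do rewrite mulrDl.
rewrite big_split/=; congr (_ + _).
rewrite (bigD1 (Ordinal j0l))//= eqxx mul1r big1 ?addr0// => j.
by rewrite -val_eqE /= => /negPf->; rewrite !mul0r.
Qed.

End Features.

(** * The perceptron *)

Section Perceptron.
Variables (K : realType) (I : finType) (m b : nat) (R : K).
Variables (w : I -> K) (ac : I -> bool) (zt : I -> nat -> K).
Hypotheses (R1 : 1 < R) (b2 : (2 <= b)%N) (mb : (m <= b)%N) (Rb : R + 2 <= b%:R).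
Hypotheses (wpos : \sum_(r | 0 < w r) w r = 1) (wneg : \sum_(r | w r <= 0) w r = - R).
Hypothesis ztb : forall r j, ac r -> (j < m)%N -> `|zt r j| <= 1.

Definition pev (q : nat -> K) (r : I) : K := \sum_(j < m) q j * zt r j.
(** In the application positive weights sit on [S'] and the others on [S]. With this sign the terms
    of nonpositive weight pair to [w r * |pev q r|], so that [upd q] is a supergradient at [q] of
    the concave homogeneous function [E_S'[q] - R E_S[|q|]] on the active points. *)
Definition sg (q : nat -> K) (r : I) : K := if (w r <= 0) && (pev q r < 0) then -1 else 1.
Definition upd (q : nat -> K) (j : nat) : K :=
  \sum_r (if ac r then w r * (sg q r * zt r j) else 0).
(** By how much the active points with [q] above level [z / b ^ 18] weigh more in [S'] than [R]
    times their weight in [S]. *)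
Definition excess (q : nat -> K) (z : nat) : K :=
  \sum_r (if ac r && ((z%:R / (b ^ 18)%:R : K) < pev q r) then w r else 0).
Definition quiet (q : nat -> K) : Prop :=
  forall z, (z < b ^ 36)%N -> excess q z <= ((b ^ 18)%:R)^-1.

Local Notation B := (b%:R : K).

Lemma B2 : 2 <= B. Proof. by rewrite ler_nat. Qed.

(** The sum counts the levels of mesh [1 / H] that lie below [y]; the condition on [Z] says that the
    levels reach up to [y]. *)
Lemma layer_cake (y H : K) (Z : nat) : 0 < H -> y * H <= Z%:R ->
  Num.max y 0 <= H^-1 * \sum_(z < Z) (z%:R / H < y)%R%:R <= Num.max y 0 + H^-1.
Proof.
move=> H0 yZ.
have -> : \sum_(z < Z) (z%:R / H < y)%R%:R = \sum_(z < Z) (z%:R < y * H)%R%:R :> K.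
  by apply: eq_bigr => z _; rewrite ltr_pdivrMr.
have -> : Num.max y 0 = H^-1 * Num.max (y * H) 0.
  by rewrite maxr_pMr ?invr_ge0 ?ltW// mulr0 mulrC mulfK// gt_eqF.
suff [l u] : Num.max (y * H) 0 <= \sum_(z < Z) (z%:R < y * H)%R%:R :> K /\
   \sum_(z < Z) (z%:R < y * H)%R%:R <= Num.max (y * H) 0 + 1 :> K.
  have Hi : 0 <= H^-1 by rewrite invr_ge0 ltW.
  by rewrite -[X in _ + X]mulr1 -mulrDr !(ler_wpM2l Hi).
move: (y * H) yZ => {}y; elim: Z => [|Z IH] yZ.
  by rewrite big_ord0 max_r ?addr_ge0.
rewrite big_ord_recr/=; have [yZ'|yZ'] := leP y Z%:R.
  by rewrite addr0; apply: IH.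
rewrite (eq_bigr (fun=> 1)) => [|z _].
  rewrite sumr_const card_ord max_l ?(le_trans _ (ltW yZ'))//.
  by split; [rewrite -natr1 in yZ|rewrite lerD2r ltW].
by rewrite (lt_trans _ yZ')// ltr_nat.
Qed.

Lemma upd_pairing (q : nat -> K) : \sum_(j < m) q j * upd q j =
  \sum_r (if ac r then w r * (sg q r * pev q r) else 0).
Proof.
under eq_bigr do rewrite /upd mulr_sumr.
rewrite exchange_big; apply: eq_bigr => r _ /=; case: ifP => _; last first.
  by rewrite big1// => j _; rewrite mulr0.
rewrite /pev !mulr_sumr; apply: eq_bigr => j _.
by rewrite mulrCA; congr (_ * _); rewrite mulrCA.
Qed.

Lemma sg_pev (q : nat -> K) r : sg q r * pev q r = if w r <= 0 then `|pev q r| else pev q r.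
Proof.
rewrite /sg; case: (w r <= 0); rewrite /= ?mul1r//; case: ltrP => p0.
  by rewrite mulN1r ltr0_norm.
by rewrite mul1r ger0_norm.
Qed.

(** [E r] exceeds the positive part of [pev q r] by at most [1 / H]. On positive weights [pev <= E],
    on the others [|pev| >= E - 1 / H], so the pairing is at most the weighted sum of [E] plus
    [R / H]. That sum is [1 / H] times [b ^ 36 = H ^ 2] excesses, each at most [1 / H] by quietness;
    both terms are thus at most 1. *)
Lemma quiet_pairing (q : nat -> K) : quiet q -> (forall r, ac r -> `|pev q r| <= (b ^ 18)%:R) ->
  \sum_(j < m) q j * upd q j <= 2.
Proof.
move=> qq qb; rewrite upd_pairing.
have H0 : 0 < (b ^ 18)%:R :> K by rewrite ltr0n expn_gt0 (leq_trans _ b2).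
set H := (b ^ 18)%:R in qb H0 *.
pose E r : K := H^-1 * \sum_(z < b ^ 36) (z%:R / H < pev q r)%R%:R.
apply: (@le_trans _ _ (\sum_r (if ac r then w r * E r else 0) - H^-1 * \sum_(r | w r <= 0) w r)).
  rewrite [X in _ - _ * X]big_mkcond/= -mulrN -sumrN mulr_sumr -big_split/=.
  apply: ler_sum => r _; rewrite sg_pev.
  have Eb : ac r -> Num.max (pev q r) 0 <= E r <= Num.max (pev q r) 0 + H^-1.
    move=> ar; apply: layer_cake => //; rewrite (_ : _%:R = H * H).
      by rewrite ler_wpM2r ?(ltW H0)// (le_trans (ler_norm _) (qb _ ar)).
    by rewrite /H -natrM -expnD.
  have [wr|wr] := leP (w r) 0; case: ifPn => ar; rewrite ?oppr0 ?mulr0 ?addr0 ?add0r//.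
  - have /andP[_ u] := Eb ar.
    rewrite mulrN (mulrC H^-1) -mulrBr ler_wnM2l// lerBlDr (le_trans u)// lerD2r.
    by rewrite ge_max ler_norm normr_ge0.
  - by rewrite mulr_ge0 ?invr_ge0 ?(ltW H0)// oppr_ge0.
  - have /andP[l _] := Eb ar.
    by rewrite ler_wpM2l ?(ltW wr)//; apply: le_trans l; rewrite le_max lexx.
rewrite wneg mulrN opprK.
have -> : \sum_r (if ac r then w r * E r else 0) = H^-1 * \sum_(z < b ^ 36) excess q z.
  rewrite /excess exchange_big mulr_sumr; apply: eq_bigr => r _ /=.
  case: (ac r) => /=; last by rewrite big1 ?mulr0.
  rewrite /E mulrCA; congr (_ * _); rewrite mulr_sumr; apply: eq_bigr => z _.
  by rewrite -/H; case: ltP => _; rewrite ?mulr1 ?mulr0.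
have : H^-1 * \sum_(z < b ^ 36) excess q z <= 1.
  rewrite ler_pdivrMl// mulr1; apply: (@le_trans _ _ (\sum_(z < b ^ 36) H^-1)).
    by apply: ler_sum => z _; exact: qq.
  rewrite sumr_const card_ord -mulr_natl (_ : 36 = 18 + 18)%N// expnD natrM.
  by rewrite -/H mulfK// gt_eqF.
have : H^-1 * R <= 1.
  rewrite ler_pdivrMl// mulr1 (@le_trans _ _ B)//; first by move: Rb; lra.
  by rewrite ler_nat (leq_trans _ (leq_pexp2l _ (isT : 1 <= 18)%N)) ?expn1// (leq_trans _ b2).
lra.
Qed.

Lemma upd_le (q : nat -> K) j : (j < m)%N -> `|upd q j| <= 1 + R.
Proof.
move=> jm; rewrite /upd; apply: (le_trans (ler_norm_sum _ _ _)).
rewrite (bigID (fun r => 0 < w r))/= -wpos.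
rewrite -[R]opprK -wneg -sumrN; apply: lerD.
  apply: ler_sum => r wr; case: ifP => ar; last by rewrite normr0 ltW.
  rewrite !normrM (gtr0_norm wr) ler_piMr ?(ltW wr)//.
  rewrite -[1]mulr1 ler_pM// ?ztb//; rewrite /sg; case: ifP => _; by rewrite ?normrN normr1.
rewrite [X in _ <= X](eq_bigl (fun r => ~~ (0 < w r))); last by move=> r; rewrite -leNgt.
apply: ler_sum => r; rewrite -leNgt => wr; case: ifP => ar; last by rewrite normr0 oppr_ge0.
rewrite !normrM (ler0_norm wr) ler_piMr ?oppr_ge0//.
rewrite -[1]mulr1 ler_pM// ?ztb//; rewrite /sg; case: ifP => _; by rewrite ?normrN normr1.
Qed.

(** Iterates are kept on a grid so that only finitely many cuts can ever be produced. *)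
Definition rounded (u v : K) := u - ((b ^ 18)%:R)^-1 <= v <= u.

Definition upath (q : nat -> nat -> K) (t : nat) : Prop :=
  (forall j, q 0%N j = 0) /\
  forall s, (s < t)%N -> quiet (q s) /\
    forall j, (j < m)%N -> rounded (upd (q s) j) (q s.+1 j - q s j).

Lemma Bexp n : B ^+ n = (b ^ n)%:R. Proof. by rewrite natrX. Qed.

Lemma upath_le1 q t s j : upath q t -> (s <= t)%N -> (j < m)%N -> `|q s j| <= s%:R * B.
Proof.
move=> [q0 qS]; elim: s => [|s IH] st jm; first by rewrite q0 normr0 mul0r.
have [_ /(_ j jm) /andP[l u]] := qS s st.
have := IH (ltnW st) jm; have := upd_le (q s) jm.
have H1 : ((b ^ 18)%:R)^-1 <= 1 :> K.
  by rewrite invf_le1 ?ler1n ?ltr0n ?expn_gt0 (leq_trans _ b2).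
rewrite -[s.+1%:R]natr1 mulrDl mul1r !ler_norml => /andP[a1 a2] /andP[c1 c2].
by move: Rb; lra.
Qed.

(** A rounded step [v] raises the square norm by twice its pairing with [q] plus its own square
    norm. The pairing is at most 2 by [quiet_pairing], plus at most 1 for rounding; each coordinate
    of [v] is at most [b]. The increase is therefore at most [6 + b ^ 3 <= b ^ 4]. *)
Lemma upath_sqr q t : upath q t -> (t <= b ^ 16)%N ->
  \sum_(j < m) q t j ^+ 2 <= t%:R * B ^+ 4.
Proof.
have Bge2 := B2; have B0 : 0 <= B by lra.
elim: t => [|t IH] qp tT.
  by rewrite mul0r big1// => j _; rewrite qp.1 expr0n.
have qpt : upath q t by split; [exact: qp.1|move=> s st; apply: qp.2; exact: ltnW].
(* The crude bound [t * b] on the coordinates suffices here: it keeps the values of [q] below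
   [b ^ 18], within the range of the tested levels. *)
have qtb (j : 'I_m) : `|q t j| <= B ^+ 17.
  apply: (le_trans (upath_le1 qpt (leqnn _) (ltn_ord j))).
  by rewrite exprSr ler_wpM2r// Bexp ler_nat ltnW.
have [qq qr] := qp.2 t (ltnSn t).
have pevb r : ac r -> `|pev (q t) r| <= (b ^ 18)%:R.
  move=> ar; apply: (le_trans (ler_norm_sum _ _ _)).
  apply: (@le_trans _ _ (\sum_(j < m) B ^+ 17)).
    by apply: ler_sum => j _; rewrite normrM -[B ^+ 17]mulr1 ler_pM// ztb.
  by rewrite sumr_const card_ord -[X in X <= _]mulr_natl -Bexp exprS ler_wpM2r ?exprn_ge0// ler_nat.
have pair := quiet_pairing qq pevb.
have H0 : 0 < B ^+ 18 by rewrite exprn_gt0//; lra.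
pose v j := q t.+1 j - q t j.
have vb (j : 'I_m) : v j ^+ 2 <= B ^+ 2.
  have /andP[l u] := qr j (ltn_ord j).
  have H1 : ((b ^ 18)%:R)^-1 <= 1 :> K.
    by rewrite invf_le1 ?ler1n ?ltr0n ?expn_gt0 (leq_trans _ b2).
  have := upd_le (q t) (ltn_ord j); rewrite ler_norml => /andP[a1 a2].
  rewrite -ler_sqr ?nnegrE ?sqr_ge0// ler_sqr ?nnegrE ?sqr_ge0//.
  by rewrite -[v j ^+ 2]real_normK ?num_real// ler_sqr ?nnegrE// ler_norml /v;
    apply/andP; split; move: Rb; lra.
have cross : \sum_(j < m) q t j * v j <= 3.
  have -> : \sum_(j < m) q t j * v j = \sum_(j < m) q t j * upd (q t) j +
      \sum_(j < m) q t j * (v j - upd (q t) j).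
    by rewrite -big_split; apply: eq_bigr => j _ /=; rewrite -mulrDr subrKC.
  suff : \sum_(j < m) q t j * (v j - upd (q t) j) <= 1 by lra.
  apply: (@le_trans _ _ (\sum_(j < m) B ^+ 17 * (B ^+ 18)^-1)).
    apply: ler_sum => j _; apply: (le_trans (ler_norm _)); rewrite normrM ler_pM//.
    have /andP[l u] := qr j (ltn_ord j).
    by rewrite -/(v j) -Bexp in l u *; rewrite ler_norml; apply/andP; split; lra.
  rewrite sumr_const card_ord -[X in X <= _]mulr_natl mulrA ler_pdivrMr// mul1r exprS.
  by rewrite ler_wpM2r ?exprn_ge0// ler_nat.
have sv : \sum_(j < m) v j ^+ 2 <= B ^+ 3.
  apply: (@le_trans _ _ (\sum_(j < m) B ^+ 2)); first exact: ler_sum.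
  by rewrite sumr_const card_ord -[X in X <= _]mulr_natl exprS ler_wpM2r ?exprn_ge0// ler_nat.
have -> : \sum_(j < m) q t.+1 j ^+ 2 = \sum_(j < m) q t j ^+ 2 +
    2 * (\sum_(j < m) q t j * v j) + \sum_(j < m) v j ^+ 2.
  rewrite mulr_sumr -!big_split; apply: eq_bigr => j _ /=; rewrite /v; ring.
have := IH qpt (ltnW tT); rewrite -[t.+1%:R]natr1 mulrDl mul1r.
have : 6 + B ^+ 3 <= B ^+ 4.
  have h2 : 4 <= B ^+ 2 by nra.
  have h3 : 8 <= B ^+ 3 by rewrite exprS; nra.
  by rewrite [B ^+ 4]exprS; nra.
lra.
Qed.

(** By the supergradient property the left-hand side [X] is at most the pairing of [al] with every
    update. Summed over the rounds, the updates telescope to [q T], whose coordinates are at most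
    [b ^ 10] by [upath_sqr]. Hence [T * X <= b ^ 14 + b ^ 2], the last term coming from rounding,
    and [T = b ^ 16]. *)
Lemma certificate q (al : nat -> K) : upath q (b ^ 16) ->
  (forall j, (j < m)%N -> `|al j| <= B ^+ 3) ->
  \sum_r (if ac r then w r * (if w r <= 0 then `|pev al r| else pev al r) else 0)
    <= 2 / B ^+ 2.
Proof.
move=> qp alb; have Bge2 := B2; have B0 : 0 < B by lra.
set T := (b ^ 16)%N in qp *; set X := \sum_r _.
have TE : T%:R = B ^+ 16 by rewrite /T Bexp.
have XE t : X <= \sum_(j < m) al j * upd (q t) j.
  under [leRHS]eq_bigr do rewrite /upd mulr_sumr.
  rewrite exchange_big; apply: ler_sum => r _ /=; case: ifP => ar; last first.
    by rewrite big1// => j _; rewrite mulr0.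
  under [leRHS]eq_bigr => j _ do rewrite mulrCA (mulrCA (al j)).
  rewrite -2!mulr_sumr -/(pev al r) /sg; have [wr|wr] := leP (w r) 0 => /=; last by rewrite mul1r.
  rewrite ler_wnM2l//; case: ifP => _; rewrite ?mulN1r ?mul1r ?ler_norm// ler_normr.
  by rewrite lexx orbT.
have vE (j : 'I_m) (t : 'I_T) : al j * upd (q t) j <=
    al j * (q t.+1 j - q t j) + B ^+ 3 * (B ^+ 18)^-1.
  have /andP[l u] := (qp.2 t (ltn_ord t)).2 j (ltn_ord j).
  rewrite -lerBlDl -mulrBr; apply: (le_trans (ler_norm _)); rewrite normrM ler_pM ?alb//.
  by rewrite -Bexp in l; rewrite ler_norml; apply/andP; split; move: l u;
    have : 0 < (B ^+ 18)^-1 by [rewrite invr_gt0 exprn_gt0]; lra.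
have E : T%:R * X <= \sum_(j < m) (al j * q T j + T%:R * (B ^+ 3 * (B ^+ 18)^-1)).
  apply: (@le_trans _ _ (\sum_(t < T) X)).
    by rewrite sumr_const card_ord mulr_natl.
  apply: (@le_trans _ _ (\sum_(t < T) \sum_(j < m) al j * upd (q t) j)); first exact: ler_sum.
  rewrite exchange_big; apply: ler_sum => j _ /=.
  apply: (le_trans (ler_sum _ (fun t _ => vE j t))).
  rewrite big_split/= -mulr_sumr sumr_const card_ord -[X in _ + X <= _]mulr_natl lerD2r.
  rewrite -(big_mkord xpredT (fun t => q t.+1 j - q t j)) telescope_sumr//.
  by rewrite qp.1 subr0.
have qTb (j : 'I_m) : `|q T j| <= B ^+ 10.
  rewrite -ler_sqr ?nnegrE ?exprn_ge0// real_normK ?num_real// -exprM.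
  apply: (@le_trans _ _ (\sum_(j < m) q T j ^+ 2)).
    by rewrite (bigD1 j)//= lerDl; apply: sumr_ge0 => i _; rewrite sqr_ge0.
  by apply: (le_trans (upath_sqr qp (leqnn _))); rewrite TE -exprD.
have {}E : T%:R * X <= B ^+ 14 + B ^+ 2.
  apply: (le_trans E); apply: (@le_trans _ _ (\sum_(j < m) (B ^+ 13 + B))).
    apply: ler_sum => j _; apply: lerD.
      apply: (le_trans (ler_norm _)); rewrite normrM -[13%N]/(3 + 10)%N exprD.
      by rewrite ler_pM ?alb.
    rewrite TE mulrA -exprD (_ : 16 + 3 = 1 + 18)%N// exprD expr1 mulfK//.
    by rewrite expf_neq0// gt_eqF.
  rewrite sumr_const card_ord -[X in X <= _]mulr_natl [B ^+ 14]exprS [B ^+ 2]expr2 -mulrDr.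
  by rewrite ler_wpM2r ?ler_nat// addr_ge0// exprn_ge0.
rewrite ler_pdivlMr ?exprn_gt0//.
suff : B ^+ 14 * (X * B ^+ 2) <= B ^+ 14 * 2 by rewrite ler_pM2l ?exprn_gt0.
rewrite mulrCA -exprD mulrC -TE (le_trans E)// mulr_natr mulr2n lerD2l.
by rewrite !Bexp ler_nat leq_pexp2l// (leq_trans _ b2).
Qed.

End Perceptron.

(** * Independent samples *)

Section MeasureTools.
Context d0 (V : measurableType d0) (K : realType).

Lemma measurable_forall_fin d (U : measurableType d) (T : finType) (A : T -> set U) :
  (forall t, measurable (A t)) -> measurable [set x | forall t, A t x].
Proof.
move=> mA; rewrite (_ : [set x | _] = \bigcap_(t in setT) A t).
  by apply: fin_bigcap_measurable => // t _; exact: mA.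
by apply/seteqP; split=> x /= H t => [_|]; [exact: H|exact: (H t I)].
Qed.

Lemma measurable_exists_fin d (U : measurableType d) (T : finType) (A : T -> set U) :
  (forall t, measurable (A t)) -> measurable [set x | exists t, A t x].
Proof.
move=> mA; rewrite (_ : [set x | _] = \bigcup_(t in setT) A t).
  by apply: fin_bigcup_measurable => // t _; exact: mA.
by apply/seteqP; split=> x /= [t]; [exists t|exists t].
Qed.

Definition box n (B : 'I_n -> set V) : set (n.-tuple V) :=
  [set x | forall j, B j (tnth x j)].

Definition boxes n : set (set (n.-tuple V)) :=
  [set box B | B in [set B : 'I_n -> set V | forall j, measurable (B j)]].

Lemma measurable_box n (B : 'I_n -> set V) : (forall j, measurable (B j)) ->
  measurable (box B).
Proof.
move=> mB; apply: measurable_forall_fin => j.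
by rewrite -[X in measurable X]setTI; apply: (measurable_tnth j).
Qed.

Lemma measurable_tuple_box n : @measurable _ (n.-tuple V) = <<s @boxes n >>.
Proof.
apply/seteqP; split; last first.
  apply: smallest_sub; first exact: sigma_algebra_measurable.
  by move=> _ [B mB <-]; exact: measurable_box.
rewrite {1}/measurable/=; apply: smallest_sub; first exact: smallest_sigma_algebra.
move=> A; rewrite -bigcup_seq => -[i _ [B mB <-]].
apply: sub_sigma_algebra; exists (fun j => if j == i then B else setT).
  by move=> j; case: ifP.
rewrite setTI; apply/seteqP; split=> x /=; first by move/(_ i); rewrite eqxx.
by move=> Bx j; case: ifP => // /eqP->.
Qed.

(** Boxes are stable under intersection and generate the sigma-algebra of tuples. *)
Lemma tuple_measure_unique n (m1 m2 : {measure set (n.-tuple V) -> \bar K}) :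
  (forall B : 'I_n -> set V, (forall j, measurable (B j)) -> m1 (box B) = m2 (box B)) ->
  (m1 setT < +oo)%E -> forall A, measurable A -> m1 A = m2 A.
Proof.
move=> m12 m1T; have bT : @boxes n setT.
  by exists (fun=> setT) => //; apply/seteqP; split.
apply: (measure_unique (@boxes n) (fun=> setT)) => //.
- exact: measurable_tuple_box.
- move=> _ _ [B mB <-] [C mC <-]; exists (fun j => B j `&` C j) => [j|].
    exact: measurableI.
  by apply/seteqP; split=> x /=; [move=> H; split=> j; have [] := H j|move=> [? ?] j; split].
- by apply/seteqP; split => // x _; exists 0%N.
- by move=> _ [B mB <-]; exact: m12.
Qed.

Definition mfunT d1 d2 (T1 : measurableType d1) (T2 : measurableType d2)
  (h : T1 -> T2) (mh : measurable_fun setT h) : {mfun T1 >-> T2} :=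
  HB.pack h (isMeasurableFun.Build _ _ _ _ h mh).

Context d (Om : measurableType d) (P : probability Om K).

Lemma pr_fin (A : set Om) : measurable A -> P A = (fine (P A))%:E.
Proof. by move=> mA; rewrite fineK// fin_num_measure. Qed.

Lemma pr_le (A B : set Om) : measurable A -> measurable B -> A `<=` B -> (P A <= P B)%E.
Proof. by move=> mA mB AB; rewrite le_measure ?inE. Qed.

Lemma pr_union (T : finType) (A : T -> set Om) : (forall t, measurable (A t)) ->
  (P [set w | exists t, A t w] <= \sum_t P (A t))%E.
Proof.
move=> mA; have mE (s : seq T) : measurable [set w | exists2 t, t \in s & A t w].
  elim: s => [|t s IH].
    by rewrite (_ : [set w | _] = set0)//; apply/seteqP; split => // w [].
  rewrite (_ : [set w | _] = A t `|` [set w | exists2 t, t \in s & A t w]).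
    exact: measurableU.
  apply/seteqP; split=> w /=.
    by move=> [u]; rewrite inE => /orP[/eqP->|us]; [left|right; exists u].
  by move=> [Aw|[u us Aw]]; [exists t; rewrite ?inE ?eqxx|exists u; rewrite ?inE ?us ?orbT].
suff H (s : seq T) : (P [set w | exists2 t, t \in s & A t w] <= \sum_(t <- s) P (A t))%E.
  apply: le_trans (H (index_enum T)); apply: pr_le => //.
    exact: measurable_exists_fin.
  by move=> w [t Aw]; exists t; rewrite ?mem_index_enum.
elim: s => [|t s IH].
  by rewrite big_nil (_ : [set w | _] = set0) ?measure0//; apply/seteqP; split => // w [].
rewrite big_cons; apply: (@le_trans _ _ (P (A t `|` [set w | exists2 t, t \in s & A t w]))).
  apply: pr_le => //; first exact: measurableU.
  move=> w [u]; rewrite inE => /orP[/eqP->|us]; [by left|by right; exists u].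
by apply: (le_trans (measureU2 _ _ _)) => //; rewrite leeD2l.
Qed.

(** The law of the pair agrees with the product law on rectangles, hence everywhere. Writing the
    probability as an integral of sections is the form in which conditioning on [Y] is used. *)
Lemma indep_prod d1 d2 (T1 : measurableType d1) (T2 : measurableType d2)
  (Y : Om -> T1) (Z : Om -> T2) (mY : measurable_fun setT Y) (mZ : measurable_fun setT Z) :
  (forall A B, measurable A -> measurable B ->
    P (Y @^-1` A `&` Z @^-1` B) = (P (Y @^-1` A) * P (Z @^-1` B))%E) ->
  forall E : set (T1 * T2), measurable E ->
  P [set w | E (Y w, Z w)] =
    (\int[distribution P (mfunT mY)]_y P (Z @^-1` xsection E y))%E.
Proof.
move=> ind E mE.
have mYZ : measurable_fun setT (fun w => (Y w, Z w)) by exact: measurable_fun_pair.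
have := @product_measure_unique _ _ T1 T2 K (distribution P (mfunT mY)) (distribution P (mfunT mZ))
  (distribution P (mfunT mYZ)) _ E mE.
move=> H; transitivity (distribution P (mfunT mYZ) E) => //.
rewrite -H// => A B mA mB; exact: ind.
Qed.

Lemma indep_le d1 d2 (T1 : measurableType d1) (T2 : measurableType d2)
  (Y : Om -> T1) (Z : Om -> T2) (mY : measurable_fun setT Y) (mZ : measurable_fun setT Z) :
  (forall A B, measurable A -> measurable B ->
    P (Y @^-1` A `&` Z @^-1` B) = (P (Y @^-1` A) * P (Z @^-1` B))%E) ->
  forall (E : set (T1 * T2)) (e : K), measurable E ->
  (forall y, P (Z @^-1` xsection E y) <= e%:E)%E ->
  (P [set w | E (Y w, Z w)] <= e%:E)%E.
Proof.
move=> ind E e mE Ee; rewrite (indep_prod mY mZ ind mE).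
apply: (@le_trans _ _ (\int[distribution P (mfunT mY)]_y e%:E)%E).
  apply: ge0_le_integral => //.
  exact: (measurable_fun_xsection (distribution P (mfunT mZ)) mE).
by rewrite integral_cst//= probability_setT mule1.
Qed.

(** Markov's inequality for the conditional probability of [E] given [Y]. *)
Lemma indep_markov d1 d2 (T1 : measurableType d1) (T2 : measurableType d2)
  (Y : Om -> T1) (Z : Om -> T2) (mY : measurable_fun setT Y) (mZ : measurable_fun setT Z) :
  (forall A B, measurable A -> measurable B ->
    P (Y @^-1` A `&` Z @^-1` B) = (P (Y @^-1` A) * P (Z @^-1` B))%E) ->
  forall (E : set (T1 * T2)) (e : K), measurable E -> 0 < e ->
  (e%:E * P [set w | (e%:E <= P (Z @^-1` xsection E (Y w)))%E] <= P [set w | E (Y w, Z w)])%E.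
Proof.
move=> ind E e mE e0; rewrite (indep_prod mY mZ ind mE).
have mphi := measurable_fun_xsection (distribution P (mfunT mZ)) mE.
set Q := distribution P (mfunT mY); set phi := (fun y => P (Z @^-1` xsection E y)).
pose A := [set y | (e%:E <= phi y)%E].
have mA : measurable A.
  rewrite -[A]setTI; apply: measurable_lee => //; exact: measurable_cst.
rewrite (_ : P _ = Q A)//.
apply: (@le_trans _ _ (\int[Q]_(y in A) e%:E)%E); first by rewrite integral_cst.
apply: (@le_trans _ _ (\int[Q]_(y in A) phi y)%E).
  apply: ge0_le_integral => //; first by move=> y _; rewrite lee_fin ltW.
  by apply: (measurable_funS measurableT) => //.
by apply: ge0_subset_integral => //.
Qed.

(** * Disjoint blocks of an independent family *)

Section Blocks.
Variables (T : finType) (c : T -> nat) (X : forall t, 'I_(c t) -> Om -> V).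
Variable mu : T -> probability V K.
Hypothesis mX : forall t j, measurable_fun setT (@X t j).
Hypothesis rule : forall B : forall t, 'I_(c t) -> set V, (forall t j, measurable (B t j)) ->
  P [set w | forall t j, B t j (X j w)] =
  (\prod_t \prod_j fine (mu t (B t j)))%:E.

Definition block t : Om -> (c t).-tuple V := fun w => [tuple X j w | j < c t].

Lemma measurable_block t : measurable_fun setT (block t).
Proof.
apply/measurable_fun_tnthP => j.
rewrite (_ : _ \o _ = @X t j)//; apply/funext => w /=; by rewrite tnth_mktuple.
Qed.

Lemma measurable_block_preim t A : measurable A -> measurable (block t @^-1` A).
Proof. by move=> mA; rewrite -[X in measurable X]setTI; exact: measurable_block. Qed.

Lemma block_box t (B : 'I_(c t) -> set V) w : box B (block t w) <-> forall j, B j (X j w).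
Proof.
by split=> H j; have := H j; rewrite /= tnth_mktuple.
Qed.

Lemma prob_setT_prod n (m : probability V K) : \prod_(j < n) fine (m setT) = 1.
Proof. by rewrite big1// => j _; rewrite probability_setT. Qed.

Lemma block_law t (B : 'I_(c t) -> set V) : (forall j, measurable (B j)) ->
  P (block t @^-1` box B) = (\prod_j fine (mu t (B j)))%:E.
Proof.
(* The sets [B] on block [t] and no constraint on the others. Block lengths depend on the index,
   whence the cast along [t = u]. *)
move=> mB; pose B' u : 'I_(c u) -> set V :=
  if eqP : reflect (t = u) (t == u) is ReflectT e then ecast u ('I_(c u) -> set V) e B else fun=> setT.
have B't : B' t = B.
  by rewrite /B'; case: eqP => // e; rewrite (eq_axiomK e).
have B'N u : u != t -> B' u = fun=> setT.
  by move=> /eqP ut; rewrite /B'; case: eqP => // e; case: ut.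
have mB' u j : measurable (B' u j).
  by have [ut|/B'N->//] := eqVneq u t; subst u; rewrite B't.
transitivity (P [set w | forall u j, B' u j (X j w)]).
  congr (P _); apply/seteqP; split => w /=.
    move=> /block_box H u j; have [ut|/B'N->//] := eqVneq u t.
    by subst u; rewrite B't.
  by move=> H; apply/block_box => j; have := H t j; rewrite B't.
rewrite rule// (bigD1 t)//= B't [X in _ * X]big1 ?mulr1// => u /B'N->.
exact: prob_setT_prod.
Qed.

(** Boxes are exchanged for arbitrary measurable sets one block at a time. With the other blocks
    held fixed, both sides are finite measures in the set assigned to block [t0], and they agree on
    boxes by the induction hypothesis. *)
Lemma block_indep (A : forall t, set ((c t).-tuple V)) : (forall t, measurable (A t)) ->
  P [set w | forall t, A t (block t w)] = (\prod_t fine (P (block t @^-1` A t)))%:E.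
Proof.
move=> mA.
suff H (s : seq T) (B : forall t, 'I_(c t) -> set V) : (forall t j, measurable (B t j)) ->
   P [set w | forall t, (if t \in s then A t else box (B t)) (block t w)] =
   (\prod_t fine (P (block t @^-1` (if t \in s then A t else box (B t)))))%:E.
  have := H (index_enum T) (fun t j => setT) (fun t j => measurableT).
  under eq_set => w do under eq_forall => t do rewrite mem_index_enum.
  by under eq_bigr do rewrite mem_index_enum.
elim: s B => [|t0 s IH] B mB.
  rewrite (_ : [set w | _] = [set w | forall t j, B t j (X j w)]).
    by rewrite rule//; congr (_%:E); apply: eq_bigr => t _; rewrite in_nil block_law.
  by apply/seteqP; split=> w H t; [apply/block_box|apply/block_box]; exact: H.
have [t0s|t0s] := boolP (t0 \in s).
  have := IH B mB.
  have E t : (t \in t0 :: s) = (t \in s) by rewrite inE; case: eqP => // ->.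
  under [in X in _ -> X]eq_set => w do under eq_forall => t do rewrite E.
  by under [in X in _ -> X]eq_bigr do rewrite E.
pose A' t := if t \in s then A t else box (B t).
have mA' t : measurable (A' t) by rewrite /A'; case: ifP => // _; exact: measurable_box.
pose C := [set w | forall t, t != t0 -> A' t (block t w)].
have mC : measurable C.
  apply: measurable_forall_fin => t; have [->|tt] := eqVneq t t0.
    rewrite [X in measurable X](_ : _ = setT)//; by apply/seteqP; split.
  rewrite [X in measurable X](_ : _ = block t @^-1` A' t); first exact: measurable_block_preim.
  by apply/seteqP; split => w /=; [apply|].
pose p := \prod_(t | t != t0) fine (P (block t @^-1` A' t)).
have p0 : 0 <= p by apply: prodr_ge0 => t _; rewrite fine_ge0.
pose m1 : {measure set ((c t0).-tuple V) -> \bar K} :=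
  measure_function_pushforward__canonical__measure_function_Measure
    (mrestr P mC) (measurable_block (t:=t0)).
pose m2 := mscale (NngNum p0) (distribution P (mfunT (measurable_block (t:=t0)))).
have key : m1 (A t0) = m2 (A t0).
  have : forall D, measurable D -> m1 D = m2 D; last by apply; exact: mA.
  apply: tuple_measure_unique => [D mD|]; last first.
    apply: (@le_lt_trans _ _ 1%E); last exact: ltry.
    by apply: probability_le1; apply: measurableI => //; rewrite preimage_setT.
  change (P (block t0 @^-1` box D `&` C) = (p%:E * P (block t0 @^-1` box D))%E).
  pose B' u : 'I_(c u) -> set V :=
    if eqP : reflect (t0 = u) (t0 == u) is ReflectT e then ecast u ('I_(c u) -> set V) e D else B u.
  have B't : B' t0 = D by rewrite /B'; case: eqP => // e; rewrite (eq_axiomK e).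
  have B'N u : u != t0 -> B' u = B u.
    by move=> /eqP ut; rewrite /B'; case: eqP => // e; case: ut.
  have mB' u j : measurable (B' u j).
    by have [ut|/B'N->//] := eqVneq u t0; subst u; rewrite B't.
  have := IH B' mB'; rewrite (bigD1 t0)//= (negPf t0s) B't.
  rewrite (eq_bigr (fun t => fine (P (block t @^-1` A' t)))); last first.
    by move=> t tt; rewrite /A' B'N.
  rewrite -/p mulrC EFinM fineK; last first.
    by rewrite fin_num_measure//; apply: measurable_block_preim; exact: measurable_box.
  move=> <-; congr (P _); apply/seteqP; split => w /=.
    move=> [H1 H2] t; have [->|tt] := eqVneq t t0; first by rewrite (negPf t0s) B't.
    by have := H2 _ tt; rewrite /A' B'N.
  move=> H; split; first by have := H t0; rewrite (negPf t0s) B't.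
  by move=> t tt; have := H t; rewrite /A' B'N.
have E t : t != t0 -> (t \in t0 :: s) = (t \in s) by rewrite inE => /negPf->.
rewrite (bigD1 t0)//= inE eqxx.
rewrite (eq_bigr (fun t => fine (P (block t @^-1` A' t)))); last first.
  by move=> t tt; rewrite /A' -E.
rewrite -/p mulrC EFinM fineK; last first.
  by rewrite fin_num_measure//; exact: measurable_block_preim.
transitivity (m1 (A t0)); last by rewrite key.
congr (P _); apply/seteqP; split=> w /=.
  move=> H; split; first by have := H t0; rewrite inE eqxx.
  by move=> t tt; have := H t; rewrite E.
move=> [H1 H2] t; have [->|tt] := eqVneq t t0; first by rewrite inE eqxx.
by have := H2 _ tt; rewrite /A' -E.
Qed.

End Blocks.

End MeasureTools.

(** * Subfamilies of an independent family and Hoeffding's bound *)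

Section Sampling.
Context d0 (V : measurableType d0) (K : realType) d (Om : measurableType d).
Variable P : probability Om K.

Definition iid_rule (I : finType) (X : I -> Om -> V) (mu : I -> probability V K) : Prop :=
  (forall i, measurable_fun setT (X i)) /\
  forall B : I -> set V, (forall i, measurable (B i)) ->
    P [set w | forall i, B i (X i w)] = (\prod_i fine (mu i (B i)))%:E.

Lemma iid_rule_inj (I J : finType) (X : I -> Om -> V) (mu : I -> probability V K) (sg : J -> I) :
  injective sg -> iid_rule X mu -> iid_rule (X \o sg) (mu \o sg).
Proof.
move=> sgI [mX rule]; split=> [j|B mB]; first exact: mX.
pose B' i := if [pick j | sg j == i] is Some j then B j else setT.
have B's j : B' (sg j) = B j.
  rewrite /B'; case: pickP => [j' /eqP/sgI->//|/(_ j)]; by rewrite eqxx.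
have B'N i : i \notin codom sg -> B' i = setT.
  rewrite /B'; case: pickP => // j /eqP <- /negP[]; exact: codom_f.
have mB' i : measurable (B' i) by rewrite /B'; case: pickP.
transitivity (P [set w | forall i, B' i (X i w)]).
  congr (P _); apply/seteqP; split=> w /= H.
    move=> i; have [|/B'N->//] := boolP (i \in codom sg).
    by move=> /codomP[j ->]; rewrite B's; exact: H.
  by move=> j; rewrite -B's; exact: H.
rewrite rule//; congr (_%:E); rewrite (bigID (mem (codom sg)))/= [X in _ * X]big1 ?mulr1; last first.
  by move=> i /B'N->; rewrite probability_setT.
rewrite -big_uniq/=; last by rewrite map_inj_uniq// enum_uniq.
by rewrite big_map big_enum; apply: eq_bigr => j _; rewrite B's.
Qed.

Lemma iid_rule_blocks (I T : finType) (X : I -> Om -> V) (mu : I -> probability V K)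
    (c : T -> nat) (nu : T -> probability V K) (sg : forall t, 'I_(c t) -> I) :
  injective (fun p : {t : T & 'I_(c t)} => sg (tag p) (tagged p)) ->
  (forall t j, mu (sg t j) = nu t) -> iid_rule X mu ->
  forall B : forall t, 'I_(c t) -> set V, (forall t j, measurable (B t j)) ->
  P [set w | forall t j, B t j (X (sg t j) w)] = (\prod_t \prod_j fine (nu t (B t j)))%:E.
Proof.
move=> sgI munu /(iid_rule_inj sgI)[_ rule] B mB.
have := rule (fun p => B (tag p) (tagged p)) (fun p => mB _ _).
rewrite (_ : [set w | _] = [set w | forall t j, B t j (X (sg t j) w)]).
  move=> ->; congr (_%:E); rewrite sig_big_dep/=.
  by apply: eq_bigr => -[t j] _ /=; rewrite munu.
by apply/seteqP; split=> w /= H; [move=> t j; exact: (H (Tagged _ j))|move=> [t j]; exact: H].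
Qed.

Lemma measurable_boolR d1 (U : measurableType d1) (h : U -> bool) :
  measurable_fun setT h -> measurable_fun setT (fun x => (h x)%:R : K).
Proof.
move=> mh; rewrite (_ : (fun x => _) = (fun x => if h x then 1 else 0 : K)).
  by apply: measurable_fun_ifT => //; exact: measurable_cst.
by apply/funext => x; case: (h x).
Qed.

Lemma measurable_bool_set d1 (U : measurableType d1) (h : U -> bool) :
  measurable_fun setT h -> measurable [set x | h x].
Proof. by move=> mh; rewrite -[X in measurable X]setTI; apply: (mh measurableT [set true]). Qed.

Lemma bool_set_measurable d1 (U : measurableType d1) (h : U -> bool) :
  measurable [set x | h x] -> measurable_fun setT h.
Proof.
move=> mh; apply: (measurable_fun_bool true).
by rewrite setTI (_ : _ @^-1` _ = [set x | h x]).
Qed.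

Section Hoeffding.
Variables (c : nat) (X : 'I_c -> Om -> V) (mu : probability V K).
Hypothesis iid : iid_rule X (fun=> mu).

(** Inverting [1 - x <= expR (- x)] gives [expR x <= 1 / (1 - x)], which for [x <= 1/2] is below the
    quadratic. *)
Lemma expR_le_quad (x : K) : x <= 1/2 -> expR x <= 1 + x + 2 * x ^+ 2.
Proof.
move=> x2; have : 1 - x <= expR (- x) by exact: expR_ge1Dx.
rewrite expRN => H; have e0 := expR_gt0 x.
have : (1 - x) * expR x <= 1 by rewrite -ler_pdivlMr// div1r.
have : 0 <= (1 - 2 * x) * x ^+ 2 by rewrite mulr_ge0 ?sqr_ge0// subr_ge0; lra.
move: (expR x) e0 => E E0 H1 H2.
suff : 0 <= (1 - x) * (1 + x + 2 * x ^+ 2 - E) by rewrite pmulr_rge0 ?subr_ge0; lra.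
nra.
Qed.

(** Chernoff's method without integrals: the space is split by the pattern of the [c] boolean
    values, whose probability is a product by independence, and the sum of the exponentially
    weighted patterns factors. The constant 1/4 leaves room for the crude [expR_le_quad]. *)
Lemma hoeffding_upper (e : V -> bool) (eps : K) : measurable_fun setT e ->
  0 < eps -> eps <= 1 ->
  (P [set w | (c%:R * (fine (mu [set x | e x]) + eps) <= \sum_(j < c) (e (X j w))%:R)%R]
   <= (expR (- (c%:R * eps ^+ 2 / 4)))%:E)%E.
Proof.
move=> me eps0 eps1; set q := fine _.
have mE := measurable_bool_set me.
have q0 : 0 <= q by rewrite fine_ge0.
have q1 : q <= 1 by rewrite -lee_fin fineK ?fin_num_measure// probability_le1.
pose pat (om : {ffun 'I_c -> bool}) := [set w | forall j, [set x | e x = om j] (X j w)].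
have mpatj (bb : bool) : measurable [set x | e x = bb].
  by rewrite -[X in measurable X]setTI; apply: (me measurableT [set bb]).
have Ppat om : P (pat om) = (\prod_j (if om j then q else 1 - q))%:E.
  rewrite /pat (iid.2 (fun j => [set x | e x = om j]))//.
  congr (_%:E); apply: eq_bigr => j _; case: (om j) => //.
  rewrite (_ : [set x | e x = false] = ~` [set x | e x]).
    by rewrite probability_setC// -/q /q fineB ?fin_num_measure.
  by apply/seteqP; split=> x /=; case: (e x).
have mpat om : measurable (pat om).
  apply: measurable_forall_fin => j.
  by rewrite -[X in measurable X]setTI; apply: (iid.1 j) => //; exact: mpatj.
pose Q (om : {ffun 'I_c -> bool}) := c%:R * (q + eps) <= \sum_(j < c) (om j)%:R :> K.
rewrite (_ : [set w | _] = [set w | exists om, (if Q om then pat om else set0) w]); last first.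
  apply/seteqP; split=> w /=.
    move=> H; exists [ffun j => e (X j w)]; rewrite /Q.
    under eq_bigr do rewrite ffunE.
    by rewrite H => j /=; rewrite ffunE.
  move=> [om]; case: ifP => // Qom pw; move: Qom; rewrite /Q.
  by under [X in _ -> is_true (_ <= X)]eq_bigr do rewrite pw.
apply: (le_trans (pr_union _ _)); first by move=> om; case: ifP.
(* Per point this choice gives the exponent [- eps ^ 2 / 2 + eps ^ 2 / 8], below [- eps ^ 2 / 4],
   and it keeps the arguments of the exponentials below 1/2. *)
pose s : K := eps / 2.
have s0 : 0 < s by rewrite divr_gt0.
pose h (bb : bool) : K := (if bb then q else 1 - q) * expR (s * (bb%:R - q)).
(* The linear terms cancel; the quadratic ones average to [2 * s ^ 2 * q * (1 - q)], at most
   [s ^ 2 / 2]. *)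
have hsum : h true + h false <= expR (s ^+ 2 / 2).
  have e1 : expR (s * (1 - q)) <= 1 + s * (1 - q) + 2 * (s * (1 - q)) ^+ 2.
    by apply: expR_le_quad; rewrite /s; nra.
  have e2 : expR (s * (0 - q)) <= 1 + s * (0 - q) + 2 * (s * (0 - q)) ^+ 2.
    by apply: expR_le_quad; rewrite /s; nra.
  apply: le_trans (expR_ge1Dx _); rewrite /h /=.
  have q10 : 0 <= 1 - q by rewrite subr_ge0.
  apply: (le_trans (lerD (ler_wpM2l q0 e1) (ler_wpM2l q10 e2))).
  have : 0 <= s ^+ 2 * (1 - 2 * q) ^+ 2 by rewrite mulr_ge0 ?sqr_ge0.
  lra.
have hsum0 : 0 <= h true + h false.
  by rewrite addr_ge0// mulr_ge0 ?expR_ge0// subr_ge0.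
have step om : (P (if Q om then pat om else set0) <=
    (expR (- (s * (c%:R * eps))) * \prod_j h (om j))%:E)%E.
  case: ifP => [Qom|_]; last first.
    rewrite measure0 lee_fin mulr_ge0 ?expR_ge0//; apply: prodr_ge0 => j _.
    by rewrite mulr_ge0 ?expR_ge0//; case: (om j) => //; rewrite subr_ge0.
  rewrite Ppat lee_fin big_split/= -expR_sum mulrCA ler_peMr//.
    by apply: prodr_ge0 => j _; case: (om j) => //; rewrite subr_ge0.
  rewrite -expRD -[leLHS]expR0 ler_expR -mulr_sumr sumrB sumr_const card_ord -[q *+ c]mulr_natl.
  rewrite -mulrN -mulrDr mulr_ge0 ?(ltW s0)//.
  by move: Qom; rewrite /Q mulrDr; lra.
apply: (@le_trans _ _ (\sum_(om : {ffun 'I_c -> bool}) (expR (- (s * (c%:R * eps))) * \prod_j h (om j))%:E)%E).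
  by apply: lee_sum => om _; exact: step.
rewrite sumEFin lee_fin -mulr_sumr -(bigA_distr_bigA (fun _ bb => h bb)) prodr_const card_ord.
rewrite big_bool/=.
apply: (@le_trans _ _ (expR (- (s * (c%:R * eps))) * expR (s ^+ 2 / 2) ^+ c)).
  by rewrite ler_wpM2l ?expR_ge0// lerXn2r ?nnegrE ?expR_ge0.
rewrite -expRM_natl -expRD ler_expR.
have : 0 <= c%:R * eps ^+ 2 by rewrite mulr_ge0 ?sqr_ge0.
rewrite /s; move: (c%:R) => C; nra.
Qed.

Lemma hoeffding (e : V -> bool) (eps : K) : measurable_fun setT e ->
  0 < eps -> eps <= 1 ->
  (P [set w | (c%:R * eps <= `|\sum_(j < c) (e (X j w))%:R - c%:R * fine (mu [set x | e x])|)%R]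
   <= (2 * expR (- (c%:R * eps ^+ 2 / 4)))%:E)%E.
Proof.
move=> me eps0 eps1; have mE := measurable_bool_set me.
have mne : measurable_fun setT (fun x => ~~ e x) by exact: measurable_neg.
have msum (h : V -> bool) : measurable_fun setT h ->
    measurable_fun setT (fun w => \sum_(j < c) (h (X j w))%:R : K).
  move=> mh; apply: measurable_sum => j; apply: measurable_boolR.
  by apply: measurableT_comp => //; exact: iid.1.
have mge (h : V -> bool) (r : K) : measurable_fun setT h ->
    measurable [set w | r <= \sum_(j < c) (h (X j w))%:R].
  move=> mh; apply: measurable_bool_set; apply: measurable_fun_ler; last exact: msum.
  exact: measurable_cst.
set S := [set w | _].
have mS : measurable S.
  apply: measurable_bool_set; apply: measurable_fun_ler; first exact: measurable_cst.
  apply: measurableT_comp => //; apply: measurable_funB; first exact: msum.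
  exact: measurable_cst.
have qC : fine (mu [set x | ~~ e x]) = 1 - fine (mu [set x | e x]).
  rewrite (_ : [set x | ~~ e x] = ~` [set x | e x]).
    by rewrite probability_setC// fineB ?fin_num_measure.
  by apply/seteqP; split=> x /=; [move/negP|move/negP].
apply: (@le_trans _ _ (P ([set w | (c%:R * (fine (mu [set x | e x]) + eps) <= \sum_(j < c) (e (X j w))%:R)%R]
   `|` [set w | (c%:R * (fine (mu [set x | ~~ e x]) + eps) <= \sum_(j < c) (~~ e (X j w))%:R)%R]))).
  apply: pr_le => //; first by apply: measurableU; [exact: (mge e)|exact: (mge (fun x => ~~ e x))].
  move=> w; rewrite /S /= ler_normr qC => /orP[H|H]; [left|right]; first by lra.
  have -> : \sum_(j < c) (~~ e (X j w))%:R = c%:R - \sum_(j < c) (e (X j w))%:R :> K.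
    have -> : c%:R = \sum_(j < c) 1 :> K by rewrite sumr_const card_ord.
    by rewrite -sumrB; apply: eq_bigr => j _; case: (e _); rewrite /= ?subrr ?subr0.
  by lra.
apply: (le_trans (measureU2 _ _ _)); [exact: (mge e)|exact: (mge (fun x => ~~ e x))|].
set E := expR _; rewrite (_ : 2 * E = E + E); last by ring.
rewrite EFinD leeD//; first exact: hoeffding_upper.
exact: (hoeffding_upper mne).
Qed.

End Hoeffding.

End Sampling.

(** * Deviations conditional on an independent part of the sample *)

Section Conditional.
Context d0 (V : measurableType d0) (K : realType) d (Om : measurableType d).
Variable P : probability Om K.
Implicit Types (mu nu : probability V K).

Definition blk c (X : 'I_c -> Om -> V) : Om -> c.-tuple V := fun w => [tuple X j w | j < c].

Lemma tnth_blk c (X : 'I_c -> Om -> V) w j : tnth (blk X w) j = X j w.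
Proof. by rewrite tnth_mktuple. Qed.

Lemma measurable_blk c (X : 'I_c -> Om -> V) : (forall j, measurable_fun setT (X j)) ->
  measurable_fun setT (blk X).
Proof.
move=> mX; apply/measurable_fun_tnthP => j.
rewrite (_ : _ \o _ = X j)//; apply/funext => w /=; by rewrite tnth_mktuple.
Qed.

Lemma measurable_preim d1 d2 (T1 : measurableType d1) (T2 : measurableType d2) (h : T1 -> T2) A :
  measurable_fun setT h -> measurable A -> measurable (h @^-1` A).
Proof. by move=> mh mA; rewrite -[X in measurable X]setTI; exact: mh. Qed.

Lemma blk_law c (X : 'I_c -> Om -> V) mu (B : 'I_c -> set V) : iid_rule P X (fun=> mu) ->
  (forall j, measurable (B j)) -> P (blk X @^-1` box B) = (\prod_j fine (mu (B j)))%:E.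
Proof.
move=> iid mB; rewrite -iid.2//; congr (P _).
by apply/seteqP; split=> w /= H j; have := H j; rewrite tnth_mktuple.
Qed.

Lemma iid_same_law c (X X' : 'I_c -> Om -> V) mu A : iid_rule P X (fun=> mu) ->
  iid_rule P X' (fun=> mu) -> measurable A -> P (blk X @^-1` A) = P (blk X' @^-1` A).
Proof.
move=> iX iX' mA.
have mX := measurable_blk iX.1; have mX' := measurable_blk iX'.1.
apply: (@tuple_measure_unique _ V K c (distribution P (mfunT mX)) (distribution P (mfunT mX'))) => //.
  by move=> B mB; transitivity (\prod_j fine (mu (B j)))%:E; [exact: blk_law|symmetry; exact: blk_law].
by apply: (@le_lt_trans _ _ 1%E); [exact: probability_le1|exact: ltry].
Qed.

Lemma iid_marginal (I : finType) (X : I -> Om -> V) (mu : I -> probability V K) i B :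
  iid_rule P X mu -> measurable B -> P (X i @^-1` B) = mu i B.
Proof.
move=> iid mB; pose B' j := if j == i then B else setT.
have mB' j : measurable (B' j) by rewrite /B'; case: ifP.
rewrite (_ : _ @^-1` _ = [set w | forall j, B' j (X j w)]).
  rewrite iid.2// (bigD1 i)//= [X in _ * X]big1 ?mulr1.
    by rewrite /B' eqxx fineK// fin_num_measure.
  by move=> j ji; rewrite /B' (negPf ji) probability_setT.
apply/seteqP; split=> w /=; last by move=> /(_ i); rewrite /B' eqxx.
by move=> H j; rewrite /B'; case: eqP => // ->.
Qed.

Lemma pair_indep (I : finType) (X : I -> Om -> V) (mu : I -> probability V K) a c
    (s1 : 'I_a -> I) (s2 : 'I_c -> I) nu1 nu2 :
  injective s1 -> injective s2 -> (forall i j, s1 i != s2 j) ->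
  (forall i, mu (s1 i) = nu1) -> (forall j, mu (s2 j) = nu2) -> iid_rule P X mu ->
  forall A B, measurable A -> measurable B ->
  P (blk (X \o s1) @^-1` A `&` blk (X \o s2) @^-1` B) =
  (P (blk (X \o s1) @^-1` A) * P (blk (X \o s2) @^-1` B))%E.
Proof.
move=> s1I s2I s12 m1 m2 iid A B mA mB.
pose c' (t : bool) := if t then a else c.
pose nu (t : bool) := if t then nu1 else nu2.
pose sg t : 'I_(c' t) -> I := match t with true => s1 | false => s2 end.
have sgI : injective (fun p : {t : bool & 'I_(c' t)} => sg (tag p) (tagged p)).
  move=> [[] i] [[] j] /= E.
  - by rewrite (s1I _ _ E).
  - by have := s12 i j; rewrite E eqxx.
  - by have := s12 j i; rewrite E eqxx.
  - by rewrite (s2I _ _ E).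
have sgnu t j : mu (sg t j) = nu t by case: t j => j; [exact: m1|exact: m2].
have mXs t j : measurable_fun setT ((fun t (j : 'I_(c' t)) => X (sg t j)) t j) by exact: iid.1.
have rule := iid_rule_blocks sgI sgnu iid.
pose AB t : set ((c' t).-tuple V) := match t with true => A | false => B end.
have mAB t : measurable (AB t) by case: t.
have := block_indep mXs rule mAB; rewrite big_bool/= EFinM !fineK.
- move=> H; transitivity (P [set w | forall t, AB t (block (fun t (j : 'I_(c' t)) => X (sg t j)) t w)]).
    by congr (P _); apply/seteqP; split=> w /=; [move=> [? ?] []|move=> H'; split; [exact: (H' true)|exact: (H' false)]].
  by rewrite H.
- by rewrite fin_num_measure//; exact: measurable_block_preim (mXs) false B mB.
- by rewrite fin_num_measure//; exact: measurable_block_preim (mXs) true A mA.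
Qed.

Lemma xsection_bool d1 (T1 : measurableType d1) (e : T1 -> V -> bool) y :
  xsection [set p : T1 * V | e p.1 p.2] y = [set x | e y x].
Proof. by apply/seteqP; split=> x /=; rewrite /xsection /= in_setE. Qed.

Lemma measurable_law d1 (T1 : measurableType d1) mu (e : T1 -> V -> bool) :
  measurable_fun setT (fun p : T1 * V => e p.1 p.2) ->
  measurable_fun setT (fun y => mu [set x | e y x]).
Proof.
move=> me; have := measurable_fun_xsection mu (measurable_bool_set me).
by apply: eq_measurable_fun => y _ /=; rewrite xsection_bool.
Qed.

Lemma measurable_slice d1 (T1 : measurableType d1) d2 (T2 : measurableType d2)
    (e : T1 -> V -> T2) y :
  measurable_fun setT (fun p : T1 * V => e p.1 p.2) -> measurable_fun setT (e y).
Proof.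
move=> me; rewrite (_ : e y = (fun p : T1 * V => e p.1 p.2) \o (fun x => (y, x)))//.
by apply: measurableT_comp => //; exact: measurable_fun_pair.
Qed.

(** For each fixed value of [Y] this is [hoeffding], and independence integrates the bound over [Y].
    It allows the event to depend on the first points of the sample. *)
Lemma cond_hoeffding d1 (T1 : measurableType d1) (Y : Om -> T1) c (X : 'I_c -> Om -> V) mu
    (e : T1 -> V -> bool) (eps : K) :
  measurable_fun setT Y -> iid_rule P X (fun=> mu) ->
  (forall A B, measurable A -> measurable B ->
    P (Y @^-1` A `&` blk X @^-1` B) = (P (Y @^-1` A) * P (blk X @^-1` B))%E) ->
  measurable_fun setT (fun p : T1 * V => e p.1 p.2) -> 0 < eps -> eps <= 1 ->
  measurable [set w | (c%:R * eps <= `|\sum_(j < c) (e (Y w) (X j w))%:R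
      - c%:R * fine (mu [set x | e (Y w) x])|)%R] /\
  (P [set w | (c%:R * eps <= `|\sum_(j < c) (e (Y w) (X j w))%:R
      - c%:R * fine (mu [set x | e (Y w) x])|)%R]
   <= (2 * expR (- (c%:R * eps ^+ 2 / 4)))%:E)%E.
Proof.
move=> mY iid ind me eps0 eps1.
pose E := [set p : T1 * c.-tuple V | c%:R * eps <= `|\sum_(j < c) (e p.1 (tnth p.2 j))%:R
      - c%:R * fine (mu [set x | e p.1 x])|].
have mE : measurable E.
  apply: measurable_bool_set; apply: measurable_fun_ler; first exact: measurable_cst.
  apply: measurableT_comp => //; apply: measurable_funB.
    apply: measurable_sum => j; apply: measurable_boolR.
    rewrite (_ : (fun x => _) = (fun p : T1 * V => e p.1 p.2) \o
      (fun p : T1 * c.-tuple V => (p.1, tnth p.2 j)))//.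
    apply: measurableT_comp => //; apply: measurable_fun_pair => //.
    by apply: (measurableT_comp (measurable_tnth j)).
  apply: measurable_funM; first exact: measurable_cst.
  apply: measurableT_comp => //.
  by apply: (measurableT_comp (measurable_law mu me)).
have mX := measurable_blk iid.1.
have sumE y w : \sum_(j < c) (e y (X j w))%:R = \sum_(j < c) (e y (tnth (blk X w) j))%:R :> K.
  by apply: eq_bigr => j _; rewrite tnth_blk.
rewrite (_ : [set w | _] = [set w | E (Y w, blk X w)]); last first.
  by apply/seteqP; split=> w; rewrite /E /= sumE.
split.
  rewrite (_ : [set w | _] = (fun w => (Y w, blk X w)) @^-1` E)//.
  by apply: measurable_preim => //; exact: measurable_fun_pair.
apply: (indep_le mY mX ind mE) => y.
rewrite (_ : _ @^-1` _ = [set w | c%:R * eps <= `|\sum_(j < c) (e y (X j w))%:R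
      - c%:R * fine (mu [set x | e y x])|]).
  by apply: hoeffding => //; exact: measurable_slice me.
by apply/seteqP; split=> w; rewrite /= /xsection /= in_setE /E /= sumE.
Qed.

End Conditional.

(** * Measurability and mass of the region of a random sample *)

Section GramSchmidtMeasurable.
Context d0 (V : measurableType d0) (K : realType).

(** [h] times the power -1 of [h ^ 2] equals the inverse even at the zeros of [h], where both are 0;
    it reduces the claim to measurability of real powers. *)
Lemma measurable_invr d1 (U : measurableType d1) (h : U -> K) :
  measurable_fun setT h -> measurable_fun setT (fun x => (h x)^-1).
Proof.
move=> mh; rewrite (_ : (fun x => _) = (fun x => h x * powR (h x ^+ 2) (-1))).
  apply: measurable_funM => //.
  apply: (@measurableT_comp _ _ _ _ _ _ (fun y : K => powR y (-1))); first exact: measurable_powR.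
  exact: measurable_funX.
apply/funext => x; rewrite powR_inv1 ?sqr_ge0//.
have [->|h0] := eqVneq (h x) 0; first by rewrite invr0 mul0r.
by rewrite expr2 invfM mulrA divff// mul1r.
Qed.

Variables (m : nat) (phi : V -> nat -> K).
Hypothesis mphi : forall j, measurable_fun setT (phi^~ j).

Section WithSize.
Variable n : nat.
Local Notation S p := (tval (p : n.-tuple V * V).1).

Lemma measurable_at r (F : n.-tuple V -> V -> K) :
  measurable_fun setT (fun p : n.-tuple V * V => F p.1 p.2) ->
  measurable_fun setT (fun p : n.-tuple V * V => F p.1 (tnth p.1 r)).
Proof.
move=> mF; rewrite (_ : (fun p => _) = (fun p : n.-tuple V * V => F p.1 p.2) \o
   (fun p : n.-tuple V * V => (p.1, tnth p.1 r)))//.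
apply: measurableT_comp => //; apply: measurable_fun_pair => //.
exact: (measurableT_comp (measurable_tnth r)).
Qed.

Lemma measurable_tuple_sum (h : n.-tuple V -> V -> K) :
  measurable_fun setT (fun p : n.-tuple V * V => h p.1 p.2) ->
  measurable_fun setT (fun p : n.-tuple V * V => \sum_(y <- S p) h p.1 y).
Proof.
move=> mh; under eq_fun do rewrite big_tuple.
by apply: measurable_sum => r; exact: measurable_at.
Qed.

Lemma measurable_gs i j :
  measurable_fun setT (fun p : n.-tuple V * V => gs (S p) phi i p.2 j).
Proof.
elim: i j => [|i IH] j /=; first exact: (measurableT_comp (mphi j)).
rewrite /gstep; case: (i < j)%N; last exact: IH.
apply: measurable_funB; first exact: IH.
have mdot a b : measurable_fun setT (fun p : n.-tuple V * V => dot (S p) (gs (S p) phi i) a b).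
  apply: (measurable_tuple_sum (h := fun t y => gs (tval t) phi i y a * gs (tval t) phi i y b)).
  by apply: measurable_funM; exact: IH.
apply: measurable_funM; last exact: IH.
by apply: measurable_funM => //; apply: measurable_invr.
Qed.

Lemma measurable_nrm j : measurable_fun setT (fun p : n.-tuple V * V => nrm m phi (S p) j).
Proof.
apply: (measurable_tuple_sum (h := fun t y => gs (tval t) phi m y j * gs (tval t) phi m y j)).
by apply: measurable_funM; exact: measurable_gs.
Qed.

Lemma measurable_zeta j : measurable_fun setT (fun p : n.-tuple V * V => zeta m phi (S p) p.2 j).
Proof.
apply: measurable_funM; first exact: measurable_gs.
apply: measurable_invr.
apply: (measurable_tuple_sum (h := fun t y => `|gs (tval t) phi m y j|)).
by apply: measurableT_comp => //; exact: measurable_gs.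
Qed.

Lemma measurable_good : measurable_fun setT (fun p : n.-tuple V * V => good m phi (S p) p.2).
Proof.
apply: measurable_and.
  apply: bool_set_measurable.
  rewrite (_ : [set p | _] = [set p : n.-tuple V * V |
     forall j : 'I_m, [set p : n.-tuple V * V | psi m phi (S p) p.2 j ^+ 2 <= nrm m phi (S p) j] p]).
    apply: measurable_forall_fin => j; apply: measurable_bool_set.
    apply: measurable_fun_ler; last exact: measurable_nrm.
    by apply: measurable_funX; exact: measurable_gs.
  by apply/seteqP; split=> p /= /forallP.
apply: measurable_fun_ler; last exact: measurable_cst.
apply: measurable_sum => j; apply: measurable_funM.
  by apply: measurable_funX; exact: measurable_gs.
by apply: measurable_invr; exact: measurable_nrm.
Qed.

End WithSize.

Context d (Om : measurableType d).
Variable P : probability Om K.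

Lemma ler_sum_inj (I J : finType) (s : J -> I) (h : I -> K) : injective s ->
  (forall i, 0 <= h i) -> \sum_j h (s j) <= \sum_i h i.
Proof.
move=> sI h0; rewrite [X in _ <= X](bigID (mem (codom s)))/= -big_uniq/=.
  by rewrite big_map big_enum lerDl sumr_ge0.
by rewrite map_inj_uniq// enum_uniq.
Qed.

Lemma measurable_bad_set n (y : n.-tuple V) : measurable [set x | ~~ good m phi (tval y) x].
Proof.
apply: measurable_bool_set; apply: measurable_neg.
rewrite (_ : good m phi y = (fun p : n.-tuple V * V => good m phi (tval p.1) p.2) \o (fun x => (y, x)))//.
by apply: measurableT_comp; [exact: measurable_good|exact: measurable_fun_pair].
Qed.

(** By exchangeability each of the [c.+1] points is bad for the remaining ones with the same
    probability, and in every outcome [leave_one_out] allows at most [2 * m] bad points. *)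
Lemma leave_one_out_prob c (X : 'I_c.+1 -> Om -> V) mu : iid_rule P X (fun=> mu) ->
  ((c.+1)%:R%:E * P [set w | ~~ good m phi (blk (X \o lift ord0) w) (X ord0 w)]
    <= (2 * m)%:R%:E)%E.
Proof.
move=> iid.
pose A := [set z : c.+1.-tuple V |
  ~~ good m phi [tuple tnth z (lift ord0 i) | i < c] (tnth z ord0)].
have mA : measurable A.
  apply: measurable_bool_set; apply: measurable_neg.
  rewrite (_ : (fun z => _) = (fun p : c.-tuple V * V => good m phi (tval p.1) p.2) \o
    (fun z : c.+1.-tuple V => ([tuple tnth z (lift ord0 i) | i < c], tnth z ord0)))//.
  apply: measurableT_comp; first exact: measurable_good.
  apply: measurable_fun_pair; last exact: measurable_tnth.
  apply/measurable_fun_tnthP => i; rewrite (_ : _ \o _ = (fun z : c.+1.-tuple V => tnth z (lift ord0 i))).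
    exact: measurable_tnth.
  by apply/funext => z /=; rewrite tnth_mktuple.
(* Reindexing that moves point [j] to the front and keeps the others in order. *)
pose pj (j k : 'I_c.+1) := if unlift ord0 k is Some i then lift j i else j.
have pj0 j : pj j ord0 = j by rewrite /pj unlift_none.
have pjS j i : pj j (lift ord0 i) = lift j i by rewrite /pj liftK.
have pjI j : injective (pj j).
  move=> k k'; case: (unliftP ord0 k) => [i|] ->; case: (unliftP ord0 k') => [i'|] ->;
    rewrite ?pj0 ?pjS//.
  - by move=> /lift_inj->.
  - by move=> E; have := neq_lift j i; rewrite E eqxx.
  - by move=> E; have := neq_lift j i'; rewrite -E eqxx.
pose Aj j := blk (X \o pj j) @^-1` A.
have iidj j : iid_rule P (X \o pj j) (fun=> mu) by exact: (iid_rule_inj (pjI j) iid).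
have mAj j : measurable (Aj j).
  by apply: measurable_preim => //; apply: measurable_blk; exact: (iidj j).1.
have PA : P [set w | ~~ good m phi (blk (X \o lift ord0) w) (X ord0 w)] = P (blk X @^-1` A).
  congr (P _); apply/funext => w; rewrite /A /= tnth_blk.
  rewrite (_ : [seq tnth _ _ | _ <- _] = [seq X (lift ord0 j) w | j <- enum 'I_c])//.
  by apply: eq_map => i; rewrite tnth_blk.
have PAj j : P (blk X @^-1` A) = P (Aj j) by exact: (iid_same_law iid (iidj j) mA).
rewrite PA; apply: (@le_trans _ _ (\sum_(j < c.+1) P (Aj j))%E).
  rewrite (eq_bigr (fun=> P (blk X @^-1` A))); last by move=> j _; rewrite -PAj.
  rewrite (pr_fin P); last by apply: measurable_preim => //; exact: measurable_blk iid.1.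
  by rewrite sumEFin sumr_const card_ord -EFinM mulr_natl.
apply: (@le_trans _ _ (\sum_(j < c.+1) \int[P]_w (\1_(Aj j) w)%:E)%E).
  by apply: lee_sum => j _; rewrite integral_indic// setIT.
rewrite -ge0_integral_sum//; last first.
  by move=> j; apply/measurable_EFinP; exact: measurable_indic.
apply: (@le_trans _ _ (\int[P]_w (2 * m)%:R%:E)%E); last first.
  by rewrite integral_cst//= probability_setT mule1.
apply: ge0_le_integral => //.
- by move=> w _; apply: sume_ge0 => j _; rewrite lee_fin.
- apply: emeasurable_sum => j; apply/measurable_EFinP; exact: measurable_indic.
move=> w _; rewrite sumEFin lee_fin.
have := leave_one_out m phi (X^~ w); rewrite -(ler_nat K); apply: le_trans.
rewrite -sum1_card natr_sum [leRHS]big_mkcond/=; apply: ler_sum => j _.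
rewrite inE indicE; case: (boolP (w \in Aj j)) => [|_]; last by case: ifP.
rewrite in_setE /Aj /A /= => H; rewrite ifT//; apply: contra H.
rewrite tnth_blk/= pj0; apply: good_sub => g.
rewrite big_map big_filter big_enum_cond/= big_map big_enum/=.
under [leRHS]eq_bigr do rewrite tnth_blk /= pjS.
pose h i := g (X i w) ^+ 2; rewrite -(lerD2l (h j)) -/(h _).
rewrite (_ : _ + \sum_(i | _) _ = \sum_i h i); last by rewrite [RHS](bigD1 j).
by rewrite (bigD1_ord j).
Qed.

(** Amplification of confidence. The region of one block of [c] points misses expected mass at most
    [2 m / (c + 1)], hence by Markov misses mass [e] with probability at most 1/2. The region of all
    [b] points contains those of [g] disjoint blocks, so it can fail only if all of them fail, and
    these failures are independent. *)
Lemma good_region n (X : 'I_n -> Om -> V) (mu : probability V K) b c g (bn : (b <= n)%N) (e : K) :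
  iid_rule P X (fun=> mu) -> (c < n)%N -> (g * c <= b)%N -> 0 < e ->
  4 * m%:R <= (c.+1)%:R * e ->
  measurable [set w | (e%:E <= mu [set x | ~~ good m phi (blk (X \o widen_ord bn) w) x])%E] /\
  (P [set w | (e%:E <= mu [set x | ~~ good m phi (blk (X \o widen_ord bn) w) x])%E]
    <= ((1 / 2) ^+ g)%:E)%E.
Proof.
move=> iid cn gcb e0 me.
pose bad c' := [set y : c'.-tuple V | (e%:E <= mu [set x | ~~ good m phi (tval y) x])%E].
have mbad c' : measurable (bad c').
  rewrite -[bad c']setTI; apply: measurable_lee => //.
  apply: (measurable_law (T1 := c'.-tuple V) mu (e := fun y x => ~~ good m phi (tval y) x)).
  by apply: measurable_neg; exact: measurable_good.
have winj : injective (widen_ord bn) by move=> i j /(congr1 val) /= /val_inj.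
split.
  apply: (measurable_preim (h := blk (X \o widen_ord bn)) (A := bad b)); last exact: mbad.
  by apply: measurable_blk => j; exact: iid.1.
have bad_half (s : 'I_c -> 'I_n) : injective s -> (P (blk (X \o s) @^-1` bad c) <= (1 / 2)%:E)%E.
  move=> sI; pose X' := X \o widen_ord cn.
  have iid' : iid_rule P X' (fun=> mu).
    by apply: (iid_rule_inj _ iid) => i j /(congr1 val) /= /val_inj.
  have li := @lift_inj c.+1 ord0.
  have iidl : iid_rule P (X' \o lift ord0) (fun=> mu) := iid_rule_inj li iid'.
  rewrite (iid_same_law (iid_rule_inj sI iid) iidl)//.
  have loo := leave_one_out_prob iid'.
  have ind := pair_indep (s1 := lift (@ord0 c)) (s2 := fun _ : 'I_1 => ord0) li
    (fun i j _ => ltac:(by rewrite !ord1)) (fun i j => ltac:(by rewrite eq_sym neq_lift))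
    (nu1 := mu) (nu2 := mu) (fun=> erefl) (fun=> erefl) iid'.
  have mE : measurable [set p : c.-tuple V * 1.-tuple V | ~~ good m phi (tval p.1) (tnth p.2 ord0)].
    apply: measurable_bool_set; apply: measurable_neg.
    rewrite (_ : (fun z => _) = (fun p : c.-tuple V * V => good m phi (tval p.1) p.2) \o
      (fun z : c.-tuple V * 1.-tuple V => (z.1, tnth z.2 ord0)))//.
    apply: measurableT_comp; first exact: measurable_good.
    apply: measurable_fun_pair => //.
    exact: (measurableT_comp (measurable_tnth ord0)).
  have := indep_markov (measurable_blk iidl.1) (measurable_blk (fun=> iid'.1 ord0)) ind mE e0.
  rewrite [X in (_ <= P X)%E](_ : _ = [set w | ~~ good m phi (blk (X' \o lift ord0) w) (X' ord0 w)]);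
    last by apply/funext => w /=; rewrite tnth_blk.
  rewrite (_ : [set w | _] = blk (X' \o lift ord0) @^-1` bad c); last first.
    apply/funext => w; rewrite /bad /=; congr (is_true (_ <= _)%E).
    rewrite -(iid_marginal ord0 iid'); last exact: (measurable_bad_set (blk (X' \o lift ord0) w)).
    by congr (P _); apply/seteqP; split=> w'; rewrite /xsection /= in_setE /= tnth_blk.
  move=> H1; have {H1 loo} := conj H1 loo.
  have m1 : measurable (blk (X' \o lift ord0) @^-1` bad c).
    by apply: measurable_preim; [exact: measurable_blk iidl.1|exact: mbad].
  have m2 : measurable [set w | ~~ good m phi (blk (X' \o lift ord0) w) (X' ord0 w)].
    apply: measurable_bool_set; apply: measurable_neg.
    rewrite (_ : (fun z => _) = (fun p : c.-tuple V * V => good m phi (tval p.1) p.2) \o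
      (fun w => (blk (X' \o lift ord0) w, X' ord0 w)))//.
    apply: measurableT_comp; first exact: measurable_good.
    by apply: measurable_fun_pair; [exact: measurable_blk iidl.1|exact: iid'.1].
  rewrite (pr_fin P m1) (pr_fin P m2) -!EFinM !lee_fin natrM => -[H1 H2].
  have c0 : 0 < c.+1%:R :> K by [].
  move: H1 H2 me c0; move: (fine (P _)) (fine (P _)) (c.+1%:R) m%:R => p1 p2 C M.
  move=> H1 H2 H3 C0; rewrite -(ler_pM2l e0) -(ler_pM2l C0); nra.
have blk_lt (t : 'I_g) (j : 'I_c) : (t * c + j < b)%N.
  by apply: leq_trans gcb; rewrite (@leq_trans (t.+1 * c))// ?leq_mul// mulSn addnC ltn_add2r.
pose s1 t j := Ordinal (blk_lt t j); pose sg t j := widen_ord bn (s1 t j).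
have sgE (t t' : 'I_g) (j j' : 'I_c) : (t * c + j = t' * c + j')%N -> (t = t' /\ j = j').
  move=> E; have c0 : (0 < c)%N by apply: leq_ltn_trans (ltn_ord j).
  split; apply: val_inj => /=.
    by have := congr1 (fun x => x %/ c)%N E; rewrite !divnMDl// !divn_small// !addn0.
  by have := congr1 (fun x => x %% c)%N E; rewrite !modnMDl !modn_small.
have sgI : injective (fun p : {t : 'I_g & 'I_c} => sg (tag p) (tagged p)).
  by move=> [t j] [t' j'] /= /(congr1 val) /= /sgE[-> ->].
have sgtI t : injective (sg t) by move=> j j' /(congr1 val) /= /sgE[].
have rule := iid_rule_blocks sgI (fun _ _ => erefl mu) iid.
have mXs (t : 'I_g) (j : 'I_c) : measurable_fun setT ((fun t j => X (sg t j)) t j) by exact: iid.1.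
have := block_indep mXs rule (fun=> mbad c).
set C := [set w | _] => PC.
apply: (@le_trans _ _ (P C)).
  apply: pr_le => //.
  - apply: (measurable_preim (h := blk (X \o widen_ord bn)) (A := bad b)); last exact: mbad.
    by apply: measurable_blk => j; exact: iid.1.
  - by apply: measurable_forall_fin => t; exact: (measurable_block_preim mXs (mbad c)).
  move=> w /= H t; rewrite /bad /=; apply: (le_trans H); apply: pr_le.
  - exact: (measurable_bad_set (blk (X \o widen_ord bn) w)).
  - exact: (measurable_bad_set (block (fun t j => X (sg t j)) t w)).
  move=> x /=; apply: contra; apply: good_sub => h.
  rewrite big_map big_enum big_map big_enum/=.
  apply: (ler_sum_inj (s := s1 t) (h := fun i => h (X (widen_ord bn i) w) ^+ 2)).
    by move=> j j' /(congr1 val) /= /sgE[].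
  by move=> i; exact: sqr_ge0.
rewrite PC lee_fin -[X in _ ^+ X]card_ord -prodr_const; apply: ler_prod => t _.
rewrite fine_ge0//= -lee_fin fineK; first exact: (bad_half _ (sgtI t)).
by rewrite fin_num_measure//; exact: (measurable_block_preim mXs (mbad c)).
Qed.

End GramSchmidtMeasurable.

(** * Implementation *)

Section StoreAlgebra.
Variable K : realType.
Implicit Types (st s : store K).

Definition aset st (c i : nat) (v : K) : store K := rset st (nmem st BASE + (i * 16 + c))%N v.

Lemma nmem_aset st c i v x : nmem (aset st c i v) x = nmem st x. Proof. by []. Qed.

Lemma ar_aset st c i v c' j : (c < 16)%N -> (c' < 16)%N ->
  ar (aset st c i v) c' j = if (c' == c) && (j == i) then v else ar st c' j.
Proof.
by move=> c16 c'16; have := ar_rset st (NLit i) v j c16 c'16; rewrite neval_cell.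
Qed.

Lemma rmem_aset st c i v a : (a < nmem st BASE)%N -> rmem (aset st c i v) a = rmem st a.
Proof. by move=> aB; have := rmem_rset c (NLit i) v aB; rewrite neval_cell. Qed.

Variables (d k : nat) (f : 'I_k -> Rn K d -> bool).
Local Notation den := (den f).

Lemma den_PSkip st : den PSkip st = st. Proof. by []. Qed.
Lemma den_PN v e st : den (PN v e) st = nset st v (neval st e). Proof. by []. Qed.
Lemma den_PA c e r st : den (PA c e r) st = aset st c (neval st e) (reval st r).
Proof. by rewrite /aset -neval_cell. Qed.
Lemma den_PAsk v i a st : den (PAsk v i a) st = nset st v (ask f st (neval st i) (neval st a)).
Proof. by []. Qed.
Lemma den_PSeq p q st : den (PSeq p q) st = den q (den p st). Proof. by []. Qed.
Lemma den_PIf b p q st : den (PIf b p q) st = if teval st b then den p st else den q st.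
Proof. by []. Qed.

Lemma den_PO e r st : den (PO e r) st = rset st (neval st e) (reval st r). Proof. by []. Qed.
Lemma rmem_rset' st a v x : rmem (rset st a v) x = if x == a then v else rmem st x.
Proof. by []. Qed.
Lemma nmem_rset st a v x : nmem (rset st a v) x = nmem st x. Proof. by []. Qed.
Lemma ar_raw st a v c i : (a < nmem st BASE)%N -> ar (rset st a v) c i = ar st c i.
Proof.
move=> aB; rewrite /ar rmem_rset' nmem_rset ifF//; apply/eqP => E.
by move: aB; rewrite -E ltnNge leq_addr.
Qed.

(** Loop rule for the output phase, where raw writes break the frame of the read-only zone. *)
Lemma for_raw (I : nat -> store K -> Prop) v w p st : I 0%N (nset st v 0) ->
  (forall i s, (i < nmem st w)%N -> I i s -> I i.+1 (nset (den p s) v (nmem (den p s) v).+1)) ->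
  I (nmem st w) (den (PFor v w p) st).
Proof. by move=> I0 IS; exact: iter_inv. Qed.

Lemma den_rnat p st : pure p -> awrites p = [::] -> rmem (den p st) = rmem st.
Proof.
elim: p st => //=.
- move=> p IHp q IHq st /andP[? ?]; case: (awrites p) (IHp) => //= IHp' aq.
  by rewrite IHq// IHp'.
- move=> t p IHp q IHq st /andP[? ?]; case: (awrites p) (IHp) => //= IHp' aq.
  by case: ifP => _; [rewrite IHp'|rewrite IHq].
- move=> v w p IHp st pp ap.
  by apply: (iter_inv (I := fun _ s => rmem s = rmem st)) => // i s _ <-; exact: IHp.
Qed.

Definition framed (p : prog) st s : Prop :=
  [/\ forall x, x \notin nwrites p -> nmem s x = nmem st x,
      forall c j, c \notin awrites p -> (c < 16)%N -> ar s c j = ar st c j &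
      forall a, (a < nmem st BASE)%N -> rmem s a = rmem st a].

Lemma den_framed p st : pure p -> BASE \notin nwrites p -> framed p st (den p st).
Proof.
move=> pp Bp; split=> [x|c j|a]; first exact: den_nframe.
- by move=> *; exact: den_aframe.
- exact: den_rframe.
Qed.

(** The side conditions of the loop rule as one boolean, discharged by computation on concrete
    programs. *)
Definition okfor v w p := [&& v \notin nwrites p, v != w, w \notin nwrites p, v != BASE,
  BASE \notin nwrites p & pure p].

Lemma for_rule (I : nat -> store K -> Prop) v w p st : okfor v w p ->
  (forall s, framed (PN v (NLit 0)) st s -> nmem s v = 0%N -> I 0%N s) ->
  (forall i s, (i < nmem st w)%N -> nmem s v = i -> framed (PFor v w p) st s ->
     I i s -> I i.+1 (nset (den p s) v i.+1)) ->
  I (nmem st w) (den (PFor v w p) st).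
Proof.
move=> /and5P[vp vw wp vB /andP[Bp pp]] I0 IS.
apply: for_inv => //.
  apply: I0; last by rewrite nmem_nset eqxx.
  split=> [x|c j _ _|//]; last by rewrite ar_nset.
  by rewrite inE nmem_nset => /negPf->.
by move=> i s iw sv fn fa fr; apply: IS.
Qed.

Lemma for_sum c0 (g : nat -> K) v w p st : okfor v w p -> (c0 < 16)%N ->
  (forall i s, (i < nmem st w)%N -> nmem s v = i -> framed (PFor v w p) st s ->
     ar (den p s) c0 0 = ar s c0 0 + g i) ->
  ar (den (PFor v w p) st) c0 0 = ar st c0 0 + \sum_(i < nmem st w) g i.
Proof.
move=> ok c16 H; have vB : v != BASE by case/and5P: ok.
apply: (for_rule (I := fun n s => ar s c0 0 = ar st c0 0 + \sum_(i < n) g i) ok).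
  move=> s [_ fa _] _; rewrite big_ord0 addr0; exact: fa.
by move=> i s iw sv fr IH; rewrite ar_nset// (H i)// IH big_ord_recr/= addrA.
Qed.

Lemma for_sum2 c0 c1 (g h : nat -> K) v w p st : okfor v w p -> (c0 < 16)%N -> (c1 < 16)%N ->
  (forall i s, (i < nmem st w)%N -> nmem s v = i -> framed (PFor v w p) st s ->
     ar (den p s) c0 0 = ar s c0 0 + g i /\ ar (den p s) c1 0 = ar s c1 0 + h i) ->
  ar (den (PFor v w p) st) c0 0 = ar st c0 0 + \sum_(i < nmem st w) g i /\
  ar (den (PFor v w p) st) c1 0 = ar st c1 0 + \sum_(i < nmem st w) h i.
Proof.
move=> ok c16 c16' H.
by split; apply: for_sum => // i s iw sv fr; have [] := H i s iw sv fr.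
Qed.

(** [v := a * w] by repeated addition; the machine cannot multiply naturals. *)
Definition mul (v a w : nat) : prog :=
  PSeq (PN v (NLit 0)) (PFor TMP a (PN v (NAdd (var v) (var w)))).

Lemma den_mul v a w st : a != v -> a != TMP -> w != v -> w != TMP -> v != TMP -> v != BASE ->
  den (mul v a w) st = nset (nset st v (nmem st a * nmem st w)) TMP (nmem st a).
Proof.
move=> av aT wv wT vT vB; rewrite /mul den_PSeq.
set st1 := den _ st.
have E : nmem st1 a = nmem st a by rewrite /st1 den_PN nmem_nset (negPf av).
have Ew : nmem st1 w = nmem st w by rewrite /st1 den_PN nmem_nset (negPf wv).
pose J n s := rmem s = rmem st /\ forall x, nmem s x =
   if x == TMP then n else if x == v then (n * nmem st w)%N else nmem st x.
have : J (nmem st a) (den (PFor TMP a (PN v (NAdd (var v) (var w)))) st1).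
  rewrite -E; apply: iter_inv.
    by split=> // x; rewrite nmem_nset; case: eqP => // _.
  move=> i s _ [J1 J2]; split; first by [].
  move=> x; rewrite !nmem_nset.
  rewrite [TMP == v]eq_sym (negPf vT) J2 eqxx.
  case: eqP => // xT; case: eqP => // xv.
    rewrite /= !J2 (negPf vT) eqxx (negPf wT) (negPf wv).
    by rewrite mulSn addnC.
  by rewrite J2; move/eqP/negPf: xT => ->; move/eqP/negPf: xv => ->.
move: (den _ st1) => [sn sr] [/= J1 J2]; rewrite /nset J1; congr Store.
by apply/funext => x /=; rewrite J2.
Qed.

End StoreAlgebra.
#[global] Arguments den : simpl never.
#[global] Arguments arr : simpl never.
#[global] Arguments aset : simpl never.
#[global] Arguments mul : simpl never.
Global Opaque arr cell den nset rset aset.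

(** Memory map. Cells 0 to 4 receive the input of the learner: [d], [l], [k], [n], [n']. Then [vM]
    is the number of features, [vN] the number of points, [vB] the size of [S1], [vO] the row of its
    first point and [vOFF] the address of the first point. Array 0 is the matrix of the features,
    then of [psi], then of [zeta]; 1 marks the selected points, 2 holds the values of [q], 3 marks
    the active points, 4 holds [q], 5 the stored cuts, 6 and 7 [nrm] and [scal], 13 the weights; 8
    and 9 are accumulators. *)
Local Notation vD := 0%N.
Local Notation vL := 1%N.
Local Notation vK := 2%N.
Local Notation vM := 7%N.
Local Notation vN := 8%N.
Local Notation vB := 9%N.
Local Notation vO := 10%N.
Local Notation vOFF := 11%N.
Local Notation vr := 15%N.
Local Notation vi := 16%N.
Local Notation vj := 17%N.
Local Notation vx := 18%N.
Local Notation vrp := 19%N.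
Local Notation vxp := 20%N.
Local Notation vlen := 21%N.
Local Notation vlp := 22%N.
Local Notation vrr := 23%N.

(** * Monomial features as a program *)

(** A row grows one degree at a time: the prefix of length [vlen] is appended once per coordinate,
    multiplied by it, in accordance with the indexing of [feat]. The loop runs to [vM] under a guard
    because [vlen] is written by the program, and [cost_le] wants loop bounds that are never
    written. *)
Definition FEAT_copy : prog :=
  PFor vj vM (PIf (NLe (NAdd (var vj) (NLit 1)) (var vlen))
    (PA 0 (NAdd (var vrp) (NAdd (var vlp) (var vj)))
       (RMul (arr 0 (NAdd (var vrp) (var vj))) (RMem (NAdd (var vxp) (var vi)))))
    PSkip).
Definition FEAT_mult : prog :=
  PFor vi vD (PSeq FEAT_copy (PN vlp (NAdd (var vlp) (var vlen)))).
Definition FEAT_deg : prog :=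
  PFor vx vL (PSeq (PN vlp (var vlen)) (PSeq FEAT_mult (PN vlen (var vlp)))).
Definition ROWPTR (r : nat) : prog := mul vrp vM r.
Definition FEAT : prog :=
  PFor vr vN (PSeq (ROWPTR vr) (PSeq (mul vxp vD vr)
    (PSeq (PN vxp (NAdd (var vxp) (var vOFF)))
    (PSeq (PA 0 (var vrp) (RNat (NLit 1))) (PSeq (PN vlen (NLit 1)) FEAT_deg))))).

Section Features.
Variables (K : realType) (d k : nat) (f : 'I_k -> Rn K d -> bool).
Variables (l : nat) (x : Rn K d).
Local Notation den := (den f).
Local Notation m := (d.+1 ^ l)%N.
Implicit Types s st : store K.

Definition rowpt st := forall c, (c < d)%N ->
  (nmem st vxp + c < nmem st BASE)%N /\ rmem st (nmem st vxp + c) = nth 0 (tval x : seq K) c.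

Lemma FEAT_copyP st : nmem st vM = m -> rowpt st -> (nmem st vlen <= m)%N -> (nmem st vi < d)%N ->
  (nmem st vlen <= nmem st vlp)%N ->
  forall a, ar (den FEAT_copy st) 0 a =
    if (nmem st vrp + nmem st vlp <= a < nmem st vrp + nmem st vlp + nmem st vlen)%N
    then ar st 0 (a - nmem st vlp) * xhom x (nmem st vi).+1 else ar st 0 a.
Proof.
move=> mE px lm id lenlp; set rp := nmem st vrp; set lp := nmem st vlp; set len := nmem st vlen.
have := for_rule (f := f) (st := st) (v := vj) (w := vM)
  (p := PIf (NLe (NAdd (var vj) (NLit 1)) (var vlen))
    (PA 0 (NAdd (var vrp) (NAdd (var vlp) (var vj)))
       (RMul (arr 0 (NAdd (var vrp) (var vj))) (RMem (NAdd (var vxp) (var vi)))))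
    PSkip)
  (I := fun n s => forall a, ar s 0 a =
    if (rp + lp <= a < rp + lp + minn n len)%N
    then ar st 0 (a - lp) * xhom x (nmem st vi).+1 else ar st 0 a) isT.
rewrite -/FEAT_copy mE (minn_idPr lm); apply.
  move=> s [_ fa _] _ a; rewrite min0n addn0 ifF; last by lia.
  by rewrite fa.
move=> j s jm sj [fn fa fr] IH a; rewrite ar_nset// den_PIf /= sj !fn//.
case: ifP => jl; last first.
  rewrite -/len in jl; rewrite den_PSkip IH (_ : minn j.+1 len = minn j len)//; lia.
rewrite den_PA ar_aset//= sj !fn// -/rp -/lp.
rewrite reval_arr /= sj !fn// -/rp.
have [rB rE] := px _ id; rewrite fr// rE -/len in jl *.
have -> : ar s 0 (rp + j) = ar st 0 (rp + j) by rewrite IH ifF//; lia.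
case: eqP => [->|an].
  by rewrite ifT; [congr (ar _ _ _ * _); lia|lia].
rewrite IH; congr (if _ then _ else _); lia.
Qed.

(** The block of leading digit 0 is the old prefix itself, as [xhom] is 1 there; this is why [n]
    rounds produce [n.+1] blocks. *)
Lemma FEAT_multP st : nmem st vM = m -> nmem st vD = d -> rowpt st -> (0 < nmem st vlen)%N ->
  (nmem st vlen <= m)%N -> nmem st vlp = nmem st vlen ->
  nmem (den FEAT_mult st) vlp = (nmem st vlen * d.+1)%N /\
  forall a, (a < nmem st vrp + nmem st vlen * d.+1)%N -> ar (den FEAT_mult st) 0 a =
    if (a < nmem st vrp)%N then ar st 0 a else
    ar st 0 (nmem st vrp + (a - nmem st vrp) %% nmem st vlen)%N *
      xhom x ((a - nmem st vrp) %/ nmem st vlen)%N.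
Proof.
move=> mE dE px; set rp := nmem st vrp; set len := nmem st vlen => len0 lenm lpE.
have := for_rule (f := f) (st := st) (v := vi) (w := vD)
  (p := PSeq FEAT_copy (PN vlp (NAdd (var vlp) (var vlen))))
  (I := fun n s => nmem s vlp = (len * n.+1)%N /\
    forall a, (a < rp + len * n.+1)%N -> ar s 0 a =
    if (a < rp)%N then ar st 0 a else
    ar st 0 (rp + (a - rp) %% len)%N * xhom x ((a - rp) %/ len)%N) isT.
rewrite -/FEAT_mult dE; apply.
  move=> s [fn fa fr] si; split; first by rewrite fn// lpE muln1.
  move=> a; rewrite muln1 fa// => aL; case: ifP => // arp.
  rewrite modn_small ?divn_small ?subnKC ?mulr1//; lia.
move=> i s iD si [fn fa fr] [lpi IH]; split.
  rewrite nmem_nset /= den_PSeq den_PN nmem_nset /= !den_nframe// lpi fn//.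
  by rewrite [in RHS]mulnS addnC.
move=> a aL; rewrite ar_nset// den_PSeq den_PN ar_nset// FEAT_copyP.
- rewrite lpi si !fn// -/rp -/len; case: ifP => ac; last by apply: IH; lia.
  have -> : (a < rp)%N = false by lia.
  rewrite IH; last by lia.
  have -> : (a - len * i.+1 < rp)%N = false by lia.
  have E : (a - rp = i.+1 * len + (a - len * i.+1 - rp))%N by lia.
  have E2 : (a - len * i.+1 - rp < len)%N by lia.
  rewrite [in RHS]E modnMDl divnMDl// divn_small// addn0.
  by rewrite /= mulr1.
- by rewrite fn.
- by move=> c cd; rewrite !fn// fr//; [exact: px|exact: (px _ cd).1].
- by rewrite fn.
- by rewrite si.
- by rewrite lpi fn// leq_pmulr.
Qed.

Lemma FEAT_degP st : nmem st vM = m -> nmem st vD = d -> nmem st vL = l -> rowpt st ->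
  nmem st vlen = 1%N -> ar st 0 (nmem st vrp) = 1 ->
  (forall a, (a < nmem st vrp)%N -> ar (den FEAT_deg st) 0 a = ar st 0 a) /\
  forall j, (j < m)%N -> ar (den FEAT_deg st) 0 (nmem st vrp + j) = feat l x j.
Proof.
move=> mE dE lE px len1; set rp := nmem st vrp => rp1.
have := for_rule (f := f) (st := st) (v := vx) (w := vL)
  (p := PSeq (PN vlp (var vlen)) (PSeq FEAT_mult (PN vlen (var vlp))))
  (I := fun n s => [/\ nmem s vlen = (d.+1 ^ n)%N,
    forall a, (a < rp)%N -> ar s 0 a = ar st 0 a &
    forall j, (j < d.+1 ^ n)%N -> ar s 0 (rp + j) = feat n x j]) isT.
rewrite -/FEAT_deg lE => /(_ _ _)-[].
- move=> s [fn fa fr] sx; split=> [|a _|j]; [by rewrite fn|by rewrite fa|].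
  by case: j => // _; rewrite addn0 fa.
- move=> n s nl sx [fn fa fr] [lenn IH1 IH2].
  have lenm : (d.+1 ^ n <= m)%N by rewrite leq_pexp2l// ltnW.
  have len0 : (0 < d.+1 ^ n)%N by rewrite expn_gt0.
  rewrite !den_PSeq !den_PN /=; set s1 := nset s vlp _.
  have s1E y : nmem s1 y = if y == vlp then (d.+1 ^ n)%N else nmem s y.
    by rewrite /s1 nmem_nset lenn.
  have P1 : nmem s1 vM = m by rewrite s1E/= fn.
  have P2 : nmem s1 vD = d by rewrite s1E/= fn.
  have P3 : rowpt s1.
    by move=> c cd; rewrite !s1E/= !fn// rmem_nset fr//; [exact: px|exact: (px _ cd).1].
  have P4 : (0 < nmem s1 vlen)%N by rewrite s1E/= lenn.
  have P5 : (nmem s1 vlen <= m)%N by rewrite s1E/= lenn.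
  have P6 : nmem s1 vlp = nmem s1 vlen by rewrite !s1E/= lenn.
  have [] := FEAT_multP P1 P2 P3 P4 P5 P6; rewrite !s1E/= lenn fn// -/rp => lpE aE.
  split.
  + by rewrite !nmem_nset/= lpE expnSr.
  + by move=> a arp; rewrite !ar_nset// aE ?arp ?ar_nset ?IH1//; lia.
  move=> j; rewrite expnSr => jl; rewrite !ar_nset// aE; last by lia.
  rewrite (_ : (rp + j < rp)%N = false); last by lia.
  by rewrite addKn ar_nset// IH2// ltn_mod.
by move=> _ H1 H2; split.
Qed.

End Features.

Section FeatureRows.
Variables (K : realType) (d k : nat) (f : 'I_k -> Rn K d -> bool).
Variables (l : nat) (pt : nat -> Rn K d).
Local Notation den := (den f).
Local Notation m := (d.+1 ^ l)%N.
Implicit Types s st : store K.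

Definition rawpts (off N : nat) st := forall r c, (r < N)%N -> (c < d)%N ->
  (off + (r * d + c) < nmem st BASE)%N /\ rmem st (off + (r * d + c)) = nth 0 (tval (pt r) : seq K) c.

Lemma FEATP st : nmem st vM = m -> nmem st vD = d -> nmem st vL = l ->
  rawpts (nmem st vOFF) (nmem st vN) st ->
  forall r j, (r < nmem st vN)%N -> (j < m)%N -> ar (den FEAT st) 0 (r * m + j) = feat l (pt r) j.
Proof.
move=> mE dE lE rpt.
have := for_rule (f := f) (st := st) (v := vr) (w := vN)
  (p := PSeq (ROWPTR vr) (PSeq (mul vxp vD vr)
    (PSeq (PN vxp (NAdd (var vxp) (var vOFF)))
    (PSeq (PA 0 (var vrp) (RNat (NLit 1))) (PSeq (PN vlen (NLit 1)) FEAT_deg)))))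
  (I := fun n s => forall r j, (r < n)%N -> (j < m)%N -> ar s 0 (r * m + j) = feat l (pt r) j) isT.
rewrite -/FEAT; apply => // r s rN sr [fn fa fr] IH r' j r'r jm.
rewrite ar_nset// den_PSeq /ROWPTR den_mul// den_PSeq den_mul//.
set s1 := nset (nset (nset (nset s _ _) _ _) _ _) _ _.
have sM : nmem s vM = m by rewrite fn.
have sD : nmem s vD = d by rewrite fn.
have s1E y : nmem s1 y = if y == TMP then d else if y == vxp then (d * r)%N else
    if y == vrp then (m * r)%N else nmem s y.
  by rewrite /s1 !nmem_nset/= sr sM sD; do 3 (case: eqP => // _).
have s1r a : rmem s1 a = rmem s a by rewrite /s1 !rmem_nset.
have s1a c i : ar s1 c i = ar s c i by rewrite /s1 !ar_nset.
clearbody s1.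
rewrite den_PSeq den_PN den_PSeq den_PA den_PSeq den_PN; set s2 := nset _ vlen _.
have s2E y : nmem s2 y = if y == vlen then 1%N else if y == vxp then (d * r + nmem st vOFF)%N else nmem s1 y.
  rewrite /s2 nmem_nset; case: eqP => // _.
  by rewrite nmem_aset nmem_nset /= !s1E/= (fn vOFF).
have s2r a : (a < nmem st BASE)%N -> rmem s2 a = rmem st a.
  move=> aB; rewrite /s2 rmem_nset rmem_aset ?rmem_nset ?s1r ?fr//.
  by rewrite nmem_nset/= s1E/= fn.
have s2a a : ar s2 0 a = if a == (m * r)%N then 1 else ar s 0 a.
  by rewrite /s2 ar_nset// ar_aset//= nmem_nset/= s1E/= ar_nset// s1a.
clearbody s2.
have P1 : nmem s2 vM = m by rewrite s2E/= s1E/= fn.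
have P2 : nmem s2 vD = d by rewrite s2E/= s1E/= fn.
have P3 : nmem s2 vL = l by rewrite s2E/= s1E/= fn.
have P4 : rowpt (pt r) s2.
  move=> c cd; rewrite !s2E/= s1E/= fn//; have [H1 H2] := rpt r c rN cd.
  have E : (d * r + nmem st vOFF + c = nmem st vOFF + (r * d + c))%N by lia.
  by rewrite E s2r.
have P5 : nmem s2 vlen = 1%N by rewrite s2E.
have P6 : ar s2 0 (nmem s2 vrp) = 1 by rewrite s2E/= s1E/= s2a eqxx.
have [] := FEAT_degP f P1 P2 P3 P4 P5 P6; rewrite s2E/= s1E/= => H1 H2.
move: r'r; rewrite ltnS leq_eqVlt => /orP[/eqP->|r'r]; first by rewrite mulnC H2.
rewrite H1; last by nia.
rewrite s2a ifF ?IH//; by nia.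
Qed.

End FeatureRows.

(** * Gram-Schmidt and the test of the region as programs *)

Definition r0 := RNat (NLit 0).
Definition r1 := RNat (NLit 1).
Definition Zat (v : nat) : rexp := arr 0 (NAdd (var vrp) (var v)).
(** The offset [vO] lets learner and evaluator share this code: it is 0 when [S1] occupies the first
    rows, and 1 in the evaluator, where row 0 is the point to be classified. *)
Definition SROW : prog := PSeq (PN vr (NAdd (var vrr) (var vO))) (ROWPTR vr).
Definition incr (c : nat) (e : rexp) : prog := PA c (NLit 0) (RAdd (arr c (NLit 0)) e).

Definition GS_coef : prog :=
  PSeq (PA 8 (NLit 0) r0) (PSeq (PA 9 (NLit 0) r0)
    (PFor vrr vB (PSeq SROW (PSeq (incr 8 (RMul (Zat vi) (Zat vj)))
       (incr 9 (RMul (Zat vi) (Zat vi))))))).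
Definition GS_upd : prog :=
  PFor vr vN (PSeq (ROWPTR vr) (PA 0 (NAdd (var vrp) (var vj))
    (RSub (Zat vj) (RMul (RDiv (arr 8 (NLit 0)) (arr 9 (NLit 0))) (Zat vi))))).
Definition GS_col : prog :=
  PFor vj vM (PIf (NLe (NAdd (var vi) (NLit 1)) (var vj)) (PSeq GS_coef GS_upd) PSkip).
Definition GS : prog := PFor vi vM GS_col.

Definition rabs (e : rexp) (c : nat) : prog :=
  PIf (RLe r0 e) (incr c e) (incr c (RSub r0 e)).
Definition NRM_col : prog :=
  PSeq (PA 8 (NLit 0) r0) (PSeq (PA 9 (NLit 0) r0)
    (PFor vrr vB (PSeq SROW (PSeq (incr 8 (RMul (Zat vj) (Zat vj))) (rabs (Zat vj) 9))))).
Definition NRM : prog :=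
  PFor vj vM (PSeq NRM_col (PSeq (PA 6 (var vj) (arr 8 (NLit 0)))
    (PA 7 (var vj) (arr 9 (NLit 0))))).
(** A single pass: an entry is tested against [nrm], adds to the leverage, and is then overwritten
    by its value of [zeta]. *)
Definition GOOD_row : prog :=
  PFor vj vM (PSeq (PIf (RLe (RMul (Zat vj) (Zat vj)) (arr 6 (var vj))) PSkip (PA 1 (var vr) r0))
    (PSeq (incr 8 (RDiv (RMul (Zat vj) (Zat vj)) (arr 6 (var vj))))
      (PA 0 (NAdd (var vrp) (var vj)) (RDiv (Zat vj) (arr 7 (var vj)))))).
Definition GOOD : prog :=
  PFor vr vN (PSeq (ROWPTR vr) (PSeq (PA 1 (var vr) r1) (PSeq (PA 8 (NLit 0) r0)
    (PSeq GOOD_row (PIf (RLe (arr 8 (NLit 0)) r1) PSkip (PA 1 (var vr) r0)))))).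

Section Orthogonalization.
Variables (K : realType) (d k : nat) (f : 'I_k -> Rn K d -> bool).
Variables (m N b o : nat) (pt : nat -> Rn K d) (F : Rn K d -> nat -> K).
Hypothesis boN : (b + o <= N)%N.
Local Notation den := (den f).
Implicit Types s st : store K.

Definition ctx st := [/\ nmem st vM = m, nmem st vN = N, nmem st vB = b & nmem st vO = o].

Lemma ctx_framed p st s : framed p st s ->
  all (fun v => v \notin nwrites p) [:: vM; vN; vB; vO] -> ctx st -> ctx s.
Proof. by case=> fn _ _ /and5P[? ? ? ? _] [? ? ? ?]; split; rewrite fn. Qed.

Lemma ctx_nset st v x : v \notin [:: vM; vN; vB; vO] -> ctx st -> ctx (nset st v x).
Proof.
rewrite !inE !negb_or => /and4P[? ? ? ?] [? ? ? ?].
by split; rewrite nmem_nset eq_sym ifN.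
Qed.

Lemma rowptrE st : ctx st ->
  den (ROWPTR vr) st = nset (nset st vrp (nmem st vr * m)) TMP m.
Proof. by case=> mE _ _ _; rewrite /ROWPTR den_mul// mE mulnC. Qed.

Definition mat st (G : nat -> nat -> K) := forall r j, (r < N)%N -> (j < m)%N ->
  ar st 0 (r * m + j) = G r j.

Lemma mat_ext st st' G G' : (forall i, ar st' 0 i = ar st 0 i) ->
  (forall r j, (r < N)%N -> (j < m)%N -> G' r j = G r j) -> mat st G -> mat st' G'.
Proof. by move=> E EG H r j rN jm; rewrite E EG// H. Qed.

Lemma mat_aset st G r0 v j0 : (j0 < m)%N -> mat st G ->
  mat (aset st 0 (r0 * m + j0) v) (fun r j => if (r == r0) && (j == j0) then v else G r j).
Proof.
move=> j0m H r j rN jm; rewrite ar_aset// eqxx/= H//; congr (if _ then _ else _).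
apply/eqP/andP => [E|[/eqP-> /eqP->]//].
have m0 : (0 < m)%N by apply: leq_ltn_trans jm.
have : r = r0.
  by have := congr1 (divn^~ m) E; rewrite !divnMDl// !divn_small// !addn0.
by move=> rr; move: E; rewrite rr => /addnI ->.
Qed.

Lemma for_sum_0 c0 (g : nat -> K) v w p st n : nmem st w = n -> ar st c0 0 = 0 ->
  (forall i s, (i < n)%N -> nmem s v = i -> framed (PFor v w p) st s ->
     ar (den p s) c0 0 = ar s c0 0 + g i) ->
  okfor v w p -> (c0 < 16)%N ->
  ar (den (PFor v w p) st) c0 0 = \sum_(i < n) g i.
Proof.
move=> wE a0 + ok l0; rewrite -wE => H; have := for_sum ok l0 H.
by rewrite a0 !add0r.
Qed.

Lemma for_sum2_0 c0 c1 (g h : nat -> K) v w p st n : nmem st w = n ->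
  ar st c0 0 = 0 -> ar st c1 0 = 0 ->
  (forall i s, (i < n)%N -> nmem s v = i -> framed (PFor v w p) st s ->
     ar (den p s) c0 0 = ar s c0 0 + g i /\ ar (den p s) c1 0 = ar s c1 0 + h i) ->
  okfor v w p -> (c0 < 16)%N -> (c1 < 16)%N ->
  ar (den (PFor v w p) st) c0 0 = \sum_(i < n) g i /\
  ar (den (PFor v w p) st) c1 0 = \sum_(i < n) h i.
Proof.
move=> wE a0 a1 + ok l0 l1; rewrite -wE => H; have := for_sum2 ok l0 l1 H.
by rewrite a0 a1 !add0r.
Qed.

Definition S1 : seq (Rn K d) := [seq pt (r + o) | r <- iota 0 b].

Lemma sum_S1 (h : Rn K d -> K) : \sum_(y <- S1) h y = \sum_(r < b) h (pt (r + o)).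
Proof. by rewrite big_map -{1}(subn0 b) big_mkord. Qed.

Lemma srowE st : ctx st -> exists s,
  [/\ den SROW st = s, ctx s, nmem s vrp = ((nmem st vrr + o) * m)%N,
    forall y, y \notin [:: vr; vrp; TMP] -> nmem s y = nmem st y &
    forall c i, ar s c i = ar st c i].
Proof.
move=> C; exists (den SROW st); split=> //.
- rewrite /SROW den_PSeq den_PN /= rowptrE; last exact: ctx_nset.
  by do 3 apply: ctx_nset => //.
- rewrite /SROW den_PSeq den_PN /= rowptrE; last exact: ctx_nset.
  by case: C => _ _ _ <-; rewrite !nmem_nset.
- move=> y yn; apply: den_nframe; move: yn; rewrite !inE !negb_or => /and3P[y1 y2 y3].
  by rewrite /= y1 y2 y3.
- move=> c i; rewrite /SROW den_PSeq den_PN /= rowptrE; last exact: ctx_nset.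
  by rewrite !ar_nset.
Qed.

Lemma ar_incr st c e c' i : (c < 16)%N -> (c' < 16)%N -> ar (den (incr c e) st) c' i =
  if (c' == c) && (i == 0%N) then ar st c 0 + reval st e else ar st c' i.
Proof. by move=> cl cl'; rewrite den_PA ar_aset//= reval_arr. Qed.

Lemma reval_Zat st v G : mat st G -> (nmem st v < m)%N ->
  forall r, (r < N)%N -> nmem st vrp = (r * m)%N -> reval st (Zat v) = G r (nmem st v).
Proof. by move=> H vm r rN rp; rewrite reval_arr/= rp H. Qed.

Lemma GS_coefP st G : ctx st -> mat st G -> (nmem st vi < m)%N -> (nmem st vj < m)%N ->
  ar (den GS_coef st) 8 0 = \sum_(r < b) G (r + o)%N (nmem st vi) * G (r + o)%N (nmem st vj) /\
  ar (den GS_coef st) 9 0 = \sum_(r < b) G (r + o)%N (nmem st vi) * G (r + o)%N (nmem st vi).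
Proof.
move=> C M im jm; rewrite /GS_coef !den_PSeq !den_PA /=; set st1 := aset _ 9 _ _.
have C1 : ctx st1 by [].
have M1 : mat st1 G by apply: mat_ext M => // i; rewrite !ar_aset.
have a8 : ar st1 8 0 = 0 by rewrite !ar_aset.
have a9 : ar st1 9 0 = 0 by rewrite !ar_aset.
have i1 : nmem st1 vi = nmem st vi by [].
have j1 : nmem st1 vj = nmem st vj by [].
clearbody st1; rewrite -i1 -j1 in im jm *.
have [_ _ bE _] := C1.
apply: (for_sum2_0 (g := fun r => G (r + o)%N (nmem st1 vi) * G (r + o)%N (nmem st1 vj))
  (h := fun r => G (r + o)%N (nmem st1 vi) * G (r + o)%N (nmem st1 vi)) bE a8 a9) => //.
move=> r s rb sr fr; have Cs := ctx_framed fr isT C1; have [fn fa _] := fr.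
rewrite den_PSeq; have [s' [-> C' rp' n' a']] := srowE Cs.
have Ms : mat s' G by apply: mat_ext M1 => // i; rewrite a' fa.
have rN : (r + o < N)%N by lia.
rewrite sr in rp'; have := reval_Zat Ms _ rN rp' => Zr.
rewrite !den_PSeq !ar_incr//= !Zr ?n'// ?fn// !a'; split=> //.
rewrite den_PA; set s2 := aset _ 8 _ _.
have M2 : mat s2 G by apply: mat_ext Ms => // i; rewrite ar_aset.
have Z2 := reval_Zat M2 _ rN rp'.
by rewrite !Z2 /s2 ?nmem_aset ?n' ?fn.
Qed.

Lemma GS_updP st G c : ctx st -> mat st G -> (nmem st vi < m)%N -> (nmem st vj < m)%N ->
  nmem st vi != nmem st vj -> ar st 8 0 / ar st 9 0 = c ->
  mat (den GS_upd st) (fun r j => if j == nmem st vj then G r j - c * G r (nmem st vi) else G r j).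
Proof.
move=> C M im jm ij cE; have [_ NE _ _] := C.
have := for_rule (f := f) (st := st) (v := vr) (w := vN) (p := PSeq (ROWPTR vr) (PA 0 (NAdd (var vrp) (var vj))
    (RSub (Zat vj) (RMul (RDiv (arr 8 (NLit 0)) (arr 9 (NLit 0))) (Zat vi)))))
  (I := fun n s => mat s (fun r j => if (r < n)%N && (j == nmem st vj) then
     G r j - c * G r (nmem st vi) else G r j)) isT.
rewrite -/GS_upd NE => H; apply: (mat_ext (st := den GS_upd st) _ _ (H _ _)) => //.
- by move=> r j rN _; rewrite rN.
- by move=> s [fn fa fr] _; apply: mat_ext M => // i; exact: fa.
move=> r s rN sr fr IH; have Cs := ctx_framed fr isT C; have [fn fa _] := fr.
rewrite den_PSeq rowptrE// sr den_PA /= !nmem_nset/= fn//.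
set s1 := nset (nset _ _ _) _ _; set v := _ - _.
have vE : v = G r (nmem st vj) - c * G r (nmem st vi).
  rewrite /v !reval_arr/= !nmem_nset/= !fn// !ar_nset// (fa 8%N)// (fa 9%N)// cE.
  by rewrite !IH// ltnn/=.
apply: mat_ext (mat_aset r v jm IH).
  by move=> i; rewrite ar_nset// !ar_aset// /s1 !ar_nset.
move=> r' j r'N j'm; rewrite vE; case: (r' =P r) => [->|rr].
  by rewrite ltnSn ltnn/=; case: eqP => // ->.
by congr (if _ then _ else _); congr andb; lia.
Qed.

Local Notation Fg i := (fun r j => gs S1 F i (pt r) j).

(** Columns are updated in place. The inner invariant separates those that have undergone sweep [i]
    from those that have not; column [i] is untouched by its own sweep, so the coefficients are read
    from the right data. *)
Lemma GSP st : ctx st -> mat st (fun r j => F (pt r) j) ->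
  mat (den GS st) (fun r j => psi m F S1 (pt r) j).
Proof.
move=> C M; have [mE _ _ _] := C.
have := for_rule (f := f) (st := st) (v := vi) (w := vM) (p := GS_col)
  (I := fun n s => mat s (Fg n)) isT.
rewrite -/GS mE; apply; first by move=> s [_ fa _] _; apply: mat_ext M => // i; exact: fa.
move=> i s im si fr IH; have Cs := ctx_framed fr isT C.
suff M' : mat (den GS_col s) (Fg i.+1) by apply: mat_ext M' => // j; rewrite ar_nset.
clear fr.
have [mEs _ _ _] := Cs.
have := for_rule (f := f) (st := s) (v := vj) (w := vM)
  (p := PIf (NLe (NAdd (var vi) (NLit 1)) (var vj)) (PSeq GS_coef GS_upd) PSkip)
  (I := fun n t => mat t (fun r j => if (j < n)%N then gs S1 F i.+1 (pt r) j else gs S1 F i (pt r) j)) isT.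
rewrite -/GS_col mEs => H; apply: (mat_ext (st := den GS_col s) _ _ (H _ _)) => //.
- by move=> r j _ jm; rewrite jm.
- by move=> t [_ fa _] _; apply: mat_ext IH => // a; exact: fa.
move=> j t jm tj fr IH2; have Ct := ctx_framed fr isT Cs; have [fn fa _] := fr.
rewrite den_PIf /= tj fn// si addn1.
set G := (fun r j0 => _) in IH2.
case: ifPn => ij; last first.
  rewrite den_PSkip; apply: mat_ext IH2 => [a|r j' rN j'm]; first by rewrite ar_nset.
  rewrite /G ltnS leq_eqVlt; case: eqP => //= ->; rewrite ltnn.
  by rewrite gstep_le// leqNgt.
rewrite den_PSeq.
have it : (nmem t vi < m)%N by rewrite fn// si.
have jt : (nmem t vj < m)%N by rewrite tj.
have [c8 c9] := GS_coefP Ct IH2 it jt.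
have fr2 := den_framed f (p := GS_coef) t isT isT; have [gn ga _] := fr2.
have C2 := ctx_framed fr2 isT Ct.
have M2 : mat (den GS_coef t) G by apply: mat_ext IH2 => // a; exact: ga.
have P1 : (nmem (den GS_coef t) vi < m)%N by rewrite gn.
have P2 : (nmem (den GS_coef t) vj < m)%N by rewrite gn.
have P3 : nmem (den GS_coef t) vi != nmem (den GS_coef t) vj by rewrite !gn// (fn vi)// si tj neq_ltn ij.
have := GS_updP C2 M2 P1 P2 P3 erefl; rewrite c8 c9 !gn// (fn vi)// si tj.
apply: mat_ext => [a|r j' rN j'm]; first by rewrite ar_nset.
rewrite /G ltnS leq_eqVlt; case: eqP => //= ->; rewrite ltnn ij /= /gstep ij.
congr (_ - _ * _).
  by rewrite ltnn {1 2}/dot !sum_S1.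
by rewrite ltnn.
Qed.

Lemma ar_rabs st c e c' i : (c < 16)%N -> (c' < 16)%N -> ar (den (rabs e c) st) c' i =
  if (c' == c) && (i == 0%N) then ar st c 0 + `|reval st e| else ar st c' i.
Proof.
move=> cl cl'; rewrite /rabs den_PIf /=; have [ge|lt] := leP 0 (reval st e).
  by rewrite ar_incr// ger0_norm.
by rewrite ar_incr//= sub0r ltr0_norm.
Qed.

Lemma NRM_colP st G : ctx st -> mat st G -> (nmem st vj < m)%N ->
  ar (den NRM_col st) 8 0 = \sum_(r < b) G (r + o)%N (nmem st vj) * G (r + o)%N (nmem st vj) /\
  ar (den NRM_col st) 9 0 = \sum_(r < b) `|G (r + o)%N (nmem st vj)|.
Proof.
move=> C M jm; rewrite /NRM_col !den_PSeq !den_PA /=; set st1 := aset _ 9 _ _.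
have C1 : ctx st1 by [].
have M1 : mat st1 G by apply: mat_ext M => // i; rewrite !ar_aset.
have a8 : ar st1 8 0 = 0 by rewrite !ar_aset.
have a9 : ar st1 9 0 = 0 by rewrite !ar_aset.
have j1 : nmem st1 vj = nmem st vj by [].
clearbody st1; rewrite -j1 in jm *.
have [_ _ bE _] := C1.
apply: (for_sum2_0 (g := fun r => G (r + o)%N (nmem st1 vj) * G (r + o)%N (nmem st1 vj))
  (h := fun r => `|G (r + o)%N (nmem st1 vj)|) bE a8 a9) => //.
move=> r s rb sr fr; have Cs := ctx_framed fr isT C1; have [fn fa _] := fr.
rewrite den_PSeq; have [s' [-> C' rp' n' a']] := srowE Cs.
have Ms : mat s' G by apply: mat_ext M1 => // i; rewrite a' fa.
have rN : (r + o < N)%N by lia.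
rewrite sr in rp'; have := reval_Zat Ms _ rN rp' => Zr.
rewrite !den_PSeq !ar_rabs//= ar_incr//= !Zr ?n'// ?fn// !a'; split=> //.
rewrite den_PA; set s2 := aset _ 8 _ _.
have M2 : mat s2 G by apply: mat_ext Ms => // i; rewrite ar_aset.
have Z2 := reval_Zat M2 _ rN rp'.
by rewrite ar_aset//= a' !Z2 /s2 ?nmem_aset ?n' ?fn.
Qed.

Lemma NRMP st : ctx st -> mat st (fun r j => psi m F S1 (pt r) j) ->
  [/\ mat (den NRM st) (fun r j => psi m F S1 (pt r) j),
    forall j, (j < m)%N -> ar (den NRM st) 6 j = nrm m F S1 j &
    forall j, (j < m)%N -> ar (den NRM st) 7 j = scal m F S1 j].
Proof.
move=> C M; have [mE _ _ _] := C; set G := (fun r j => _) in M *.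
have [_ fa _] := den_framed f (p := NRM) st isT isT.
split; first by apply: mat_ext M => // i; exact: fa.
all: suff [H6 H7] : (forall j, (j < m)%N -> ar (den NRM st) 6 j = nrm m F S1 j) /\
  (forall j, (j < m)%N -> ar (den NRM st) 7 j = scal m F S1 j) by [].
all: have := for_rule (f := f) (st := st) (v := vj) (w := vM)
  (p := PSeq NRM_col (PSeq (PA 6 (var vj) (arr 8 (NLit 0))) (PA 7 (var vj) (arr 9 (NLit 0)))))
  (I := fun n s => (forall j, (j < n)%N -> ar s 6 j = nrm m F S1 j) /\
  (forall j, (j < n)%N -> ar s 7 j = scal m F S1 j)) isT.
all: rewrite -/NRM mE; apply => //.
all: move=> j s jm sj fr [I1 I2]; have Cs := ctx_framed fr isT C; have [fn {}fa _] := fr.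
all: have Ms : mat s G by apply: mat_ext M => // i; exact: fa.
all: have sjm : (nmem s vj < m)%N by rewrite sj.
all: have [c8 c9] := NRM_colP Cs Ms sjm.
all: have [gn ga _] := den_framed f (p := NRM_col) s isT isT.
all: rewrite !den_PSeq !den_PA /= !reval_arr/= nmem_aset gn// sj.
all: split=> j'; rewrite ltnS leq_eqVlt ar_nset// !ar_aset//= ?c8 ?c9 ?sj.
all: case: eqP => [->|_] /= j'j; rewrite ?ga ?I1 ?I2//.
all: by rewrite /nrm /dot /scal sum_S1; apply: eq_bigr.
Qed.

Lemma GOOD_rowP st G r (nr sc : nat -> K) : ctx st -> mat st G -> (r < N)%N ->
  nmem st vr = r -> nmem st vrp = (r * m)%N ->
  (forall j, (j < m)%N -> ar st 6 j = nr j) -> (forall j, (j < m)%N -> ar st 7 j = sc j) ->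
  ar st 1 r = 1 -> ar st 8 0 = 0 ->
  [/\ mat (den GOOD_row st) (fun r' j => if r' == r then G r j / sc j else G r' j),
   ar (den GOOD_row st) 8 0 = \sum_(j < m) G r j ^+ 2 / nr j,
   ar (den GOOD_row st) 1 r = [forall j : 'I_m, G r j ^+ 2 <= nr j]%:R &
   forall r', r' != r -> ar (den GOOD_row st) 1 r' = ar st 1 r'].
Proof.
move=> C M rN vrE rpE nrE scE s1 a8; have [mE _ _ _] := C.
have := for_rule (f := f) (st := st) (v := vj) (w := vM)
  (p := PSeq (PIf (RLe (RMul (Zat vj) (Zat vj)) (arr 6 (var vj))) PSkip (PA 1 (var vr) r0))
    (PSeq (incr 8 (RDiv (RMul (Zat vj) (Zat vj)) (arr 6 (var vj))))
      (PA 0 (NAdd (var vrp) (var vj)) (RDiv (Zat vj) (arr 7 (var vj))))))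
  (I := fun n s => [/\ mat s (fun r' j => if (r' == r) && (j < n)%N then G r j / sc j else G r' j),
   ar s 8 0 = \sum_(j < n) G r j ^+ 2 / nr j,
   ar s 1 r = (all (fun j => G r j ^+ 2 <= nr j) (iota 0 n))%:R &
   forall r', r' != r -> ar s 1 r' = ar st 1 r']) isT.
rewrite -/GOOD_row mE => /(_ _ _)-[].
- move=> s [fn fa _] _; split.
  + by apply: mat_ext M => [i|r' j' _ _]; [exact: fa|rewrite ltn0 andbF].
  + by rewrite fa// big_ord0.
  + by rewrite fa.
  + by move=> r' _; rewrite fa.
- move=> j s jm sj fr [IM I8 I1 I1']; have [fn fa _] := fr.
  rewrite !den_PSeq; set s1' := den (PIf _ _ _) s.
  have n1 y : nmem s1' y = nmem s y by rewrite /s1' den_PIf; case: ifP.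
  have a1 c i : (c < 16)%N -> c != 1%N -> ar s1' c i = ar s c i.
    by move=> cl c1; rewrite /s1' den_PIf; case: ifP => // _; rewrite den_PA ar_aset//= (negPf c1).
  have rZ : reval s (Zat vj) = G r j.
    by rewrite reval_arr/= fn// rpE sj IM// ltnn andbF.
  have h1 i : ar s1' 1 i = if (i == r) && ~~ (G r j ^+ 2 <= nr j) then 0 else ar s 1 i.
    rewrite /s1' den_PIf /= !rZ reval_arr/= sj fa// nrE// -expr2; case: ifP => _.
      by rewrite andbF.
    by rewrite den_PA ar_aset//= fn// vrE andbT; case: eqP.
  clearbody s1'.
  have rZ1 : reval s1' (Zat vj) = G r j.
    by move: rZ; rewrite !reval_arr/= !n1 a1.
  rewrite [den (incr _ _) _]den_PA; set s2 := aset s1' 8 _ _.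
  have s2E : s2 = aset s1' 8 0 (\sum_(j0 < j) G r j0 ^+ 2 / nr j0 + G r j ^+ 2 / nr j).
    by rewrite /s2 /= !rZ1 !reval_arr/= n1 sj !a1// (fa 6%N)// nrE// I8 -expr2.
  rewrite den_PA.
  have -> : reval s2 (RDiv (Zat vj) (arr 7 (var vj))) = G r j / sc j.
    rewrite /= !reval_arr /= s2E !nmem_aset !n1 !ar_aset//= !a1// fn// rpE sj.
    by rewrite IM// ltnn andbF (fa 7%N)// scE.
  rewrite [neval _ _]/= s2E !nmem_aset !n1 sj fn// rpE; split.
  + have := mat_aset r (G r j / sc j) jm IM.
    apply: mat_ext => [i|r' j' r'N j'm]; first by rewrite ar_nset// !ar_aset//= a1.
    rewrite ltnS leq_eqVlt; case: (r' == r) => //=.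
    by case: eqP => [->|].
  + by rewrite ar_nset// !ar_aset//= big_ord_recr.
  + have -> : iota 0 j.+1 = iota 0 j ++ [:: j] by rewrite -addn1 iotaD.
    rewrite ar_nset// !ar_aset//= h1 eqxx/= I1 all_cat/= andbT.
    by case: (G r j ^+ 2 <= nr j); rewrite ?andbT ?andbF.
  + by move=> r' rr; rewrite ar_nset// !ar_aset//= h1 (negPf rr)/= I1'.
move=> M' a8' a1' a1''; split=> //.
- by apply: mat_ext M' => // r' j' r'N j'm; rewrite j'm andbT; case: eqP.
- rewrite a1'; congr (nat_of_bool _)%:R; apply/allP/forallP => [H j|H j].
    by apply: H; rewrite mem_iota/= add0n.
  by rewrite mem_iota add0n/= => jm; exact: (H (Ordinal jm)).
Qed.

Lemma GOODP st : ctx st -> mat st (fun r j => psi m F S1 (pt r) j) ->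
  (forall j, (j < m)%N -> ar st 6 j = nrm m F S1 j) ->
  (forall j, (j < m)%N -> ar st 7 j = scal m F S1 j) ->
  mat (den GOOD st) (fun r j => zeta m F S1 (pt r) j) /\
  forall r, (r < N)%N -> ar (den GOOD st) 1 r = (good m F S1 (pt r))%:R.
Proof.
move=> C M nE sE; have [_ NE _ _] := C.
have := for_rule (f := f) (st := st) (v := vr) (w := vN)
  (p := (PSeq (ROWPTR vr) (PSeq (PA 1 (var vr) r1) (PSeq (PA 8 (NLit 0) r0)
    (PSeq GOOD_row (PIf (RLe (arr 8 (NLit 0)) r1) PSkip (PA 1 (var vr) r0)))))))
  (I := fun n s => mat s (fun r j => if (r < n)%N then zeta m F S1 (pt r) j else psi m F S1 (pt r) j) /\
  forall r, (r < n)%N -> ar s 1 r = (good m F S1 (pt r))%:R) isT.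
rewrite -/GOOD NE => /(_ _ _)-[].
- by move=> s [fn fa _] _; split=> //; apply: mat_ext M => // i; exact: fa.
- move=> r s rN sr fr [IM I1]; have Cs := ctx_framed fr isT C; have [fn fa _] := fr.
  rewrite den_PSeq rowptrE// sr !den_PSeq !den_PA /=; set s1 := aset _ 8 _ _.
  have s1E y : nmem s1 y = if y == TMP then m else if y == vrp then (r * m)%N else nmem s y by [].
  have s1a c i : (c < 16)%N -> ar s1 c i = if (c == 8%N) && (i == 0%N) then 0 else if (c == 1%N) && (i == r) then 1 else ar s c i.
    by move=> cl; rewrite /s1 !ar_aset//= !ar_nset// nmem_nset/= nmem_nset/= sr.
  have C1 : ctx s1 by do 2 apply: (ctx_nset _ (v := _)) => //.
  clearbody s1.
  have := @GOOD_rowP s1 (fun r' j => if (r' < r)%N then zeta m F S1 (pt r') j else psi m F S1 (pt r') j) r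
    (nrm m F S1) (scal m F S1) C1.
  case=> //.
  + by apply: mat_ext IM => // i; rewrite s1a.
  + by rewrite s1E.
  + by move=> j jm; rewrite s1a//= fa// nE.
  + by move=> j jm; rewrite s1a//= fa// sE.
  + by rewrite s1a//= eqxx.
  + by rewrite s1a.
  rewrite ltnn => M2 a8 a1 a1'.
  have [gn ga _] := den_framed f (p := GOOD_row) s1 isT isT.
  have vr2 : nmem (den GOOD_row s1) vr = r by rewrite gn// s1E.
  rewrite den_PIf /= reval_arr/= a8 -/(lev m F S1 (pt r)) in a1 a1' M2 *.
  split.
  + apply: mat_ext M2 => [i|r' j r'N jm].
      by rewrite ar_nset//; case: ifP => _; rewrite ?den_PSkip// den_PA ar_aset.
    by rewrite ltnS leq_eqVlt; case: eqP => //= ->.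
  + move=> r'; rewrite ltnS leq_eqVlt => /orP[/eqP->|r'r].
      rewrite ar_nset// /good; case: ifP => _; rewrite ?den_PSkip ?andbT ?andbF//.
      by rewrite den_PA ar_aset//= vr2 eqxx.
    rewrite ar_nset// -I1//; have rr : r' != r by rewrite neq_ltn r'r.
    have E : ar (den GOOD_row s1) 1 r' = ar s 1 r' by rewrite a1'// s1a//= (negPf rr).
    case: ifP => _; rewrite ?den_PSkip//.
    by rewrite den_PA ar_aset//= vr2 (negPf rr).
move=> M' H; split=> //; apply: mat_ext M' => // r j rN _; by rewrite rN.
Qed.

End Orthogonalization.

Local Notation vT := 12%N.
Local Notation vMx := 13%N.
Local Notation vH := 14%N.
Local Notation vround := 24%N.
Local Notation vkk := 25%N.
Local Notation vt := 26%N.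
Local Notation vz := 27%N.
Local Notation vviol := 28%N.
Local Notation vF := 29%N.
Local Notation vfp := 30%N.
Local Notation vZ := 31%N.
Local Notation vans := 32%N.
Local Notation vmm := 33%N.
Local Notation vC := 34%N.
Local Notation vh := 35%N.
Local Notation vtt := 36%N.

(** * The learning loop as a program *)

Definition PVAL_row : prog :=
  PFor vj vM (incr 8 (RMul (arr 4 (var vj)) (Zat vj))).
Definition PVAL : prog :=
  PFor vr vN (PSeq (ROWPTR vr) (PSeq (PA 8 (NLit 0) r0) (PSeq PVAL_row
    (PSeq (PA 2 (var vr) (arr 8 (NLit 0)))
    (PSeq (mul vxp vD vr) (PSeq (PN vxp (NAdd (var vxp) (var vOFF)))
    (PSeq (PAsk vans (var vh) (var vxp))
      (PA 3 (var vr) (RMul (arr 1 (var vr)) (RNat (var vans))))))))))).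
Definition invH : rexp := RDiv r1 (RNat (var vH)).
Definition TEST_row : prog :=
  PFor vr vN (PIf (RLe (arr 2 (var vr)) (RDiv (RNat (var vz)) (RNat (var vH)))) PSkip
    (incr 8 (RMul (arr 13 (var vr)) (arr 3 (var vr))))).
(** [vviol] encodes the outcome: 0 if no level is violated, otherwise 1 plus the last violated
    level. *)
Definition TEST : prog :=
  PSeq (PN vviol (NLit 0)) (PFor vz vZ (PSeq (PA 8 (NLit 0) r0) (PSeq TEST_row
    (PIf (RLe (arr 8 (NLit 0)) invH) PSkip (PN vviol (NAdd (var vz) (NLit 1))))))).
Definition tau : rexp := RDiv (RNat (NSub (var vviol) (NLit 1))) (RNat (var vH)).
Definition CLEARQ : prog := PFor vj vM (PA 4 (var vj) r0).
Definition CUT : prog :=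
  PFor vr vN (PIf (RLe (arr 2 (var vr)) tau) PSkip
    (PA 1 (var vr) (RSub (arr 1 (var vr)) (arr 3 (var vr))))).
Definition STORE : prog :=
  PSeq (PA 5 (var vfp) (RNat (var vh))) (PSeq (PA 5 (NAdd (var vfp) (NLit 1)) tau)
    (PFor vj vM (PA 5 (NAdd (NAdd (var vfp) (NLit 2)) (var vj)) (arr 4 (var vj))))).
(** A cut shrinks the selected set, so the runs completed for earlier hypotheses no longer concern
    the present selection; the search starts again at hypothesis 0 with [q = 0]. *)
Definition FILTER : prog :=
  PSeq CUT (PSeq STORE (PSeq CLEARQ (PSeq (PN vF (NAdd (var vF) (NLit 1)))
    (PSeq (PN vfp (NAdd (var vfp) (var vmm))) (PSeq (PN vh (NLit 0)) (PN vtt (NLit 0))))))).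
Definition wterm : rexp := RMul (RMul (arr 13 (var vr)) (arr 3 (var vr))) (Zat vj).
Definition DIR : prog :=
  PSeq (PA 8 (NLit 0) r0) (PFor vr vN (PSeq (ROWPTR vr)
    (PIf (RLe (arr 13 (var vr)) r0)
      (PIf (RLe r0 (arr 2 (var vr))) (incr 8 wterm) (incr 8 (RSub r0 wterm)))
      (incr 8 wterm)))).
(** Rounding down without a floor function: from [- (1 + R)] the mesh is added as long as the value
    stays at most the target. [b ^ 19] rounds of mesh [b ^ -18] span a length [b], enough for
    targets of absolute value at most [1 + R]. *)
Definition ROUND : prog :=
  PSeq (PA 9 (NLit 0) (RSub r0 (RAdd r1 (RMem (NLit 0))))) (PFor vx vC
    (PIf (RLe (RAdd (arr 9 (NLit 0)) invH) (arr 8 (NLit 0))) (incr 9 invH) PSkip)).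
Definition UPDATE : prog :=
  PFor vj vM (PSeq DIR (PSeq ROUND (PA 4 (var vj) (RAdd (arr 4 (var vj)) (arr 9 (NLit 0)))))).
Definition ADVANCE : prog :=
  PSeq (PN vtt (NAdd (var vtt) (NLit 1)))
    (PIf (NLe (var vT) (var vtt))
      (PSeq (PN vtt (NLit 0)) (PSeq (PN vh (NAdd (var vh) (NLit 1))) CLEARQ)) PSkip).
Definition STEP : prog :=
  PIf (NLe (NAdd (var vh) (NLit 1)) (var vK))
    (PSeq PVAL (PSeq TEST (PIf (NLe (var vviol) (NLit 0)) (PSeq UPDATE ADVANCE) FILTER))) PSkip.
(** The three loops merely supply [b ^ 19 * k * b ^ 16] steps; the state is in [vh] and [vtt], and
    steps taken after the last hypothesis do nothing. *)
Definition MAIN : prog := PFor vround vMx (PFor vkk vK (PFor vt vT STEP)).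

Section Learning.
Variables (K : realType) (d k : nat) (f : 'I_k -> Rn K d -> bool).
Variables (m N b o : nat) (pt : nat -> Rn K d) (zt : Rn K d -> nat -> K) (w : nat -> K) (R : K).
Variables (st0 : store K).
Local Notation den := (den f).
Implicit Types s st : store K.
Local Notation H := ((b ^ 18)%:R : K).

Definition svars := [:: vD; vK; BASE; vM; vN; vB; vO; vOFF; vT; vMx; vH; vZ; vmm; vC].
Definition same st := [/\ forall v, v \in svars -> nmem st v = nmem st0 v,
  forall c i, c \in [:: 0; 13]%N -> ar st c i = ar st0 c i &
  forall a, (a < nmem st0 BASE)%N -> rmem st a = rmem st0 a].

Hypotheses (C0 : ctx m N b o st0) (D0 : nmem st0 vD = d) (K0 : nmem st0 vK = k)
  (H0 : nmem st0 vH = (b ^ 18)%N) (Z0 : nmem st0 vZ = (b ^ 36)%N) (T0 : nmem st0 vT = (b ^ 16)%N)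
  (mm0 : nmem st0 vmm = m.+2) (Cb0 : nmem st0 vC = (b ^ 19)%N)
  (rp0 : rawpts pt (nmem st0 vOFF) N st0) (M0 : mat m N st0 (fun r j => zt (pt r) j))
  (W0 : forall r, (r < N)%N -> ar st0 13 r = w r) (R0 : rmem st0 0 = R) (B0 : (0 < nmem st0 BASE)%N).

Lemma same_framed p st s : framed p st s -> all (fun v => v \notin nwrites p) svars ->
  0%N \notin awrites p -> 13%N \notin awrites p -> same st -> same s.
Proof.
move=> [fn fa fr] /allP Hv a0 a13 [sn sa sr]; split.
- by move=> v vs; rewrite fn ?sn//; exact: Hv.
- by move=> c i; rewrite !inE => /orP[] /eqP ->; rewrite fa// sa.
- by move=> a aB; rewrite fr ?sr// sn.
Qed.

Lemma same_den p st : all (fun v => v \notin nwrites p) svars -> pure p ->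
  0%N \notin awrites p -> 13%N \notin awrites p -> same st -> same (den p st).
Proof.
move=> Hv pp a0 a13; apply: (same_framed (den_framed f st pp _)) => //.
by apply: (allP Hv).
Qed.

Lemma same_nset st v x : v \notin svars -> same st -> same (nset st v x).
Proof.
move=> vs [sn sa sr]; split=> [u us|c i ci|//]; last first.
  by rewrite ar_nset ?sa//; apply: contraNneq vs => ->.
by rewrite nmem_nset; case: eqP => [uv|_]; [rewrite uv in us; rewrite us in vs|exact: sn].
Qed.

Lemma same_aset st c i v : c \notin [:: 0; 13]%N -> (c < 16)%N -> same st -> same (aset st c i v).
Proof.
move=> c0 c16 [sn sa sr]; split=> [|c' j cj|a aB]; first by [].
  have cc : c' != c by apply: contraNneq c0 => <-.
  rewrite ar_aset// ?(negPf cc)/= ?sa//.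
  by move: cj; rewrite !inE => /orP[] /eqP->.
by rewrite rmem_aset ?sr// sn.
Qed.

Lemma same_ctx st : same st -> ctx m N b o st.
Proof. by case=> sn _ _; case: C0 => ? ? ? ?; split; rewrite sn. Qed.

Lemma same_mat st : same st -> mat m N st (fun r j => zt (pt r) j).
Proof. by case=> _ sa _; apply: mat_ext M0 => // i; rewrite sa. Qed.

Lemma same_R st : same st -> rmem st 0 = R.
Proof. by case=> _ _ sr; rewrite sr. Qed.

Lemma same_ask st r (i : 'I_k) : same st -> (r < N)%N ->
  ask f st i (nmem st0 vOFF + r * d)%N = f i (pt r).
Proof.
move=> [_ _ sr] rN; rewrite /ask valK; congr (f i _); apply: eq_from_tnth => j.
rewrite tnth_mktuple -addnA; have [lt E] := rp0 rN (ltn_ord j).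
by rewrite sr// E -tnth_nth.
Qed.

Definition pv (q : nat -> K) (x : Rn K d) : K := \sum_(j < m) q j * zt x j.

Lemma PVALP st (i : 'I_k) q (sx : nat -> bool) : same st -> nmem st vh = i ->
  (forall j, (j < m)%N -> ar st 4 j = q j) ->
  (forall r, (r < N)%N -> ar st 1 r = (sx r)%:R) ->
  forall r, (r < N)%N -> ar (den PVAL st) 2 r = pv q (pt r) /\
    ar (den PVAL st) 3 r = (f i (pt r) && sx r)%:R.
Proof.
move=> S hE qE sE; have [_ NE _ _] := same_ctx S.
have := for_rule (f := f) (st := st) (v := vr) (w := vN)
  (p := PSeq (ROWPTR vr) (PSeq (PA 8 (NLit 0) r0) (PSeq PVAL_row
    (PSeq (PA 2 (var vr) (arr 8 (NLit 0)))
    (PSeq (mul vxp vD vr) (PSeq (PN vxp (NAdd (var vxp) (var vOFF)))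
    (PSeq (PAsk vans (var vh) (var vxp))
      (PA 3 (var vr) (RMul (arr 1 (var vr)) (RNat (var vans)))))))))))
  (I := fun n s => forall r, (r < n)%N -> ar s 2 r = pv q (pt r) /\
    ar s 3 r = (f i (pt r) && sx r)%:R) isT.
rewrite -/PVAL NE; apply=> // r s rN sr fr IH.
have Ss := same_framed fr isT isT isT S; have [fn fa _] := fr.
rewrite den_PSeq (rowptrE _ (same_ctx Ss)) den_PSeq den_PA /=; set s1 := aset _ 8 _ _.
have S1' : same s1 by apply: same_aset => //; do 2 apply: same_nset => //.
have rp1 : nmem s1 vrp = (r * m)%N by rewrite -sr.
have n1 v : v != vrp -> v != TMP -> nmem s1 v = nmem s v.
  by move=> v1 v2; rewrite /s1 nmem_aset !nmem_nset (negPf v1) (negPf v2).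
have a1 c j : (c < 16)%N -> c != 8%N -> ar s1 c j = ar s c j.
  by move=> cl c8; rewrite /s1 ar_aset// (negPf c8) !ar_nset.
have a8 : ar s1 8 0 = 0 by rewrite /s1 ar_aset.
clearbody s1; rewrite den_PSeq.
have [gn ga gr] := den_framed f (p := PVAL_row) s1 isT isT.
have c8 : ar (den PVAL_row s1) 8 0 = pv q (pt r).
  have [ME _ _ _] := same_ctx S1'.
  apply: (for_sum_0 (g := fun j => q j * zt (pt r) j) ME a8) => //.
  move=> j t jm tj ft; have St := same_framed ft isT isT isT S1'; have [hn ha _] := ft.
  rewrite ar_incr//= reval_arr/= (ha 4%N)// a1// (fa 4%N)// tj qE//.
  have Zr := reval_Zat (same_mat St) _ rN; rewrite Zr ?tj//.
  by rewrite hn.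
have S2 : same (den PVAL_row s1) by apply: same_den.
set s2 := den PVAL_row s1 in gn ga gr c8 S2 *; clearbody s2.
rewrite den_PSeq den_PA den_PSeq den_mul// !den_PSeq den_PN /=.
rewrite !nmem_nset /= !nmem_aset !gn// !n1// sr.
rewrite reval_arr/= c8.
have -> : nmem s vD = d by rewrite fn//; case: S => ->.
have -> : nmem s vOFF = nmem st0 vOFF by rewrite fn//; case: S => -> .
set s3 := nset (nset (nset (aset _ _ _ _) _ _) _ _) _ _.
have S3 : same s3 by rewrite /s3; do 3 apply: same_nset => //; apply: same_aset.
have n3 v : v \notin [:: vrp; TMP; vxp] -> v \notin nwrites PVAL_row -> nmem s3 v = nmem s v.
  move=> + vw; rewrite !inE !negb_or => /and3P[v1 v2 v3].
  by rewrite /s3 !nmem_nset (negPf v2) (negPf v3) nmem_aset gn// n1.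
have x3 : nmem s3 vxp = (nmem st0 vOFF + r * d)%N by rewrite /s3 nmem_nset/=; lia.
have a3 c j : (c < 16)%N -> c != 8%N -> ar s3 c j = if (c == 2%N) && (j == r) then pv q (pt r) else ar s c j.
  by move=> cl c8'; rewrite /s3 !ar_nset// ar_aset//; case: ifP => // _; rewrite ga ?a1// inE.
clearbody s3; rewrite den_PAsk/= x3 n3// (fn vh)// hE (same_ask _ S3)// den_PA /=.
rewrite reval_arr/= !nmem_nset/= n3// sr.
move=> r'; rewrite ltnS ar_nset// (ar_nset _ _ _ _ (v := vr))// !ar_aset//= !ar_nset// !a3//=.
rewrite leq_eqVlt; case: eqP => [->|_] //=; last exact: IH.
by move=> _; split=> //; rewrite fa// sE// -natrM mulnb andbC.
Qed.

Definition excs (q : nat -> K) (a : nat -> bool) (z : nat) : K :=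
  \sum_(r < N) (if a r && (z%:R / H < pv q (pt r)) then w r else 0).

Lemma TESTP st q (a : nat -> bool) : same st ->
  (forall r, (r < N)%N -> ar st 2 r = pv q (pt r) /\ ar st 3 r = (a r)%:R) ->
  (nmem (den TEST st) vviol = 0%N /\ forall z, (z < b ^ 36)%N -> excs q a z <= H^-1) \/
  exists z, [/\ (z < b ^ 36)%N, nmem (den TEST st) vviol = z.+1 & H^-1 < excs q a z].
Proof.
move=> S pa; rewrite /TEST den_PSeq den_PN.
have := for_rule (f := f) (st := nset st vviol 0) (v := vz) (w := vZ)
  (p := PSeq (PA 8 (NLit 0) r0) (PSeq TEST_row
    (PIf (RLe (arr 8 (NLit 0)) invH) PSkip (PN vviol (NAdd (var vz) (NLit 1))))))
  (I := fun n s => (nmem s vviol = 0%N /\ forall z, (z < n)%N -> excs q a z <= H^-1) \/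
  exists z, [/\ (z < n)%N, nmem s vviol = z.+1 & H^-1 < excs q a z]) isT.
have ZE : nmem (nset st vviol 0) vZ = (b ^ 36)%N by rewrite nmem_nset/=; case: S => ->.
rewrite ZE; apply.
  by move=> s [fn _ _] _; left; rewrite fn.
move=> z s zZ sz fr IH.
have Ss : same s by apply: same_framed fr isT isT isT _; apply: same_nset.
have [fn fa _] := fr.
rewrite !den_PSeq den_PA /=; set s1 := aset s 8 _ _.
have S1' : same s1 by apply: same_aset.
have a8 : ar s1 8 0 = 0 by rewrite /s1 ar_aset.
have a1 c j : (c < 16)%N -> c != 8%N -> ar s1 c j = ar st c j.
  by move=> cl c8; rewrite /s1 ar_aset// (negPf c8) fa ?ar_nset//= !inE (negPf c8).
have n1 v : nmem s1 v = nmem s v by [].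
clearbody s1.
have [gn ga gr] := den_framed f (p := TEST_row) s1 isT isT.
have HE : nmem (den TEST_row s1) vH = (b ^ 18)%N by rewrite gn// n1; case: Ss => ->.
have c8 : ar (den TEST_row s1) 8 0 = excs q a z.
  have [_ NE _ _] := same_ctx S1'.
  apply: (for_sum_0 (g := fun r => if a r && (z%:R / H < pv q (pt r)) then w r else 0) NE a8) => //.
  move=> r t rN tr ft; have St := same_framed ft isT isT isT S1'; have [hn ha _] := ft.
  have [p2 p3] := pa r rN; have [sn sa _] := St.
  rewrite den_PIf /= reval_arr/= tr (ha 2%N)// a1// p2 (sn vH)// H0 (hn vz)// n1 sz.
  have -> : (pv q (pt r) <= z%:R / H) = ~~ (z%:R / H < pv q (pt r)) by rewrite -leNgt.
  case: ltP => _ /=; last by rewrite andbF addr0.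
  rewrite ar_incr//= !reval_arr/= tr (sa 13%N)// W0// (ha 3%N)// a1// p3 andbT.
  by case: (a r); rewrite ?mulr1 ?mulr0.
have vio : nmem (den TEST_row s1) vviol = nmem s vviol by rewrite gn.
rewrite den_PIf /= reval_arr/= c8 HE div1r.
have [le|lt] := leP (excs q a z) H^-1.
  rewrite den_PSkip nmem_nset/= vio; case: IH => [[v0 vz]|[z' [z'z v1 v2]]].
    by left; split=> // z'; rewrite ltnS leq_eqVlt => /orP[/eqP->//|]; exact: vz.
  by right; exists z'; split=> //; rewrite ltnS ltnW.
right; exists z; rewrite ltnSn; split=> //.
by rewrite nmem_nset/= den_PN nmem_nset /= gn// n1 sz addn1.
Qed.

Lemma CLEARQP st : same st -> forall j, (j < m)%N -> ar (den CLEARQ st) 4 j = 0.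
Proof.
move=> S; have [ME _ _ _] := same_ctx S.
have := for_rule (f := f) (st := st) (v := vj) (w := vM) (p := PA 4 (var vj) r0)
  (I := fun n s => forall j, (j < n)%N -> ar s 4 j = 0) isT.
rewrite -/CLEARQ ME; apply=> // j s jm sj fr IH j'; rewrite ltnS ar_nset// den_PA ar_aset//= sj.
by rewrite leq_eqVlt; case: eqP => //= _; exact: IH.
Qed.

Lemma CUTP st q (a sx : nat -> bool) z : same st -> nmem st vviol = z.+1 ->
  (forall r, (r < N)%N -> ar st 2 r = pv q (pt r) /\ ar st 3 r = (a r)%:R) ->
  (forall r, (r < N)%N -> ar st 1 r = (sx r)%:R) -> (forall r, a r -> sx r) ->
  forall r, (r < N)%N -> ar (den CUT st) 1 r = (sx r && ~~ (a r && (z%:R / H < pv q (pt r))))%:R.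
Proof.
move=> S vE pa sE asx; have [_ NE _ _] := same_ctx S; have [sn _ _] := S.
have := for_rule (f := f) (st := st) (v := vr) (w := vN) (p := PIf (RLe (arr 2 (var vr)) tau) PSkip
    (PA 1 (var vr) (RSub (arr 1 (var vr)) (arr 3 (var vr)))))
  (I := fun n s => forall r, (r < N)%N -> ar s 1 r = (if (r < n)%N then sx r && ~~ (a r && (z%:R / H < pv q (pt r))) else sx r)%:R) isT.
rewrite -/CUT NE => HH r rN; have := HH _ _ r rN; rewrite rN; apply=> {r rN}.
  by move=> s [_ fa _] _ r rN; rewrite fa// sE.
move=> r s rN sr [fn fa _] IH r' r'N; rewrite ar_nset//.
have [p2 p3] := pa r rN.
rewrite den_PIf /= !reval_arr/= sr (fa 2%N)// p2 !fn// vE (sn vH)// H0 subn1/=.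
have -> : (pv q (pt r) <= z%:R / H) = ~~ (z%:R / H < pv q (pt r)) by rewrite -leNgt.
have E : ar s 1 r = (sx r)%:R by rewrite IH// ltnn.
rewrite ltnS [(r' <= r)%N]leq_eqVlt; case: ltP => lt /=.
  rewrite den_PA ar_aset//= !reval_arr/= sr E fa// p3; case: eqP => [->|_] /=; last by rewrite IH.
  rewrite lt andbT; have := asx r; case: (a r); case: (sx r) => //= H';
    rewrite ?subrr ?subr0//; by have := H' isT.
rewrite den_PSkip IH//; case: eqP => [->|] //=.
by rewrite ltnn ltNge lt andbF andbT.
Qed.

Lemma STOREP st (i : nat) q z : same st -> nmem st vviol = z.+1 -> nmem st vh = i ->
  (forall j, (j < m)%N -> ar st 4 j = q j) ->
  [/\ ar (den STORE st) 5 (nmem st vfp) = i%:R, ar (den STORE st) 5 (nmem st vfp).+1 = z%:R / H,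
   (forall j, (j < m)%N -> ar (den STORE st) 5 ((nmem st vfp).+2 + j) = q j) &
   forall a, (a < nmem st vfp)%N -> ar (den STORE st) 5 a = ar st 5 a].
Proof.
move=> S vE hE qE; rewrite /STORE !den_PSeq !den_PA /=.
rewrite !nmem_aset hE vE subn1/=; have [sn _ _] := S; rewrite (sn vH)// H0 addn1.
set p := nmem st vfp; set s1 := aset _ _ _ _.
have S1' : same s1 by do 2 apply: same_aset => //.
have [ME _ _ _] := same_ctx S1'.
have := for_rule (f := f) (st := s1) (v := vj) (w := vM)
  (p := PA 5 (NAdd (NAdd (var vfp) (NLit 2)) (var vj)) (arr 4 (var vj)))
  (I := fun n s => [/\ forall a, (a < p.+2)%N -> ar s 5 a = ar s1 5 a &
    forall j, (j < n)%N -> ar s 5 (p.+2 + j) = q j]) isT.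
rewrite ME => /(_ _ _)-[].
- by move=> s [_ fa _] _; split=> // a ap; rewrite fa.
- move=> j s jm sj [fn fa _] [I1 I2].
  have pE : nmem s vfp = p by rewrite fn.
  rewrite den_PA /= pE sj addn2 reval_arr/= sj; split=> a aH; rewrite ar_nset// ar_aset//=.
    by rewrite ifF ?I1//; lia.
  rewrite fa// /s1 !ar_aset//= eqn_add2l.
  by move: aH; rewrite ltnS leq_eqVlt; case: eqP => [->|_] /=; [rewrite qE|exact: I2].
move=> I1 I2; split.
- by rewrite I1// /s1 !ar_aset//= eqxx ifF//; lia.
- by rewrite I1// /s1 !ar_aset//= eqxx.
- exact: I2.
- by move=> a ap; rewrite I1 1?ltnW ?ltnS 1?ltnW// /s1 !ar_aset//= !ifF//; lia.
Qed.

Definition dirn (q : nat -> K) (a : nat -> bool) (j : nat) : K :=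
  \sum_(r < N) (if a r then w r *
     ((if (w r <= 0) && (pv q (pt r) < 0) then -1 else 1) * zt (pt r) j) else 0).

Lemma DIRP st q (a : nat -> bool) : same st -> (nmem st vj < m)%N ->
  (forall r, (r < N)%N -> ar st 2 r = pv q (pt r) /\ ar st 3 r = (a r)%:R) ->
  ar (den DIR st) 8 0 = dirn q a (nmem st vj).
Proof.
move=> S jm pa; rewrite /DIR den_PSeq den_PA /=; set s1 := aset _ _ _ _.
have S1' : same s1 by apply: same_aset.
have a8 : ar s1 8 0 = 0 by rewrite /s1 ar_aset.
have [_ NE _ _] := same_ctx S1'.
apply: (for_sum_0 (g := fun r => if a r then w r *
     ((if (w r <= 0) && (pv q (pt r) < 0) then -1 else 1) * zt (pt r) (nmem st vj)) else 0) NE a8) => //.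
move=> r s rN sr fr; have Ss := same_framed fr isT isT isT S1'; have [fn fa _] := fr.
rewrite den_PSeq (rowptrE _ (same_ctx Ss)) sr; set s2 := nset _ _ _.
have a2 c j : ar s2 c j = ar s c j by rewrite /s2 !ar_nset.
have M2 : mat m N s2 (fun r j => zt (pt r) j).
  by apply: mat_ext (same_mat Ss) => // i; rewrite a2.
have rp2 : nmem s2 vrp = (r * m)%N by [].
have r2 : nmem s2 vr = r by [].
have j2 : nmem s2 vj = nmem st vj by rewrite /s2 !nmem_nset/= fn.
clearbody s2.
have wE : reval s2 (arr 13 (var vr)) = w r.
  by rewrite reval_arr/= a2 r2; case: Ss => _ sa _; rewrite sa// W0.
have [p2 p3] := pa r rN.
have pE : reval s2 (arr 2 (var vr)) = pv q (pt r) by rewrite reval_arr/= a2 r2 fa// ar_aset.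
have aE : reval s2 (arr 3 (var vr)) = (a r)%:R by rewrite reval_arr/= a2 r2 fa// ar_aset.
have tE : reval s2 wterm = w r * (a r)%:R * zt (pt r) (nmem st vj).
  by rewrite /wterm /= wE aE (reval_Zat M2 _ rN rp2) j2.
have tE' : reval s2 (RSub r0 wterm) = - (w r * (a r)%:R * zt (pt r) (nmem st vj)) by rewrite -tE -sub0r.
rewrite !den_PIf /= wE pE; case: (leP (w r) 0) => wr /=; last first.
  rewrite ar_incr// tE/= a2; case: (a r); last by rewrite mulr0 mul0r.
  by rewrite mulr1 mul1r.
case: leP => p0; rewrite ar_incr// ?tE ?tE'/= a2; case: (a r);
  by rewrite ?mulr0 ?mul0r ?oppr0 ?mulr1 ?mul1r// mulN1r mulrN.
Qed.

Hypotheses (b2 : (2 <= b)%N) (Rb2 : 2 * (1 + R) <= b%:R) (Rgt1 : 1 < R).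

Lemma Hgt0 : 0 < H. Proof. by rewrite ltr0n expn_gt0 (leq_trans _ b2). Qed.

Lemma ROUNDP st u : same st -> ar st 8 0 = u -> `|u| <= 1 + R ->
  exists2 c, (c <= b ^ 19)%N & let v := c%:R / H - (1 + R) in
    ar (den ROUND st) 9 0 = v /\ rounded b u v.
Proof.
move=> S uE uR; rewrite /ROUND den_PSeq den_PA /= (same_R S) sub0r; set s1 := aset _ _ _ _.
have S1' : same s1 by apply: same_aset.
have CE : nmem s1 vC = (b ^ 19)%N by case: S1' => ->.
have := for_rule (f := f) (st := s1) (v := vx) (w := vC)
  (p := PIf (RLe (RAdd (arr 9 (NLit 0)) invH) (arr 8 (NLit 0))) (incr 9 invH) PSkip)
  (I := fun n s => exists c, [/\ (c <= n)%N, ar s 9 0 = c%:R / H - (1 + R),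
     c%:R / H - (1 + R) <= u & (c == n) || (u < c%:R / H - (1 + R) + H^-1)]) isT.
rewrite CE => /(_ _ _)-[].
- move=> s [_ fa _] _; exists 0%N; split=> //.
    by rewrite fa// /s1 ar_aset//= mul0r sub0r.
  by move: uR; rewrite mul0r sub0r ler_norml => /andP[].
- move=> n s nC sn fr [c [cn v9 cu cx]].
  have Ss : same s by apply: same_framed fr isT isT isT _.
  have HE : nmem s vH = (b ^ 18)%N by case: Ss => ->.
  have u8 : ar s 8 0 = u by case: fr => _ fa _; rewrite fa// /s1 ar_aset.
  rewrite den_PIf /= !reval_arr/= v9 u8 HE div1r.
  case: leP => lt; last first.
    by exists c; split=> //; rewrite ?ar_nset// ?lt ?orbT// leqW.
  move: cx; rewrite ltNge lt orbF => /eqP cE.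
  have E : n.+1%:R / H - (1 + R) = n%:R / H - (1 + R) + H^-1 by rewrite -natr1 mulrDl div1r addrAC.
  exists n.+1; split=> //; rewrite ?E -?cE ?eqxx//.
  by rewrite ar_nset// ar_incr//= v9 HE div1r.
move=> c [cC v9 cu cx]; exists c => //; split=> //.
apply/andP; split=> //.
(* If every round was used, the value is [b - (1 + R)], which is already at least [1 + R]. *)
case/orP: cx => [/eqP cE|]; last by lra.
have Hp := Hgt0; have -> : c%:R / H = b%:R by rewrite cE (expnS b 18) natrM mulfK// gt_eqF.
have : 0 < H^-1 by rewrite invr_gt0.
move: Rb2 uR; rewrite ler_norml => + /andP[_]; lra.
Qed.

Lemma UPDATEP st q (a : nat -> bool) : same st ->
  (forall r, (r < N)%N -> ar st 2 r = pv q (pt r) /\ ar st 3 r = (a r)%:R) ->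
  (forall j, (j < m)%N -> ar st 4 j = q j) ->
  (forall j, (j < m)%N -> `|dirn q a j| <= 1 + R) ->
  forall j, (j < m)%N -> exists2 c, (c <= b ^ 19)%N & let v := c%:R / H - (1 + R) in
    ar (den UPDATE st) 4 j = q j + v /\ rounded b (dirn q a j) v.
Proof.
move=> S pa qE dR; have [ME _ _ _] := same_ctx S.
have := for_rule (f := f) (st := st) (v := vj) (w := vM)
  (p := PSeq DIR (PSeq ROUND (PA 4 (var vj) (RAdd (arr 4 (var vj)) (arr 9 (NLit 0))))))
  (I := fun n s => (forall j, (n <= j)%N -> ar s 4 j = ar st 4 j) /\
    forall j, (j < n)%N -> exists2 c, (c <= b ^ 19)%N & let v := c%:R / H - (1 + R) in
    ar s 4 j = q j + v /\ rounded b (dirn q a j) v) isT.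
rewrite -/UPDATE ME => /(_ _ _)-[] //.
- by move=> s [_ fa _] _; split=> // j _; rewrite fa.
- move=> j s jm sj fr [I1 I2].
  have Ss := same_framed fr isT isT isT S; have [fn fa _] := fr.
  rewrite !den_PSeq.
  have pas r : (r < N)%N -> ar s 2 r = pv q (pt r) /\ ar s 3 r = (a r)%:R.
    by move=> rN; rewrite !fa//; exact: pa.
  have jm' : (nmem s vj < m)%N by rewrite sj.
  have dE := DIRP Ss jm' pas; rewrite sj in dE.
  have Sd : same (den DIR s) by apply: same_den.
  have [c cC [c9 cr]] := ROUNDP Sd dE (dR j jm).
  have [gn ga _] := den_framed f (p := DIR) s isT isT.
  have [hn ha _] := den_framed f (p := ROUND) (den DIR s) isT isT.
  rewrite den_PA /= !reval_arr/= c9 !hn// !gn// sj ha// ga// (I1 j (leqnn _)) qE//.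
  split=> j' jj; rewrite ar_nset// ar_aset//=.
    by rewrite ifF ?ha ?ga ?I1 ?(ltnW jj)//; lia.
  case: eqP => [->|jn]; first by exists c.
  by rewrite ha// ga//; apply: I2; lia.
Qed.

Definition filt := ('I_k * nat * (nat -> K))%type.
Definition cuts (c : filt) (x : Rn K d) : bool := f c.1.1 x && (c.1.2%:R / H < pv c.2 x).
Variable g0 : Rn K d -> bool.
Definition sel (F : seq filt) x := g0 x && all (fun c => ~~ cuts c x) F.
(** Each of [t] updates adds [c / H - (1 + R)] with an integer [c <= b ^ 19], so the integers [zz j]
    determine the iterate exactly. *)
Definition coded (q : nat -> K) t := exists zz : nat -> nat, forall j, (j < m)%N ->
  (zz j <= t * b ^ 19)%N /\ q j = (zz j)%:R / H - t%:R * (1 + R).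
Definition fcoded (c : filt) :=
  (c.1.2 < b ^ 36)%N /\ exists2 t, (t <= b ^ 16)%N & coded c.2 t.
Definition stored st (F : seq filt) := forall e c, (c < size F)%N ->
  [/\ ar st 5 (c * m.+2) = (nth e F c).1.1%:R,
     ar st 5 (c * m.+2).+1 = (nth e F c).1.2%:R / H &
     forall j, (j < m)%N -> ar st 5 ((c * m.+2).+2 + j) = (nth e F c).2 j].
Definition path (F : seq filt) (i : 'I_k) (q : nat -> nat -> K) t :=
  upath m b (fun r : 'I_N => w r) (fun r => f i (pt r) && sel F (pt r)) (fun r => zt (pt r)) q t.

(** The invariant after [n] steps, with cuts [F], current hypothesis [h] and round [t]. [run_gain]
    limits the number of cuts, [run_done] records full paths for the finished hypotheses relative to
    the present selection, and [run_n] measures progress: at most [k * b ^ 16] steps for each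
    cut. *)
Record run n st (F : seq filt) (h t : nat) : Prop := Run {
  run_F : nmem st vF = size F;
  run_fp : nmem st vfp = (size F * m.+2)%N;
  run_st : stored st F;
  run_cd : forall c, List.In c F -> fcoded c;
  run_s : forall r, (r < N)%N -> ar st 1 r = (sel F (pt r))%:R;
  run_gain : (size F)%:R / H <= \sum_(r < N) w r * ((g0 (pt r))%:R - (sel F (pt r))%:R);
  run_h : nmem st vh = h;
  run_t : nmem st vtt = t;
  run_hk : (h <= k)%N;
  run_tT : (t < b ^ 16)%N;
  run_done : forall i : 'I_k, (i < h)%N -> exists q, path F i q (b ^ 16);
  run_cur : forall i : 'I_k, i = h :> nat -> exists q,
    [/\ path F i q t, forall j, (j < m)%N -> ar st 4 j = q t j & coded (q t) t];
  run_n : (n <= (size F * k + h) * b ^ 16 + t)%N \/ h = k }.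

Lemma run_frame n st st' F h t : run n st F h t ->
  (forall v, v \in [:: vF; vfp; vh; vtt] -> nmem st' v = nmem st v) ->
  (forall c i, c \in [:: 1; 4; 5]%N -> ar st' c i = ar st c i) -> run n st' F h t.
Proof.
case=> hF hfp hst hcd hs hg hh ht hk htT hdone hcur hn En Ea; split=> //.
- by rewrite En.
- by rewrite En.
- by move=> e c cF; have [A1 A2 A3] := hst e c cF; split=> [||j jm]; rewrite Ea//; exact: A3.
- by move=> r rN; rewrite Ea// hs.
- by rewrite En.
- by rewrite En.
- move=> i ih; have [q [Q1 Q2 Q3]] := hcur i ih; exists q; split=> // j jm.
  by rewrite Ea// Q2.
Qed.

Hypotheses (wpos : \sum_(r < N | 0 < w r) w r = 1) (wneg : \sum_(r < N | w r <= 0) w r = - R)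
  (ztb : forall r j, (r < N)%N -> g0 (pt r) -> (j < m)%N -> `|zt (pt r) j| <= 1).

Lemma dirn_le q F (i : 'I_k) j : (j < m)%N ->
  `|dirn q (fun r => f i (pt r) && sel F (pt r)) j| <= 1 + R.
Proof.
move=> jm; apply: (@upd_le _ 'I_N m R (fun r : 'I_N => w r)
  (fun r => f i (pt r) && sel F (pt r)) (fun r => zt (pt r)) wpos wneg _ q j jm).
by move=> r j' /and3P[_ gr _] j'm; exact: ztb.
Qed.

(** The gain of all cuts together is at most the total positive weight, which is 1. *)
Lemma run_size n st F h t : run n st F h t -> (size F <= b ^ 18)%N.
Proof.
case=> _ _ _ _ _ hg _ _ _ _ _ _ _; have Hp := Hgt0.
rewrite -(ler_nat K) -[leRHS]mul1r -ler_pdivrMr//; apply: (le_trans hg).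
apply: (@le_trans _ _ (\sum_(r < N | 0 < w r) w r)); last by rewrite wpos.
rewrite [leRHS]big_mkcond/=; apply: ler_sum => r _; rewrite /sel.
case: ltP => wr; case: (g0 _) => /=; case: (all (fun c => ~~ cuts c (pt r)) F);
  by rewrite ?subrr ?subr0 ?mulr0 ?mulr1 ?(ltW wr).
Qed.

Lemma sel_rcons F c x : sel (rcons F c) x = sel F x && ~~ cuts c x.
Proof. by rewrite /sel all_rcons andbCA andbC. Qed.

(** The excess above [1 / H] of the violated level pays for one more cut in [run_gain]; the fewer
    than [k * b ^ 16] updates since the previous cut are covered by the new term in [run_n]. *)
Lemma STEP_filter n st F h t (i : 'I_k) q z : same st -> i = h :> nat ->
  run n st F h t -> nmem st vviol = z.+1 -> (z < b ^ 36)%N -> coded q t ->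
  (forall j, (j < m)%N -> ar st 4 j = q j) ->
  (forall r, (r < N)%N -> ar st 2 r = pv q (pt r) /\ ar st 3 r = (f i (pt r) && sel F (pt r))%:R) ->
  H^-1 < excs q (fun r => f i (pt r) && sel F (pt r)) z ->
  run n.+1 (den FILTER st) (rcons F (i, z, q)) 0 0.
Proof.
move=> S ih [hF hfp hst hcd hs hg hh ht hk htT hdone hcur hn] vE zZ qc qE pa viol.
have CE := CUTP S vE pa hs (fun r => _ : f i (pt r) && sel F (pt r) -> sel F (pt r)).
have {}CE := CE (fun r => ltac:(by case/andP)).
have Sc : same (den CUT st) by apply: same_den.
have [cn ca _] := den_framed f (p := CUT) st isT isT.
set s1 := den CUT st in CE Sc cn ca.
have q1 j : (j < m)%N -> ar s1 4 j = q j by move=> jm; rewrite ca// qE.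
have v1 : nmem s1 vviol = z.+1 by rewrite cn.
have h1 : nmem s1 vh = i by rewrite cn// hh ih.
have [E1 E2 E3 E4] := STOREP Sc v1 h1 q1.
have [sn sa _] := den_framed f (p := STORE) s1 isT isT.
have Ss : same (den STORE s1) by apply: same_den.
set s2 := den STORE s1 in E1 E2 E3 E4 sn sa Ss.
have Q0 := CLEARQP Ss.
have [zn za _] := den_framed f (p := CLEARQ) s2 isT isT.
set s3 := den CLEARQ s2 in Q0 zn za.
have sz := run_size (Run hF hfp hst hcd hs hg hh ht hk htT hdone hcur hn).
have mmE : nmem s3 vmm = m.+2 by rewrite zn//; case: Ss => -> .
rewrite /FILTER !den_PSeq -/s1 -/s2 -/s3 !den_PN /=.
set s4 := nset _ vtt 0; have a4 c j : ar s4 c j = ar s3 c j by rewrite /s4 !ar_nset.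
have fp1 : nmem s1 vfp = (size F * m.+2)%N by rewrite cn.
have k0 : (0 < k)%N by case: (i) => /= ? /(leq_ltn_trans (leq0n _)).
have T0' : (0 < b ^ 16)%N by rewrite expn_gt0 (leq_trans _ b2).
split=> //.
- by rewrite /s4 !nmem_nset/= zn// sn// cn// hF size_rcons addn1.
- by rewrite /s4 !nmem_nset/= mmE zn// sn// fp1 size_rcons; lia.
- move=> e c; rewrite size_rcons ltnS nth_rcons !a4 !za// leq_eqVlt => cE.
  have A5 j : (j < size F * m.+2)%N -> ar s2 5 j = ar st 5 j by move=> jl; rewrite E4 ?fp1// ca.
  case: ltngtP cE => // [cF _|-> _] /=.
    have [A1 A2 A3] := hst e c cF.
    have lt : (c.+1 * m.+2 <= size F * m.+2)%N by rewrite leq_mul2r cF orbT.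
    rewrite !A5; try by lia.
    by split=> // j jm; rewrite a4 za// A5; [exact: A3|lia].
  by rewrite -fp1; split=> // j jm; rewrite a4 za// E3.
- move=> c; rewrite -cats1 => /List.in_app_iff[/hcd//|[<-|//]].
  by split=> //; exists t => //; exact: ltnW.
- move=> r rN; rewrite a4 za// sa// CE// sel_rcons /cuts/=; congr (nat_of_bool _)%:R.
  by case: (sel F _); rewrite /= ?andbF ?andbT.
- rewrite size_rcons -natr1 mulrDl div1r; apply: (le_trans (lerD hg (ltW viol))).
  rewrite -big_split/=; apply: ler_sum => r _; rewrite sel_rcons /cuts/=.
  case: (sel F _); rewrite ?andbF ?andbT ?addr0//=.
  case: (f i _ && _) => /=; last by rewrite addr0.
  by rewrite subr0 mulrBr mulr1 subrK.
- by move=> i' i'0; exists (fun _ _ => 0); split=> [|j jm|];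
    [split|rewrite a4 Q0|exists (fun=> 0%N) => j jm; rewrite !mul0n mul0r mul0r subrr].
- case: hn => [hn|hn]; last first.
    by have := ltn_ord i; rewrite ih hn ltnn.
  left; rewrite size_rcons addn0 addn0.
  have hk' : (h.+1 <= k)%N by rewrite -ih.
  apply: (leq_ltn_trans hn).
  have : (h.+1 * b ^ 16 <= k * b ^ 16)%N by rewrite leq_mul2r hk' orbT.
  by rewrite !mulSn !mulnDl; lia.
Qed.

(** With no violated level the present iterate is quiet, so the path extends by the rounded update;
    at round [b ^ 16] the hypothesis counts as finished. *)
Lemma STEP_update n st F h t (i : 'I_k) q : same st -> i = h :> nat ->
  run n st F h t -> path F i q t -> coded (q t) t ->
  (forall j, (j < m)%N -> ar st 4 j = q t j) ->
  (forall r, (r < N)%N -> ar st 2 r = pv (q t) (pt r) /\ ar st 3 r = (f i (pt r) && sel F (pt r))%:R) ->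
  (forall z, (z < b ^ 36)%N -> excs (q t) (fun r => f i (pt r) && sel F (pt r)) z <= H^-1) ->
  exists h' t', run n.+1 (den (PSeq UPDATE ADVANCE) st) F h' t'.
Proof.
move=> S ih [hF hfp hst hcd hs hg hh ht hk htT hdone hcur hn] pq qc qE pa quiet.
have UE := UPDATEP S pa qE (fun j => @dirn_le (q t) F i j).
have Su : same (den UPDATE st) by apply: same_den.
have [un ua _] := den_framed f (p := UPDATE) st isT isT.
set s1 := den UPDATE st in UE Su un ua.
pose q' (u : nat) (j : nat) := if u == t.+1 then (if (j < m)%N then ar s1 4 j else 0) else q u j.
have q'E u : (u <= t)%N -> q' u = q u.
  by move=> ut; apply/funext => j; rewrite /q' ifF//; lia.
have pq' : path F i q' t.+1.
  split=> [j|s]; first by rewrite q'E//; case: pq.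
  rewrite ltnS leq_eqVlt => /orP[/eqP->|st']; last first.
    rewrite !q'E//; last exact: ltnW.
    by case: pq => _; apply.
  rewrite q'E//; split=> [z zZ|j jm]; first exact: quiet.
  rewrite /q' eqxx jm; have [c _ [-> cr]] := UE j jm.
  by rewrite addrC addKr.
have cq' : coded (q' t.+1) t.+1.
  have [zz zzE] := qc.
  have : forall j, exists c, (j < m)%N -> (c <= b ^ 19)%N /\ ar s1 4 j = q t j + (c%:R / H - (1 + R)).
    move=> j; have [jm|] := boolP (j < m)%N; last by exists 0%N.
    by have [c c1 [c2 _]] := UE j jm; exists c.
  move=> /choice[cc ccE]; exists (fun j => (zz j + cc j)%N) => j jm.
  have [z1 z2] := zzE j jm; have [c1 c2] := ccE j jm.
  split; first by rewrite mulSn addnC leq_add.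
  by rewrite /q' eqxx jm c2 z2 natrD -natr1 !mulrDl mul1r; lra.
have q1 j : (j < m)%N -> ar s1 4 j = q' t.+1 j by rewrite /q' eqxx => ->.
rewrite den_PSeq -/s1 /ADVANCE den_PSeq den_PN /= un// ht; set s2 := nset _ _ _.
have S2 : same s2 by apply: same_nset.
have a2 c j : ar s2 c j = ar s1 c j by rewrite /s2 !ar_nset.
have n2 v : v \notin [:: vtt; vr; vj; vx; vrp; TMP] -> nmem s2 v = nmem st v.
  rewrite /s2 nmem_nset !inE !negb_or => /and5P[/negPf-> v1 v2 v3 /andP[v4 v5]].
  by rewrite un// /= !inE !negb_or ?v1 ?v2 ?v3 ?v4 ?v5.
have T2 : nmem s2 vT = (b ^ 16)%N by case: S2 => ->.
have t2 : nmem s2 vtt = t.+1 by rewrite /s2 nmem_nset/= addn1.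
have ih' : (h.+1 <= k)%N by rewrite -ih.
have done' (i' : 'I_k) : i' = h :> nat -> i' = i by move=> E; apply: val_inj; rewrite /= E ih.
clearbody s2; rewrite den_PIf /= T2 t2; case: leqP => tT; last first.
  exists h, t.+1; rewrite den_PSkip; split=> //; rewrite ?n2//.
  - move=> e c cF; have [A1 A2 A3] := hst e c cF.
    by split=> [||j jm]; rewrite a2 ua//; exact: A3.
  - by move=> r rN; rewrite a2 ua// hs.
  - by move=> i' /done' ->; exists q'; split=> // j jm; rewrite a2 q1.
  - by case: hn => [hn|]; [left; rewrite addnS ltnS|right].
have tE : t.+1 = (b ^ 16)%N by apply/eqP; rewrite eqn_leq htT.
exists h.+1, 0%N; rewrite !den_PSeq !den_PN /=; set s3 := nset _ _ _.
have S3 : same s3 by rewrite /s3; do 2 apply: same_nset => //.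
have [zn za _] := den_framed f (p := CLEARQ) s3 isT isT.
have Q0 := CLEARQP S3.
have n3 v : v \notin [:: vtt; vh; vr; vj; vx; vrp; TMP] -> nmem s3 v = nmem st v.
  move=> vn; rewrite /s3 !nmem_nset; move: vn; rewrite in_cons negb_or => /andP[v1].
  by rewrite in_cons negb_or => /andP[v2 v3]; rewrite (negPf v1) (negPf v2) n2// in_cons negb_or v1.
have a3 c j : ar s3 c j = ar s1 c j by rewrite /s3 !ar_nset// a2.
have h3 : nmem s3 vh = h.+1 by rewrite /s3 nmem_nset/= nmem_nset/= n2// hh addn1.
have t3 : nmem s3 vtt = 0%N by [].
clearbody s3; split=> //; rewrite ?zn ?h3 ?t3 ?(n3 vF) ?(n3 vfp)//.
- move=> e c cF; have [A1 A2 A3] := hst e c cF.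
  by split=> [||j jm]; rewrite za// a3 ua//; exact: A3.
- by move=> r rN; rewrite za// a3 ua// hs.
- by rewrite expn_gt0 (leq_trans _ b2).
- move=> i'; rewrite ltnS leq_eqVlt => /orP[/eqP/done' ->|]; last exact: hdone.
  by exists q'; rewrite -tE.
- by move=> i' _; exists (fun _ _ => 0); split=> [|j jm|];
    [split|rewrite Q0|exists (fun=> 0%N) => j jm; rewrite !mul0n mul0r mul0r subrr].
- case: hn => [hn|hn]; last by right; move: ih'; rewrite hn ltnn.
  by left; rewrite addn0 addnS mulSn -tE; lia.
Qed.

Definition Inv n st := same st /\ exists F h t, run n st F h t.

Lemma STEPP n st : Inv n st -> Inv n.+1 (den STEP st).
Proof.
move=> [S [F [h [t rn]]]].
split; first exact: same_den.
have [hF hfp hst hcd hs hg hh ht hk htT hdone hcur hn] := rn.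
have kE : nmem st vK = k by case: S => ->.
rewrite /STEP den_PIf /= hh kE addn1; case: ltnP => hk'; last first.
  exists F, h, t; rewrite den_PSkip; split=> //.
  by right; apply/eqP; rewrite eqn_leq hk.
pose i := Ordinal hk'; have ih : i = h :> nat by [].
have [q [pq qE qc]] := hcur i ih.
have pa := PVALP S hh (i := i) qE hs.
have Sp : same (den PVAL st) by apply: same_den.
have [pn pa' _] := den_framed f (p := PVAL) st isT isT.
rewrite den_PSeq; set s1 := den PVAL st in pa Sp pn pa' *.
have te := TESTP Sp pa.
have St : same (den TEST s1) by apply: same_den.
have [tn ta _] := den_framed f (p := TEST) s1 isT isT.
rewrite den_PSeq; set s2 := den TEST s1 in te St tn ta *.
have rn2 : run n s2 F h t.
  apply: (run_frame rn) => [v|c j]; rewrite !inE.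
    by move=> /or4P[] /eqP->; rewrite tn// pn.
  by move=> /or3P[] /eqP->; rewrite ta// pa'.
have pa2 r : (r < N)%N -> ar s2 2 r = pv (q t) (pt r) /\ ar s2 3 r = (f i (pt r) && sel F (pt r))%:R.
  by move=> rN; rewrite !ta//; exact: pa.
have qE2 j : (j < m)%N -> ar s2 4 j = q t j by move=> jm; rewrite ta// pa'// qE.
rewrite den_PIf /=; case: te => [[-> quiet]|[z [zZ vE viol]]].
  by have [h' [t' H']] := STEP_update St ih rn2 pq qc qE2 pa2 quiet; exists F, h', t'.
rewrite vE leqn0 /=.
by exists (rcons F (i, z, q t)), 0%N, 0%N; apply: (STEP_filter St ih rn2 vE zZ qc qE2 pa2 viol).
Qed.

Lemma Inv_nset n st v x : v \notin [:: vF; vfp; vh; vtt] -> v \notin svars -> Inv n st ->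
  Inv n (nset st v x).
Proof.
move=> v1 v2 [S [F [h [t rn]]]]; split; first exact: same_nset.
have vB : v != BASE by apply: contraNneq v2 => ->.
exists F, h, t; apply: (run_frame rn) => [u u1|c i _]; last by rewrite ar_nset.
by rewrite nmem_nset ifN//; apply: contraNneq v1 => <-.
Qed.

Lemma Inv_for n v vw p c st : Inv n st -> v \notin [:: vF; vfp; vh; vtt] -> v \notin svars ->
  v \notin nwrites p -> (forall n s, Inv n s -> Inv (n + c) (den p s)) ->
  Inv (n + nmem st vw * c) (den (PFor v vw p) st).
Proof.
move=> I0 v1 v2 vp IS.
have : forall N, Inv (n + N * c) (iter N (fun s => nset (den p s) v (nmem (den p s) v).+1) (nset st v 0)).
  elim=> [|N' IH] /=; first by rewrite mul0n addn0; exact: Inv_nset.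
  by rewrite mulSn (addnC c) addnA; apply: Inv_nset => //; exact: IS.
exact.
Qed.

Lemma MAINP st : (0 < k)%N -> nmem st0 vMx = (b ^ 19)%N -> Inv 0 st -> exists F : seq filt,
  [/\ same (den MAIN st), nmem (den MAIN st) vF = size F /\ nmem (den MAIN st) vfp = (size F * m.+2)%N, stored (den MAIN st) F,
    (forall c, List.In c F -> fcoded c) /\ (size F <= b ^ 18)%N &
    (size F)%:R / H <= \sum_(r < N) w r * ((g0 (pt r))%:R - (sel F (pt r))%:R) /\
    forall i, exists q, path F i q (b ^ 16)].
Proof.
move=> k0 MxE I0.
have IT n s : Inv n s -> Inv (n + b ^ 16) (den (PFor vt vT STEP) s).
  move=> I; have TE : nmem s vT = (b ^ 16)%N by case: I => [[-> ]].
  have := @Inv_for n vt vT STEP 1 s I isT isT isT; rewrite TE muln1; apply=> n' s' I'.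
  by rewrite addn1; exact: STEPP.
have IK n s : Inv n s -> Inv (n + k * b ^ 16) (den (PFor vkk vK (PFor vt vT STEP)) s).
  move=> I; have KE : nmem s vK = k by case: I => [[-> ]].
  by have := @Inv_for n vkk vK (PFor vt vT STEP) (b ^ 16) s I isT isT isT IT; rewrite KE.
have : Inv (0 + b ^ 19 * (k * b ^ 16)) (den MAIN st).
  have ME : nmem st vMx = (b ^ 19)%N by case: I0 => [[-> ]].
  by have := @Inv_for 0 vround vMx (PFor vkk vK (PFor vt vT STEP)) (k * b ^ 16) st I0 isT isT isT IK; rewrite ME.
rewrite add0n => -[S [F [h [t rn]]]]; exists F.
have sz := run_size rn.
case: rn => hF hfp hst hcd hs hg hh ht hk htT hdone hcur hn.
(* Were a hypothesis unfinished, fewer than [(b ^ 18 * k + k) * b ^ 16] steps would have been taken,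
   and this is at most the number supplied because [b ^ 18 + 1 <= b ^ 19]. *)
have hE : h = k.
  case: hn => // hn; apply/eqP; rewrite eqn_leq hk leqNgt; apply/negP => hk'.
  have B1 : ((size F * k + h.+1) * b ^ 16 <= (b ^ 18 * k + k) * b ^ 16)%N.
    by rewrite leq_mul2r; apply/orP; right; rewrite leq_add// leq_mul2r sz orbT.
  have B2' : ((b ^ 18 * k + k) * b ^ 16 <= b ^ 19 * (k * b ^ 16))%N.
    rewrite mulnA leq_mul2r; apply/orP; right.
    rewrite (_ : b ^ 19 = b * b ^ 18)%N ?expnS// -mulSnr leq_mul2r; apply/orP; right.
    have : (0 < b ^ 18)%N by rewrite expn_gt0 (leq_trans _ b2).
    have : (2 * b ^ 18 <= b * b ^ 18)%N by rewrite leq_mul2r b2 orbT.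
    lia.
  by move: hn B1 B2' htT; rewrite addnS mulSn; lia.
split=> //; split=> // i; apply: hdone; by rewrite hE.
Qed.

End Learning.

Local Notation vn := 3%N.
Local Notation vn' := 4%N.
Local Notation ve := 37%N.
Local Notation vd1 := 38%N.
Local Notation vpw := 39%N.
Local Notation vbd := 40%N.

(** * Computing sizes, powers and weights *)

Definition POW (p a e : nat) : prog :=
  PSeq (PN p (NLit 1)) (PFor vx e (PSeq (mul vpw a p) (PN p (var vpw)))).
(** For [d = 0] the quantity [(d + 1) ^ l] is 1 and cannot pay for a loop of length [l]. All
    polynomials are then constant, so the degree may be lowered to 0. *)
Definition FIXL : prog := PIf (NLe (var vD) (NLit 0)) (PN vL (NLit 0)) PSkip.
Definition SIZES : prog :=
  PSeq (PN vd1 (NAdd (var vD) (NLit 1))) (PSeq (POW vM vd1 vL)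
    (PSeq (PN vmm (NAdd (var vM) (NLit 2))) (PSeq (PN vN (NAdd (var vn) (var vn')))
    (PSeq (mul vxp vN vD) (mul vbd vN vmm))))).
(** The zone below [BASE] holds the input, [3 + N * d] reals, and later the description written over
    it: at most [N * d] reals for points, [N * (m + 2)] for cuts, [N] of padding and 3 of header.
    The arrays above thus stay intact while they are copied. *)
Definition SETBASE : prog :=
  PN BASE (NAdd (NAdd (NAdd (var vxp) (var vbd)) (var vN)) (NLit 6)).
(** Powers are formed in the reals, where a multiplication is one operation. The exponent goes
    through a cell because loop bounds are cells. *)
Definition SEARCH : prog :=
  PSeq (PN ve (NLit 40)) (PFor vr vn (PSeq (PA 8 (NLit 0) r1)
    (PSeq (PFor vx ve (PA 8 (NLit 0) (RMul (arr 8 (NLit 0)) (RNat (NAdd (var vr) (NLit 1))))))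
    (PIf (RLe (arr 8 (NLit 0)) (RNat (var vn)))
      (PIf (RLe (arr 8 (NLit 0)) (RNat (var vn'))) (PN vB (NAdd (var vr) (NLit 1))) PSkip) PSkip)))).
Definition POWERS : prog :=
  PSeq (PN ve (NLit 16)) (PSeq (POW vT vB ve) (PSeq (PN ve (NLit 18)) (PSeq (POW vH vB ve)
    (PSeq (PN ve (NLit 19)) (PSeq (POW vC vB ve) (PSeq (PN vMx (var vC))
    (PSeq (PN ve (NLit 36)) (PSeq (POW vZ vB ve) (PN vOFF (NLit 3)))))))))).
(** The points of [S1] weigh 0: they define the region, and cuts have to be judged on points
    independent of it. *)
Definition WEIGHTS : prog :=
  PFor vr vN (PIf (NLe (var vn) (var vr)) (PA 13 (var vr) (RDiv r1 (RNat (var vn'))))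
    (PIf (NLe (var vB) (var vr))
      (PA 13 (var vr) (RDiv (RSub r0 (RMem (NLit 0))) (RNat (NSub (var vn) (var vB)))))
      (PA 13 (var vr) r0))).

Section Setup.
Variables (K : realType) (d k : nat) (f : 'I_k -> Rn K d -> bool).
Local Notation den := (den f).
Implicit Types s st : store K.

Lemma POWP p a e st : [&& p != a, p != e, p != vx, p != vpw, p != TMP & p != BASE] ->
  [&& a != vx, a != vpw, a != TMP & e != vx] -> [&& e != vpw, e != TMP & a != BASE] ->
  nmem (den (POW p a e) st) p = (nmem st a ^ nmem st e)%N.
Proof.
move=> /and5P[pa pe px pv /andP[pT pB]] /and4P[ax av aT ex] /and3P[ev eT aB].
have pa' := negPf pa; have pe' := negPf pe; have px' := negPf px.
rewrite /POW den_PSeq den_PN /=; set st1 := nset _ _ _.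
have eE : nmem st1 e = nmem st e by rewrite /st1 nmem_nset eq_sym pe'.
have ok : okfor vx e (PSeq (mul vpw a p) (PN p (var vpw))).
  rewrite /okfor /= !inE !negb_or.
  by rewrite ?(eq_sym vx) ?(eq_sym BASE) px pB ex /= eT ev /= (eq_sym e) pe.
have := for_rule (f := f) (st := st1) (v := vx) (w := e) (p := PSeq (mul vpw a p) (PN p (var vpw)))
  (I := fun n s => nmem s p = (nmem st a ^ n)%N) ok.
rewrite eE; apply.
  by move=> s [fn _ _] _; rewrite fn ?inE// /st1 nmem_nset eqxx.
move=> n s ne sn [fn _ _] IH.
have aE : nmem s a = nmem st a.
  rewrite fn; first by rewrite /st1 nmem_nset eq_sym pa'.
  by rewrite /= !inE !negb_or ax av aT /= eq_sym.
rewrite nmem_nset px' den_PSeq den_mul// den_PN !nmem_nset eqxx/= nmem_nset/=.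
by rewrite nmem_nset/= IH aE expnS.
Qed.

Definition bmax (n n' : nat) : nat :=
  \max_(c < n.+1 | (c ^ 40 <= n)%N && (c ^ 40 <= n')%N) c.

Lemma bmaxP n n' : (bmax n n' ^ 40 <= n)%N /\ (bmax n n' ^ 40 <= n')%N.
Proof.
rewrite /bmax; elim/big_ind: _ => // [x y [? ?] [? ?]|i /andP[]//].
by case: (leqP x y) => _.
Qed.

Lemma bmax_ge n n' c : (c ^ 40 <= n)%N -> (c ^ 40 <= n')%N -> (c <= bmax n n')%N.
Proof.
move=> cn cn'; have cl : (c < n.+1)%N.
  by rewrite ltnS (leq_trans _ cn)//; case: c {cn cn'} => // c; rewrite -{1}(expn1 c.+1) leq_pexp2l.
by apply: (bigop.bigmax_sup (Ordinal cl)) => //; rewrite cn cn'.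
Qed.

Lemma SEARCHP st : nmem st vB = 0%N ->
  nmem (den SEARCH st) vB = bmax (nmem st vn) (nmem st vn').
Proof.
move=> B0; rewrite /SEARCH den_PSeq den_PN/=; set st1 := nset _ _ _.
pose P c := (c ^ 40 <= nmem st vn)%N && (c ^ 40 <= nmem st vn')%N.
have nE : nmem st1 vn = nmem st vn by [].
have B1 : nmem st1 vB = 0%N by [].
have := for_rule (f := f) (st := st1) (v := vr) (w := vn) (p := PSeq (PA 8 (NLit 0) r1)
    (PSeq (PFor vx ve (PA 8 (NLit 0) (RMul (arr 8 (NLit 0)) (RNat (NAdd (var vr) (NLit 1))))))
    (PIf (RLe (arr 8 (NLit 0)) (RNat (var vn)))
      (PIf (RLe (arr 8 (NLit 0)) (RNat (var vn'))) (PN vB (NAdd (var vr) (NLit 1))) PSkip) PSkip)))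
  (I := fun i s => nmem s vB = \max_(c < i.+1 | P c) c) isT.
rewrite nE; apply.
  by move=> s [fn _ _] _; rewrite fn// B1; apply/esym/eqP; rewrite -leqn0; apply/bigop.bigmax_leqP => c _; rewrite -ltnS.
move=> i s il si [fn fa fr] IH.
rewrite !den_PSeq den_PA /=; set s1 := aset _ _ _ _.
set Q := PFor vx ve _.
have [gn _ _] := den_framed f (p := Q) s1 isT isT.
have a8 : ar (den Q s1) 8 0 = (i.+1 ^ 40)%:R.
  have eE : nmem s1 ve = 40%N by rewrite /s1 nmem_aset fn.
  rewrite -eE natrX; apply: (for_rule (f := f) (st := s1) (v := vx) (w := ve)
   (p := PA 8 (NLit 0) (RMul (arr 8 (NLit 0)) (RNat (NAdd (var vr) (NLit 1)))))
   (I := fun n s => ar s 8 0 = i.+1%:R ^+ n) isT).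
    by move=> t [_ ga _] _; rewrite ga// /s1 ar_aset//= expr0.
  move=> n t nl tn [hn ha _] IH2; rewrite ar_nset// den_PA ar_aset//= reval_arr/= IH2.
  by rewrite hn// /s1 nmem_aset si addn1 exprSr.
have nE2 v : v \notin [:: vx] -> nmem (den Q s1) v = nmem s v by move=> vv; rewrite gn.
rewrite den_PIf /= reval_arr/= a8 nE2// fn// nE ler_nat.
have E : (\max_(c < i.+2 | P c) c = if P i.+1 then i.+1 else \max_(c < i.+1 | P c) c)%N.
  rewrite big_mkcond big_ord_recr/= -big_mkcond/=.
  case: ifP => _; last by rewrite maxn0.
  by apply/maxn_idPr/bigop.bigmax_leqP => c _; exact: ltnW.
rewrite nmem_nset/= E /P; case: ifP => c1 /=; last by rewrite den_PSkip nE2.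
rewrite den_PIf /= reval_arr/= a8 nE2// fn// ler_nat.
case: ifP => c2 /=; last by rewrite den_PSkip nE2.
by rewrite den_PN nmem_nset/= nE2// si addn1.
Qed.

Lemma WEIGHTSP st : (0 < nmem st BASE)%N ->
  forall r, (r < nmem st vN)%N -> ar (den WEIGHTS st) 13 r =
    if (nmem st vn <= r)%N then 1 / (nmem st vn')%:R else
    if (nmem st vB <= r)%N then - rmem st 0 / (nmem st vn - nmem st vB)%:R else 0.
Proof.
move=> B0.
apply: (for_rule (f := f) (st := st) (v := vr) (w := vN)
  (p := PIf (NLe (var vn) (var vr)) (PA 13 (var vr) (RDiv r1 (RNat (var vn'))))
    (PIf (NLe (var vB) (var vr))
      (PA 13 (var vr) (RDiv (RSub r0 (RMem (NLit 0))) (RNat (NSub (var vn) (var vB)))))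
      (PA 13 (var vr) r0)))
  (I := fun i s => forall r, (r < i)%N -> ar s 13 r =
    if (nmem st vn <= r)%N then 1 / (nmem st vn')%:R else
    if (nmem st vB <= r)%N then - rmem st 0 / (nmem st vn - nmem st vB)%:R else 0) isT) => //.
move=> r s rN sr [fn fa fr] IH r'; rewrite ltnS leq_eqVlt ar_nset// den_PIf /= sr !fn//.
rewrite (_ : ar _ 13 r' = if r' == r then
    if (nmem st vn <= r)%N then 1 / (nmem st vn')%:R else
    if (nmem st vB <= r)%N then - rmem st 0 / (nmem st vn - nmem st vB)%:R else 0 else ar s 13 r').
  by case: eqP => [->|_] //=; exact: IH.
case: ifP => _; first by rewrite den_PA ar_aset//= sr fn//.
rewrite den_PIf /= sr !fn//; case: ifP => _; rewrite den_PA ar_aset//= sr//.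
by rewrite !fn// sub0r fr.
Qed.

End Setup.

(** * The learner assembled *)

Definition PREP : prog := PSeq FIXL (PSeq SIZES (PSeq SETBASE (PSeq SEARCH POWERS))).
Definition BASIS : prog := PSeq FEAT (PSeq GS (PSeq NRM GOOD)).
Definition TRAIN : prog := PSeq BASIS (PSeq WEIGHTS (PSeq CLEARQ MAIN)).
(** The source lies three cells above the target and the copy goes upward, so nothing is overwritten
    before it is read. *)
Definition COPY : prog := PFor vx vbd (PO (var vx) (RMem (NAdd (var vx) (NLit 3)))).
Definition DUMP : prog := PFor vx vfp (PO (NAdd (var vbd) (var vx)) (arr 5 (var vx))).
(** Placed last, where the evaluator finds it from the length alone. The [b] cells skipped before it
    make the length at least [b]: the evaluator decodes [b] and the degree by a search up to the
    length, which could be too short when [d = 0]. *)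
Definition HEADER : prog :=
  PSeq (PN vbd (NAdd (NAdd (var vbd) (var vfp)) (var vB))) (PSeq (PO (var vbd) (RNat (var vL)))
    (PSeq (PO (NAdd (var vbd) (NLit 1)) (RNat (var vB)))
    (PSeq (PO (NAdd (var vbd) (NLit 2)) (RNat (var vF))) (PN 0 (NAdd (var vbd) (NLit 3)))))).
Definition OUTPUT : prog := PSeq (mul vbd vB vD) (PSeq COPY (PSeq DUMP HEADER)).
Definition LEARN : prog := PSeq PREP (PSeq TRAIN OUTPUT).

Lemma nth_flatten_const (T : Type) (x0 : T) d (ss : seq (seq T)) r c :
  (forall s, List.In s ss -> size s = d) -> (r < size ss)%N -> (c < d)%N ->
  nth x0 (flatten ss) (r * d + c) = nth x0 (nth [::] ss r) c.
Proof.
elim: ss r => // s ss IH r H rs cd; rewrite /= nth_cat (H s); last by left.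
case: r rs => [|r] rs; first by rewrite mul0n add0n cd.
rewrite ifF; last by rewrite mulSn; lia.
by rewrite mulSn -addnA addKn IH// => s' s's; apply: H; right.
Qed.

Section Weights.
Variables (K : realType) (n n' b : nat) (R : K).
Hypotheses (bn : (b < n)%N) (n'0 : (0 < n')%N) (R0 : 0 < R).

(** Summation against [wt] is the functional [E_S'[h] - R E_S[h]], the second mean being over the
    points of [S] outside [S1]. *)
Definition wt (r : nat) : K :=
  if (n <= r)%N then 1 / n'%:R else if (b <= r)%N then - R / (n - b)%:R else 0.

Lemma wt_sum (h : nat -> K) : \sum_(r < n + n') wt r * h r =
  n'%:R^-1 * \sum_(r < n') h (n + r)%N - R / (n - b)%:R * \sum_(r < n - b) h (b + r)%N.
Proof.
rewrite big_split_ord/= addrC; congr (_ + _).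
  rewrite mulr_sumr; apply: eq_bigr => r _.
  by rewrite /wt leq_addr div1r.
rewrite -(big_mkord xpredT (fun r => wt r * h r)) (big_cat_nat (n := b))//=; last exact: ltnW.
rewrite big_nat big1 ?add0r => [|r /andP[_ rb]]; last first.
  by rewrite /wt !ifN ?mul0r// -ltnNge// (ltn_trans rb).
rewrite -{1}(add0n b) big_addn big_mkord mulr_sumr -sumrN; apply: eq_bigr => r _.
have rn : (r + b < n)%N by have := ltn_ord r; lia.
by rewrite /wt leqNgt rn /= leq_addl addnC !mulNr.
Qed.

Lemma wt_gt0 r : (0 < wt r) = (n <= r)%N.
Proof.
rewrite /wt; case: leqP => nr; first by rewrite div1r invr_gt0 ltr0n.
case: leqP => br; last by rewrite ltxx.
by rewrite mulNr oppr_gt0 ltNge divr_ge0// ltW.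
Qed.

Lemma wt_pos : \sum_(r < n + n' | 0 < wt r) wt r = 1.
Proof.
rewrite big_mkcond (eq_bigr (fun r : 'I_(n + n') => wt r * (n <= r)%:R)) => [|r _]; last first.
  by rewrite wt_gt0; case: leqP; rewrite ?mulr1 ?mulr0.
rewrite (wt_sum (fun r => (n <= r)%:R)) [X in _ * X - _](eq_bigr (fun=> 1)) => [|r _]; last by rewrite leq_addr.
rewrite [X in _ - _ * X]big1 => [|r _]; last by rewrite leqNgt (_ : (b + r < n)%N)//; have := ltn_ord r; lia.
by rewrite sumr_const card_ord mulr0 subr0 mulVf// pnatr_eq0 -lt0n.
Qed.

Lemma wt_neg : \sum_(r < n + n' | wt r <= 0) wt r = - R.
Proof.
rewrite big_mkcond (eq_bigr (fun r : 'I_(n + n') => wt r * (r < n)%:R)) => [|r _]; last first.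
  by rewrite leNgt wt_gt0; case: leqP; rewrite ?mulr1 ?mulr0.
rewrite (wt_sum (fun r => (r < n)%:R)) [X in _ * X - _]big1 => [|r _]; last by rewrite ltnNge leq_addr.
rewrite [X in _ - _ * X](eq_bigr (fun=> 1)) => [|r _]; last by rewrite (_ : (b + r < n)%N)//; have := ltn_ord r; lia.
by rewrite sumr_const card_ord mulr0 sub0r mulfVK// pnatr_eq0 subn_eq0 -ltnNge.
Qed.

End Weights.

Section Pipeline.
Variables (K : realType) (d l k : nat) (f : 'I_k -> Rn K d -> bool) (n n' : nat).
Variables (R beta eps : K) (S : n.-tuple (Rn K d)) (S' : n'.-tuple (Rn K d)).
Local Notation den := (den f).

Definition deg := if (d <= 0)%N then 0%N else l.
Local Notation m := (d.+1 ^ deg)%N.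
Local Notation b := (bmax n n').
Local Notation st0 := (learner_input l k R beta eps S S').

Definition sample (r : nat) : Rn K d := nth [tuple 0 | _ < d] (tval S ++ tval S') r.
Definition S1s := S1 b 0 sample.

Definition prepared (st : store K) := [/\
  [/\ nmem st vM = m, nmem st vN = (n + n')%N, nmem st vB = b & nmem st vO = 0%N],
  [/\ nmem st vD = d, nmem st vL = deg, nmem st vK = k, nmem st vn = n & nmem st vn' = n'],
  [/\ nmem st vT = (b ^ 16)%N, nmem st vH = (b ^ 18)%N, nmem st vC = (b ^ 19)%N,
     nmem st vMx = (b ^ 19)%N & nmem st vZ = (b ^ 36)%N],
  [/\ nmem st vmm = m.+2, nmem st vOFF = 3%N & nmem st BASE = ((n + n') * d + (n + n') * m.+2 + (n + n') + 6)%N] &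
  [/\ nmem st vF = 0%N, nmem st vfp = 0%N, nmem st vh = 0%N, nmem st vtt = 0%N &
     forall a, (a < 3 + (n + n') * d)%N -> rmem st a = rmem st0 a]].

Lemma rmem_input r c : (r < n + n')%N -> (c < d)%N ->
  rmem st0 (3 + (r * d + c)) = nth 0 (tval (sample r) : seq K) c.
Proof.
move=> rN cd; rewrite /= -flatten_cat -map_cat (@nth_flatten_const _ 0 d)//.
- by rewrite (nth_map [tuple 0 | _ < d])// size_cat !size_tuple.
- by move=> s /List.in_map_iff[x [<- _]]; rewrite size_tuple.
- by rewrite size_map size_cat !size_tuple.
Qed.

Lemma den_PREP st : den PREP st =
  den POWERS (den SEARCH (den SETBASE (den SIZES (den FIXL st)))).
Proof.
by rewrite /PREP (den_PSeq f FIXL) (den_PSeq f SIZES) (den_PSeq f SETBASE) (den_PSeq f SEARCH).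
Qed.
Lemma den_SIZES st : den SIZES st = den (mul vbd vN vmm) (den (mul vxp vN vD)
  (den (PN vN (NAdd (var vn) (var vn'))) (den (PN vmm (NAdd (var vM) (NLit 2)))
  (den (POW vM 38 vL) (den (PN 38 (NAdd (var vD) (NLit 1))) st))))).
Proof.
by rewrite /SIZES (den_PSeq f (PN 38 _)) (den_PSeq f (POW _ _ _)) (den_PSeq f (PN vmm _))
  (den_PSeq f (PN vN _)) (den_PSeq f (mul vxp _ _)).
Qed.
Lemma den_POWERS st : den POWERS st = den (PN vOFF (NLit 3)) (den (POW vZ vB 37) (den (PN 37 (NLit 36))
  (den (PN vMx (var vC)) (den (POW vC vB 37) (den (PN 37 (NLit 19))
  (den (POW vH vB 37) (den (PN 37 (NLit 18)) (den (POW vT vB 37) (den (PN 37 (NLit 16)) st))))))))).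
Proof.
by rewrite /POWERS (den_PSeq f (PN 37 (NLit 16))) (den_PSeq f (POW vT _ _)) (den_PSeq f (PN 37 (NLit 18)))
  (den_PSeq f (POW vH _ _)) (den_PSeq f (PN 37 (NLit 19))) (den_PSeq f (POW vC _ _)) (den_PSeq f (PN vMx _))
  (den_PSeq f (PN 37 (NLit 36))) (den_PSeq f (POW vZ _ _)).
Qed.

(** After each stage only its results and a frame fact ([n1], [n2], ...) are kept and the store is
    made opaque; otherwise the nested updates would grow out of hand. *)
Lemma PREPP : prepared (den PREP st0).
Proof.
rewrite den_PREP; set s1 := den FIXL st0.
have L1 : nmem s1 vL = deg.
  by rewrite /s1 /FIXL den_PIf /= /deg; case: ifP => _; rewrite ?den_PN ?den_PSkip.
have n1 v : v != vL -> nmem s1 v = nmem st0 v.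
  by move=> vL'; rewrite /s1 den_nframe//= inE.
have r1 a : rmem s1 a = rmem st0 a by rewrite /s1 den_PIf; case: ifP.
clearbody s1; rewrite den_SIZES [den (PN 38 _) _]den_PN /=; set s2 := nset s1 _ _.
have n2 v : v != 38%N -> nmem s2 v = nmem s1 v by move=> vv; rewrite /s2 nmem_nset (negPf vv).
have d2 : nmem s2 38 = d.+1 by rewrite /s2 nmem_nset /= n1//= addn1.
have r2 a : rmem s2 a = rmem s1 a by [].
clearbody s2; set s3 := den (POW _ _ _) s2.
have M3 : nmem s3 vM = m by rewrite /s3 POWP// d2 n2// L1.
have n3 v : v \notin [:: vM; vx; 39; TMP]%N -> nmem s3 v = nmem s2 v.
  move=> vv; rewrite /s3 den_nframe//; move: vv; rewrite !inE !negb_or => /and4P[v1 v2 v3 v4].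
  by rewrite v1 v2 v3 v4.
have r3 a : rmem s3 a = rmem s2 a.
  by rewrite /s3 den_rnat.
clearbody s3; rewrite [den (PN vmm _) _]den_PN [den (PN vN _) _]den_PN [den (mul vxp _ _) _]den_mul// [den (mul vbd _ _) _]den_mul//.
set s4 := nset (nset (nset _ _ _) _ _) _ _.
have N4 : nmem s4 vN = (n + n')%N by rewrite /s4 !nmem_nset/= ?nmem_nset/= !n3// !n2// !n1.
have xp4 : nmem s4 vxp = ((n + n') * d)%N.
  by rewrite /s4 !nmem_nset/= ?nmem_nset/= !n3// !n2// !n1//=.
have bd4 : nmem s4 40 = ((n + n') * m.+2)%N.
  by rewrite /s4 !nmem_nset/= ?nmem_nset/= M3 !n3// !n2// !n1//= addn2.
have mm4 : nmem s4 vmm = m.+2 by rewrite /s4 !nmem_nset/= ?nmem_nset/= M3 addn2.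
have n4 v : v \notin [:: vmm; vN; vxp; TMP; 40]%N -> nmem s4 v = nmem s3 v.
  rewrite !inE !negb_or => /and5P[/negPf v1 /negPf v2 /negPf v3 /negPf v4 /negPf v5].
  by rewrite /s4 !nmem_nset !(v1, v2, v3, v4, v5).
have r4 a : rmem s4 a = rmem s3 a by rewrite /s4 !rmem_nset.
clearbody s4; rewrite /SETBASE den_PN /=; set s5 := nset _ _ _.
have B5 : nmem s5 BASE = ((n + n') * d + (n + n') * m.+2 + (n + n') + 6)%N.
  by rewrite /s5 nmem_nset/= xp4 bd4 N4.
have n5 v : v != BASE -> nmem s5 v = nmem s4 v by move=> /negPf v1; rewrite /s5 nmem_nset v1.
have r5 a : rmem s5 a = rmem s4 a by [].
clearbody s5; set s6 := den SEARCH s5.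
have B6 : nmem s6 vB = b.
  by rewrite /s6 SEARCHP ?n5// ?n4// ?n3// ?n2// !n1.
have [n6 _ r6] := den_framed f (p := SEARCH) s5 isT isT; rewrite -/s6 in n6 r6.
clearbody s6; rewrite den_POWERS.
pose P (s : store K) := forall v, v \notin [:: 37; 12; 14; 34; 13; 31; 11; vx; 39; TMP]%N -> nmem s v = nmem s6 v.
rewrite [den (PN 37 (NLit 16)) _]den_PN /=.
set t1 := nset s6 _ _; set t2 := den _ t1.
have T2 : nmem t2 vT = (b ^ 16)%N by rewrite /t2 POWP// /t1 nmem_nset/= nmem_nset/= B6.
have n7 v : v \notin [:: 37; 12; vx; 39; TMP]%N -> nmem t2 v = nmem s6 v.
  rewrite !inE !negb_or => /and5P[v1 v2 v3 v4 v5].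
  rewrite /t2 den_nframe; last by rewrite /= ?inE ?negb_or v2 ?v3 ?v4 ?v5.
  by rewrite /t1 nmem_nset (negPf v1).
have r7 a : rmem t2 a = rmem s6 a by rewrite /t2 den_rnat.
clearbody t2; clear t1; rewrite [den (PN 37 (NLit 18)) _]den_PN /=.
set t1 := nset t2 _ _; set t3 := den _ t1.
have T3 : nmem t3 vH = (b ^ 18)%N by rewrite /t3 POWP// /t1 nmem_nset/= nmem_nset/= n7// B6.
have n8 v : v \notin [:: 37; 14; vx; 39; TMP]%N -> nmem t3 v = nmem t2 v.
  rewrite !inE !negb_or => /and5P[v1 v2 v3 v4 v5].
  rewrite /t3 den_nframe; last by rewrite /= ?inE ?negb_or v2 ?v3 ?v4 ?v5.
  by rewrite /t1 nmem_nset (negPf v1).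
have r8 a : rmem t3 a = rmem s6 a by rewrite /t3 den_rnat// /t1 rmem_nset r7.
clearbody t3; clear t1; rewrite [den (PN 37 (NLit 19)) _]den_PN /=.
set t1 := nset t3 _ _; set t4 := den _ t1.
have T4 : nmem t4 vC = (b ^ 19)%N by rewrite /t4 POWP// /t1 nmem_nset/= nmem_nset/= n8// n7// B6.
have n9 v : v \notin [:: 37; 34; vx; 39; TMP]%N -> nmem t4 v = nmem t3 v.
  rewrite !inE !negb_or => /and5P[v1 v2 v3 v4 v5].
  rewrite /t4 den_nframe; last by rewrite /= ?inE ?negb_or v2 ?v3 ?v4 ?v5.
  by rewrite /t1 nmem_nset (negPf v1).
have r9 a : rmem t4 a = rmem s6 a by rewrite /t4 den_rnat// /t1 rmem_nset r8.
clearbody t4; clear t1; rewrite [den (PN 13 _) _]den_PN /= [den (PN 37 (NLit 36)) _]den_PN /=.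
set t1 := nset (nset t4 _ _) _ _; set t5 := den _ t1.
have T5 : nmem t5 vZ = (b ^ 36)%N by rewrite /t5 POWP// /t1 nmem_nset/= nmem_nset/= nmem_nset/= n9// n8// n7// B6.
have Mx5 : nmem t5 vMx = (b ^ 19)%N by rewrite /t5 den_nframe// /t1 nmem_nset/= nmem_nset/= T4.
have n10 v : v \notin [:: 37; 13; 31; vx; 39; TMP]%N -> nmem t5 v = nmem t4 v.
  rewrite in_cons negb_or !inE !negb_or => /andP[v0 /and5P[v1 v2 v3 v4 v5]].
  rewrite /t5 den_nframe; last by rewrite /= ?inE ?negb_or v2 ?v3 ?v4 ?v5.
  by rewrite /t1 nmem_nset (negPf v0) nmem_nset (negPf v1).
have r10 a : rmem t5 a = rmem s6 a by rewrite /t5 den_rnat// /t1 !rmem_nset r9.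
clearbody t5; clear t1; rewrite den_PN /=; set t6 := nset _ _ _.
have nt v : v \notin [:: 37; 12; 14; 34; 13; 31; 11; vx; 39; TMP]%N -> nmem t6 v = nmem s6 v.
  rewrite !in_cons !negb_or in_nil => /and5P[v0 v1 v2 v3 /and5P[v4 v5 v6 v7 /and3P[v8 v9 _]]].
  rewrite /t6 nmem_nset (negPf v6) n10 ?n9 ?n8 ?n7// !inE !negb_or ?v0 ?v1 ?v2 ?v3 ?v4 ?v5 ?v6 ?v7 ?v8 ?v9//.
split; split.
- by rewrite nt// n6// n5// n4// M3.
- by rewrite nt// n6// n5// N4.
- by rewrite nt// B6.
- by rewrite nt// n6// n5// n4// n3// n2// n1.
- by rewrite nt// n6// n5// n4// n3// n2// n1.
- by rewrite nt// n6// n5// n4// n3// n2// L1.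
- by rewrite nt// n6// n5// n4// n3// n2// n1.
- by rewrite nt// n6// n5// n4// n3// n2// n1.
- by rewrite nt// n6// n5// n4// n3// n2// n1.
- by rewrite /t6 nmem_nset/= n10// n9// n8// T2.
- by rewrite /t6 nmem_nset/= n10// n9// T3.
- by rewrite /t6 nmem_nset/= n10// T4.
- by rewrite /t6 nmem_nset/= Mx5.
- by rewrite /t6 nmem_nset/= T5.
- by rewrite nt// n6// n5// mm4.
- by rewrite /t6 nmem_nset/=.
- by rewrite nt// n6// B5.
- by rewrite nt// n6// n5// n4// n3// n2// n1.
- by rewrite nt// n6// n5// n4// n3// n2// n1.
- by rewrite nt// n6// n5// n4// n3// n2// n1.
- by rewrite nt// n6// n5// n4// n3// n2// n1.
- move=> a aB; rewrite /t6 rmem_nset r10 r6 ?r5 ?r4 ?r3 ?r2 ?r1// B5; lia.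
Qed.

End Pipeline.

Section Basis.
Variables (K : realType) (d k : nat) (f : 'I_k -> Rn K d -> bool).
Variables (l N b o : nat) (pt : nat -> Rn K d).
Local Notation den := (den f).
Local Notation m := (d.+1 ^ l)%N.

Lemma BASISP (st : store K) : (b + o <= N)%N -> ctx m N b o st -> nmem st vD = d ->
  nmem st vL = l -> rawpts pt (nmem st vOFF) N st ->
  mat m N (den BASIS st) (fun r j => zeta m (feat l) (S1 b o pt) (pt r) j) /\
  forall r, (r < N)%N -> ar (den BASIS st) 1 r = (good m (feat l) (S1 b o pt) (pt r))%:R.
Proof.
move=> boN C D L rp; have [ME NE BE OE] := C.
rewrite -NE in rp; have FP := FEATP f ME D L rp.
have CF : ctx m N b o (den FEAT st).
  by apply: (ctx_framed (den_framed f (p := FEAT) st isT isT) isT C).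
have {}FP : mat m N (den FEAT st) (fun r j => feat l (pt r) j).
  by move=> r j rN jm; apply: FP => //; rewrite NE.
rewrite /BASIS (den_PSeq f FEAT) (den_PSeq f GS) (den_PSeq f NRM).
move: (den FEAT st) CF FP => s1 C1 F1.
have G2 := GSP f boN C1 F1.
have C2 : ctx m N b o (den GS s1).
  by apply: (ctx_framed (den_framed f (p := GS) s1 isT isT) isT C1).
move: (den GS s1) C2 G2 => s2 C2 G2.
have [G3 n3 c3] := NRMP f boN C2 G2.
have C3 : ctx m N b o (den NRM s2).
  by apply: (ctx_framed (den_framed f (p := NRM) s2 isT isT) isT C2).
exact: (GOODP f C3 G3 n3 c3).
Qed.

End Basis.

Section Train.
Variables (K : realType) (d l k : nat) (f : 'I_k -> Rn K d -> bool) (n n' : nat).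
Variables (R beta eps : K) (S : n.-tuple (Rn K d)) (S' : n'.-tuple (Rn K d)).
Local Notation den := (den f).
Local Notation dg := (deg d l).
Local Notation m := (d.+1 ^ dg)%N.
Local Notation b := (bmax n n').
Local Notation st0 := (learner_input l k R beta eps S S').
Local Notation pt := (sample S S').
Local Notation N := (n + n')%N.
Local Notation S1s := (S1 b 0 pt).
Local Notation gd := (good m (feat dg) S1s).
Local Notation zt := (zeta m (feat dg) S1s).
Local Notation w := (wt n n' b R).

Hypotheses (k0 : (0 < k)%N) (b2 : (2 <= b)%N) (Rb2 : 2 * (1 + R) <= b%:R) (Rgt1 : 1 < R).

Lemma b_ltn : (b < n)%N /\ (0 < n')%N.
Proof.
have [bn bn'] := bmaxP n n'; split; last by apply: leq_trans bn'; rewrite expn_gt0 (leq_trans _ b2).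
apply: leq_trans bn; rewrite -{1}(expn1 b) ltn_exp2l//.
Qed.

(** The interface between the program and the statistics: what is used later about a run, free of
    any reference to memory. *)
Definition learned (F : seq (filt K k)) : Prop :=
  [/\ forall c, List.In c F -> fcoded m b R c, (size F <= b ^ 18)%N,
   0 <= \sum_(r < N) w r * ((gd (pt r))%:R - (sel f m b zt gd F (pt r))%:R) &
   forall i : 'I_k, exists q, path f m N b pt zt w gd F i q (b ^ 16)].

Lemma TRAINP : exists F : seq (filt K k), let st := den TRAIN (den PREP st0) in
  [/\ learned F, stored m b st F, nmem st vF = size F /\ nmem st vfp = (size F * m.+2)%N,
    [/\ nmem st vB = b, nmem st vD = d, nmem st vL = dg & nmem st BASE = (N * d + N * m.+2 + N + 6)%N] &
    forall a, (a < 3 + N * d)%N -> rmem st a = rmem st0 a].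
Proof.
have [bn n'0] := b_ltn; have Rp : 0 < R by apply: lt_trans Rgt1.
have := PREPP l f R beta eps S S'; move: (den PREP st0) => s0.
case=> [[ME NE BE OE] [DE LE KE nE n'E] [TE HE CE MxE ZE] [mmE OFFE BSE] [FE fpE hE tE rE]].
have C0 : ctx m N b 0 s0 by [].
have rp0 : rawpts pt (nmem s0 vOFF) N s0.
  move=> r c rN cd; rewrite OFFE BSE.
  have rd : (r * d + c < N * d)%N.
    have : (r.+1 * d <= N * d)%N by rewrite leq_mul2r rN orbT.
    by rewrite mulSn; lia.
  split; first by lia.
  rewrite rE; last by lia.
  exact: rmem_input.
have bN : (b + 0 <= N)%N by lia.
have [MB gB] := BASISP f bN C0 DE LE rp0.
rewrite /TRAIN (den_PSeq f BASIS) (den_PSeq f WEIGHTS) (den_PSeq f CLEARQ).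
have [n1 a1 r1'] := den_framed f (p := BASIS) s0 isT isT.
move: (den BASIS s0) MB gB n1 a1 r1' => s1 MB gB n1 a1 r1'.
have B1 : (0 < nmem s1 BASE)%N by rewrite n1// BSE; lia.
have WP := WEIGHTSP f B1.
have [n2 a2 r2'] := den_framed f (p := WEIGHTS) s1 isT isT.
move: (den WEIGHTS s1) WP n2 a2 r2' => s2 WP n2 a2 r2'.
have [n3 a3 r3'] := den_framed f (p := CLEARQ) s2 isT isT.
have R0 : rmem s2 0 = R.
  by rewrite r2' // r1' ?BSE ?rE//; lia.
set s3 := den CLEARQ s2 in n3 a3 r3' *.
have nn v : v \notin nwrites BASIS -> v \notin nwrites WEIGHTS -> v \notin nwrites CLEARQ ->
    nmem s3 v = nmem s0 v.
  by move=> v1 v2 v3; rewrite n3// n2// n1.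
have M3 : mat m N s3 (fun r j => zt (pt r) j).
  by apply: mat_ext MB => // i; rewrite a3// a2.
have C3 : ctx m N b 0 s3 by split; rewrite nn.
have W3 r : (r < N)%N -> ar s3 13 r = w r.
  move=> rN; rewrite a3// WP; last by rewrite n1// NE.
  rewrite /wt !n1// nE n'E BE.
  by rewrite r1' ?BSE ?rE//; lia.
have rr a : (a < 3 + N * d)%N -> rmem s3 a = rmem st0 a.
  by move=> aN; rewrite r3' ?r2' ?r1' ?n2 ?n1 ?BSE ?rE//; lia.
have rp3 : rawpts pt (nmem s3 vOFF) N s3.
  rewrite nn// => r c rN cd; have [r1 r2] := rp0 r c rN cd.
  split; first by rewrite nn.
  by rewrite r3' ?r2' ?r1' ?n2 ?n1.
have R3 : rmem s3 0 = R by rewrite rr//; lia.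
have ztb r j : (r < N)%N -> gd (pt r) -> (j < m)%N -> `|zt (pt r) j| <= 1.
  by move=> _ gr jm; exact: zeta_le1.
have wp : \sum_(r < N | 0 < w r) w r = 1 by exact: wt_pos.
have wn : \sum_(r < N | w r <= 0) w r = - R by exact: wt_neg.
have B3 : (0 < nmem s3 BASE)%N by rewrite nn// BSE; lia.
have D3 : nmem s3 vD = d by rewrite nn.
have K3 : nmem s3 vK = k by rewrite nn.
have H3 : nmem s3 vH = (b ^ 18)%N by rewrite nn.
have Z3 : nmem s3 vZ = (b ^ 36)%N by rewrite nn.
have T3 : nmem s3 vT = (b ^ 16)%N by rewrite nn.
have mm3 : nmem s3 vmm = m.+2 by rewrite nn.
have c3 : nmem s3 vC = (b ^ 19)%N by rewrite nn.
have Mx3 : nmem s3 vMx = (b ^ 19)%N by rewrite nn.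
have Q3 : forall j, (j < m)%N -> ar s3 4 j = 0.
  have := @for_rule _ _ _ f (fun n s => forall j, (j < n)%N -> ar s 4 j = 0) 17 7 (PA 4 (var 17) r0) s2 isT.
  rewrite -/CLEARQ -/s3 n2// n1// ME; apply=> // j s jm sj [fn fa fr] IH j'.
  by rewrite ltnS ar_nset// den_PA ar_aset//= sj leq_eqVlt; case: eqP => //= _; exact: IH.
have I0 : Inv f m N b pt zt w R s3 gd 0 s3.
  split; first by split.
  exists [::], 0%N, 0%N; split=> //; rewrite ?nn//.
  - by move=> r rN; rewrite a3// a2// gB// /sel andbT.
  - by rewrite mul0r; apply: sumr_ge0 => r _; rewrite /sel andbT subrr mulr0.
  - by rewrite expn_gt0 (leq_trans _ b2).
  - move=> i _; exists (fun _ _ => 0); split=> //.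
    by exists (fun=> 0%N) => j jm; rewrite !mul0n mul0r mul0r subrr.
  - by left.
have [F [[sn sa sr] [F1 F2] F3 [F4 F5] [F6 F7]]] :=
  MAINP C3 D3 K3 H3 Z3 T3 mm3 c3 rp3 M3 W3 R3 B3 b2 Rb2 Rgt1 wp wn ztb k0 Mx3 I0.
exists F; split=> //.
- split=> //; apply: le_trans F6; by rewrite divr_ge0.
- split; [by rewrite sn// nn|by rewrite sn|by rewrite den_nframe// nn|by rewrite sn// nn].
- by move=> a aN; rewrite sr ?rr// nn// BSE; lia.
Qed.

End Train.

Section Output.
Variables (K : realType) (d k : nat) (f : 'I_k -> Rn K d -> bool) (l b N : nat).
Variables (pt : nat -> Rn K d).
Local Notation den := (den f).
Local Notation m := (d.+1 ^ l)%N.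

Definition encodes (desc : seq K) (F : seq (filt K k)) : Prop :=
  [/\ size desc = (b * d + size F * m.+2 + b + 3)%N,
    forall r c, (r < b)%N -> (c < d)%N -> nth 0 desc (r * d + c) = nth 0 (tval (pt r) : seq K) c,
    forall e c, (c < size F)%N -> [/\ nth 0 desc (b * d + c * m.+2) = (nth e F c).1.1%:R,
      nth 0 desc (b * d + (c * m.+2).+1) = (nth e F c).1.2%:R / (b ^ 18)%:R &
      forall j, (j < m)%N -> nth 0 desc (b * d + ((c * m.+2).+2 + j)) = (nth e F c).2 j] &
    [/\ nth 0 desc (b * d + size F * m.+2 + b) = l%:R,
      nth 0 desc (b * d + size F * m.+2 + b).+1 = b%:R &
      nth 0 desc (b * d + size F * m.+2 + b).+2 = (size F)%:R]].

Lemma COPYP st : (nmem st vbd <= nmem st BASE)%N -> [/\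
  forall v, v != vx -> nmem (den COPY st) v = nmem st v,
  forall c i, ar (den COPY st) c i = ar st c i &
  forall a, rmem (den COPY st) a = if (a < nmem st vbd)%N then rmem st (a + 3) else rmem st a].
Proof.
move=> bB; have := @for_raw _ _ _ f (fun i s => [/\ nmem s vx = i,
  forall v, v != vx -> nmem s v = nmem st v, forall c j, ar s c j = ar st c j &
  forall a, rmem s a = if (a < i)%N then rmem st (a + 3) else rmem st a])
  vx vbd (PO (var vx) (RMem (NAdd (var vx) (NLit 3)))) st.
case.
- by split=> // v vv; rewrite nmem_nset (negPf vv).
- move=> i s ib [I1 I2 I3 I4]; rewrite den_PO /= I1 !nmem_rset I1; split.
  + by rewrite nmem_nset eqxx.
  + by move=> v vv; rewrite nmem_nset (negPf vv) nmem_rset I2.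
  + by move=> c j; rewrite ar_nset// ar_raw// I2//; exact: leq_trans bB.
  + move=> a; rewrite rmem_nset rmem_rset' !I4 [in RHS]ltnS [in RHS]leq_eqVlt.
    case: (a =P i) => [->|_] //=; rewrite ifF//.
    by lia.
by move=> _ E1 E2 E3.
Qed.

Lemma DUMPP st : (nmem st vbd + nmem st vfp <= nmem st BASE)%N -> [/\
  forall v, v != vx -> nmem (den DUMP st) v = nmem st v,
  forall c i, ar (den DUMP st) c i = ar st c i &
  forall a, rmem (den DUMP st) a =
    if (nmem st vbd <= a < nmem st vbd + nmem st vfp)%N then ar st 5 (a - nmem st vbd) else rmem st a].
Proof.
move=> bB; have := @for_raw _ _ _ f (fun i s => [/\ nmem s vx = i,
  forall v, v != vx -> nmem s v = nmem st v, forall c j, ar s c j = ar st c j &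
  forall a, rmem s a = if (nmem st vbd <= a < nmem st vbd + i)%N then ar st 5 (a - nmem st vbd) else rmem st a])
  vx vfp (PO (NAdd (var vbd) (var vx)) (arr 5 (var vx))) st.
case.
- split=> // [v vv|a]; last by rewrite ifF//; lia.
  by rewrite nmem_nset (negPf vv).
- move=> i s ib [I1 I2 I3 I4]; rewrite den_PO /= I1 !nmem_rset I1 I2// reval_arr/= I1 I3; split.
  + by rewrite nmem_nset eqxx.
  + by move=> v vv; rewrite nmem_nset (negPf vv) nmem_rset I2.
  + by move=> c j; rewrite ar_nset// ar_raw// I2//; lia.
  + move=> a; rewrite rmem_nset rmem_rset' !I4.
    case: eqP => [->|an]; first by rewrite ifT ?addKn//; lia.
    by congr (if _ then _ else _); lia.
by move=> _ E1 E2 E3.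
Qed.

Lemma OUTPUTP st F : nmem st vB = b -> nmem st vD = d -> nmem st vL = l -> nmem st vF = size F ->
  nmem st vfp = (size F * m.+2)%N -> (b * d + size F * m.+2 + b + 3 < nmem st BASE)%N ->
  stored m b st F -> (forall r c, (r < b)%N -> (c < d)%N ->
    rmem st (3 + (r * d + c)) = nth 0 (tval (pt r) : seq K) c) ->
  encodes (mkseq (rmem (den OUTPUT st)) (nmem (den OUTPUT st) 0)) F.
Proof.
move=> BE DE LE FE fpE BS sF pts.
rewrite /OUTPUT (den_PSeq f (mul _ _ _)) (den_PSeq f COPY) (den_PSeq f DUMP) den_mul// BE DE.
set s1 := nset (nset _ _ _) _ _.
have n1 v : v != TMP -> v != vbd -> nmem s1 v = nmem st v.
  by move=> /negPf v1 /negPf v2; rewrite /s1 !nmem_nset v1 v2.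
have bd1 : nmem s1 vbd = (b * d)%N by rewrite /s1 !nmem_nset.
have a1 c i : ar s1 c i = ar st c i by rewrite /s1 !ar_nset.
have r1 a : rmem s1 a = rmem st a by rewrite /s1 !rmem_nset.
clearbody s1; have [|n2 a2 r2] := @COPYP s1; first by rewrite bd1 n1//; lia.
move: (den COPY s1) n2 a2 r2 => s2 n2 a2 r2.
have [|n3 a3 r3] := @DUMPP s2; first by rewrite !n2// bd1 !n1// fpE; lia.
rewrite !n2// bd1 !n1// fpE in r3.
move: (den DUMP s2) n3 a3 r3 => s3 n3 a3 r3.
set e := (b * d + size F * m.+2 + b)%N.
have [d3 r4] : nmem (den HEADER s3) 0 = e.+3 /\ forall a, rmem (den HEADER s3) a =
    if a == e.+2 then (size F)%:R else if a == e.+1 then b%:R else if a == e then l%:R else rmem s3 a.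
  rewrite /HEADER (den_PSeq f (PN _ _)) den_PN /=.
  rewrite !n3// !n2// bd1 !n1// fpE BE -/e.
  rewrite (den_PSeq f (PO _ _)) den_PO /= !nmem_nset/=.
  rewrite (den_PSeq f (PO _ _)) den_PO /= !nmem_rset !nmem_nset/=.
  rewrite (den_PSeq f (PO _ _)) den_PO /= !nmem_rset !nmem_nset/=.
  rewrite den_PN /= nmem_nset/=.
  split; first by rewrite addn3.
  move=> a; rewrite rmem_nset !rmem_rset' rmem_nset !n3// !n2// !n1// FE BE LE.
  by rewrite addn2 addn1.
have rr a : (a < e)%N -> rmem (den HEADER s3) a = rmem s3 a.
  by move=> ae; rewrite r4 !ifF//; lia.
rewrite d3; move: (den HEADER s3) r4 rr {d3} => s4 r4 rr.
have nm a : (a < e.+3)%N -> nth 0 (mkseq (rmem s4) e.+3) a = rmem s4 a by exact: nth_mkseq.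
split.
- by rewrite size_mkseq addn3.
- move=> r c rb cd; have E : (r.+1 * d <= b * d)%N by rewrite leq_mul2r rb orbT.
  rewrite mulSn in E; rewrite nm; last by rewrite /e; lia.
  rewrite rr; last by rewrite /e; lia.
  rewrite r3 ifF; last by lia.
  by rewrite r2 bd1 ifT; [rewrite r1 addnC pts|lia].
- move=> e0 c cF; have [A1 A2 A3] := sF e0 c cF.
  have E : (c.+1 * m.+2 <= size F * m.+2)%N by rewrite leq_mul2r cF orbT.
  rewrite mulSn in E.
  have key a : (a < m.+2)%N -> nth 0 (mkseq (rmem s4) e.+3) (b * d + (c * m.+2 + a)) = ar st 5 (c * m.+2 + a).
    move=> am; rewrite nm; last by rewrite /e; lia.
    rewrite rr; last by rewrite /e; lia.
    rewrite r3 ifT; last by lia.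
    by rewrite addKn a2 a1.
  split.
  + by have := key 0%N; rewrite !addn0 => ->.
  + by have := key 1%N; rewrite !addn1 => ->.
  + by move=> j jm; rewrite -(A3 j jm) (_ : (c * m.+2).+2 + j = c * m.+2 + j.+2)%N ?key//; lia.
- split; rewrite nm ?r4 -/e//; try by lia.
  + by rewrite eqxx ifF ?ifF//; lia.
  + by rewrite eqxx ifF//; lia.
  + by rewrite eqxx.
Qed.

End Output.

Local Notation vsz := 41%N.
Local Notation vend := 42%N.
Local Notation vad := 43%N.

(** * The evaluator as a program *)

(** Reads a natural number out of a real cell: each [z] below it sets [v] to [z + 1], and the last
    such [z] leaves the number itself. *)
Definition DECODE (v w : nat) : prog :=
  PSeq (PN v (NLit 0)) (PFor vz w
    (PIf (RLe (RMem (var vad)) (RNat (var vz))) PSkip (PN v (NAdd (var vz) (NLit 1))))).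
Definition FIELD (v i : nat) : prog :=
  PSeq (PN vad (NSub (var vend) (NLit i))) (DECODE v vsz).
(** The length is moved first, since its cell 2 then receives [k]. The point and the points of [S1]
    at the head of the description are contiguous, so they are read as [b + 1] rows from address
    0. *)
Definition ENTRY : prog :=
  PSeq (PN vsz (var 2)) (PSeq (PN vK (var 1)) (PSeq (PN vend (NAdd (var vD) (var vsz)))
    (PN BASE (var vend)))).
Definition FIELDS : prog := PSeq (FIELD vL 3) (PSeq (FIELD vB 2) (FIELD vF 1)).
Definition LAYOUT : prog :=
  PSeq (PN vd1 (NAdd (var vD) (NLit 1))) (PSeq (POW vM vd1 vL)
    (PSeq (PN vmm (NAdd (var vM) (NLit 2))) (PSeq (PN vN (NAdd (var vB) (NLit 1)))
    (PSeq (PN vO (NLit 1)) (PSeq (mul vbd vB vD) (PN vad (NAdd (var vD) (var vbd)))))))).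
Definition DOTQ : prog :=
  PFor vj vM (incr 8 (RMul (RMem (NAdd (NAdd (var vad) (NLit 2)) (var vj))) (arr 0 (var vj)))).
Definition CHECK : prog :=
  PSeq (DECODE vh vK) (PSeq (PAsk vans (var vh) (NLit 0)) (PSeq (PA 8 (NLit 0) r0)
    (PSeq DOTQ (PSeq (PIf (RLe (arr 8 (NLit 0)) (RMem (NAdd (var vad) (NLit 1)))) PSkip
       (PIf (NLe (NLit 1) (var vans)) (PA 1 (NLit 0) r0) PSkip))
     (PN vad (NAdd (var vad) (var vmm))))))).
Definition CHECKS : prog := PFor vround vF CHECK.
Definition ANSWER : prog := PIf (RLe r1 (arr 1 (NLit 0))) (PN 0 (NLit 1)) (PN 0 (NLit 0)).
Definition EVAL : prog :=
  PSeq ENTRY (PSeq FIELDS (PSeq LAYOUT (PSeq BASIS (PSeq CHECKS ANSWER)))).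

Section Learned.
Variables (K : realType) (d l k : nat) (f : 'I_k -> Rn K d -> bool) (n n' : nat).
Variables (R beta eps : K) (S : n.-tuple (Rn K d)) (S' : n'.-tuple (Rn K d)).
Local Notation den := (den f).
Local Notation b := (bmax n n').
Local Notation st0 := (learner_input l k R beta eps S S').

Lemma LEARNP : (0 < k)%N -> (2 <= b)%N -> 2 * (1 + R) <= b%:R -> 1 < R ->
  exists2 F : seq (filt K k), learned l f R S S' F &
    encodes (deg d l) b (sample S S')
      (mkseq (rmem (den LEARN st0)) (nmem (den LEARN st0) 0)) F.
Proof.
move=> k0 b2 Rb2 R1; have := TRAINP l f beta eps S S' k0 b2 Rb2 R1.
case=> F [LF sF [F1 F2] [B1 D1 L1 BS] raw]; exists F => //.
rewrite /LEARN (den_PSeq f PREP) (den_PSeq f TRAIN).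
move: (den TRAIN _) sF F1 F2 B1 D1 L1 BS raw => st sF F1 F2 B1 D1 L1 BS raw.
have [_ szF _ _] := LF.
have [bn bn'] := bmaxP n n'.
have bb : (b <= b ^ 40)%N by rewrite -{1}(expn1 b) leq_pexp2l// (leq_trans _ b2).
have b18 : (b ^ 18 <= b ^ 40)%N by rewrite leq_pexp2l// (leq_trans _ b2).
have bN := leq_trans bb bn.
apply: OUTPUTP => //.
- have E1 : (b * d <= (n + n') * d)%N by rewrite leq_mul2r (leq_trans bb) ?orbT// (leq_trans bn) ?leq_addr.
  have E2 : (size F * (d.+1 ^ deg d l).+2 <= (n + n') * (d.+1 ^ deg d l).+2)%N.
    by rewrite leq_mul2r (leq_trans szF) ?orbT// (leq_trans b18)// (leq_trans bn) ?leq_addr.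
  rewrite BS; clear -E1 E2 bN; move: (bmax n n') ((d.+1 ^ deg d l).+2) bN E1 E2 => b m' bN E1 E2.
  by move: (b * d)%N (size F * m')%N ((n + n') * d)%N ((n + n') * m')%N E1 E2; lia.
- move=> r c rb cd; have rN : (r < n + n')%N by apply: (leq_trans rb); apply: (leq_trans bN); exact: leq_addr.
  have rd : (r.+1 * d <= (n + n') * d)%N by rewrite leq_mul2r rN orbT.
  rewrite raw ?rmem_input//; rewrite mulSn in rd; clear -rd cd.
  by move: ((n + n') * d)%N (r * d)%N rd; lia.
Qed.

End Learned.

Section Evaluation.
Variables (K : realType) (d k : nat) (f : 'I_k -> Rn K d -> bool) (l b : nat).
Variables (pt : nat -> Rn K d) (desc : seq K) (F : seq (filt K k)) (x : Rn K d).
Local Notation den := (den f).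
Local Notation m := (d.+1 ^ l)%N.
Local Notation gd := (good m (feat l) (S1 b 0 pt)).
Local Notation zt := (zeta m (feat l) (S1 b 0 pt)).
Local Notation st0 := (load [:: d; k; size desc] (tval x ++ desc)).
Hypotheses (enc : encodes l b pt desc F) (lsz : (l <= size desc)%N).

Lemma DECODEP st v w (y : nat) : [&& v != vz, v != vad, v != BASE, w != v & w != vz] ->
  rmem st (nmem st vad) = y%:R -> (nmem st vad < nmem st BASE)%N -> (y <= nmem st w)%N ->
  nmem (den (DECODE v w) st) v = y.
Proof.
move=> /and5P[v1 v2 v3 v4 v5] yE aB yw; rewrite /DECODE (den_PSeq f (PN _ _)) den_PN /=.
set st1 := nset st v 0.
have wE : nmem st1 w = nmem st w by rewrite /st1 nmem_nset (negPf v4).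
have aE : nmem st1 vad = nmem st vad by rewrite /st1 nmem_nset eq_sym (negPf v2).
have BE : nmem st1 BASE = nmem st BASE by rewrite /st1 nmem_nset eq_sym (negPf v3).
set p := PIf _ _ _.
have ok : okfor vz w p.
  by rewrite /okfor /= !inE !(eq_sym _ v) v1 (eq_sym vz) v5 /= (eq_sym v) v4 v3.
have := for_rule (f := f) (st := st1) (v := vz) (w := w) (p := p)
  (I := fun i s => nmem s v = minn i y) ok.
rewrite wE => H; rewrite H ?(minn_idPr yw)//.
  by move=> s [fn _ _] _; rewrite fn ?min0n ?inE// /st1 nmem_nset eqxx.
move=> i s iw si [fn fa fr] IH; rewrite nmem_nset (negPf v1).
have aS : nmem s vad = nmem st vad by rewrite fn ?aE//= !inE (eq_sym _ v) (negPf v2).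
rewrite /p den_PIf /= aS fr ?BE// /st1 rmem_nset yE si ler_nat.
by case: leqP => iy; rewrite ?den_PSkip ?den_PN ?nmem_nset ?eqxx /= ?IH ?si; lia.
Qed.

Definition ptx (r : nat) : Rn K d := if r is r'.+1 then pt r' else x.

Lemma S1_ptx : S1 b 1 ptx = S1 b 0 pt.
Proof. by apply: eq_map => r; rewrite addn1 addn0. Qed.

Lemma raw_desc a : rmem st0 (d + a) = nth 0 desc a.
Proof. by rewrite /= nth_cat size_tuple ifN ?addKn// -leqNgt leq_addr. Qed.

Lemma raw_point c : (c < d)%N -> rmem st0 c = nth 0 (tval x : seq K) c.
Proof. by move=> cd; rewrite /= nth_cat size_tuple cd. Qed.

Lemma FIELDP st v i (y : nat) : [&& v != vz, v != vad, v != BASE, v != vsz & v != TMP] ->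
  nmem st vend = nmem st BASE -> (0 < i <= nmem st BASE)%N -> (y <= nmem st vsz)%N ->
  rmem st (nmem st BASE - i) = y%:R -> nmem (den (FIELD v i) st) v = y.
Proof.
move=> /and5P[v1 v2 v3 v4 _] eE iB ys rE; rewrite /FIELD (den_PSeq f (PN _ _)) den_PN /= eE.
apply: DECODEP; first by rewrite v1 v2 v3 eq_sym v4.
- by rewrite rmem_nset nmem_nset.
- by case/andP: iB => i0 iB; rewrite !nmem_nset/= ltn_subrL i0 (leq_trans i0 iB).
- by rewrite nmem_nset.
Qed.

Definition entered st := [/\ forall a, (a < d + size desc)%N -> rmem st a = rmem st0 a,
  nmem st BASE = (d + size desc)%N /\ nmem st vD = d, nmem st vK = k &
  [/\ nmem st vsz = size desc, nmem st vOFF = 0%N & nmem st vend = (d + size desc)%N]].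

Lemma ENTRYP : entered (den ENTRY st0).
Proof.
rewrite /ENTRY (den_PSeq f (PN _ _)) (den_PSeq f (PN _ _)) (den_PSeq f (PN _ _)) !den_PN /=.
by split=> //; split.
Qed.

Lemma entered_den p st : pure p -> all (fun v => v \notin nwrites p) [:: BASE; vD; vK; vsz; vOFF; vend] ->
  entered st -> entered (den p st).
Proof.
move=> pp /and5P[v1 v2 v3 v4 /and3P[v5 v6 _]] [E1 [E2 E2'] E3 [E4 E5 E6]].
split; [move=> a aB|split|by rewrite den_nframe|split]; rewrite ?den_nframe//.
by rewrite den_rframe ?E1// E2.
Qed.

Lemma FIELDSP st : entered st -> let s := den FIELDS st in
  [/\ entered s, nmem s vL = l, nmem s vB = b & nmem s vF = size F].
Proof.
move=> E /=; rewrite /FIELDS (den_PSeq f (FIELD _ _)) (den_PSeq f (FIELD _ _)).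
have [szE _ _ [H1 H2 H3]] := enc.
have E1 : entered (den (FIELD vL 3) st) by apply: entered_den.
have E2 : entered (den (FIELD vB 2) (den (FIELD vL 3) st)) by apply: entered_den.
have E3 := entered_den (p := FIELD vF 1) isT isT E2.
set e := (b * d + size F * m.+2 + b)%N in szE H1 H2 H3.
have Fsz : (size F <= size F * m.+2)%N by rewrite leq_pmulr.
have key st' i y : entered st' -> (0 < i <= 3)%N -> nth 0 desc (size desc - i) = y%:R ->
  (y <= size desc)%N -> forall v, [&& v != vz, v != vad, v != BASE, v != vsz & v != TMP] ->
    nmem (den (FIELD v i) st') v = y.
  case=> A1 [A2 _] _ [A4 _ A6] i3 yE ysz v vv; apply: FIELDP => //.
  - by rewrite A2.
  - by rewrite A2 szE; lia.
  - by rewrite A4.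
  - rewrite A2 A1 ?szE; last by lia.
    by rewrite -addnBA -?szE ?raw_desc// szE; lia.
split=> //.
- rewrite den_nframe// den_nframe//; apply: key => //.
  by rewrite szE addnK.
- rewrite den_nframe//; apply: key => //; last by rewrite szE; lia.
  by rewrite szE (_ : e + 3 - 2 = e.+1)%N//; lia.
- apply: key => //; last by rewrite szE; lia.
  by rewrite szE (_ : e + 3 - 1 = e.+2)%N//; lia.
Qed.

Lemma LAYOUTP st : entered st -> nmem st vL = l -> nmem st vB = b -> nmem st vF = size F ->
  let s := den LAYOUT st in [/\ entered s, ctx m b.+1 b 1 s, nmem s vL = l,
    nmem s vmm = m.+2 /\ nmem s vF = size F & nmem s vad = (d + b * d)%N].
Proof.
move=> E LE BE FE; have E1 : entered (den LAYOUT st) by apply: entered_den.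
have L1 : nmem (den LAYOUT st) vL = l by rewrite den_nframe.
have F1 : nmem (den LAYOUT st) vF = size F by rewrite den_nframe.
have B1 : nmem (den LAYOUT st) vB = b by rewrite den_nframe.
have [_ [_ DE] _ _] := E.
suff [h1 h2 h3 h4 h5] : let s := den LAYOUT st in [/\ nmem s vM = m, nmem s vN = b.+1, nmem s vO = 1%N,
    nmem s vmm = m.+2 & nmem s vad = (d + b * d)%N] by split.
move=> {E1 L1 F1 B1} /=.
rewrite /LAYOUT (den_PSeq f (PN _ _)) (den_PSeq f (POW _ _ _)) (den_PSeq f (PN _ _)) (den_PSeq f (PN _ _))
  (den_PSeq f (PN _ _)) (den_PSeq f (mul _ _ _)).
rewrite [den (PN vd1 _) _]den_PN /= DE addn1; set s1 := nset _ _ _.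
have M2 : nmem (den (POW vM vd1 vL) s1) vM = m.
  by rewrite POWP// /s1 !nmem_nset/= LE.
have [n2 _ _] := den_framed f (p := POW vM vd1 vL) s1 isT isT.
move: (den (POW _ _ _) s1) M2 n2 => s2 M2 n2.
have D2' : nmem s2 vD = d by rewrite n2.
have B2' : nmem s2 vB = b by rewrite n2.
rewrite [den (PN vmm _) _]den_PN [den (PN vN _) _]den_PN [den (PN vO _) _]den_PN den_mul// den_PN /=.
by rewrite !nmem_nset/= M2 D2' B2' addn2 addn1.
Qed.

Lemma DOTQP st c e : entered st -> nmem st vM = m -> (c < size F)%N ->
  nmem st vad = (d + (b * d + c * m.+2))%N ->
  (forall j, (j < m)%N -> ar st 0 j = zt x j) -> ar st 8 0 = 0 ->
  ar (den DOTQ st) 8 0 = pv m zt (nth e F c).2 x.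
Proof.
move=> E ME cF aE ZE a8; have [szE _ H _] := enc; have [_ _ H3] := H e c cF.
apply: (for_sum_0 (g := fun j => (nth e F c).2 j * zt x j) ME a8) => //.
move=> j s jm sj fr; rewrite ar_incr//=; congr (_ + _ * _); last first.
  by rewrite reval_arr/= sj; case: fr => _ fa _; rewrite fa// ZE.
have [fn fa fr'] := fr; have [E1 [E2 _] _ _] := E.
have cl : (c.+1 * m.+2 <= size F * m.+2)%N by rewrite leq_mul2r cF orbT.
rewrite mulSn in cl.
rewrite fn// sj aE fr' ?E2 ?E1 ?szE; try by lia.
by rewrite -(H3 j jm) -raw_desc; congr (rmem _ _); lia.
Qed.

Lemma CHECKP st c (e : filt K k) (g : bool) : entered st -> nmem st vM = m -> (c < size F)%N -> nmem st vmm = m.+2 ->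
  nmem st vad = (d + (b * d + c * m.+2))%N -> (forall j, (j < m)%N -> ar st 0 j = zt x j) ->
  ar st 1 0 = g%:R ->
  ar (den CHECK st) 1 0 = (g && ~~ cuts f m b zt (nth e F c) x)%:R /\
  nmem (den CHECK st) vad = (d + (b * d + c.+1 * m.+2))%N.
Proof.
move=> E ME cF mmE aE ZE gE; have [szE _ H _] := enc; have [H1 H2 H3] := H e c cF.
have cl : (c.+1 * m.+2 <= size F * m.+2)%N by rewrite leq_mul2r cF orbT.
rewrite mulSn in cl.
rewrite /CHECK (den_PSeq f (DECODE _ _)) (den_PSeq f (PAsk _ _ _)) (den_PSeq f (PA _ _ _)) (den_PSeq f DOTQ)
  (den_PSeq f (PIf _ _ _)).
have [E1 [E2 E2'] E3 [E4 E5 E6]] := E.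
have hE : nmem (den (DECODE vh vK) st) vh = (nth e F c).1.1.
  apply: DECODEP => //.
  - by rewrite aE E1 ?raw_desc ?H1// szE; lia.
  - by rewrite aE E2 szE; lia.
  - by rewrite E3 ltnW.
have [n1 a1 r1'] := den_framed f (p := DECODE vh vK) st isT isT.
have Ed := entered_den (p := DECODE vh vK) isT isT E.
move: (den (DECODE vh vK) st) hE n1 a1 r1' Ed => s1 hE n1 a1 r1' Ed.
rewrite [den (PAsk _ _ _) _]den_PAsk /= hE.
have -> : ask f s1 (nth e F c).1.1 0 = f (nth e F c).1.1 x.
  rewrite /ask valK; congr (f _ _); apply: eq_from_tnth => i; rewrite tnth_mktuple add0n.
  by case: Ed => E1' _ _ _; rewrite E1' ?raw_point -?tnth_nth//; have := ltn_ord i; lia.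
set ans := f _ x; rewrite [den (PA _ _ _) _]den_PA /=.
set s2 := aset _ _ _ _.
have n2 v : v != vans -> nmem s2 v = nmem s1 v by move=> /negPf vv; rewrite /s2 nmem_aset nmem_nset vv.
have ans2 : nmem s2 vans = ans by rewrite /s2 nmem_aset nmem_nset.
have a2 c' i : (c' < 16)%N -> c' != 8%N -> ar s2 c' i = ar st c' i.
  by move=> cl' c8; rewrite /s2 ar_aset// (negPf c8) ar_nset// a1.
have E2s : entered s2.
  case: Ed => A1 [A2 A2'] A3 [A4 A5 A6]; split=> [a aB|||]; rewrite ?n2//.
  by rewrite /s2 rmem_aset ?rmem_nset ?A1// nmem_nset/= A2.
have dE := DOTQP (st := s2) (c := c) e E2s.
have {}dE : ar (den DOTQ s2) 8 0 = pv m zt (nth e F c).2 x.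
  apply: dE => //; rewrite ?n2 ?n1//; last by rewrite /s2 ar_aset.
  by move=> j jm; rewrite a2// ZE.
have [n3 a3 r3'] := den_framed f (p := DOTQ) s2 isT isT.
have E3s := entered_den (p := DOTQ) isT isT E2s.
move: (den DOTQ s2) dE n3 a3 r3' E3s => s3 dE n3 a3 r3' E3s.
have ad3 : nmem s3 vad = (d + (b * d + c * m.+2))%N by rewrite n3// n2// n1.
have tE : rmem s3 (nmem s3 vad + 1) = (nth e F c).1.2%:R / (b ^ 18)%:R.
  case: E3s => A1 _ _ _; rewrite ad3 A1 ?szE; last by lia.
  by rewrite -H2 -raw_desc; congr (rmem _ _); lia.
have g3 : ar s3 1 0 = g%:R by rewrite a3// a2.
have ans3 : nmem s3 vans = ans by rewrite n3.
have mm3 : nmem s3 vmm = m.+2 by rewrite n3// n2// n1.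
rewrite den_PN [den (PIf _ _ _) _]den_PIf /= reval_arr/= dE tE ar_nset// nmem_nset /cuts -/ans.
rewrite [in X in X /\ _](_ : (pv m zt (nth e F c).2 x <= (nth e F c).1.2%:R / (b ^ 18)%:R) =
  ~~ ((nth e F c).1.2%:R / (b ^ 18)%:R < pv m zt (nth e F c).2 x)); last by rewrite -leNgt.
set t := (_ < pv _ _ _ _).
rewrite (_ : (pv m zt (nth e F c).2 x <= (nth e F c).1.2%:R / (b ^ 18)%:R) = ~~ t); last by rewrite -leNgt.
case: t => /=.
  rewrite den_PIf /= ans3; case: (ans) => /=; rewrite ?den_PSkip ?den_PA /= ?ar_aset//= ?nmem_aset;
  by rewrite ?g3 ?andbF ?andbT ad3 mm3 mulSn; split=> //; lia.
by rewrite den_PSkip g3 andbF andbT ad3 mm3 mulSn; split=> //; lia.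
Qed.

Lemma EVALP : nmem (den EVAL st0) 0 = sel f m b zt gd F x.
Proof.
rewrite /EVAL (den_PSeq f ENTRY) (den_PSeq f FIELDS) (den_PSeq f LAYOUT) (den_PSeq f BASIS) (den_PSeq f CHECKS).
have [E1 L1 B1 F1] := FIELDSP ENTRYP.
have [E2 C2 L2 [mm2 F2] ad2] := LAYOUTP E1 L1 B1 F1.
move: (den LAYOUT _) E2 C2 L2 mm2 F2 ad2 => s2 E2 C2 L2 mm2 F2 ad2.
have [szE Hp H _] := enc.
have [raw [BS DE] KE [_ OFF _]] := E2.
have rp : rawpts ptx (nmem s2 vOFF) b.+1 s2.
  move=> r c rb cd; rewrite OFF add0n BS szE.
  have rd : (r.+1 * d <= b.+1 * d)%N by rewrite leq_mul2r rb orbT.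
  rewrite !mulSn in rd.
  split; first by lia.
  rewrite raw; last by rewrite szE; lia.
  case: r rb rd => [|r] rb rd; first by rewrite mul0n add0n raw_point.
  have -> : (r.+1 * d + c = d + (r * d + c))%N by rewrite mulSn addnA.
  by rewrite raw_desc Hp.
have bN : (b + 1 <= b.+1)%N by lia.
have [MB gB] := BASISP f bN C2 DE L2 rp; rewrite S1_ptx in MB gB.
have E3 := entered_den (p := BASIS) isT isT E2.
have [n3 _ _] := den_framed f (p := BASIS) s2 isT isT.
move: (den BASIS s2) MB gB E3 n3 => s3 MB gB E3 n3.
(* An element of the list is wanted as the default value of [nth]; the empty list, without any check
   to run, is treated apart. *)
have [[e _]|F0] : (exists e : filt K k, True) \/ F = [::] by case: (F) => [|e ?]; [right|left; exists e].
- suff a1 : ar (den CHECKS s3) 1 0 = (sel f m b zt gd F x)%:R.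
    rewrite /ANSWER den_PIf /= reval_arr/= a1 ler1n lt0b.
    by case: (sel _ _ _ _ _ _ _); rewrite den_PN.
  have := for_rule (f := f) (st := s3) (v := vround) (w := vF) (p := CHECK)
    (I := fun c s => ar s 1 0 = (gd x && all (fun e => ~~ cuts f m b zt e x) (take c F))%:R /\
      nmem s vad = (d + (b * d + c * m.+2))%N) isT.
  have -> : nmem s3 vF = size F by rewrite n3.
  rewrite -/CHECKS => -[].
  + move=> s [fn fa _] _; rewrite take0 andbT fa// gB// fn// n3// ad2; split=> //; lia.
  + move=> c s cF _ [fn fa fr] [I1 I2]; rewrite ar_nset// nmem_nset/=.
    have Es : entered s.
      have [A1 [A2 A2'] A3 [A4 A5 A6]] := E3; split; [move=> a aB| | |]; rewrite ?fn//.
      by rewrite fr ?A1// A2.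
    have [|||CA CB] := CHECKP (c := c) e Es _ cF _ I2 _ I1.
    * by rewrite fn// n3//; case: C2.
    * by rewrite fn// n3.
    * by move=> j jm; rewrite fa// -(MB 0%N j)// mul0n.
    rewrite CA CB; split=> //.
    rewrite (take_nth e)// all_rcons -andbA; congr (nat_of_bool (_ && _))%:R.
    exact: andbC.
  + by rewrite take_size.
- rewrite /sel F0 andbT /ANSWER den_PIf /= reval_arr/=.
  have -> : ar (den CHECKS s3) 1 0 = ar s3 1 0.
    have := @for_raw _ _ _ f (fun _ s => ar s 1 0 = ar s3 1 0) vround vF CHECK s3.
    have -> : nmem s3 vF = 0%N by rewrite n3// F2 F0.
    by apply=> //; rewrite ar_nset.
  rewrite gB// ler1n lt0b.
  by case: (good _ _ _ _); rewrite den_PN.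
Qed.

End Evaluation.

(** * Running time *)

Section Costs.
Variables (K : realType) (d k : nat) (f : 'I_k -> Rn K d -> bool) (W kk : nat).
Hypotheses (W0 : (0 < W)%N) (kk0 : (0 < kk)%N).

(** One bound shape for all stages, so that sequences add their text sizes: at most six nested loops
    bounded by [W] and one by [k]. Stages are bounded separately because the loop bounds of one are
    computed by those before it. *)
Definition cheap (p : prog) (st : store K) : Prop := (cost f p st <= csize p * (W ^ 6 * kk))%N.

Lemma cheap_loops (s : seq nat) p st : [&& wf p, all [predC nwrites p] (bvars p),
  (depth 2 p <= 6)%N, (kdepth 2 p <= 1)%N & all (mem s) (bvars p)] ->
  all (fun w => (nmem st w <= if w == 2%N then kk else W)%N) s -> cheap p st.
Proof.
move=> /and5P[wp ap d6 k1 /allP bs] /allP H.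
apply: leq_trans (cost_le f wp ap W0 kk0 (fun w wb => H w (bs w wb))) _.
rewrite leq_mul2l; apply/orP; right; apply: leq_mul; first by rewrite leq_pexp2l.
by rewrite -[leqRHS]expn1 leq_pexp2l.
Qed.

Lemma cheap_seq p q st : cheap p st -> cheap q (den f p st) -> cheap (PSeq p q) st.
Proof.
rewrite /cheap => Hp Hq.
have -> : cost f (PSeq p q) st = (cost f p st + cost f q (den f p st))%N by [].
apply: (leq_trans (leq_add Hp Hq)).
by rewrite -mulnDl leq_mul2r; apply/orP; right; rewrite /=.
Qed.

End Costs.

Section LearnCost.
Variables (K : realType) (d l k : nat) (f : 'I_k -> Rn K d -> bool) (n n' : nat).
Variables (R beta eps : K) (S : n.-tuple (Rn K d)) (S' : n'.-tuple (Rn K d)).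
Local Notation den := (den f).
Local Notation dg := (deg d l).
Local Notation m := (d.+1 ^ dg)%N.
Local Notation b := (bmax n n').
Local Notation st0 := (learner_input l k R beta eps S S').
Local Notation X := (n + n' + d.+1 ^ l + 40)%N.
Local Notation W := (X ^ 2)%N.
Local Notation cheap := (cheap f W k).
Hypotheses (k0 : (0 < k)%N) (l0 : (0 < l)%N) (b2 : (2 <= b)%N).

Lemma W0 : (0 < W)%N. Proof. by rewrite expn_gt0 addn_gt0 orbT. Qed.
Lemma X_W c : (c <= X)%N -> (c <= W)%N.
Proof. by move=> cX; rewrite (leq_trans cX)// -{1}(expn1 X) leq_pexp2l// addn_gt0 orbT. Qed.

Lemma deg_le : (m <= d.+1 ^ l)%N.
Proof. by rewrite leq_pexp2l// /deg; case: ifP. Qed.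

Lemma deg_leX : (dg <= d.+1 ^ l)%N.
Proof. by rewrite /deg; case: (leqP d 0) => // d0; apply: ltnW; exact: ltn_expl. Qed.

Lemma bexp_le e : (e <= 40)%N -> (b ^ e <= n)%N.
Proof.
move=> e40; have [bn _] := bmaxP n n'; apply: leq_trans bn.
by rewrite leq_pexp2l// (leq_trans _ b2).
Qed.

Lemma dS_le : (d.+1 <= d.+1 ^ l)%N.
Proof. by rewrite -{1}(expn1 d.+1) leq_pexp2l. Qed.

Lemma b_le : (b <= n)%N. Proof. by rewrite -{1}(expn1 b) bexp_le. Qed.

Lemma cheap_sizes (st : store K) : nmem st 0 = d -> nmem st 1 = dg -> nmem st 3 = n -> nmem st 4 = n' ->
  cheap SIZES st.
Proof.
move=> D L E3 E4; have c := @cheap_loops _ _ _ f W k W0 k0.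
have dS := dS_le; have dX := deg_leX.
have dW : (d.+1 <= W)%N by apply: X_W; lia.
have lW : (dg <= W)%N by apply: X_W; lia.
have NW : (n + n' <= W)%N by apply: X_W; lia.
do 2 (apply: cheap_seq; first by [exact: (c [::])|
  apply: (c [:: 1; 38]%N) => //=; rewrite den_PN !nmem_nset/= D L addn1 dW lW]).
set st2 := den (POW _ _ _) _.
do 2 (apply: cheap_seq; first exact: (c [::])).
have NE : nmem (den (PN 8 (NAdd (var 3) (var 4))) (den (PN 33 (NAdd (var 7) (NLit 2))) st2)) 8 = (n + n')%N.
  rewrite den_PN nmem_nset /= den_PN !nmem_nset/= /st2 !den_nframe// E3 E4 //.
apply: cheap_seq; first by apply: (c [:: 8]%N) => //=; rewrite NE NW.
by apply: (c [:: 8]%N) => //=; rewrite den_nframe// NE NW.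
Qed.

Lemma cheap_prep : cheap PREP st0.
Proof.
have c := @cheap_loops _ _ _ f W k W0 k0.
apply: cheap_seq; first exact: (c [::]).
have n1 v : v != 1%N -> nmem (den FIXL st0) v = nmem st0 v.
  by move=> vL'; rewrite den_nframe//= inE.
have L1 : nmem (den FIXL st0) 1 = dg.
  by rewrite /FIXL den_PIf /= /deg; case: ifP => _; rewrite ?den_PN ?den_PSkip.
move: (den FIXL st0) n1 L1 => s1 n1 L1.
apply: cheap_seq; first by apply: cheap_sizes => //; rewrite n1.
have n2 v : v \notin nwrites SIZES -> v != 1%N -> nmem (den SIZES s1) v = nmem st0 v.
  by move=> v1 v2; rewrite den_nframe// n1.
move: (den SIZES s1) n2 => s2 n2.
apply: cheap_seq; first exact: (c [::]).
have n3 v : v \notin BASE :: nwrites SIZES -> v != 1%N -> nmem (den SETBASE s2) v = nmem st0 v.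
  by rewrite inE negb_or => /andP[v1 v2] v3; rewrite den_nframe ?n2//= inE.
move: (den SETBASE s2) n3 => s3 n3.
have nW : (n <= W)%N by apply: X_W; lia.
have eW e : (e <= 40)%N -> (e <= W)%N by move=> e40; apply: X_W; lia.
apply: cheap_seq.
  apply: cheap_seq; first exact: (c [::]).
  by apply: (c [:: 3; 37]%N) => //=; rewrite den_PN !nmem_nset/= n3//= nW eW.
have B4 : nmem (den SEARCH s3) 9 = b by rewrite SEARCHP ?n3.
move: (den SEARCH s3) B4 => s4 B4.
have bW : (b <= W)%N by apply: X_W; have := b_le; lia.
have pw p e (st : store K) : nmem st 9 = b -> [&& p \in [:: 12; 14; 34; 31]%N & (e <= 40)%N] ->
    cheap (POW p 9 37) (den (PN 37 (NLit e)) st).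
  move=> bE /andP[pin e40]; apply: (c [:: 9; 37]%N); last by rewrite /= den_PN !nmem_nset/= bE bW eW.
  by move: pin; rewrite !inE => /or4P[] /eqP->.
rewrite /POWERS.
apply: cheap_seq; first exact: (c [::]).
apply: cheap_seq; first exact: pw.
apply: cheap_seq; first exact: (c [::]).
apply: cheap_seq; first by apply: pw => //; rewrite !den_nframe.
apply: cheap_seq; first exact: (c [::]).
apply: cheap_seq; first by apply: pw => //; rewrite !den_nframe.
apply: cheap_seq; first exact: (c [::]).
apply: cheap_seq; first exact: (c [::]).
apply: cheap_seq; first by apply: pw => //; rewrite !den_nframe.
exact: (c [::]).
Qed.

Lemma cheap_train st : prepared l k R beta eps S S' st -> cheap TRAIN st.
Proof.
case=> [[ME NE BE OE] [DE LE KE nE n'E] [TE HE CE MxE ZE] _ _].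
apply: (@cheap_loops _ _ _ f W k W0 k0 [:: 8; 7; 0; 1; 9; 13; 2; 12; 31; 34]%N) => //=.
have d1 := dS_le; have m1 := deg_le; have l1 := deg_leX; have b1 := b_le.
have e1 := bexp_le (isT : 16 <= 40)%N; have e2 := bexp_le (isT : 19 <= 40)%N.
have e3 := bexp_le (isT : 36 <= 40)%N.
have Hn c : (c <= n)%N -> (c <= W)%N.
  by move=> cn; apply: X_W; rewrite (leq_trans cn)// -!addnA leq_addr.
have HD c : (c <= d.+1 ^ l)%N -> (c <= W)%N.
  by move=> cn; apply: X_W; rewrite (leq_trans cn)// addnAC leq_addl.
have NW : (n + n' <= W)%N by apply: X_W; rewrite -addnA leq_addr.
have dW : (d <= W)%N by apply: HD; exact: ltnW.
rewrite NE ME DE LE BE MxE KE TE ZE CE leqnn NW dW /=.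
by rewrite (HD _ m1) (HD _ l1) (Hn _ b1) (Hn _ e1) (Hn _ e2) (Hn _ e3).
Qed.

Hypotheses (Rb2 : 2 * (1 + R) <= b%:R) (Rgt1 : 1 < R).

(** The reason for the square in [W]: the output loops have the products [b * d] and
    [size F * (m + 2)] as bounds. *)
Lemma X2_W a c : (a <= X)%N -> (c <= X)%N -> (a * c <= W)%N.
Proof. by move=> aX cX; rewrite -mulnn leq_mul. Qed.

Lemma cheap_learn : cheap LEARN st0.
Proof.
have [F [LF sF [F1 F2] [B1 D1 L1 BS] raw]] := TRAINP l f beta eps S S' k0 b2 Rb2 Rgt1.
have [_ szF _ _] := LF.
apply: cheap_seq; first exact: cheap_prep.
apply: cheap_seq; first exact: (cheap_train (PREPP l f R beta eps S S')).
move: (den TRAIN _) F1 F2 B1 D1 {L1 BS raw sF} => st F1 F2 B1 D1.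
have c := @cheap_loops _ _ _ f W k W0 k0.
have d1 := dS_le; have m1 := deg_le; have b1 := b_le.
have s1 : (size F <= n)%N := leq_trans szF (bexp_le (isT : 18 <= 40)%N).
have bW : (b <= W)%N by apply: X_W; lia.
apply: cheap_seq; first by apply: (c [:: 9]%N) => //=; rewrite B1 bW.
have bd2 : nmem (den (mul 40 9 0) st) 40 = (b * d)%N by rewrite den_mul// !nmem_nset/= B1 D1.
have fp2 : nmem (den (mul 40 9 0) st) 30 = (size F * m.+2)%N by rewrite den_nframe.
move: (den (mul _ _ _) st) bd2 fp2 => s2 bd2 fp2.
have bdW : (b * d <= W)%N by apply: X2_W; lia.
have fpW : (size F * m.+2 <= W)%N by apply: X2_W; lia.
apply: cheap_seq; first by apply: (c [:: 40]%N) => //=; rewrite bd2 bdW.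
apply: cheap_seq; last exact: (c [::]).
by apply: (c [:: 30]%N) => //=; rewrite den_nframe// fp2 fpW.
Qed.

(** The bound is free of [n'], as the time of an evaluation has to be. *)
Lemma desc_size F (desc : seq K) : learned l f R S S' F -> encodes dg b (sample S S') desc F ->
  (size desc <= 4 * (n + d.+1 ^ l + 40) ^ 2)%N.
Proof.
clear k0 Rb2 Rgt1; move=> [_ szF _ _] [-> _ _ _].
have d1 := dS_le; have m1 := deg_le; have b1 := b_le.
have s1 : (size F <= n)%N := leq_trans szF (bexp_le (isT : 18 <= 40)%N).
set Y := (n + _ + 40)%N; have H a c : (a <= Y)%N -> (c <= Y)%N -> (a * c <= Y ^ 2)%N.
  by move=> aY cY; rewrite -mulnn leq_mul.
have h1 : (b * d <= Y ^ 2)%N by apply: H; rewrite /Y; lia.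
have h2 : (size F * m.+2 <= Y ^ 2)%N by apply: H; rewrite /Y; lia.
have h3 : (b * 1 <= Y ^ 2)%N by apply: H; rewrite /Y; lia.
have h4 : (3 * 1 <= Y ^ 2)%N by apply: H; rewrite /Y; lia.
by move: (Y ^ 2)%N h1 h2 h3 h4 => Z; rewrite !muln1; lia.
Qed.

End LearnCost.

Section EvalCost.
Variables (K : realType) (d l k : nat) (f : 'I_k -> Rn K d -> bool) (n n' : nat) (R : K).
Variables (S : n.-tuple (Rn K d)) (S' : n'.-tuple (Rn K d)).
Local Notation den := (den f).
Local Notation dg := (deg d l).
Local Notation m := (d.+1 ^ dg)%N.
Local Notation b := (bmax n n').
Local Notation Y := (n + d.+1 ^ l + 40)%N.
Local Notation W := (4 * Y ^ 2)%N.
Local Notation cheap := (cheap f W k).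
Variables (F : seq (filt K k)) (desc : seq K) (x : Rn K d).
Hypotheses (k0 : (0 < k)%N) (l0 : (0 < l)%N) (b2 : (2 <= b)%N) (dgb : (dg <= b)%N).
Hypotheses (LF : learned l f R S S' F) (enc : encodes dg b (sample S S') desc F).
Local Notation st0 := (load [:: d; k; size desc] (tval x ++ desc)).

Lemma deg_desc : (dg <= size desc)%N.
Proof. by have [-> _ _ _] := enc; lia. Qed.

Lemma cheap_eval : cheap EVAL st0.
Proof.
have W1 : (0 < W)%N by rewrite muln_gt0 expn_gt0 addn_gt0 orbT.
have c := @cheap_loops _ _ _ f W k W1 k0.
have d1 := dS_le d l0; have m1 := deg_le d l; have l1 := deg_leX d l; have b1 := b_le b2.
have sz := desc_size l0 b2 LF enc; have [szE _ _ _] := enc.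
have Y_W e : (e <= Y)%N -> (e <= W)%N.
  move=> eY; apply: (leq_trans eY).
  by rewrite -mulnn mulnA leq_pmull// muln_gt0 addn_gt0 orbT.
have s1 : (size F <= n)%N by have [_ szF _ _] := LF; exact: leq_trans szF (bexp_le b2 (isT : 18 <= 40)%N).
apply: cheap_seq; first exact: (c [::]).
have E1 := @ENTRYP K d k f desc x.
move: (den ENTRY _) E1 => s1' E1'.
have [E2 L2 B2 F2] := FIELDSP f enc deg_desc E1'.
apply: cheap_seq; first by apply: (c [:: 41]%N) => //=; case: E1' => _ _ _ [-> _ _]; rewrite sz.
move: (den FIELDS s1') E2 L2 B2 F2 => s2 E2 L2 B2 F2.
have [E3 [M3 N3 B3 _] L3 [_ F3] _] := LAYOUTP f E2 L2 B2 F2.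
have D2 : nmem s2 0 = d by case: E2 => _ [].
have dW : (d.+1 <= W)%N by apply: Y_W; lia.
have lW : (dg <= W)%N by apply: Y_W; lia.
have bW : (b <= W)%N by apply: Y_W; lia.
apply: cheap_seq.
  apply: cheap_seq; first exact: (c [::]).
  apply: cheap_seq; first by apply: (c [:: 1; 38]%N) => //=; rewrite den_PN !nmem_nset/= D2 L2 addn1 dW lW.
  have B4 : nmem (den (POW 7 38 1) (den (PN 38 (NAdd (var 0) (NLit 1))) s2)) 9 = b by rewrite !den_nframe.
  move: (den (POW 7 38 1) _) B4 => s3 B4.
  do 3 (apply: cheap_seq; first exact: (c [::])).
  apply: cheap_seq; last exact: (c [::]).
  by apply: (c [:: 9]%N) => //=; rewrite !den_nframe// B4 bW.
move: (den LAYOUT s2) E3 M3 N3 B3 L3 F3 => s4 E3 M3 N3 B3 L3 F3.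
have [_ [_ D4] K4 _] := E3.
apply: cheap_seq.
  apply: (c [:: 8; 7; 0; 1; 9]%N) => //=; rewrite N3 M3 D4 L3 B3 !Y_W//; lia.
apply: cheap_seq; last exact: (c [::]).
apply: (c [:: 29; 2; 7]%N) => //=; rewrite !den_nframe// F3 K4 M3 leqnn !Y_W//; lia.
Qed.

End EvalCost.

Import(canonicals) mpoly.

Section Polynomials.
Variables (K : realType).

(** The one shape of polynomial used for the sample size and for both running times. *)
Lemma poly_at_power q (a c : K) e : exists Q : mpoly.mpoly q K, forall v : q.-tuple K,
  poly_at Q v = c * (a + \sum_(i < q) tnth v i) ^+ e.
Proof.
exists (mpoly.mpolyC q c * (mpoly.mpolyC q a + \sum_(i < q) mpoly.mpolyX K (mpoly.mnm1 i)) ^+ e) => v.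
rewrite /poly_at mpoly.mevalM mpoly.mevalC rmorphXn /= mpoly.mevalD mpoly.mevalC rmorph_sum.
by congr (_ * (_ + _) ^+ _); apply: eq_bigr => i _; rewrite /= mpoly.mevalXU.
Qed.

End Polynomials.

(** * Statistical guarantees *)

Section Expectation.
Variables (d0 : measure_display) (V : measurableType d0) (K : realType) (mu : probability V K).
Implicit Types (g h : V -> K).

Lemma bounded_integrable g L : measurable_fun setT g -> (forall x, `|g x| <= L) ->
  mu.-integrable setT (EFin \o g).
Proof.
move=> mg gL; apply: (le_integrable measurableT _ _ (finite_measure_integrable_cst mu L measurableT)).
  exact/measurable_EFinP.
by move=> x _ /=; rewrite lee_fin (le_trans (gL x))// ler_norm.
Qed.

Definition mean g : K := fine (\int[mu]_x (g x)%:E).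

Lemma mean_EFin g L : measurable_fun setT g -> (forall x, `|g x| <= L) ->
  (\int[mu]_x (g x)%:E)%E = (mean g)%:E.
Proof.
by move=> mg gL; rewrite /mean fineK//; apply: integrable_fin_num => //; exact: bounded_integrable gL.
Qed.

Lemma mean_le g h L : measurable_fun setT g -> measurable_fun setT h ->
  (forall x, `|g x| <= L) -> (forall x, `|h x| <= L) -> (forall x, g x <= h x) -> mean g <= mean h.
Proof.
move=> mg mh gL hL gh; rewrite -lee_fin -(mean_EFin mg gL) -(mean_EFin mh hL).
apply: le_integral => //; [exact: bounded_integrable gL|exact: bounded_integrable hL|].
by move=> x _; rewrite lee_fin.
Qed.

Lemma meanB g h L : measurable_fun setT g -> measurable_fun setT h ->
  (forall x, `|g x| <= L) -> (forall x, `|h x| <= L) -> mean (g \- h) = mean g - mean h.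
Proof.
move=> mg mh gL hL; apply: EFin_inj; rewrite EFinB -(mean_EFin mg gL) -(mean_EFin mh hL).
rewrite -integralB//; [|exact: bounded_integrable gL|exact: bounded_integrable hL].
rewrite -(@mean_EFin _ (L + L)) //; first exact: measurable_funB.
by move=> x; rewrite (le_trans (ler_normB _ _))// lerD.
Qed.

Lemma mean_cst r : mean (cst r) = r.
Proof.
rewrite /mean; have := integral_cst mu measurableT (r%:E).
by rewrite [X in (_ * X)%E]probability_setT mule1 /cst => ->.
Qed.

Lemma mean_layers (e : nat -> V -> bool) (H : K) (Z : nat) : 0 <= H ->
  (forall z, measurable_fun setT (e z)) ->
  mean (fun x => H * \sum_(z < Z) (e z x)%:R) = H * \sum_(z < Z) fine (mu [set x | e z x]).
Proof.
move=> H0 me; have mS z : measurable [set x | e z x] by exact: measurable_bool_set.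
rewrite /mean; under eq_integral do rewrite EFinM.
rewrite ge0_integralZl_EFin//; last 2 first.
- by move=> x _; rewrite lee_fin sumr_ge0.
- apply/measurable_EFinP; apply: measurable_sum => z; exact: measurable_boolR.
under eq_integral do rewrite -sumEFin.
rewrite ge0_integral_sum//; last first.
  by move=> z; apply/measurable_EFinP; exact: measurable_boolR.
rewrite (eq_bigr (fun z : 'I_Z => (fine (mu [set x | e z x]))%:E)); last first.
  move=> z _; rewrite -(pr_fin mu (mS z)) -(setIT [set x | e z x]) -integral_indic//.
  apply: eq_integral => x _; rewrite indicE; congr (nat_of_bool _)%:R%:E.
  by apply/idP/idP => [ex|]; [exact: mem_set|rewrite inE].
by rewrite sumEFin.
Qed.

(** Layer cake for the empirical and for the true mean: discretization costs [1 / H], and deviations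
    at most [e] at [Z] levels cost [Z / H * e]. Means of bounded functions are thereby reduced to
    indicators, to which Hoeffding's bound applies. *)
Lemma emp_close (c : nat) (y : 'I_c -> V) g (H L e : K) (Z : nat) : (0 < c)%N -> 1 <= H ->
  measurable_fun setT g -> (forall x, 0 <= g x <= L) -> L * H <= Z%:R ->
  (forall z, (z < Z)%N -> `|\sum_(j < c) (z%:R / H < g (y j))%R%:R
     - c%:R * fine (mu [set x | (z%:R / H < g x)%R])| <= c%:R * e) ->
  `|c%:R^-1 * \sum_(j < c) g (y j) - mean g| <= H^-1 + Z%:R / H * e.
Proof.
move=> c0 H1 mg gL LZ dev; have H0 : 0 < H by apply: lt_le_trans H1.
have Hi : 0 <= H^-1 by rewrite invr_ge0 ltW.
have c0' : 0 < c%:R :> K by rewrite ltr0n.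
pose lc x := H^-1 * \sum_(z < Z) (z%:R / H < g x)%R%:R.
have lcE x : g x <= lc x <= g x + H^-1.
  have /andP[g0 gl] := gL x; have := @layer_cake K (g x) H Z H0.
  rewrite (max_l g0) => -> //; apply: le_trans LZ; by rewrite ler_wpM2r// ltW.
have me z : measurable_fun setT (fun x => (z%:R / H < g x)%R : bool).
  by apply: measurable_fun_ltr => //; exact: measurable_cst.
have mlc : measurable_fun setT lc.
  apply: measurable_funM; first exact: measurable_cst.
  by apply: measurable_sum => z; apply: measurable_boolR; exact: me.
have L0 : 0 <= L by have /andP[a b] := gL (y (Ordinal c0)); exact: le_trans b.
have gL' x : `|g x| <= L + H^-1 + H^-1.
  by have /andP[a b] := gL x; rewrite ger0_norm//; lra.
have lcL x : `|lc x| <= L + H^-1 + H^-1.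
  have /andP[a b] := gL x; have /andP[a' b'] := lcE x; rewrite ger0_norm//; lra.
have gHL x : `|g x + H^-1| <= L + H^-1 + H^-1.
  by have /andP[a b] := gL x; rewrite ger0_norm//; lra.
have mH : mean (fun x => g x + H^-1) = mean g + H^-1.
  rewrite (_ : (fun x => _) = g \- cst (- H^-1)); last by apply/funext => x; rewrite /= opprK.
  rewrite (@meanB _ _ (L + H^-1 + H^-1))//; last first.
    by move=> x /=; rewrite normrN ger0_norm//; move: L0; lra.
  by rewrite mean_cst opprK.
have l1 : mean g <= mean lc by apply: (@mean_le _ _ (L + H^-1 + H^-1)) => // x; have /andP[] := lcE x.
have l2 : mean lc <= mean g + H^-1.
  rewrite -mH; apply: (@mean_le _ _ (L + H^-1 + H^-1)) => //; last by move=> x; have /andP[] := lcE x.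
  by apply: measurable_funD => //; exact: measurable_cst.
have lcm : mean lc = H^-1 * \sum_(z < Z) fine (mu [set x | (z%:R / H < g x)%R]).
  exact: (mean_layers Z Hi me).
pose emp (h : V -> K) := c%:R^-1 * \sum_(j < c) h (y j).
have e1 : emp g <= emp lc.
  rewrite ler_wpM2l ?invr_ge0//; apply: ler_sum => j _; by have /andP[] := lcE (y j).
have e2 : emp lc <= emp g + H^-1.
  rewrite ler_pdivrMl// mulrDr mulVKf ?gt_eqF// mulr_natl -[in X in _ + X](card_ord c) -sumr_const -big_split/=.
  by apply: ler_sum => j _; have /andP[] := lcE (y j).
have close : `|emp lc - mean lc| <= Z%:R / H * e.
  have -> : emp lc - mean lc = H^-1 * \sum_(z < Z) (c%:R^-1 * (\sum_(j < c) (z%:R / H < g (y j))%R%:R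
     - c%:R * fine (mu [set x | (z%:R / H < g x)%R]))).
    rewrite lcm /emp -mulr_sumr mulrCA -mulrBr; congr (_ * _).
    rewrite exchange_big mulr_sumr -sumrB; apply: eq_bigr => z _ /=.
    by rewrite mulrBr mulKf// gt_eqF.
  rewrite normrM (ger0_norm Hi) (mulrC Z%:R) -mulrA ler_wpM2l//.
  apply: (le_trans (ler_norm_sum _ _ _)).
  apply: (@le_trans _ _ (\sum_(z < Z) e)); last by rewrite sumr_const card_ord mulr_natl.
  apply: ler_sum => z _; rewrite normrM normfV (gtr0_norm c0') ler_pdivrMl//.
  exact: dev.
rewrite -/(emp g); move: close; rewrite !ler_norml => /andP[? ?]; apply/andP; split; lra.
Qed.

End Expectation.

Lemma In_nth (T : Type) (x0 : T) s i : (i < size s)%N -> List.In (nth x0 s i) s.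
Proof. by elim: s i => // y s IH [|i] /= il; [left|right; exact: IH]. Qed.

(** * Finitely many outputs for a given [S1] *)

Section Codes.
Variables (K : realType) (d k : nat) (f : 'I_k -> Rn K d -> bool).
Variables (m b : nat) (R : K) (phi : Rn K d -> nat -> K).
Implicit Types (S : seq (Rn K d)) (x : Rn K d).

(** Hypothesis, level, number [t] of rounds, and the numerators of [q], which are at most
    [t * b ^ 19 <= b ^ 35]. A [code] has [b ^ 19] slots, more than there are cuts; the spare ones
    hold [None]. *)
Definition cutcode := ('I_k * 'I_(b ^ 36) * 'I_((b ^ 16).+1) * {ffun 'I_m -> 'I_((b ^ 35).+1)})%type.
Definition code := {ffun 'I_(b ^ 19) -> option cutcode}.

Definition cutc S (c : cutcode) x : bool :=
  f c.1.1.1 x && ((c.1.1.2 : nat)%:R / (b ^ 18)%:R < \sum_(j < m)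
    ((c.2 j : nat)%:R / (b ^ 18)%:R - (c.1.2 : nat)%:R * (1 + R)) * zeta m phi S x j).
Definition selc S (C : code) x : bool :=
  good m phi S x && [forall i, if C i is Some c then ~~ cutc S c x else true].

Lemma sel_code S F : (2 <= b)%N -> (forall c, List.In c F -> fcoded m b R c) -> (size F <= b ^ 18)%N ->
  exists C, forall x, sel f m b (zeta m phi S) (good m phi S) F x = selc S C x.
Proof.
move=> b2 cF sF.
have one (c : filt K k) : exists cc : cutcode, List.In c F -> forall x,
    cuts f m b (zeta m phi S) c x = cutc S cc x.
  have [i0 _] : exists i : 'I_k, True by exists c.1.1.
  have [cin|cin] := pselect (List.In c F); last first.
    have z0 : (0 < b ^ 36)%N by rewrite expn_gt0 (leq_trans _ b2).
    by exists (i0, Ordinal z0, ord0, [ffun=> ord0]).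
  have [zb [t tT [zz zzE]]] := cF c cin.
  have tT' : (t < (b ^ 16).+1)%N by [].
  exists (c.1.1, Ordinal zb, Ordinal tT', [ffun j : 'I_m => inord (zz j)]) => _ x.
  rewrite /cuts /cutc /=; congr (_ && (_ < _)); apply: eq_bigr => j _.
  have [z1 z2] := zzE j (ltn_ord j); rewrite z2 ffunE inordK// ltnS (leq_trans z1)//.
  by rewrite (_ : 35 = 16 + 19)%N// expnD leq_mul2r tT orbT.
have [cc ccE] := choice one.
have b1819 : (b ^ 18 <= b ^ 19)%N by rewrite leq_pexp2l// (leq_trans _ b2).
exists [ffun i : 'I_(b ^ 19) => omap cc (onth F i)] => x.
rewrite /sel /selc; congr (_ && _).
case: F ccE cF sF {one} => [|c0 F] ccE cF sF.
  by symmetry; apply/forallP => i; rewrite ffunE onthE nth_nil.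
have onthE' i : (i < size (c0 :: F))%N -> onth (c0 :: F) i = Some (nth c0 (c0 :: F) i).
  by move=> il; rewrite onthE (nth_map c0).
apply/(all_nthP c0)/forallP => [H i|H i il].
  rewrite ffunE; have [il|il] := ltnP i (size (c0 :: F)).
    rewrite onthE' //=; rewrite -ccE; first exact: H.
    exact: In_nth.
  by rewrite onthE nth_default// size_map.
have := H (Ordinal (leq_trans il (leq_trans sF b1819))).
rewrite ffunE /= onthE' //= ccE//; exact: In_nth.
Qed.

Variable n : nat.
Hypotheses (mphi : forall j, measurable_fun setT (phi^~ j)) (mf : forall i, measurable_fun setT (f i)).

Lemma measurable_cutc c : measurable_fun setT (fun p : n.-tuple (Rn K d) * Rn K d => cutc p.1 c p.2).
Proof.
apply: measurable_and; first by apply: (measurableT_comp (mf _)).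
apply: measurable_fun_ltr; first exact: measurable_cst.
apply: measurable_sum => j; apply: measurable_funM; first exact: measurable_cst.
exact: measurable_zeta.
Qed.

Lemma measurable_selc C : measurable_fun setT (fun p : n.-tuple (Rn K d) * Rn K d => selc p.1 C p.2).
Proof.
apply: measurable_and; first exact: measurable_good.
apply: bool_set_measurable.
rewrite (_ : [set p | _] = [set p : n.-tuple (Rn K d) * Rn K d | forall i : 'I_(b ^ 19),
   [set p : n.-tuple (Rn K d) * Rn K d | if C i is Some c then ~~ cutc p.1 c p.2 else true] p]).
  apply: measurable_forall_fin => i; case: (C i) => [c|].
    apply: measurable_bool_set; apply: measurable_neg; exact: measurable_cutc.
  by rewrite [X in measurable X](_ : _ = setT)//; apply/seteqP; split.
apply/seteqP; split=> p /= => [/forallP H i|H]; first by have := H i; case: (C i).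
by apply/forallP => i; have := H i; case: (C i).
Qed.

End Codes.

(** * Deviations that are small for all queries at once *)

Section Concentration.
Variables (K : realType) (d k : nat) (f : 'I_k -> Rn K d -> bool).
Variables (m b : nat) (R : K) (phi : Rn K d -> nat -> K).
Hypotheses (mphi : forall j, measurable_fun setT (phi^~ j)) (mf : forall i, measurable_fun setT (f i)).
Variables (D D' : probability (Rn K d) K) (n n' : nat).
Variables (disp : measure_display) (Omega : measurableType disp) (P : probability Omega K).
Variables (X : Omega -> n.-tuple (Rn K d)) (X' : Omega -> n'.-tuple (Rn K d)).
Hypotheses (iidX : iid_samples D D' P X X').
Variable p : 'I_k -> Rn K d -> K.
Hypothesis mp : forall i, measurable_fun setT (p i).
Hypotheses (bn : (b <= n)%N) (b2 : (2 <= b)%N).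

Definition draw (i : 'I_n + 'I_n') (w : Omega) : Rn K d :=
  match i with inl j => tnth (X w) j | inr j => tnth (X' w) j end.
Definition law (i : 'I_n + 'I_n') := match i with inl _ => D | inr _ => D' end.

Lemma draw_iid : iid_rule P draw law.
Proof.
have [mX mX' H] := iidX; split=> [[j|j]|B mB] /=.
- exact: (measurableT_comp (measurable_tnth j) mX).
- exact: (measurableT_comp (measurable_tnth j) mX').
rewrite big_sumType/= -(H (fun j => B (inl j)) (fun j => B (inr j)))//.
congr (P _); apply/seteqP; split=> w /=.
  by move=> Hw; split=> j; [exact: (Hw (inl j))|exact: (Hw (inr j))].
by move=> [H1 H2] [j|j]; [exact: H1|exact: H2].
Qed.

(** The sample splits into [S1], the other points of [S], and [S']; the index sets are disjoint,
    which makes the last two parts independent of the region. *)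
Definition at1 (j : 'I_b) : 'I_n + 'I_n' := inl (widen_ord bn j).
Definition at2 (j : 'I_(n - b)) : 'I_n + 'I_n' := inl (cast_ord (subnKC bn) (rshift b j)).
Definition at3 (j : 'I_n') : 'I_n + 'I_n' := inr j.
Definition Y := blk (draw \o at1).

Lemma at_inj : [/\ injective at1, injective at2 & injective at3].
Proof.
split=> i j; rewrite /at1 /at2 /at3 => -[] H; apply: val_inj => //.
  by apply/eqP; rewrite -(eqn_add2l b) H.
by rewrite H.
Qed.

(** The layer cake requires nonnegative functions, so the signed mean under [D'] goes through the
    positive and the negative part, and the mean under [D] through the absolute value. *)
Definition part (y : 'I_3) (i : 'I_k) (x : Rn K d) : K :=
  if y == 0 then Num.max (p i x) 0 else if y == 1 then Num.max (- p i x) 0 else `|p i x|.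
(* [Some] queries concern one layer of the positive part, the negative part or the
   absolute value of a hypothesis polynomial; [None] asks for the mass cut off. *)
Definition query := (option ('I_k * 'I_3 * 'I_(b ^ 5)) * code k m b)%type.
Definition event (u : query) (S : b.-tuple (Rn K d)) (x : Rn K d) : bool :=
  if u.1 is Some (i, y, z) then [&& f i x, selc f R phi S u.2 x & (z : nat)%:R / (b ^ 2)%:R < part y i x]
  else good m phi S x && ~~ selc f R phi S u.2 x.

Lemma measurable_part y i : measurable_fun setT (part y i).
Proof.
rewrite /part; case: (y == 0); last case: (y == 1).
- by apply: measurable_maxr => //; exact: measurable_cst.
- by apply: measurable_maxr; [exact: measurable_funN|exact: measurable_cst].
- exact: measurableT_comp.
Qed.

Lemma measurable_event u : measurable_fun setT (fun q : b.-tuple (Rn K d) * Rn K d => event u q.1 q.2).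
Proof.
rewrite /event; case: u => [[[[i y] z]|] C] /=.
  apply: measurable_and; first exact: (measurableT_comp (mf i)).
  apply: measurable_and; first exact: measurable_selc.
  apply: measurable_fun_ltr; first exact: measurable_cst.
  exact: (measurableT_comp (measurable_part y i)).
apply: measurable_and; first exact: measurable_good.
by apply: measurable_neg; exact: measurable_selc.
Qed.

Definition deviates2 u (e : K) := [set w | (n - b)%:R * e <=
   `|\sum_(j < n - b) (event u (Y w) (draw (at2 j) w))%:R - (n - b)%:R * fine (D [set x | event u (Y w) x])|].
Definition deviates3 u (e : K) := [set w | n'%:R * e <=
   `|\sum_(j < n') (event u (Y w) (draw (at3 j) w))%:R - n'%:R * fine (D' [set x | event u (Y w) x])|].

Lemma deviation u e : 0 < e -> e <= 1 ->
  [/\ measurable (deviates2 u e), measurable (deviates3 u e),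
   (P (deviates2 u e) <= (2 * expR (- ((n - b)%:R * e ^+ 2 / 4)))%:E)%E &
   (P (deviates3 u e) <= (2 * expR (- (n'%:R * e ^+ 2 / 4)))%:E)%E].
Proof.
move=> e0 e1; have [i1 i2 i3] := at_inj; have iid := draw_iid.
have mY : measurable_fun setT Y by apply: measurable_blk => j; exact: iid.1.
have me := measurable_event u.
have I2 : iid_rule P (draw \o at2) (fun=> D) by exact: (iid_rule_inj i2 iid).
have I3 : iid_rule P (draw \o at3) (fun=> D') by exact: (iid_rule_inj i3 iid).
have [] := cond_hoeffding mY I2 _ me e0 e1.
  move=> A B mA mB; apply: (pair_indep (nu1 := D) (nu2 := D) i1 i2 _ _ _ iid) => //.
  move=> i j; apply/eqP => -[] H; have := ltn_ord i; by rewrite H ltnNge leq_addr.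
move=> m2 p2; have [] := cond_hoeffding mY I3 _ me e0 e1.
  by move=> A B mA mB; apply: (pair_indep (nu1 := D) (nu2 := D') i1 i3 _ _ _ iid).
by move=> m3 p3; split.
Qed.

(** Union bound over the ways to fail: some [p i] is large at one of the [b] points of [S1], the
    region misses mass [eg], or some query deviates on the rest of [S] or on [S']. A query depends
    on the sample only through [S1], so its deviation is bounded conditionally on [S1]. *)
Lemma concentration (lam da eg : K) (c g : nat) (e : K) : 0 < e -> e <= 1 ->
  (forall i, (D [set x | (lam < `|p i x|)%R] <= da%:E)%E) ->
  (c < n)%N -> (g * c <= b)%N -> 0 < eg -> 4 * m%:R <= (c.+1)%:R * eg ->
  exists E0, [/\ measurable E0,
   ((1 - (k%:R * b%:R * da + (1 / 2) ^+ g + #|{: query}|%:R * (2 * expR (- ((n - b)%:R * e ^+ 2 / 4))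
      + 2 * expR (- (n'%:R * e ^+ 2 / 4)))))%:E <= P E0)%E &
   forall w, E0 w -> [/\ forall i (j : 'I_b), `|p i (draw (at1 j) w)| <= lam,
     (D [set x | ~~ good m phi (Y w) x] < eg%:E)%E &
     forall u, ~ deviates2 u e w /\ ~ deviates3 u e w]].
Proof.
move=> e0 e1 pl cn gcb eg0 mc.
have iid := draw_iid; have [i1 i2 i3] := at_inj.
have In : iid_rule P (fun j => draw (inl j)) (fun=> D).
  by apply: (iid_rule_inj (sg := inl) _ iid) => i j [].
have [mG pG] := good_region mphi bn In cn gcb eg0 mc.
pose A1 (t : 'I_k * 'I_b) := draw (at1 t.2) @^-1` [set x | lam < `|p t.1 x|].
have mS i : measurable [set x | lam < `|p i x|].
  by apply: measurable_bool_set; apply: measurable_fun_ltr; [exact: measurable_cst|exact: measurableT_comp].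
have mA1 t : measurable (A1 t) by apply: measurable_preim => //; exact: iid.1.
have pA1 t : (P (A1 t) <= da%:E)%E by rewrite (iid_marginal _ iid).
pose A2 (u : query) := deviates2 u e; pose A3 (u : query) := deviates3 u e.
have mA2 u : measurable (A2 u) by have [] := deviation u e0 e1.
have mA3 u : measurable (A3 u) by have [] := deviation u e0 e1.
set G := [set w | _] in mG pG.
pose U1 := [set w | exists t, A1 t w]; pose U2 := [set w | exists u, A2 u w]; pose U3 := [set w | exists u, A3 u w].
have mU1 : measurable U1 by exact: measurable_exists_fin.
have mU2 : measurable U2 by exact: measurable_exists_fin.
have mU3 : measurable U3 by exact: measurable_exists_fin.
have u1 : (P U1 <= (k%:R * b%:R * da)%:E)%E.
  apply: (le_trans (pr_union P mA1)); apply: (@le_trans _ _ (\sum_(t : 'I_k * 'I_b) da%:E)%E).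
    by apply: lee_sum => t _; exact: pA1.
  by rewrite sumEFin sumr_const card_prod !card_ord lee_fin -[leLHS]mulr_natl natrM.
have u23 (A : query -> set Omega) v : (forall u, measurable (A u)) -> (forall u, (P (A u) <= v%:E)%E) ->
    (P [set w | exists u, A u w] <= (#|{: query}|%:R * v)%:E)%E.
  move=> mA pA; apply: (le_trans (pr_union P mA)); apply: (@le_trans _ _ (\sum_(t : query) v%:E)%E).
    by apply: lee_sum => t _.
  by rewrite sumEFin sumr_const lee_fin -[leLHS]mulr_natl.
have u2 := u23 A2 _ mA2 (fun u => let: And4 _ _ h _ := deviation u e0 e1 in h).
have u3 := u23 A3 _ mA3 (fun u => let: And4 _ _ _ h := deviation u e0 e1 in h).
have mU : measurable (U1 `|` G `|` (U2 `|` U3)) by do ?apply: measurableU.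
exists (~` (U1 `|` G `|` (U2 `|` U3))); split.
- exact: measurableC.
- rewrite probability_setC//= EFinB leeB//.
  apply: (le_trans (measureU2 _ _ _)) => //; do ?apply: measurableU => //.
  rewrite EFinD; apply: leeD.
    apply: (le_trans (measureU2 _ _ _)) => //; rewrite EFinD; exact: leeD.
  apply: (le_trans (measureU2 _ _ _)) => //; rewrite mulrDr EFinD; exact: leeD.
- move=> w /not_orP[/not_orP[n1 nG] /not_orP[n2 n3]]; split.
  + move=> i j; rewrite leNgt; apply/negP => H; apply: n1; by exists (i, j).
  + by rewrite ltNge; apply/negP => H; apply: nG.
  + by move=> u; split=> H; [apply: n2|apply: n3]; exists u.
Qed.

End Concentration.

(** * Consequences for a sample without deviations *)

Section Conclusions.
Variables (K : realType) (d l k : nat) (f : 'I_k -> Rn K d -> bool).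
Variables (R : K) (D D' : probability (Rn K d) K) (n n' : nat).
Variables (disp : measure_display) (Omega : measurableType disp).
Variables (X : Omega -> n.-tuple (Rn K d)) (X' : Omega -> n'.-tuple (Rn K d)).
Local Notation dg := (deg d l).
Local Notation m := (d.+1 ^ dg)%N.
Local Notation b := (bmax n n').
Variable p : 'I_k -> Rn K d -> K.
Hypotheses (mp : forall i, measurable_fun setT (p i)) (mf : forall i, measurable_fun setT (f i)).
Hypothesis mphi : forall j, measurable_fun setT (fun x : Rn K d => feat dg x j).
Hypotheses (b2 : (2 <= b)%N) (R1 : 1 < R) (mb : (m <= b)%N) (Rb : R + 2 <= b%:R).
Variables (bn : (b <= n)%N) (w : Omega) (F : seq (filt K k)).
Local Notation pt := (sample (X w) (X' w)).
Local Notation phi := (feat dg).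
Local Notation draw := (draw X X').
Local Notation at2 := (at2 n' bn).
Local Notation at3 := (@at3 n n').
Local Notation Y := (Y X X' bn w).
Local Notation zt := (zeta m phi Y).
Local Notation s := (sel f m b zt (good m phi Y) F).
Local Notation eb := ((b%:R ^+ 5)^-1 : K).
Hypotheses (learn : learned l f R (X w) (X' w) F) (C : code k m b)
  (CE : forall x, s x = selc f R phi Y C x).
Hypothesis dev : forall u : query k m b,
  ~ deviates2 f R phi D X X' p bn u eb w /\ ~ deviates3 f R phi D' X X' p bn u eb w.

Lemma pt2 (j : 'I_(n - b)) : pt (b + j) = draw (at2 j) w.
Proof.
have jn : (b + j < n)%N by have := ltn_ord j; lia.
by rewrite /sample nth_cat size_tuple jn /draw /at2 (tnth_nth [tuple 0 | _ < d]).
Qed.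

Lemma pt3 (j : 'I_n') : pt (n + j) = draw (at3 j) w.
Proof. by rewrite /sample nth_cat size_tuple ltnNge leq_addr /= addKn /draw /at3 (tnth_nth [tuple 0 | _ < d]). Qed.

Lemma S1_Y : S1 b 0 pt = tval Y.
Proof.
apply: (@eq_from_nth _ [tuple 0 | _ < d]); first by rewrite size_map size_iota size_tuple.
move=> r; rewrite size_map size_iota => rb.
rewrite (nth_map 0%N) ?size_iota// nth_iota// add0n addn0.
rewrite -(tnth_nth _ _ (Ordinal rb)) tnth_blk /= /sample nth_cat size_tuple (leq_trans rb bn).
by rewrite (tnth_nth [tuple 0 | _ < d]).
Qed.

Lemma b_pos : 0 < b%:R :> K. Proof. by rewrite ltr0n (leq_trans _ b2). Qed.

Lemma n_pos : (0 < n - b)%N /\ (0 < n')%N.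
Proof. by have [h1 h2] := b_ltn b2; rewrite subn_gt0. Qed.

Lemma dev_lt (u : query k m b) : `|\sum_(j < n - b) (event f R phi p u Y (draw (at2 j) w))%:R
      - (n - b)%:R * fine (D [set x | event f R phi p u Y x])| <= (n - b)%:R * eb /\
  `|\sum_(j < n') (event f R phi p u Y (draw (at3 j) w))%:R
      - n'%:R * fine (D' [set x | event f R phi p u Y x])| <= n'%:R * eb.
Proof.
have [h2 h3] := dev u; split; rewrite leNgt; apply/negP => H; [apply: h2|apply: h3]; exact: ltW.
Qed.

Lemma measurable_s : measurable_fun setT s.
Proof.
rewrite (_ : s = selc f R phi Y C); last by apply/funext.
exact: (measurable_slice (e := fun (y : b.-tuple (Rn K d)) x => selc f R phi y C x) Y (measurable_selc R mphi mf C)).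
Qed.

Section OneHypothesis.
Variables (i : 'I_k) (lam : K).
Hypotheses (pspan : inspan m phi (p i)) (plam : forall y, List.In y (tval Y) -> `|p i y| <= lam)
  (lamb : b%:R * lam <= b%:R ^+ 3).

Definition selected (y : 'I_3) (x : Rn K d) : K := (f i x && s x)%:R * part p y i x.

Lemma p_bounded x : s x -> `|p i x| <= b%:R ^+ 3.
Proof.
move=> /andP[gx _]; have [a [_ aE]] := zeta_coord pspan plam.
by have [_] := aE x gx; rewrite size_tuple => /le_trans; apply.
Qed.

Lemma selected_bound y x : 0 <= selected y x <= b%:R ^+ 3.
Proof.
have B3 : 0 <= b%:R ^+ 3 :> K by rewrite exprn_ge0.
rewrite /selected; case: (f i x) => /=; last by rewrite mul0r lexx.
have [sx|sx] := boolP (s x); last by rewrite mul0r lexx.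
have := p_bounded sx; rewrite mul1r /part ler_norml => /andP[l1 l2].
case: ifP => _; last case: ifP => _.
- by rewrite le_max lexx orbT ge_max B3 andbT.
- by rewrite le_max lexx orbT ge_max B3 andbT lerNl.
- by rewrite normr_ge0 ler_norml l1.
Qed.

Lemma measurable_selected y : measurable_fun setT (selected y).
Proof.
apply: measurable_funM; last exact: measurable_part.
by apply: measurable_boolR; apply: measurable_and => //; exact: measurable_s.
Qed.

Lemma selected_event y x (z : 'I_(b ^ 5)) :
  ((z : nat)%:R / (b%:R ^+ 2) < selected y x) = event f R phi p (Some (i, y, z), C) Y x.
Proof.
rewrite /event /= -CE /selected natrX; case: (f i x) => /=.
  case: (s x); rewrite ?mul1r//= mul0r; apply/negbTE; rewrite -leNgt.
  by rewrite divr_ge0// exprn_ge0.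
by rewrite mul0r; apply/negbTE; rewrite -leNgt divr_ge0// exprn_ge0.
Qed.

(** [emp_close] with mesh [b ^ -2], the [b ^ 5] levels that reach [b ^ 3], and deviation [b ^ -5]:
    both error terms equal [b ^ -2]. *)
Lemma selected_close y :
  `|(n - b)%:R^-1 * \sum_(j < n - b) selected y (draw (at2 j) w) - mean D (selected y)| <= 2 / b%:R ^+ 2 /\
  `|n'%:R^-1 * \sum_(j < n') selected y (draw (at3 j) w) - mean D' (selected y)| <= 2 / b%:R ^+ 2.
Proof.
have [n0 n'0] := n_pos; have bp := b_pos.
have E : (b%:R ^+ 2)^-1 + (b ^ 5)%:R / b%:R ^+ 2 * eb = 2 / b%:R ^+ 2 :> K.
  by rewrite natrX; field; rewrite gt_eqF.
have b1 : 1 <= b%:R ^+ 2 :> K by rewrite exprn_ege1// ler1n (leq_trans _ b2).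
have LZ : b%:R ^+ 3 * b%:R ^+ 2 <= (b ^ 5)%:R :> K by rewrite -exprD natrX.
rewrite -E; split; [apply: (emp_close n0 b1 (measurable_selected y) (selected_bound y) LZ)
  |apply: (emp_close n'0 b1 (measurable_selected y) (selected_bound y) LZ)] => z zb.
- have [h2 _] := dev_lt (Some (i, y, Ordinal zb), C).
  rewrite (eq_bigr (fun j => (event f R phi p (Some (i, y, Ordinal zb), C) Y (draw (at2 j) w))%:R)); last first.
    by move=> j _; rewrite -selected_event.
  rewrite (_ : [set x | _] = [set x | event f R phi p (Some (i, y, Ordinal zb), C) Y x])//.
  by apply/seteqP; split=> x /=; rewrite -selected_event.
- have [_ h3] := dev_lt (Some (i, y, Ordinal zb), C).
  rewrite (eq_bigr (fun j => (event f R phi p (Some (i, y, Ordinal zb), C) Y (draw (at3 j) w))%:R)); last first.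
    by move=> j _; rewrite -selected_event.
  rewrite (_ : [set x | _] = [set x | event f R phi p (Some (i, y, Ordinal zb), C) Y x])//.
  by apply/seteqP; split=> x /=; rewrite -selected_event.
Qed.

Let y0 : 'I_3 := ord0.
Let y1 : 'I_3 := Ordinal (isT : 1 < 3)%N.
Let y2 : 'I_3 := Ordinal (isT : 2 < 3)%N.

(** This is [certificate] for the coordinates of [p i] over [zeta], which [zeta_coord] bounds by
    [b * lam <= b ^ 3]. *)
Lemma empirical_certificate :
  n'%:R^-1 * \sum_(j < n') (selected y0 (draw (at3 j) w) - selected y1 (draw (at3 j) w))
  - R * ((n - b)%:R^-1 * \sum_(j < n - b) selected y2 (draw (at2 j) w)) <= 2 / b%:R ^+ 2.
Proof.
have [bn' n'0] := b_ltn b2; have R0 : 0 < R by apply: lt_trans R1.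
have [_ _ _ /(_ i) [q qP]] := learn; rewrite /path S1_Y in qP.
have [a [a1 a2]] := zeta_coord pspan plam; rewrite size_tuple in a1.
have ab j : (j < m)%N -> `|a j| <= b%:R ^+ 3 by move=> jm; exact: le_trans (a1 j jm) lamb.
have wp := wt_pos bn' n'0 R0; have wn := wt_neg bn' n'0 R0.
have ztb (r : 'I_(n + n')) j : f i (pt r) && s (pt r) -> (j < m)%N -> `|zt (pt r) j| <= 1.
  by move=> /and3P[_ gr _] jm; exact: zeta_le1.
have := certificate b2 mb Rb wp wn ztb qP ab.
set LHS := \sum_r _; suff -> : LHS = n'%:R^-1 * \sum_(j < n') (selected y0 (draw (at3 j) w) - selected y1 (draw (at3 j) w))
  - R * ((n - b)%:R^-1 * \sum_(j < n - b) selected y2 (draw (at2 j) w)) by [].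
pose h r := (f i (pt r) && s (pt r))%:R * (if (r < n)%N then `|p i (pt r)| else p i (pt r)).
have -> : LHS = \sum_(r < n + n') wt n n' b R r * h r.
  apply: eq_bigr => r _; rewrite /h; case: ifP => [ac|_]; last by rewrite mul0r mulr0.
  have gr : good m phi Y (pt r) by case/and3P: ac.
  have [pE _] := a2 _ gr; rewrite /pev -pE leNgt wt_gt0// mul1r.
  by case: leqP.
rewrite wt_sum// mulrA; congr (_ * _ - _ * _).
- apply: eq_bigr => j _; rewrite /h pt3 ltnNge leq_addr /= /selected -mulrBr; congr (_ * _).
  rewrite /part /=; case: (leP 0 (p i _)) => p0.
    by rewrite max_r ?subr0// oppr_le0.
  by rewrite max_l ?oppr_ge0 ?(ltW p0)// sub0r opprK.
- apply: eq_bigr => j _; rewrite /h pt2.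
  by rewrite (_ : (b + j < n)%N)//; have := ltn_ord j; lia.
Qed.

(** The two transfers from [S'] to [D'] and the certificate cost [2 / b ^ 2] each; the transfer from
    [S] to [D] costs [R] times as much. *)
Lemma bound1 : mean D' (fun x => (f i x)%:R * p i x * (s x)%:R) <=
  R * mean D (fun x => (f i x && s x)%:R * `|p i x|) + (6 + 2 * R) / b%:R ^+ 2.
Proof.
have E : (fun x => (f i x)%:R * p i x * (s x)%:R) = selected y0 \- selected y1.
  apply/funext => x; rewrite /selected /= -mulrBr mulrAC -natrM mulnb; congr (_ * _).
  rewrite /part /=; case: (leP 0 (p i _)) => p0.
    by rewrite max_r ?subr0// oppr_le0.
  by rewrite max_l ?oppr_ge0 ?(ltW p0)// sub0r opprK.
have nb y x : `|selected y x| <= b%:R ^+ 3 by have /andP[h1 h2] := selected_bound y x; rewrite ger0_norm.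
rewrite E (@meanB _ _ _ _ _ _ (b%:R ^+ 3))//; try exact: measurable_selected.
rewrite -[mean D (fun x => _)]/(mean D (selected y2)).
have [_ c0] := selected_close y0; have [_ c1] := selected_close y1; have [c2 _] := selected_close y2.
have := empirical_certificate; rewrite sumrB mulrBr.
rewrite [(6 + 2 * R) / _](_ : _ = 2 / b%:R ^+ 2 + 2 / b%:R ^+ 2 + 2 / b%:R ^+ 2 + R * (2 / b%:R ^+ 2)); last by ring.
move: c0 c1 c2; move: (2 / b%:R ^+ 2) (mean _ _) (mean _ _) (mean _ _) (_ * \sum_(j < _) _) (_ * \sum_(j < _) _)
  (_ * \sum_(j < _) _) => t m0 m1 m2 e0 e1 e2.
rewrite !ler_norml => /andP[a1 a2] /andP[a3 a4] /andP[a5 a6] H.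
have : R * e0 <= R * (m0 + t) by rewrite ler_wpM2l; [|move: R1; lra|lra].
rewrite mulrDr; lra.
Qed.

End OneHypothesis.

(** The part cut off has nonnegative total weight, being built from cuts of positive excess; the
    [None] query transfers this to the distributions. *)
Lemma bound2 : R * (fine (D [set x | good m phi Y x && ~~ s x]) - eb) <=
  fine (D' [set x | good m phi Y x && ~~ s x]) + eb.
Proof.
have [bn' n'0] := b_ltn b2; have R0 : 0 < R by apply: lt_trans R1.
have [n0 _] := n_pos; have [_ _ + _] := learn; rewrite S1_Y.
have [] := dev_lt (None, C).
have eE x : event f R phi p (None, C) Y x = good m phi Y x && ~~ s x by rewrite /event /= CE.
rewrite (_ : [set x | event _ _ _ _ _ _ x] = [set x | good m phi Y x && ~~ s x]); last first.
  by apply/seteqP; split=> x /=; rewrite eE.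
move: (fine (D _)) (fine (D' _)) => q q' d2 d3.
have hE (x : Rn K d) : (good m phi Y x)%:R - (s x)%:R = (event f R phi p (None, C) Y x)%:R :> K.
  by rewrite eE /sel; case: (good m phi Y x); case: (all _ F); rewrite /= ?subrr ?subr0.
rewrite (wt_sum bn' n'0 R0 (fun r => (good m phi Y (pt r))%:R - (s (pt r))%:R)).
under eq_bigr do rewrite pt3 hE.
under [X in _ - _ * X]eq_bigr do rewrite pt2 hE.
move: d2 d3; move: (\sum_(j < n - b) _) (\sum_(j < n') _) => e2 e3.
have N0 : 0 < (n - b)%:R :> K by rewrite ltr0n.
have N'0 : 0 < n'%:R :> K by rewrite ltr0n.
rewrite !ler_norml => /andP[h1 h2] /andP[h3 h4].
have E2 : q - eb <= e2 / (n - b)%:R by rewrite ler_pdivlMr// mulrC mulrBr; lra.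
have E3 : e3 / n'%:R <= q' + eb by rewrite ler_pdivrMr// mulrC mulrDr; lra.
rewrite subr_ge0 mulrAC -mulrA (mulrC _ e3) => H.
by apply: le_trans E3; apply: le_trans H; rewrite ler_wpM2l// ltW.
Qed.

End Conclusions.

(** * Tails of polynomials under hypercontractivity *)

Section Tails.
Variables (K : realType) (d : nat).

Lemma measurable_xhom i : measurable_fun setT (fun x : Rn K d => xhom x i).
Proof.
case: i => [|i] /=; first exact: measurable_cst.
have [id|di] := ltnP i d.
  rewrite (_ : (fun x => _) = fun x : Rn K d => tnth x (Ordinal id)); first exact: measurable_tnth.
  by apply/funext => x; rewrite (tnth_nth 0).
rewrite (_ : (fun x => _) = cst 0); first exact: measurable_cst.
by apply/funext => x; rewrite nth_default// size_tuple.
Qed.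

Lemma measurable_feat l j : measurable_fun setT (fun x : Rn K d => feat l x j).
Proof.
elim: l j => [|l IH] j /=; first exact: measurable_cst.
by apply: measurable_funM; [exact: IH|exact: measurable_xhom].
Qed.

Lemma total_degree_deg l (p : mpoly.mpoly d K) : (total_degree p <= l)%N -> (total_degree p <= deg d l)%N.
Proof.
rewrite /deg; case: ifP => // d0 _; rewrite /total_degree; elim/big_rec: _ => // mu y _ y0.
rewrite geq_max y0 andbT mpoly.mdegE big1// => i _; by have := leq_trans (ltn_ord i) d0.
Qed.

Lemma measurable_peval (p : mpoly.mpoly d K) : measurable_fun setT (peval p : Rn K d -> K).
Proof.
have [a aE] := peval_feat (leqnn (total_degree p)).
rewrite (_ : peval p = fun x => \sum_(j < d.+1 ^ total_degree p) a j * feat (total_degree p) x j); last by apply/funext.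
by apply: measurable_sum => j; apply: measurable_funM; [exact: measurable_cst|exact: measurable_feat].
Qed.

Variable D : probability (Rn K d) K.

Lemma abs_moment_le (g : Rn K d -> K) (beta : K) : measurable_fun setT g ->
  ('E_D[fun x => (g x ^+ 2)%R] <= beta%:E)%E -> ('E_D[fun x => `|g x|%R] <= (1 + beta)%:E)%E.
Proof.
move=> mg; rewrite !unlock => gb.
apply: (@le_trans _ _ (\int[D]_x ((1 + g x ^+ 2)%:E))%E).
  apply: ge0_le_integral => //.
  - apply/measurable_EFinP; exact: measurableT_comp.
  - apply/measurable_EFinP; apply: measurable_funD; first exact: measurable_cst.
    exact: measurable_funX.
  move=> x _; rewrite lee_fin -[g x ^+ 2]real_normK ?num_real//.
  have : 0 <= (`|g x| - 1) ^+ 2 by exact: sqr_ge0.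
  have := normr_ge0 (g x); nra.
under eq_integral do rewrite EFinD.
rewrite ge0_integralD//; last 2 first.
- by move=> x _; rewrite lee_fin sqr_ge0.
- by apply/measurable_EFinP; exact: measurable_funX.
rewrite EFinD; apply: leeD => //.
by have := integral_cst D measurableT 1%E; rewrite [X in (_ * X)%E]probability_setT mule1 /cst => ->.
Qed.

(** Markov's inequality for the moment of order [t], which is at most [T0 ^ t] because the first
    absolute moment is at most [1 + beta]. The order stays free: it will grow with
    [ln (k / delta)]. *)
Lemma hypercontractive_tail (A beta t lam b0 T0 : K) l (p : mpoly.mpoly d K) :
  1 <= A -> 0 < beta -> 2 <= t -> hypercontractive A D -> (total_degree p <= l)%N ->
  ('E_D[fun x => (peval p x ^+ 2)%R] <= beta%:E)%E ->
  1 <= b0 -> T0 = (A * t) ^+ l * (1 + beta) -> lam = b0 * T0 ->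
  (D [set x | (lam < `|peval p x|)%R] <= (b0 `^ t)^-1%:E)%E.
Proof.
move=> A1 beta0 t2 [hyp _] pl pb b1 T0E lamE.
have mp := measurable_peval p.
have At1 : 1 <= A * t by rewrite -[1]mulr1 ler_pM//; lra.
have t0 : 0 <= t by lra.
have T0p : 0 < T0 by rewrite T0E mulr_gt0 ?exprn_gt0//; lra.
have lam0 : 0 < lam by rewrite lamE mulr_gt0//; lra.
have mS : measurable [set x | lam < `|peval p x|].
  by apply: measurable_bool_set; apply: measurable_fun_ltr; [exact: measurable_cst|exact: measurableT_comp].
have mS' : measurable [set x : Rn K d | (lam%:E <= `|(peval p x)%:E|)%E].
  rewrite (_ : [set x | _] = [set x | lam <= `|peval p x|]).
    by apply: measurable_bool_set; apply: measurable_fun_ler; [exact: measurable_cst|exact: measurableT_comp].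
  by apply/seteqP; split=> x /=; rewrite lee_fin.
have mk := @markov _ _ _ D (mfunT mp) (fun r => r `^ t) lam lam0.
have {mk} : ((lam `^ t)%:E * D [set x | (lam%:E <= `|(peval p x)%:E|)%E] <=
   'E_D[fun x => (`|peval p x| `^ t)%R])%E.
  apply: mk; first exact: measurable_powR.
  - by move=> r _; exact: powR_ge0.
  - exact: ge0_ler_powR.
move=> mk.
have h := hyp p t t2.
have m1 := abs_moment_le mp pb.
have [r [r0 rb rE]] : exists r, [/\ 0 <= r, r <= 1 + beta & ('E_D[fun x => `|peval p x|%R] = r%:E)%E].
  have e0 : (0 <= 'E_D[fun x => `|peval p x|%R])%E by apply: expectation_ge0.
  have fn : ('E_D[fun x => `|peval p x|%R])%E \is a fin_num.
    by rewrite ge0_fin_numE// (le_lt_trans m1) ?ltry.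
  exists (fine ('E_D[fun x => `|peval p x|%R])%E); rewrite fineK//; split=> //; first exact: fine_ge0.
  by rewrite -lee_fin fineK.
rewrite rE poweR_EFin -EFinM in h.
have h2 : ((A * t) `^ (t * (total_degree p)%:R) * r `^ t) <= T0 `^ t.
  have At0 : 0 <= A * t by lra.
  rewrite (mulrC t) powRrM powR_mulrn// -powRM ?exprn_ge0//.
  apply: ge0_ler_powR => //; rewrite ?nnegrE ?mulr_ge0 ?exprn_ge0//; first exact: ltW.
  by rewrite T0E ler_pM ?exprn_ge0// ler_weXn2l.
have key : ((lam `^ t)%:E * D [set x | (lam < `|peval p x|)%R] <= (T0 `^ t)%:E)%E.
  apply: (le_trans _ (le_trans (le_trans mk h) _)); last by rewrite lee_fin.
  apply: lee_wpmul2l; first by rewrite lee_fin powR_ge0.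
  by apply: pr_le => // x /=; rewrite lee_fin; exact: ltW.
move: key; rewrite (pr_fin D mS) -EFinM !lee_fin lamE powRM; [|lra|exact: ltW].
have b0t : 0 < b0 `^ t by apply: powR_gt0; lra.
have T0t : 0 < T0 `^ t by apply: powR_gt0.
rewrite mulrAC -ler_pdivlMr// divff ?gt_eqF// => H.
by rewrite -[leRHS]mul1r ler_pdivlMr// mulrC.
Qed.

End Tails.

(** * Sample sizes *)

Section Constants.
Variables (K : realType) (d l k b n n' : nat) (A R beta eps delta v : K).
Hypotheses (k0 : (0 < k)%N) (l0 : (0 < l)%N) (A1 : 1 <= A) (R1 : 1 < R) (beta0 : 0 < beta).
Hypotheses (eps01 : 0 < eps < 1) (delta01 : 0 < delta < 1).
Local Notation L := (ln (k%:R / delta) : K).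
Local Notation B := (b%:R : K).
Hypotheses (v2 : 2 <= v) (Rv : R <= v) (betav : beta <= v) (Av : A ^+ l <= v)
  (Dv : (d.+1)%:R ^+ l <= v) (epsv : eps^-1 <= v) (Lv : L ^+ l <= v) (vb : v ^+ 16 <= B).
Hypotheses (bn : (b ^ 40 <= n)%N) (bn' : (b ^ 40 <= n')%N).

Lemma v_pow i j : (i <= j)%N -> v ^+ i <= v ^+ j.
Proof. by move=> ij; rewrite ler_weXn2l//; move: v2; lra. Qed.

Lemma v_pow_B i : (i <= 16)%N -> v ^+ i <= B.
Proof. by move=> i16; apply: le_trans vb; exact: v_pow. Qed.

Lemma two_pow_v i : 2 ^+ i <= v ^+ i.
Proof. by rewrite lerXn2r ?nnegrE//; move: v2; lra. Qed.

Lemma kd_ge : 1 <= k%:R :> K. Proof. by rewrite ler1n. Qed.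

Lemma kd1 : 1 < k%:R / delta.
Proof.
case/andP: delta01 => p1 p2; rewrite ltr_pdivlMr// mul1r (lt_le_trans p2)//; exact: kd_ge.
Qed.

Lemma expL : expR L = k%:R / delta.
Proof. by rewrite lnK// posrE (lt_trans ltr01)//; exact: kd1. Qed.

Lemma L_gt0 : 0 < L. Proof. by rewrite ln_gt0//; exact: kd1. Qed.

Lemma L_le : L <= v.
Proof.
have [L1|L1] := leP L 1; first by move: v2; lra.
by apply: le_trans Lv; rewrite ler_eXnr// ltW.
Qed.

Lemma expR1_le4 : expR 1 <= 4 :> K.
Proof.
have h : 1/2 <= expR (- (1/2)) :> K by have := expR_ge1Dx (- (1/2) : K); lra.
have h2 : expR (- 1) = expR (- (1/2)) ^+ 2 :> K.
  by rewrite expr2 -expRD; congr expR; lra.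
have h3 : 1/4 <= expR (- 1) :> K by rewrite h2; nra.
by move: h3; rewrite expRN div1r lef_pV2 ?posrE ?expR_gt0//.
Qed.

Lemma b4 : 4 <= B.
Proof. apply: le_trans (v_pow_B (isT : 2 <= 16)%N); by have := two_pow_v 2; lra. Qed.

Lemma b_ge4 : (4 <= b)%N. Proof. by rewrite -(ler_nat K) b4. Qed.

Lemma small_sizes : [/\ (d.+1 ^ deg d l <= b)%N, (deg d l <= b)%N, 2 * (1 + R) <= B & R + 2 <= B].
Proof.
have Db : (d.+1 ^ l <= b)%N.
  by rewrite -(ler_nat K) natrX (le_trans Dv)// -(expr1 v) v_pow_B.
split.
- exact: leq_trans (deg_le d l) Db.
- exact: leq_trans (deg_leX d l) Db.
- apply: le_trans (v_pow_B (isT : 3 <= 16)%N); rewrite !exprS expr0; move: v2 Rv; nra.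
- apply: le_trans (v_pow_B (isT : 3 <= 16)%N); rewrite !exprS expr0; move: v2 Rv; nra.
Qed.

Local Notation T0 := ((A * (2 + L)) ^+ deg d l * (1 + beta)).

Lemma T0_le : T0 <= B.
Proof.
have Lp := L_gt0.
have A0 : 0 <= A by move: A1; lra.
(* [2 + L] is at most 3 or at most [3 * L], and for [d > 0] the factor [3 ^ l <= 4 ^ l] is at most
   the square of [(d + 1) ^ l]. For [d = 0] the degree is 0. *)
have tb : (2 + L) ^+ deg d l <= v ^+ 3.
  rewrite /deg; case: (leqP d 0) => d0; first by rewrite expr0 exprn_ege1//; move: v2; lra.
  have v1 : 1 <= v by move: v2; lra.
  have l3 : 3 ^+ l <= v ^+ 2.
    apply: (@le_trans _ _ (((d.+1)%:R ^+ l) ^+ 2)); last first.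
      by rewrite lerXn2r ?nnegrE ?exprn_ge0//; move: v2; lra.
    rewrite -exprM mulnC exprM lerXn2r ?nnegrE ?exprn_ge0//.
    have : 2 <= (d.+1)%:R :> K by rewrite ler_nat.
    by nra.
  have [L1|L1] := leP L 1.
    apply: (@le_trans _ _ (3 ^+ l)); first by rewrite lerXn2r ?nnegrE//; lra.
    by apply: (le_trans l3); exact: v_pow.
  apply: (@le_trans _ _ (3 ^+ l * L ^+ l)).
    by rewrite -exprMn lerXn2r ?nnegrE//; lra.
  by rewrite (exprSr v 2) ler_pM ?exprn_ge0//; lra.
have ab : A ^+ deg d l <= v.
  apply: le_trans Av; rewrite ler_weXn2l// /deg; by case: ifP.
apply: (@le_trans _ _ (v * v ^+ 3 * (2 * v))).
  rewrite exprMn ler_pM ?mulr_ge0 ?exprn_ge0 ?ler_pM ?exprn_ge0//; move: v2 betav beta0 Lp; lra.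
apply: le_trans (v_pow_B (isT : 6 <= 16)%N); rewrite -exprS (exprSr v 5) (exprSr v 4) -mulrA.
rewrite ler_wpM2l ?exprn_ge0//; move: v2; nra.
Qed.

(** The moment order [2 + L] is made for this: [B ^ L >= expR L = k / delta] as [ln B >= 1], and the
    two further powers of [B] absorb the factors [B] and 4. *)
Lemma tail_small : k%:R * B * (B `^ (2 + L))^-1 <= delta / 4.
Proof.
have Bp : 0 < B by have := b4; lra.
case/andP: delta01 => dp _.
have lnb : 1 <= ln B.
  rewrite -ler_expR lnK ?posrE//; exact: le_trans expR1_le4 b4.
have LB : k%:R / delta <= B `^ L.
  apply: (@le_trans _ _ (expR L)); first by rewrite expL.
  by rewrite /powR gt_eqF// ler_expR ler_peMr// ltW// L_gt0.
have k1 := kd_ge.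
have kdp : 0 < k%:R / delta by rewrite divr_gt0//; lra.
rewrite powRD; last by apply/implyP => _; rewrite gt_eqF.
rewrite (powR_mulrn 2) ?(ltW Bp)// ler_pdivrMr ?mulr_gt0 ?exprn_gt0 ?powR_gt0//.
apply: (@le_trans _ _ (delta / 4 * (B ^+ 2 * (k%:R / delta)))); last first.
  have d4 : 0 <= delta / 4 by lra.
  have B2' : 0 <= B ^+ 2 by rewrite exprn_ge0.
  by rewrite ler_wpM2l// ler_wpM2l.
rewrite (_ : delta / 4 * (B ^+ 2 * (k%:R / delta)) = k%:R * (B * (B / 4))); last by field; rewrite gt_eqF.
rewrite ler_wpM2l//.
by rewrite ler_peMr ?(ltW Bp)// ler_pdivlMr// mul1r b4.
Qed.

(** Let [w] be an integer just above [v]. Blocks of [16 w ^ 3] points suffice because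
    [16 m R <= 16 v ^ 2] and [eps * v >= 1]. With [2 w + 2] blocks the failure probability is
    [4 ^ - w / 4], and [4 ^ w >= expR L >= 1 / delta]. They fit into [b] because
    [64 w ^ 4 <= 2 ^ 10 * v ^ 4 <= v ^ 14]. *)
Lemma region_sizes : exists c g, [/\ (c < n)%N, (g * c <= b)%N,
  4 * (d.+1 ^ deg d l)%:R <= (c.+1)%:R * (eps / (4 * R)) & (1 / 2) ^+ g <= delta / 4].
Proof.
case/andP: eps01 => ep e1; case/andP: delta01 => dp _.
have vp : 0 <= v by move: v2; lra.
pose w := (Num.truncn v).+1; have /andP[w1 w2] := truncn_itv vp; rewrite -/w in w2.
have w3 : w%:R <= 2 * v by rewrite /w -natr1; move: v2; lra.
have w0 : 0 <= w%:R :> K by [].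
have w1' : 1 <= w%:R :> K by rewrite ler1n.
have gc : ((2 * w + 2) * (16 * w ^ 3) <= b)%N.
  have g4 : ((2 * w + 2) * (16 * w ^ 3) <= 64 * w ^ 4)%N.
    rewrite (_ : 64 * w ^ 4 = (4 * w) * (16 * w ^ 3))%N; last first.
      by rewrite (expnS w 3) mulnACA.
    apply: leq_mul => //; rewrite (_ : 4 * w = 2 * w + 2 * w)%N; last by rewrite -mulnDl.
    by rewrite leq_add2l leq_pmulr.
  apply: (leq_trans g4); rewrite -(ler_nat K) natrM natrX.
  apply: (@le_trans _ _ (64 * (2 * v) ^+ 4)).
    by rewrite ler_wpM2l// lerXn2r ?nnegrE//; lra.
  apply: le_trans (v_pow_B (isT : 14 <= 16)%N).
  rewrite exprMn mulrA (_ : 64 * 2 ^+ 4 = 2 ^+ 10); last by rewrite -[64]/(64%:R) -!natrX -natrM.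
  by rewrite (_ : 14 = 10 + 4)%N// exprD ler_wpM2r ?exprn_ge0//; exact: two_pow_v.
have bn0 : (b < n)%N.
  apply: leq_trans bn; rewrite -{1}(expn1 b) ltn_exp2l//; exact: leq_trans b_ge4.
exists (16 * w ^ 3)%N, (2 * w + 2)%N; split=> //.
- apply: leq_ltn_trans bn0; apply: leq_trans gc; by rewrite leq_pmull// addn_gt0 orbT.
- have mv : (d.+1 ^ deg d l)%:R <= v.
    apply: le_trans Dv; rewrite -natrX ler_nat; exact: deg_le.
  have Rp : 0 < R by move: R1; lra.
  have -> : (16 * w ^ 3).+1%:R = 16 * w%:R ^+ 3 + 1 :> K by rewrite -natr1 natrM natrX.
  apply: (@le_trans _ _ (16 * w%:R ^+ 3 * (eps / (4 * R)))); last first.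
    by rewrite ler_wpM2r ?divr_ge0//; lra.
  rewrite mulrA ler_pdivlMr; last by lra.
  have ev : 1 <= eps * v.
    by rewrite mulrC -ler_pdivrMr// div1r.
  apply: (@le_trans _ _ (16 * v ^+ 2 )).
    rewrite (_ : 4 * _ * (4 * R) = 16 * ((d.+1 ^ deg d l)%:R * R)); last by ring.
    by rewrite ler_wpM2l// expr2 ler_pM//; lra.
  rewrite -mulrA ler_wpM2l//; apply: (@le_trans _ _ (v ^+ 3 * eps)).
    by rewrite (exprSr v 2) -mulrA (mulrC v eps) ler_peMr// exprn_ge0.
  by rewrite ler_wpM2r ?(ltW ep)// lerXn2r ?nnegrE//; lra.
- have h4 : (1 / 2) ^+ 2 = 4^-1 :> K by field.
  rewrite exprD exprM h4 exprVn.
  have H : delta^-1 <= 4 ^+ w.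
    apply: (@le_trans _ _ (expR L)).
      by rewrite expL ler_peMl ?invr_ge0 ?(ltW dp)//; exact: kd_ge.
    apply: (@le_trans _ _ (expR (w%:R * 1))).
      rewrite ler_expR mulr1; apply: (le_trans L_le); lra.
    by rewrite expRM_natl lerXn2r ?nnegrE ?expR_ge0//; exact: expR1_le4.
  have w4 : 0 < 4 ^+ w :> K by rewrite exprn_gt0.
  have H2 : 1 <= delta * 4 ^+ w.
    by rewrite mulrC -ler_pdivrMr// div1r.
  rewrite ler_pdivrMl//; lra.
Qed.

Lemma bmul_exp i : B ^+ i <= expR (i%:R * B).
Proof.
rewrite expRM_natl; apply: lerXn2r; rewrite ?nnegrE ?expR_ge0//.
by apply: le_trans (expR_ge1Dx B); lra.
Qed.

Lemma k_exp : k%:R <= expR B.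
Proof.
apply: (@le_trans _ _ (expR L)).
  rewrite expL ler_peMr//; case/andP: delta01 => p1 p2; rewrite invf_ge1//; exact: ltW.
by rewrite ler_expR (le_trans L_le)// -(expr1 v) v_pow_B.
Qed.

Local Notation m := (d.+1 ^ deg d l)%N.

(** All factors become exponentials through [B <= expR B] and [k <= expR B]; the coefficients
    dominate with exponent [36 * B ^ 2]. *)
Lemma cutcode_count : (1 + #|{: cutcode k m b}|)%:R <= expR (B ^+ 6).
Proof.
have [mb _ _ _] := small_sizes.
have Bb := b4; have b0 : (0 < b)%N by apply: leq_trans b_ge4.
have c1 : (#|{: cutcode k m b}| = k * b ^ 36 * (b ^ 16).+1 * ((b ^ 35).+1) ^ m)%N.
  by rewrite !card_prod card_ffun !card_ord.
have c2 : (1 + #|{: cutcode k m b}| <= b * (k * b ^ 36 * b ^ 17 * (b ^ 36) ^ b))%N.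
  have p0 e : (0 < b ^ e)%N by rewrite expn_gt0 b0.
  have S e : ((b ^ e).+1 <= b ^ e.+1)%N.
    rewrite expnS; apply: (@leq_trans (2 * b ^ e)); last by rewrite leq_mul2r (leq_trans _ b_ge4) ?orbT.
    by rewrite mul2n -addnn -addn1 leq_add2l.
  have le : (#|{: cutcode k m b}| <= k * b ^ 36 * b ^ 17 * (b ^ 36) ^ b)%N.
    rewrite c1 !leq_mul//; apply: (@leq_trans ((b ^ 36) ^ m)); first by rewrite leq_exp2r ?S ?expn_gt0.
    by rewrite leq_pexp2l.
  set Q := (k * _ * _ * _)%N in le *; have Q0 : (0 < Q)%N by rewrite !muln_gt0 k0 !expn_gt0 b0.
  apply: (@leq_trans (2 * Q)); last by rewrite leq_mul2r (leq_trans _ b_ge4) ?orbT.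
  by rewrite mul2n -addnn; apply: leq_add.
apply: (@le_trans _ _ (B * (k%:R * B ^+ 36 * B ^+ 17 * (B ^+ 36) ^+ b))).
  by rewrite -!natrX -!natrM ler_nat.
apply: (@le_trans _ _ (expR (1%:R * B) * (expR B * expR (36%:R * B) * expR (17%:R * B) * expR (36%:R * B) ^+ b))).
  have h i := bmul_exp i.
  have B0 : 0 <= B by lra.
  rewrite ler_pM ?mulr_ge0 ?exprn_ge0//; first by have := h 1%N; rewrite expr1.
  rewrite ler_pM ?mulr_ge0 ?exprn_ge0// ?lerXn2r ?nnegrE ?exprn_ge0 ?expR_ge0 ?h//.
  rewrite ler_pM ?mulr_ge0 ?exprn_ge0// ler_pM ?exprn_ge0//; exact: k_exp.
rewrite -expRM_natl -!expRD ler_expR.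
have h2 : 16 <= B ^+ 2 by nra.
have h4 : 256 <= B ^+ 4 by rewrite (exprM B 2 2); nra.
rewrite (_ : B ^+ 6 = B ^+ 4 * (B * B)); last by rewrite -expr2 -exprD.
nra.
Qed.

(** The [b ^ 19] slots with at most [expR (B ^ 6)] values each contribute [B ^ 25] to the
    exponent. *)
Lemma query_count : (#|{: query k m b}|)%:R <= expR (B ^+ 26).
Proof.
have Bb := b4; have b0 : (0 < b)%N by apply: leq_trans b_ge4.
have c1 : (#|{: query k m b}| = (k * 3 * b ^ 5).+1 * (#|{: cutcode k m b}|.+1) ^ (b ^ 19))%N.
  have gen (X : finType) : (#|{: option ('I_k * 'I_3 * 'I_(b ^ 5)) * {ffun 'I_(b ^ 19) -> option X}}|
      = (k * 3 * b ^ 5).+1 * (#|X|.+1) ^ (b ^ 19))%N.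
    by rewrite card_prod card_option !card_prod card_ffun card_option !card_ord.
  exact: gen.
have c2 : ((k * 3 * b ^ 5).+1 <= b * (k * b * b ^ 5))%N.
  have Q0 : (0 < k * 1 * b ^ 5)%N by rewrite muln1 muln_gt0 k0 expn_gt0 b0.
  apply: (@leq_trans (b * (k * 1 * b ^ 5))).
    rewrite (@leq_trans (4 * (k * 1 * b ^ 5)))//; last by rewrite leq_mul2r b_ge4 orbT.
    rewrite (_ : 4 * (k * 1 * b ^ 5) = k * 3 * b ^ 5 + k * 1 * b ^ 5)%N; last first.
      by rewrite muln1 mulnA -mulnDl -mulnSr (mulnC k).
    by rewrite -addn1 leq_add2l.
  by rewrite leq_mul2l; apply/orP; right; rewrite leq_mul2r leq_mul2l b0 !orbT.
rewrite c1 natrM natrX -add1n.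
apply: (@le_trans _ _ (B * (k%:R * B * B ^+ 5) * expR (B ^+ 6) ^+ (b ^ 19))).
  rewrite ler_pM ?exprn_ge0//; first by rewrite -!natrX -!natrM ler_nat.
  by rewrite lerXn2r ?nnegrE ?expR_ge0//; exact: cutcode_count.
have B0 : 0 <= B by lra.
apply: (@le_trans _ _ (expR (1%:R * B) * (expR B * expR (1%:R * B) * expR (5%:R * B)) * expR (B ^+ 6) ^+ (b ^ 19))).
  have h i := bmul_exp i; have h1 := h 1%N; rewrite expr1 in h1.
  rewrite ler_wpM2r ?exprn_ge0 ?expR_ge0//.
  by rewrite ler_pM ?mulr_ge0 ?exprn_ge0// ler_pM ?mulr_ge0 ?exprn_ge0// ler_pM//; exact: k_exp.
rewrite -expRM_natl -!expRD ler_expR natrX -exprD.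
have h2 : 16 <= B ^+ 2 by nra.
have h25 : 8 * B <= B ^+ 25.
  rewrite (_ : 25 = 2 + 23)%N// exprD; have : B ^+ 1 <= B ^+ 23 by rewrite ler_weXn2l//; lra.
  by rewrite expr1; nra.
rewrite (_ : B ^+ 26 = B * B ^+ 25); last by rewrite exprS.
rewrite -[(19 + 6)%N]/25%N; move: h25; move: (B ^+ 25) => y; nra.
Qed.

(** At least [B ^ 39] points remain beside [S1], so the exponent of Hoeffding's bound at accuracy
    [B ^ -5] is at least [B ^ 29 / 4], against [B ^ 26] for the number of queries. *)
Lemma deviation_small : (#|{: query k m b}|)%:R *
  (2 * expR (- ((n - b)%:R * ((B ^+ 5)^-1) ^+ 2 / 4)) + 2 * expR (- (n'%:R * ((B ^+ 5)^-1) ^+ 2 / 4))) <= delta / 4.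
Proof.
have Bb := b4; have Bp : 0 < B by lra.
case/andP: delta01 => dp _.
have B39 : B ^+ 39 <= (n - b)%:R.
  rewrite -natrX ler_nat leq_subRL; last first.
    by apply: leq_trans bn; rewrite -{1}(expn1 b) leq_pexp2l// (leq_trans _ b_ge4).
  apply: leq_trans bn; rewrite (expnS b 39); apply: (@leq_trans (2 * b ^ 39)).
    by rewrite mul2n -addnn leq_add2r -{1}(expn1 b) leq_pexp2l// (leq_trans _ b_ge4).
  by rewrite leq_mul2r (leq_trans _ b_ge4) ?orbT.
have B39' : B ^+ 39 <= n'%:R.
  by rewrite -natrX ler_nat; apply: leq_trans bn'; rewrite leq_pexp2l// (leq_trans _ b_ge4).
have ex N : B ^+ 39 <= N -> expR (- (N * ((B ^+ 5)^-1) ^+ 2 / 4)) <= expR (- (B ^+ 29 / 4)).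
  move=> BN; rewrite ler_expR lerN2 ler_pM2r ?invr_gt0//.
  rewrite -exprVn -exprM exprVn ler_pdivlMr ?exprn_gt0//.
  by rewrite -exprD.
have qc := query_count.
set q := (#|_|)%:R in qc *.
have q0 : 0 <= q by [].
apply: (@le_trans _ _ (expR (B ^+ 26) * (4 * expR (- (B ^+ 29 / 4))))).
  apply: ler_pM; [exact: q0|by rewrite addr_ge0// mulr_ge0 ?expR_ge0|exact: qc|].
  have := ex _ B39; have := ex _ B39'; lra.
rewrite mulrCA -expRD.
have del : expR (- B) <= delta.
  rewrite expRN -[leRHS]invrK lef_pV2 ?posrE ?expR_gt0 ?invr_gt0//.
  apply: (@le_trans _ _ (expR L)).
    by rewrite expL ler_peMl ?invr_ge0 ?(ltW dp)//; exact: kd_ge.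
  by rewrite ler_expR (le_trans L_le)// -(expr1 v) v_pow_B.
have e16 : expR (- 16) <= 1 / 16 :> K.
  rewrite expRN div1r lef_pV2 ?posrE ?expR_gt0//.
  by apply: le_trans (expR_ge1Dx 16); lra.
have h2 : 16 <= B ^+ 2 by nra.
have lin : B ^+ 26 + - (B ^+ 29 / 4) <= - B + - 16.
  have h26 : B ^+ 2 <= B ^+ 26 by rewrite ler_weXn2l//; lra.
  rewrite (_ : B ^+ 29 = B ^+ 26 * (B ^+ 2 * B)); last by rewrite -exprSr -exprD.
  have : 64 <= B ^+ 2 * B by nra.
  move: h26 h2; move: (B ^+ 26) (B ^+ 2 * B) => x y.
  have : B <= B ^+ 2 by nra.
  by move: (B ^+ 2) => z; nra.
apply: (@le_trans _ _ (4 * (expR (- B) * expR (- 16)))).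
  by rewrite -expRD ler_wpM2l// ler_expR.
have := expR_ge0 (- B); have := expR_ge0 (- 16 : K); nra.
Qed.

(** One estimate for each guarantee; in the second, [eps / 4] is left for the mass outside the
    region. *)
Lemma error_small : (6 + 2 * R) / B ^+ 2 <= 2 * eps /\ (R + 1) * (B ^+ 5)^-1 <= 3 / 4 * eps.
Proof.
case/andP: eps01 => ep _.
have Bb := b4; have Bp : 0 < B by lra.
have ev : 1 <= eps * v by rewrite mulrC -ler_pdivrMr// div1r.
have B8 : 8 * v ^+ 2 <= B.
  apply: le_trans (v_pow_B (isT : 5 <= 16)%N); rewrite (_ : 5 = 3 + 2)%N// exprD.
  by rewrite ler_wpM2r ?exprn_ge0//; [move: v2; lra|have := two_pow_v 3; lra].
have Rv' : 6 + 2 * R <= 5 * v by move: v2 Rv; lra.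
have BB : B <= B ^+ 2 by rewrite expr2; nra.
have vp : 0 < v by move: v2; lra.
have k1 : 8 * v <= eps * B.
  apply: (@le_trans _ _ (eps * (8 * v ^+ 2))); last by rewrite ler_wpM2l// ltW.
  rewrite expr2; nra.
split.
  rewrite ler_pdivrMr ?exprn_gt0//; apply: (le_trans Rv'); nra.
rewrite ler_pdivrMr ?exprn_gt0//.
have B5 : B <= B ^+ 5 by rewrite -{1}(expr1 B) ler_weXn2l//; lra.
have : eps * B <= eps * B ^+ 5 by rewrite ler_wpM2l// ltW.
move: R1; nra.
Qed.

End Constants.

(** * The two guarantees *)

Section Guarantees.
Variables (K : realType) (d l k n n' : nat) (A R beta eps delta v : K).
Variables (f : 'I_k -> Rn K d -> bool) (D D' : probability (Rn K d) K).
Hypothesis mf : forall i, measurable_fun setT (f i).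
Local Notation b := (bmax n n').
Local Notation L := (ln (k%:R / delta) : K).
Local Notation B := (b%:R : K).
Local Notation phi := (feat (deg d l)).
Local Notation m := (d.+1 ^ deg d l)%N.
Hypotheses (k0 : (0 < k)%N) (l0 : (0 < l)%N) (A1 : 1 <= A) (R1 : 1 < R) (beta0 : 0 < beta).
Hypotheses (eps01 : 0 < eps < 1) (delta01 : 0 < delta < 1).
Hypotheses (v2 : 2 <= v) (Rv : R <= v) (betav : beta <= v) (Av : A ^+ l <= v)
  (Dv : (d.+1)%:R ^+ l <= v) (epsv : eps^-1 <= v) (Lv : L ^+ l <= v) (vb : v ^+ 16 <= B).
Variable F : n.-tuple (Rn K d) -> n'.-tuple (Rn K d) -> seq (filt K k).
Hypothesis learnF : forall S S', learned l f R S S' (F S S').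

Definition selector S S' x : bool :=
  sel f m b (zeta m phi (S1 b 0 (sample S S'))) (good m phi (S1 b 0 (sample S S'))) (F S S') x.

Let b4' : 4 <= B. Proof. exact: b4 v2 vb. Qed.
Let b2 : (2 <= b)%N. Proof. by rewrite -(ler_nat K); move: b4'; lra. Qed.
Let bn : (b <= n)%N. Proof. exact: b_le. Qed.

Lemma selector_code S S' : exists C : code k m b, forall x,
  selector S S' x = selc f R phi (S1 b 0 (sample S S')) C x.
Proof.
have [h1 h2 _ _] := learnF S S'.
exact: sel_code.
Qed.

Lemma size_S1 (S : n.-tuple (Rn K d)) (S' : n'.-tuple (Rn K d)) : size (S1 b 0 (sample S S')) == b.
Proof. by rewrite size_map size_iota. Qed.

Lemma measurable_selector S S' : measurable_fun setT (selector S S').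
Proof.
have [C CE] := selector_code S S'.
rewrite (_ : selector S S' = selc f R phi (Tuple (size_S1 S S')) C); last exact/funext.
exact: (measurable_slice (e := fun (y : b.-tuple (Rn K d)) x => selc f R phi y C x) (Tuple (size_S1 S S'))
  (measurable_selc R (fun j => measurable_feat (deg d l) j) mf C)).
Qed.

Lemma measurable_goodset (S : n.-tuple (Rn K d)) (S' : n'.-tuple (Rn K d)) :
  measurable_fun setT (good m phi (S1 b 0 (sample S S')) : Rn K d -> bool).
Proof.
have mg : measurable_fun setT (fun q : b.-tuple (Rn K d) * Rn K d => good m phi q.1 q.2).
  by apply: measurable_good => j; exact: measurable_feat.
exact: (measurable_slice (e := fun (y : b.-tuple (Rn K d)) x => good m phi y x) (Tuple (size_S1 S S')) mg).
Qed.

Section Draws.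
Variables (disp : measure_display) (Omega : measurableType disp) (P : probability Omega K).
Variables (X : Omega -> n.-tuple (Rn K d)) (X' : Omega -> n'.-tuple (Rn K d)).
Hypothesis iidX : iid_samples D D' P X X'.
Local Notation eb := ((B ^+ 5)^-1).
Local Notation Y w := (Y X X' bn w).

Lemma S1_draw w : S1 b 0 (sample (X w) (X' w)) = tval (Y w).
Proof. exact: S1_Y. Qed.

Lemma draws_concentrate (p : 'I_k -> Rn K d -> K) (lam da : K) :
  (forall i, measurable_fun setT (p i)) ->
  (forall i, (D [set x | (lam < `|p i x|)%R] <= da%:E)%E) -> k%:R * B * da <= delta / 4 ->
  exists E0, [/\ measurable E0, ((1 - delta)%:E <= P E0)%E & forall w, E0 w ->
    [/\ forall i y, List.In y (tval (Y w)) -> `|p i y| <= lam,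
        (D [set x | ~~ good m phi (Y w) x] < (eps / (4 * R))%:E)%E &
        forall u : query k m b, ~ deviates2 f R phi D X X' p bn u eb w /\ ~ deviates3 f R phi D' X X' p bn u eb w]].
Proof.
move=> mp tail dale.
have [b1 b1'] := bmaxP n n'.
have [c [g [cn gc cm g2]]] := region_sizes k0 l0 R1 eps01 delta01 v2 Rv Dv epsv Lv vb b1.
have dv := deviation_small k0 l0 delta01 v2 Rv Dv Lv vb b1 b1'.
have Bp : 0 < B by move: b4'; lra.
have ep : 0 < eb by rewrite invr_gt0 exprn_gt0.
have e1 : eb <= 1 by rewrite invf_le1 ?exprn_gt0// exprn_ege1//; move: b4'; lra.
have egp : 0 < eps / (4 * R) by case/andP: eps01 => h _; rewrite divr_gt0// mulr_gt0//; move: R1; lra.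
have [E0 [mE PE HE]] := concentration R (fun j => measurable_feat (deg d l) j) mf iidX mp bn ep e1 tail cn gc egp cm.
exists E0; split=> //.
  apply: le_trans PE; rewrite lee_fin.
  case/andP: delta01 => dp _; move: dale g2 dv; lra.
move=> w /HE[h1 h2 h3]; split=> // i y yY.
have [j jb jy] : exists2 j, (j < size (tval (Y w)))%N & nth y (tval (Y w)) j = y.
  by elim: (tval (Y w)) yY => //= a s IH [->|/IH[j js e]]; [exists 0%N|exists j.+1].
move: jb; rewrite size_tuple -jy => jb.
by rewrite -(tnth_nth _ _ (Ordinal jb)) tnth_blk; exact: h1.
Qed.

(** [bound1] has the factor [R] and a mean over selected points only; the stated factor and the
    whole space can but enlarge the right-hand side. The last mean is an extended real, since [p i]
    is bounded on the region only. *)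
Lemma first_guarantee w (p : 'I_k -> mpoly.mpoly d K) (lam : K) i :
  (forall i, (total_degree (p i) <= l)%N) ->
  (forall y, List.In y (tval (Y w)) -> `|peval (p i) y| <= lam) -> B * lam <= B ^+ 3 ->
  (forall u : query k m b, ~ deviates2 f R phi D X X' (fun i => peval (p i)) bn u eb w /\
             ~ deviates3 f R phi D' X X' (fun i => peval (p i)) bn u eb w) ->
  let g x := (f i x)%:R * peval (p i) x * (selector (X w) (X' w) x)%:R in
  D'.-integrable setT (EFin \o g) /\
  ('E_D'[g] <= ((R + eps) * (1 + eps))%R%:E * 'E_D[fun x => ((f i x)%:R * `|peval (p i) x|)%R] + (2 * eps)%R%:E)%E.
Proof.
move=> pl plam lamb dev g.
have [C CE] := selector_code (X w) (X' w).
have sE : selector (X w) (X' w) = sel f m b (zeta m phi (Y w)) (good m phi (Y w)) (F (X w) (X' w)).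
  by rewrite /selector S1_draw.
have CE' x : sel f m b (zeta m phi (Y w)) (good m phi (Y w)) (F (X w) (X' w)) x = selc f R phi (Y w) C x.
  by rewrite -sE CE S1_draw.
have ms := measurable_selector (X w) (X' w).
have mp j : measurable_fun setT (peval (p j) : Rn K d -> K) by exact: measurable_peval.
have span j : inspan m phi (peval (p j)) by apply: peval_feat; exact: total_degree_deg.
have [mb _ _ Rb] := small_sizes v2 Rv Dv vb.
have [e6 _] := error_small R1 eps01 v2 Rv epsv vb.
have pb x : selector (X w) (X' w) x -> `|peval (p i) x| <= B ^+ 3.
  by rewrite sE; exact: (p_bounded (p := fun i => peval (p i)) (span i) plam lamb).
have B3 : 0 <= B ^+ 3 by rewrite exprn_ge0//; move: b4'; lra.
have mg : measurable_fun setT g.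
  by apply: measurable_funM; [apply: measurable_funM => //; exact: measurable_boolR|exact: measurable_boolR].
have gB x : `|g x| <= B ^+ 3.
  rewrite /g; have := pb x; case: (selector _ _ x) => [/(_ isT) h|_]; last by rewrite mulr0 normr0.
  by rewrite mulr1; case: (f i x); rewrite ?mul1r ?mul0r ?normr0.
pose h x := (f i x && selector (X w) (X' w) x)%:R * `|peval (p i) x|.
have mh : measurable_fun setT h.
  apply: measurable_funM; first by apply: measurable_boolR; exact: measurable_and.
  by apply: measurableT_comp.
have h0 x : 0 <= h x by rewrite mulr_ge0.
have hB x : `|h x| <= B ^+ 3.
  rewrite /h; have := pb x; case: (selector _ _ x) => [/(_ isT) q|_]; last by rewrite andbF mul0r normr0.
  by rewrite andbT; case: (f i x); rewrite ?mul1r ?mul0r ?normr0 ?normr_id.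
have b1 : mean D' g <= R * mean D h + 2 * eps.
  have := bound1 (p := fun i => peval (p i)) mp mf (fun j => measurable_feat (deg d l) j) b2 R1 mb Rb (learnF (X w) (X' w)) CE' dev (span i) plam lamb.
  rewrite -sE; move: e6; rewrite -/g -/h; lra.
split; first exact: bounded_integrable gB.
rewrite !unlock [X in (X <= _)%E](mean_EFin D' mg gB).
apply: (@le_trans _ _ (R%:E * (mean D h)%:E + (2 * eps)%:E)%E); first by rewrite -EFinM -EFinD lee_fin.
rewrite leeD2r// -(mean_EFin D mh hB) lee_pmul ?lee_fin//.
- by move: R1; lra.
- by apply: integral_ge0 => x _; rewrite lee_fin.
- by case/andP: eps01 => ? _; move: R1; nra.
apply: ge0_le_integral => //.
- by move=> x _; rewrite lee_fin.
- exact/measurable_EFinP.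
- apply/measurable_EFinP; apply: measurable_funM; first exact: measurable_boolR.
  exact: measurableT_comp.
- move=> x _; rewrite lee_fin /h; apply: ler_wpM2r => //.
  by rewrite ler_nat; case: (f i x) => //; case: (selector _ _ x).
Qed.

Lemma tv_dist_ge B0 : measurable B0 -> fine (D' B0) <= fine (D B0) + tv_dist D D'.
Proof.
move=> mB.
have fin (mu : probability (Rn K d) K) C : measurable C -> 0 <= fine (mu C) <= 1.
  by move=> mC; rewrite fine_ge0//= -lee_fin fineK ?fin_num_measure// probability_le1.
have : `|fine (D B0) - fine (D' B0)| <= tv_dist D D'.
  apply: ub_le_sup; last by exists B0.
  exists 1 => _ [C mC <-]; have /andP[? ?] := fin D C mC; have /andP[? ?] := fin D' C mC.
  by rewrite ler_norml; apply/andP; split; lra.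
by rewrite ler_norml => /andP[]; lra.
Qed.

(** The rejected mass is at most [eps / (4 R)] outside the region plus the cut mass [x], and
    [R * x <= y + 3 / 4 * eps] for the cut mass [y] under [D']. The two bounds of the minimum come
    from [y <= 1] and from [y <= x + tv_dist]. *)
Lemma second_guarantee w (p : 'I_k -> Rn K d -> K) :
  (D [set x | ~~ good m phi (Y w) x] < (eps / (4 * R))%:E)%E ->
  (forall u : query k m b, ~ deviates2 f R phi D X X' p bn u eb w /\ ~ deviates3 f R phi D' X X' p bn u eb w) ->
  (D [set x | selector (X w) (X' w) x = false] <=
    (Num.min ((1 + eps) / R) ((tv_dist D D' + eps) / (R - 1)))%R%:E)%E.
Proof.
move=> Dg dev.
have [C CE] := selector_code (X w) (X' w).
have sE : selector (X w) (X' w) = sel f m b (zeta m phi (Y w)) (good m phi (Y w)) (F (X w) (X' w)).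
  by rewrite /selector S1_draw.
have CE' x : sel f m b (zeta m phi (Y w)) (good m phi (Y w)) (F (X w) (X' w)) x = selc f R phi (Y w) C x.
  by rewrite -sE CE S1_draw.
have ms := measurable_selector (X w) (X' w).
have mG := measurable_goodset (X w) (X' w); rewrite S1_draw in mG.
have [mb _ _ Rb] := small_sizes v2 Rv Dv vb.
have [_ e6] := error_small R1 eps01 v2 Rv epsv vb.
have := bound2 b2 R1 mb Rb (learnF (X w) (X' w)) CE' dev; rewrite -sE.
set G := [set x | _]; move=> bd.
have mN : measurable [set x | ~~ good m phi (Y w) x].
  by rewrite -[X in measurable X]setTI; apply: (measurable_neg mG) => //.
have mGs : measurable G.
  rewrite /G -[X in measurable X]setTI.
  by apply: (measurable_and mG (measurable_neg ms)) => //.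
have sub : [set x | selector (X w) (X' w) x = false] `<=` [set x | ~~ good m phi (Y w) x] `|` G.
  by move=> x /= sx; rewrite /G /= sx andbT; case: (good _ _ _ _); [right|left].
have mS : measurable [set x | selector (X w) (X' w) x = false].
  by rewrite -[X in measurable X]setTI; have := ms measurableT [set false]; exact.
have xfin : D G = (fine (D G))%:E by rewrite fineK// fin_num_measure.
have DS : (D [set x | selector (X w) (X' w) x = false] <= (eps / (4 * R) + fine (D G))%:E)%E.
  apply: (@le_trans _ _ (D ([set x | ~~ good m phi (Y w) x] `|` G))).
    by apply: le_measure => //; rewrite inE//; exact: measurableU.
  apply: (le_trans (measureU2 D mN mGs)); rewrite EFinD -xfin; exact: leeD2r (ltW Dg).
apply: (le_trans DS); rewrite lee_fin.
have y1 : fine (D' G) <= 1 by rewrite -lee_fin fineK ?fin_num_measure// probability_le1.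
have tv := tv_dist_ge mGs.
case/andP: eps01 => ep e1.
set z := eps / (4 * R); have z0 : R * z = eps / 4 by rewrite /z; field; move: R1; lra.
have zp : 0 <= z by rewrite divr_ge0 ?(ltW ep)// mulr_ge0//; move: R1; lra.
move: bd tv y1 e6; move: (fine (D G)) (fine (D' G)) (eb) (tv_dist D D') => x y e t bd tv y1 e6.
rewrite le_min; apply/andP; split; rewrite ler_pdivlMr; move: R1; first [lra|nra].
Qed.

Lemma first_part (p : 'I_k -> mpoly.mpoly d K) : hypercontractive A D ->
  (forall i, (total_degree (p i) <= l)%N) ->
  (forall i, ('E_D[fun x => (peval (p i) x ^+ 2)%R] <= beta%:E)%E) ->
  with_prob_ge P (1 - delta)
    [set w | forall i : 'I_k,
       let g x := (f i x)%:R * peval (p i) x * (selector (X w) (X' w) x)%:R in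
       D'.-integrable setT (EFin \o g) /\
       ('E_D'[g] <= ((R + eps) * (1 + eps))%R%:E * 'E_D[fun x => ((f i x)%:R * `|peval (p i) x|)%R]
          + (2 * eps)%R%:E)%E].
Proof.
move=> hyp pl pb.
have T0B := T0_le k0 A1 beta0 delta01 v2 betav Av Dv Lv vb.
have L0 := L_gt0 k0 delta01.
have B1 : 1 <= B by move: b4'; lra.
set T0 := _ * (1 + beta) in T0B.
have tail i : (D [set x | (B * T0 < `|peval (p i) x|)%R] <= ((B `^ (2 + L))^-1)%:E)%E.
  apply: (@hypercontractive_tail _ _ _ A beta (2 + L) _ B T0 (deg d l)) => //.
  - by move: L0; lra.
  - exact: total_degree_deg.
have [E0 [mE PE HE]] := draws_concentrate (fun i => measurable_peval (p i)) tail (tail_small k0 delta01 v2 vb).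
exists E0; split=> // w /HE[h1 _ h3] i.
apply: first_guarantee h3 => //.
- exact: h1.
- by rewrite -[B ^+ 3]/(B * (B * B)); apply: ler_wpM2l; [lra|apply: ler_wpM2l => //; lra].
Qed.

Lemma second_part : with_prob_ge P (1 - delta)
  [set w | (D [set x | selector (X w) (X' w) x = false] <=
     (Num.min ((1 + eps) / R) ((tv_dist D D' + eps) / (R - 1)))%R%:E)%E].
Proof.
(* The zero family has no tail, so concentration applies to it at threshold 0 for any [D]. *)
pose p (i : 'I_k) (x : Rn K d) : K := 0.
have tail i : (D [set x | (0 < `|p i x|)%R] <= 0%:E)%E.
  by rewrite (_ : [set x | _] = set0) ?measure0//; apply/seteqP; split=> // x /=; rewrite normr0 ltxx.
have mp i : measurable_fun setT (p i) by exact: measurable_cst.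
have d0 : k%:R * B * 0 <= delta / 4 by rewrite mulr0 divr_ge0//; case/andP: delta01 => /ltW.
have [E0 [mE PE HE]] := draws_concentrate mp tail d0.
by exists E0; split=> // w /HE[_ h2 h3]; exact: second_guarantee h2 h3.
Qed.

End Draws.
End Guarantees.

(** [680 = 17 * 40]: the integer part of [v ^ 17] is a candidate in the maximum defining [bmax], and
    the extra factor [v] pays for the truncation. *)
Lemma power_threshold (K : realType) (v : K) n n' : 2 <= v -> v ^+ 680 <= n%:R -> v ^+ 680 <= n'%:R ->
  v ^+ 16 <= (bmax n n')%:R.
Proof.
move=> v2 vn vn'.
have v0 e : 0 <= v ^+ e by rewrite exprn_ge0//; lra.
have /andP[c1 c2] := truncn_itv (v0 17%N).
set c := Num.truncn _ in c1 c2.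
have cX : (c ^ 40)%:R <= v ^+ 680.
  by rewrite natrX -[680%N]/(17 * 40)%N exprM lerXn2r ?nnegrE.
have cb : (c <= bmax n n')%N.
  by apply: bmax_ge; rewrite -(ler_nat K); [exact: le_trans cX vn|exact: le_trans cX vn'].
have v16 : 1 <= v ^+ 16 by rewrite exprn_ege1//; lra.
have : c.+1%:R <= (bmax n n')%:R + 1 :> K by rewrite -natr1 lerD2r ler_nat.
rewrite (exprS v 16) in c2; move: c2 v16; move: (v ^+ 16) (c.+1%:R) => x y; nra.
Qed.

Lemma wf_LEARN : wf LEARN. Proof. by vm_compute. Qed.

Lemma wf_EVAL : wf EVAL. Proof. by vm_compute. Qed.

Lemma sum_tnth (K : realType) q (t : q.-tuple K) : \sum_(i < q) tnth t i = \sum_(x <- t) x.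
Proof. by rewrite big_tuple. Qed.

Theorem theoremB3 (K : realType) :
  exists (alg ev : cmd) (Q : mpoly.mpoly 6 K)
         (Talg : mpoly.mpoly 3 K) (Tev : mpoly.mpoly 2 K),
  forall (d l k : nat) (A R beta eps delta : K)
         (f : 'I_k -> Rn K d -> bool)
         (D D' : probability (Rn K d) K) (n n' : nat),
  (0 < l)%N -> (0 < k)%N ->
  1 <= A -> 1 < R -> 0 < beta ->
  0 < eps < 1 -> 0 < delta < 1 ->
  (forall i, measurable_fun setT (f i)) ->
  hypercontractive A D ->
  let N := poly_at Q [tuple R; beta; A ^+ l; (d.+1)%:R ^+ l; eps^-1;
                      ln (k%:R / delta) ^+ l] in
  N <= n%:R -> N <= n'%:R ->
  exists s : n.-tuple (Rn K d) -> n'.-tuple (Rn K d) -> Rn K d -> bool,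
    (forall S S',
       measurable_fun setT (s S S') /\
       exists2 desc : seq K,
         outputs_description f alg (learner_input l k R beta eps S S')
           (k%:R * poly_at Talg [tuple n%:R; n'%:R; (d.+1)%:R ^+ l]) desc &
         describes f ev desc
           (k%:R * Num.max 1 (Num.sqrt (beta * R ^+ 3 / eps ^+ 5)) *
            poly_at Tev [tuple n%:R; (d.+1)%:R ^+ l]) (s S S')) /\
    (forall (disp : measure_display) (Omega : measurableType disp)
            (P : probability Omega K)
            (X : Omega -> n.-tuple (Rn K d)) (X' : Omega -> n'.-tuple (Rn K d)),
       iid_samples D D' P X X' ->
       (forall p : 'I_k -> mpoly.mpoly d K,
          (forall i, (total_degree (p i) <= l)%N) ->
          (forall i, ('E_D[fun x => (peval (p i) x ^+ 2)%R] <= beta%:E)%E) ->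
          with_prob_ge P (1 - delta)
            [set w | forall i : 'I_k,
               let g x := (f i x)%:R * peval (p i) x * (s (X w) (X' w) x)%:R in
               D'.-integrable setT (EFin \o g) /\
               ('E_D'[g] <=
                ((R + eps) * (1 + eps))%R%:E *
                  'E_D[fun x => ((f i x)%:R * `|peval (p i) x|)%R] +
                (2 * eps)%R%:E)%E]) /\
       with_prob_ge P (1 - delta)
         [set w | (D [set x | s (X w) (X' w) x = false] <=
                   (Num.min ((1 + eps) / R)
                            ((tv_dist D D' + eps) / (R - 1)))%R%:E)%E]).
Proof.
have [Q QE] := poly_at_power 6 (2 : K) 1 680.
(* [12 = 2 * 6]: six nested loops with bounds at most a square. The summand 40 covers the constant
   loop bounds, and the 4 the length of the description. *)
have [T1 T1E] := poly_at_power 3 (40 : K) (csize LEARN + 4)%:R 12.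
have [T2 T2E] := poly_at_power 2 (40 : K) (csize EVAL * 4 ^ 6)%:R 12.
exists (comp LEARN), (comp EVAL), Q, T1, T2.
move=> d l k A R beta eps delta f D D' n n' l0 k0 A1 R1 beta0 eps01 delta01 mf hyp N.
rewrite {}/N QE mul1r sum_tnth /=.
set L := ln _; set v := 2 + _ => vn vn'.
have A0 : 0 <= A ^+ l by rewrite exprn_ge0//; lra.
have D0 : 0 <= (d.+1)%:R ^+ l :> K by rewrite exprn_ge0.
have e0 : 0 <= eps^-1 by rewrite invr_ge0; case/andP: eps01 => /ltW.
have L0 : 0 <= L ^+ l by rewrite exprn_ge0// ltW//; exact: L_gt0.
have vE : v = 2 + (R + (beta + (A ^+ l + ((d.+1)%:R ^+ l + (eps^-1 + L ^+ l))))).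
  by rewrite /v !big_cons big_nil addr0.
have v2 : 2 <= v by rewrite vE; lra.
have Rv : R <= v by rewrite vE; lra.
have betav : beta <= v by rewrite vE; lra.
have Av : A ^+ l <= v by rewrite vE; lra.
have Dv : (d.+1)%:R ^+ l <= v by rewrite vE; lra.
have epsv : eps^-1 <= v by rewrite vE; lra.
have Lv : L ^+ l <= v by rewrite vE; lra.
have vb := power_threshold v2 vn vn'.
clearbody v; clear vn vn' vE A0 D0 e0 L0.
have [_ dgb Rb2 _] := small_sizes v2 Rv Dv vb.
have b2 : (2 <= bmax n n')%N by rewrite -(ler_nat K); have := b4 v2 vb; lra.
have ex (S : n.-tuple (Rn K d)) (S' : n'.-tuple (Rn K d)) := LEARNP l f beta eps S S' k0 b2 Rb2 R1.
pose spec (S : n.-tuple (Rn K d)) (S' : n'.-tuple (Rn K d)) (F : seq (filt K k)) := learned l f R S S' F /\ encodes (deg d l) (bmax n n') (sample S S')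
    (mkseq (rmem (den f LEARN (learner_input l k R beta eps S S')))
           (nmem (den f LEARN (learner_input l k R beta eps S S')) 0)) F.
have ex1 S S' : exists F, spec S S' F by have [F ? ?] := ex S S'; exists F.
pose G S := boolp.choice (ex1 S); pose F S := projT1 (G S).
have HF S S' : spec S S' (F S S') := projT2 (G S) S'.
clearbody F; clear G.
have learnF S S' : learned l f R S S' (F S S') by have [] := HF S S'.
pose W := (n + n' + d.+1 ^ l + 40)%N; pose W0 := (n + d.+1 ^ l + 40)%N.
have W0W : (W0 <= W)%N by rewrite /W0 /W leq_add2r leq_add2r leq_addr.
have T1v : poly_at T1 [tuple n%:R; n'%:R; (d.+1)%:R ^+ l] = ((csize LEARN + 4) * W ^ 12)%:R.
  rewrite T1E sum_tnth /= !big_cons big_nil addr0 natrM natrX; congr (_ * _ ^+ _).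
  by rewrite /W !natrD natrX addrC !addrA.
have T2v : poly_at T2 [tuple n%:R; (d.+1)%:R ^+ l] = ((csize EVAL * 4 ^ 6) * W0 ^ 12)%:R.
  rewrite T2E sum_tnth /= !big_cons big_nil addr0 [in RHS]natrM (natrX _ W0); congr (_ * _ ^+ _).
  by rewrite /W0 !natrD natrX addrC.
exists (selector l f F); split=> [S S'|disp Omega P X X' iidX]; last first.
  split=> [p pl pb|].
    exact: (first_part mf k0 l0 A1 R1 beta0 eps01 delta01 v2 Rv betav Av Dv epsv Lv vb learnF iidX hyp pl pb).
  exact: (second_part mf k0 l0 R1 eps01 delta01 v2 Rv Dv epsv Lv vb learnF iidX).
split; first exact: (measurable_selector mf v2 vb learnF).
have [LF enc] := HF S S'.
set desc := mkseq _ _ in enc.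
have sz := desc_size l0 b2 LF enc; rewrite -/W0 in sz.
exists desc.
  exists (cost f LEARN (learner_input l k R beta eps S S')), (den f LEARN (learner_input l k R beta eps S S')).
  split=> //; first exact: den_exec wf_LEARN.
  rewrite T1v -natrM ler_nat.
  have ct : (cost f LEARN (learner_input l k R beta eps S S') <= csize LEARN * ((W ^ 2) ^ 6 * k))%N.
    exact: (cheap_learn f beta eps S S' k0 l0 b2 Rb2 R1).
  have sz2 : (size desc <= 4 * (W ^ 12 * k))%N.
    apply: (leq_trans sz); rewrite leq_mul2l /=; apply: (@leq_trans (W ^ 12)); last exact: leq_pmulr.
    apply: (@leq_trans (W ^ 2)); first by rewrite leq_exp2r.
    by rewrite leq_pexp2l// /W addnC.
  apply: (leq_trans (leq_add ct sz2)).
  rewrite -expnM -[(2 * 6)%N]/12%N; move: (W ^ 12)%N => z.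
  by rewrite -mulnDl mulnA [X in (_ <= X)%N]mulnC.
move=> x; set st := load _ _; exists (cost f EVAL st), (den f EVAL st); split; first exact: den_exec wf_EVAL.
  exact: EVALP enc (deg_desc k0 l0 b2 dgb enc).
have ct : (cost f EVAL st <= csize EVAL * ((4 * W0 ^ 2) ^ 6 * k))%N.
  exact: (cheap_eval x k0 l0 b2 dgb LF enc).
apply: (@le_trans _ _ (k%:R * poly_at T2 [tuple n%:R; (d.+1)%:R ^+ l])).
  rewrite T2v -natrM ler_nat; apply: (leq_trans ct).
  rewrite expnMn -expnM -[(2 * 6)%N]/12%N; move: (4 ^ 6)%N (W0 ^ 12)%N => y z.
  by rewrite [X in (_ <= X)%N]mulnC !mulnA.
rewrite T2v; apply: ler_wpM2r => //.
by rewrite -[X in X <= _]mulr1; apply: ler_wpM2l => //; rewrite le_max lexx.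
Qed.
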